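(* Let $X$ be a finite-dimensional compact metric space, and let $A$ be a pure $C^*$-algebra. Assume that $A$ has no quotient whose Cuntz semigroup contains a nonzero, compact, properly infinite Cuntz class. Then there exists $L\in\mathbb{N}$ such that, for every pair $x',x\in\mathrm{Cu}(C(X,A))$ with $x'\ll x$, there exist $y_0,y_1\in\mathrm{Cu}(C(X,A))$ satisfying $$y_0+y_1\leq x,\qquad x'\ll Ly_0\quad\text{and}\quad x'\ll Ly_1.$$
   Context: Finite-dimensional refers to covering dimension; $C(X,A)$ is the $C^*$-algebra of continuous functions $X\to A$. Quotients are quotients by closed two-sided ideals. Cuntz semigroup: for a $C^*$-algebra $B$ and $a,b\in B_+$, $a\precsim b$ means there is a sequence $(v_n)$ in $B$ with $v_n b v_n^*\to a$; $a\sim b$ means $a\precsim b$ and $b\precsim a$. With $\mathcal{K}$ the compact operators on a separable infinite-dimensional Hilbert space, $\mathrm{Cu}(B)=(B\otimes\mathcal{K})_+/\!\sim$, with classes $[a]$, order $[a]\le[b]$ iff $a\precsim b$, and addition $[a]+[b]=[a\oplus b]$. For $a\in B_+$ and $\varepsilon>0$, $(a-\varepsilon)_+$ is the functional calculus of $a$ with $\lambda\mapsto\max\{\lambda-\varepsilon,0\}$. For $x,y\in\mathrm{Cu}(B)$, $x\ll y$ means $x=[a]$, $y=[b]$ and $a\precsim(b-\varepsilon)_+$ for some $\varepsilon>0$. An element $x\in\mathrm{Cu}(B)$ is compact if $x\ll x$, and properly infinite if $2x\le x$. Pureness: $B$ is pure if $\mathrm{Cu}(B)$ is both (a) almost unperforated: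 whenever $x,y\in\mathrm{Cu}(B)$ satisfy $(k+1)x\le ky$ for some $k\in\mathbb{N}$, then $x\le y$; and (b) almost divisible: for every $x'\ll x$ in $\mathrm{Cu}(B)$ and every $N\in\mathbb{N}$ there is $y\in\mathrm{Cu}(B)$ with $Ny\le x$ and $x'\le(N+1)y$. *)

(* Defs.v *)
From HB Require Import structures.
From mathcomp Require Import all_boot all_order all_algebra.
From mathcomp Require Import mathcomp_extra boolp classical_sets functions reals.
From mathcomp Require Import topology normedtype sequences.
From mathcomp Require Import complex.

Set Implicit Arguments.
Unset Strict Implicit.
Unset Printing Implicit Defensive.

Import Order.TTheory GRing.Theory Num.Theory.
Import numFieldNormedType.Exports.
Import Normc.

Local Open Scope classical_set_scope.
Local Open Scope ring_scope.
Local Open Scope complex_scope.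

(* Complex *-algebras, not assumed unital. *)
HB.mixin Record isStarAlgebra (R : realType) V & GRing.Lmodule R[i] V := {
  smul : V -> V -> V;
  star : V -> V;
  smulA : associative smul;
  smulDl : left_distributive smul +%R;
  smulDr : right_distributive smul +%R;
  scale_smull : forall (c : R[i]) (x y : V), smul (c *: x) y = c *: smul x y;
  scale_smulr : forall (c : R[i]) (x y : V), smul x (c *: y) = c *: smul x y;
  starD : {morph star : x y / x + y};
  starZ : forall (c : R[i]) (x : V), star (c *: x) = conjc c *: star x;
  starM : forall x y : V, star (smul x y) = smul (star y) (star x);
  starK : involutive star;
}.

#[short(type="starAlgType")]
HB.structure Definition StarAlgebra (R : realType) :=
  {V of GRing.Lmodule R[i] V & isStarAlgebra R V}.

Notation "x ** y" := (smul x y) (at level 40, left associativity) : ring_scope.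

Section StarAlgebraTheory.
Context (R : realType) (V : starAlgType R).
Implicit Types x y z : V.

Lemma smulNl x y : (- x) ** y = - (x ** y).
Proof. by rewrite -scaleN1r scale_smull scaleN1r. Qed.

Lemma smulNr x y : x ** (- y) = - (x ** y).
Proof. by rewrite -scaleN1r scale_smulr scaleN1r. Qed.

Lemma smulBl x y z : (x - y) ** z = x ** z - y ** z.
Proof. by rewrite smulDl smulNl. Qed.

Lemma smulBr x y z : x ** (y - z) = x ** y - x ** z.
Proof. by rewrite smulDr smulNr. Qed.

Lemma smul0l x : 0 ** x = 0.
Proof. by rewrite -{1}(subrr 0) smulBl subrr. Qed.

Lemma smul0r x : x ** 0 = 0.
Proof. by rewrite -{1}(subrr 0) smulBr subrr. Qed.

Lemma starN x : star (- x) = - star x.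
Proof. by rewrite -scaleN1r starZ rmorphN rmorph1 scaleN1r. Qed.

Lemma starB x y : star (x - y) = star x - star y.
Proof. by rewrite starD starN. Qed.

Lemma star0 : star (0 : V) = 0.
Proof. by rewrite -{1}(subrr 0) starB subrr. Qed.

Lemma smul_sub2 x y x' y' :
  x ** y - x' ** y' = x ** (y - y') + (x - x') ** y'.
Proof. by rewrite smulBr smulBl addrA subrK. Qed.

End StarAlgebraTheory.

HB.mixin Record isCStarAlgebra (R : realType) A
    & StarAlgebra R A & CompleteNormedModule R[i] A := {
  ler_norm_smul : forall x y : A, `|x ** y| <= `|x| * `|y|;
  norm_star_smul : forall x : A, `|star x ** x| = `|x| ^+ 2;
}.

#[short(type="cstarAlgType")]
HB.structure Definition CStarAlgebra (R : realType) :=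
  {A of StarAlgebra R A & CompleteNormedModule R[i] A & isCStarAlgebra R A}.


Record cstar_seminorm (R : realType) (V : starAlgType R) (p : V -> R) : Prop := {
  csn_triangle : forall x y, p (x + y) <= p x + p y;
  csn_scale : forall (c : R[i]) x, p (c *: x) = normc c * p x;
  csn_mul : forall x y, p (x ** y) <= p x * p y;
  csn_star : forall x, p (star x ** x) = p x ^+ 2;
}.

Definition cauchy_for (R : realType) (V : zmodType) (p : V -> R) (u : nat -> V) :=
  forall e, 0 < e -> exists N, forall m n, (N <= m)%N -> (N <= n)%N ->
    p (u m - u n) < e.

Definition cvg_for (R : realType) (V : zmodType) (p : V -> R) (u : nat -> V)
    (l : V) :=
  forall e, 0 < e -> exists N, forall n, (N <= n)%N -> p (u n - l) < e.

Lemma natSinv_lt (R : realType) (e : R) : 0 < e -> exists N, N.+1%:R^-1 < e.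
Proof.
move=> e0; exists (Num.truncn e^-1).
by rewrite invf_plt ?posrE ?ltr0n// truncnS_gt.
Qed.

Section SeminormTheory.
Context (R : realType) (V : starAlgType R) (p : V -> R).
Hypothesis hp : cstar_seminorm p.

Lemma csn0 : p 0 = 0.
Proof. by rewrite -(scale0r 0) (csn_scale hp) normc0 mul0r. Qed.

Lemma csnN x : p (- x) = p x.
Proof.
rewrite -scaleN1r (csn_scale hp).
by rewrite (@normcN R (1 : R[i])) normc1 mul1r.
Qed.

Lemma csn_ge0 x : 0 <= p x.
Proof.
have := csn_triangle hp x (- x); rewrite subrr csn0 csnN -mulr2n.
by rewrite pmulrn_lge0.
Qed.

Lemma csnBC x y : p (x - y) = p (y - x).
Proof. by rewrite -csnN opprB. Qed.

Lemma csn_dist z x y : p (x - y) <= p (x - z) + p (z - y).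
Proof. by rewrite (le_trans _ (csn_triangle hp _ _))// addrA subrK. Qed.

Lemma csn_leB x y : p x - p y <= p (x - y).
Proof. by rewrite lerBlDr (le_trans _ (csn_triangle hp _ _))// subrK. Qed.

Lemma csn_starle x : p x <= p (star x).
Proof.
have := csn_mul hp (star x) x; rewrite (csn_star hp) expr2.
have [p0|p0] := eqVneq (p x) 0; first by rewrite p0 csn_ge0.
by rewrite ler_pM2r// lt_def p0 csn_ge0.
Qed.

Lemma csn_isometric_star x : p (star x) = p x.
Proof. by apply/le_anti; rewrite csn_starle -{2}(starK x) csn_starle. Qed.

End SeminormTheory.

(* A complete C*-norm with values in R; library norms of R[i]-modules are
   R[i]-valued. *)
HB.factory Record StarAlgebra_isCStar (R : realType) A & StarAlgebra R A := {
  cnorm : A -> R;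
  cnorm_seminorm : @cstar_seminorm R A cnorm;
  cnorm_eq0 : forall x : A, cnorm x = 0 -> x = 0;
  cnorm_complete : forall u : nat -> A, @cauchy_for R A cnorm u ->
    exists l : A, @cvg_for R A cnorm u l;
}.

HB.builders Context R A & StarAlgebra_isCStar R A.

Local Notation nrm := (fun x : A => (cnorm x)%:C).

Let nrmD (x y : A) : nrm (x + y) <= nrm x + nrm y.
Proof. by rewrite -rmorphD/= lecR (csn_triangle cnorm_seminorm). Qed.

Let nrmZ (c : R[i]) (x : A) : nrm (c *: x) = `|c| * nrm x.
Proof. by rewrite /= (csn_scale cnorm_seminorm) rmorphM; case: c. Qed.

Let nrm0 (x : A) : nrm x = 0 -> x = 0.
Proof. by move=> /complexI/cnorm_eq0. Qed.

HB.instance Definition _ := @Lmodule_isNormed.Build R[i] A nrm nrmD nrmZ nrm0.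

Let normE (x : A) : `|x| = (cnorm x)%:C. Proof. by []. Qed.

Let ballP (x y : A) (e : R) : ball x e%:C y <-> cnorm (x - y) < e.
Proof. by rewrite -ball_normE/= normE ltcR. Qed.

Let cplt (F : set_system A) : ProperFilter F -> cauchy F -> cvg F.
Proof.
move=> FF /(cauchyP F) Fc.
have /choice[x Fx] (n : nat) : exists x, F (ball x (n.+1%:R^-1)%:C).
  by apply: Fc; rewrite ltcR invr_gt0 ltr0n.
have cx : @cauchy_for R A cnorm x.
  move=> e e0.
  have [N Ne] := natSinv_lt (divr_gt0 e0 (ltr0Sn _ 1)).
  exists N => m n Nm Nn.
  have [z [zm zn]] := filter_ex (filterI (Fx m) (Fx n)).
  move: zm zn => /ballP zm /ballP zn.
  rewrite (le_lt_trans (csn_dist cnorm_seminorm z _ _))// (csnBC cnorm_seminorm z).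
  rewrite (splitr e) ltrD// (lt_trans zm, lt_trans zn)//.
  - by rewrite (le_lt_trans _ Ne)// lef_pV2 ?posrE ?ltr0n// ler_nat ltnS.
  - by rewrite (le_lt_trans _ Ne)// lef_pV2 ?posrE ?ltr0n// ler_nat ltnS.
have [l xl] := cnorm_complete cx.
apply/cvg_ex; exists l; apply/fcvg_ballP => e e0.
have eE : e = (complex.Re e)%:C by rewrite RRe_real// gtr0_real.
rewrite eE; set r := complex.Re e; have r0 : 0 < r by rewrite -ltcR -eE.
have [N Nr] := xl _ (divr_gt0 r0 (ltr0Sn _ 1)).
have [M Mr] := natSinv_lt (divr_gt0 r0 (ltr0Sn _ 1)).
apply: filterS (Fx (maxn N M)) => z /ballP zx; apply/ballP.
rewrite (le_lt_trans (csn_dist cnorm_seminorm (x (maxn N M)) _ _))//.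
rewrite (splitr r) ltrD//.
  by rewrite (csnBC cnorm_seminorm) Nr// leq_maxl.
rewrite (lt_trans zx)// (le_lt_trans _ Mr)//.
by rewrite lef_pV2 ?posrE ?ltr0n// ler_nat ltnS leq_maxr.
Qed.

HB.instance Definition _ := Uniform_isComplete.Build A cplt.

Let norm_mul (x y : A) : `|x ** y| <= `|x| * `|y|.
Proof. by rewrite !normE -rmorphM lecR (csn_mul cnorm_seminorm). Qed.

Let norm_star (x : A) : `|star x ** x| = `|x| ^+ 2.
Proof. by rewrite !normE (csn_star cnorm_seminorm) rmorphXn. Qed.

HB.instance Definition _ := isCStarAlgebra.Build R A norm_mul norm_star.

HB.end.

Definition rnorm (R : realType) (A : cstarAlgType R) (x : A) : R :=
  complex.Re `|x|.

Section RealNorm.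
Context (R : realType) (A : cstarAlgType R).
Implicit Types x y : A.

Lemma rnormE x : `|x| = (rnorm x)%:C.
Proof. by rewrite RRe_real// ger0_real. Qed.

Lemma rnorm_seminorm : cstar_seminorm (@rnorm R A).
Proof.
split=> [x y|c x|x y|x].
- by rewrite -lecR rmorphD/= -!rnormE ler_normD.
- by apply: complexI; rewrite rmorphM/= -!rnormE normrZ; case: c.
- by rewrite -lecR rmorphM/= -!rnormE ler_norm_smul.
- by apply: complexI; rewrite rmorphXn/= -!rnormE norm_star_smul.
Qed.

Lemma rnorm_eq0 x : rnorm x = 0 -> x = 0.
Proof. by move=> x0; apply/normr0_eq0; rewrite rnormE x0. Qed.

Lemma rnorm_cvgP (F : set_system A) (FF : Filter F) x :
  F --> x <-> forall e : R, 0 < e -> \forall y \near F, rnorm (y - x) < e.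
Proof.
split=> [Fx e e0|Fx].
- move/fcvg_ballP : Fx => /(_ e%:C); rewrite ltcR => /(_ e0).
  by apply: filterS => y; rewrite -ball_normE/= rnormE ltcR -(csnBC rnorm_seminorm).
apply/fcvg_ballP => e e0.
have eE : e = (complex.Re e)%:C by rewrite RRe_real// gtr0_real.
have /Fx : 0 < complex.Re e by rewrite -ltcR -eE.
apply: filterS => y; rewrite eE -ball_normE/= rnormE ltcR.
by rewrite -(csnBC rnorm_seminorm).
Qed.

Lemma rnorm_cvg_for (u : nat -> A) x :
  u @ \oo --> x <-> cvg_for (@rnorm R A) u x.
Proof.
split=> [/rnorm_cvgP ux e /ux[N _ uN]|ux]; first by exists N.
by apply/rnorm_cvgP => e /ux[N uN]; exists N.
Qed.

Lemma rnorm_complete (u : nat -> A) : cauchy_for (@rnorm R A) u ->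
  exists x, cvg_for (@rnorm R A) u x.
Proof.
move=> cu; have /cauchy_cvgP/cvg_ex[x ux] : cauchy (u @ \oo); last first.
  by exists x; apply/rnorm_cvg_for.
apply/cauchyP => e e0.
have eE : e = (complex.Re e)%:C by rewrite RRe_real// gtr0_real.
have [N uN] : exists N, _ := cu (complex.Re e) ltac:(by rewrite -ltcR -eE).
exists (u N); exists N => // n /= Nn.
by rewrite eE -ball_normE/= rnormE ltcR uN.
Qed.

End RealNorm.

(* C(X, A); compactness of X is needed for the sup norm. *)
Definition cfun (R : realType) (X : topologicalType)
  (cX : compact [set: X]) (A : cstarAlgType R) : Type := continuousType X A.

Section ContinuousFunctions.
Context (R : realType) (X : topologicalType) (cX : compact [set: X]).
Context (A : cstarAlgType R).
Local Notation CXA := (cfun cX A).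
Implicit Types f g h : CXA.

HB.instance Definition _ := Choice.copy CXA (continuousType X A).

Definition cfun_eval (f : CXA) : X -> A := Continuous.sort f.

Lemma cfunP f g : cfun_eval f =1 cfun_eval g -> f = g.
Proof. by move=> /continuousEP. Qed.

Lemma cfun_cts f : continuous (cfun_eval f).
Proof. exact: (@cts_fun _ _ f). Qed.

Lemma cfun_near f x e : 0 < e ->
  \forall y \near x, rnorm (cfun_eval f y - cfun_eval f x) < e.
Proof. by move=> e0; have /rnorm_cvgP := @cfun_cts f x; exact. Qed.

Definition mkcfun (u : X -> A) (cu : continuous u) : CXA :=
  (mkcts cu : continuousType X A).

Local Notation hr := (@rnorm_seminorm R A).

Lemma cfun_add_cts f g : continuous (fun x => cfun_eval f x + cfun_eval g x).
Proof. by move=> x; apply: cvgD; exact: cfun_cts. Qed.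

Lemma cfun_opp_cts f : continuous (fun x => - cfun_eval f x).
Proof. by move=> x; apply: cvgN; exact: cfun_cts. Qed.

Lemma cfun_scale_cts (c : R[i]) f : continuous (fun x => c *: cfun_eval f x).
Proof. by move=> x; apply: cvgZr; exact: cfun_cts. Qed.

Lemma cfun_zero_cts : continuous (fun _ : X => 0 : A).
Proof. by move=> x; exact: cvg_cst. Qed.

Lemma cfun_star_cts f : continuous (fun x => star (cfun_eval f x)).
Proof.
move=> x; apply/rnorm_cvgP => e e0; rewrite near_map.
near=> y; rewrite /= -starB (csn_isometric_star hr).
by near: y; exact: cfun_near.
Unshelve. all: by end_near. Qed.

Lemma cfun_mul_cts f g : continuous (fun x => cfun_eval f x ** cfun_eval g x).
Proof.
move=> x; apply/rnorm_cvgP => e e0; rewrite near_map.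
pose Mf := rnorm (cfun_eval f x) + 1; pose Mg := rnorm (cfun_eval g x) + 1.
have Mf0 : 0 < Mf by rewrite ltr_wpDl// (csn_ge0 hr).
have Mg0 : 0 < Mg by rewrite ltr_wpDl// (csn_ge0 hr).
near=> y; rewrite /=.
rewrite smul_sub2.
rewrite (le_lt_trans (csn_triangle hr _ _))// (splitr e) ltr_leD//.
- rewrite (le_lt_trans (csn_mul hr _ _))//.
  have fy : rnorm (cfun_eval f y) <= Mf.
    rewrite -(subrK (cfun_eval f x) (cfun_eval f y)).
    rewrite (le_trans (csn_triangle hr _ _))// addrC lerD2l ltW//.
    by near: y; apply: cfun_near.
  rewrite (le_lt_trans (ler_wpM2r (csn_ge0 hr _) fy))//.
  rewrite mulrC -ltr_pdivlMr//; near: y; apply: cfun_near.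
  by rewrite !divr_gt0.
- rewrite (le_trans (csn_mul hr _ _))//.
  have gx : rnorm (cfun_eval g x) <= Mg by rewrite lerDl.
  rewrite (le_trans (ler_wpM2l (csn_ge0 hr _) gx))//.
  rewrite -ler_pdivlMr// ltW//; near: y; apply: cfun_near.
  by rewrite !divr_gt0.
Unshelve. all: by end_near. Qed.

Definition cfun_add f g := mkcfun (@cfun_add_cts f g).
Definition cfun_opp f := mkcfun (@cfun_opp_cts f).
Definition cfun_zero := mkcfun (@cfun_zero_cts).
Definition cfun_scale c f := mkcfun (@cfun_scale_cts c f).
Definition cfun_mul f g := mkcfun (@cfun_mul_cts f g).
Definition cfun_star f := mkcfun (@cfun_star_cts f).

Fact cfun_addA : associative cfun_add.
Proof. by move=> f g h; apply: cfunP => x; exact: addrA. Qed.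
Fact cfun_addC : commutative cfun_add.
Proof. by move=> f g; apply: cfunP => x; exact: addrC. Qed.
Fact cfun_add0 : left_id cfun_zero cfun_add.
Proof. by move=> f; apply: cfunP => x; exact: add0r. Qed.
Fact cfun_addN : left_inverse cfun_zero cfun_opp cfun_add.
Proof. by move=> f; apply: cfunP => x; exact: addNr. Qed.

HB.instance Definition _ :=
  GRing.isZmodule.Build CXA cfun_addA cfun_addC cfun_add0 cfun_addN.

Fact cfun_scaleA c d f :
  cfun_scale c (cfun_scale d f) = cfun_scale (c * d) f.
Proof. by apply: cfunP => x; exact: scalerA. Qed.
Fact cfun_scale1 : left_id 1 cfun_scale.
Proof. by move=> f; apply: cfunP => x; exact: scale1r. Qed.
Fact cfun_scaleDr : right_distributive cfun_scale +%R.
Proof. by move=> c f g; apply: cfunP => x; exact: scalerDr. Qed.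
Fact cfun_scaleDl f : {morph cfun_scale^~ f : c d / c + d}.
Proof. by move=> c d; apply: cfunP => x; exact: scalerDl. Qed.

HB.instance Definition _ := GRing.Zmodule_isLmodule.Build R[i] CXA
  cfun_scaleA cfun_scale1 cfun_scaleDr cfun_scaleDl.

Fact cfun_mulA : associative cfun_mul.
Proof. by move=> f g h; apply: cfunP => x; exact: smulA. Qed.
Fact cfun_mulDl : left_distributive cfun_mul +%R.
Proof. by move=> f g h; apply: cfunP => x; exact: smulDl. Qed.
Fact cfun_mulDr : right_distributive cfun_mul +%R.
Proof. by move=> f g h; apply: cfunP => x; exact: smulDr. Qed.
Fact cfun_scale_mull (c : R[i]) f g : cfun_mul (c *: f) g = c *: cfun_mul f g.
Proof. by apply: cfunP => x; exact: scale_smull. Qed.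
Fact cfun_scale_mulr (c : R[i]) f g : cfun_mul f (c *: g) = c *: cfun_mul f g.
Proof. by apply: cfunP => x; exact: scale_smulr. Qed.
Fact cfun_starD : {morph cfun_star : f g / f + g}.
Proof. by move=> f g; apply: cfunP => x; exact: starD. Qed.
Fact cfun_starZ (c : R[i]) f : cfun_star (c *: f) = conjc c *: cfun_star f.
Proof. by apply: cfunP => x; exact: starZ. Qed.
Fact cfun_starM f g : cfun_star (cfun_mul f g) = cfun_mul (cfun_star g) (cfun_star f).
Proof. by apply: cfunP => x; exact: starM. Qed.
Fact cfun_starK : involutive cfun_star.
Proof. by move=> f; apply: cfunP => x; exact: starK. Qed.

HB.instance Definition _ := isStarAlgebra.Build R CXA cfun_mulA cfun_mulDl
  cfun_mulDr cfun_scale_mull cfun_scale_mulr cfun_starD cfun_starZ cfun_starM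
  cfun_starK.

(* For empty X the set is empty and its sup is 0, as it should be. *)
Definition supnorm (f : CXA) : R :=
  sup [set rnorm (cfun_eval f x) | x in [set: X]].

Lemma supnorm_has_ub f : has_ubound [set rnorm (cfun_eval f x) | x in [set: X]].
Proof.
have [M Mf] : exists M : R, forall x, rnorm (cfun_eval f x) < M.
  have cf : continuous (fun x => rnorm (cfun_eval f x) : R^o).
    move=> x; apply/cvgrPdist_lt => e e0; near=> y.
    rewrite distrC (@le_lt_trans _ _ (rnorm (cfun_eval f y - cfun_eval f x)))//.
      rewrite ler_norml (csn_leB hr) andbT lerNl opprB.
      by rewrite (csnBC hr) (csn_leB hr).
    by near: y; exact: cfun_near.
  have cK : compact ((fun x => rnorm (cfun_eval f x) : R^o) @` [set: X]).
    by apply: continuous_compact => //; exact: continuous_subspaceT.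
  have [M [_ MK]] := compact_bounded cK.
  exists (M + 2) => x; rewrite (@le_lt_trans _ _ (M + 1))//; last first.
    by rewrite ltrD2l ltr1n.
  rewrite (le_trans (ler_norm _))//.
  by apply: (MK (M + 1)); [rewrite ltrDl|exists x].
by exists M => _ [x _ <-]; exact: ltW.
Unshelve. all: by end_near. Qed.

Lemma supnorm_le f x : rnorm (cfun_eval f x) <= supnorm f.
Proof. by apply: ub_le_sup; [exact: supnorm_has_ub|exists x]. Qed.

Lemma supnorm_empty f : ~ ([set: X] !=set0) -> supnorm f = 0.
Proof. by move=> /set0P/negP; rewrite negbK /supnorm => /eqP ->; rewrite image_set0 sup0. Qed.

Lemma supnorm_leP f (M : R) : 0 <= M ->
  (forall x, rnorm (cfun_eval f x) <= M) -> supnorm f <= M.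
Proof.
move=> M0 fM; have [[x _]|X0] := pselect ([set: X] !=set0).
  apply: ge_sup; first by exists (rnorm (cfun_eval f x)); exists x.
  by move=> _ [y _ <-].
by rewrite supnorm_empty.
Qed.

Lemma supnorm_ge0 f : 0 <= supnorm f.
Proof.
have [[x _]|X0] := pselect ([set: X] !=set0).
  exact: le_trans (csn_ge0 hr _) (supnorm_le f x).
by rewrite supnorm_empty.
Qed.

Lemma normc_ge0 (c : R[i]) : 0 <= normc c.
Proof. by case: c => a b; exact: sqrtr_ge0. Qed.

Fact supnorm_scale_le (c : R[i]) f : supnorm (c *: f) <= normc c * supnorm f.
Proof.
apply: supnorm_leP => [|x]; first by rewrite mulr_ge0 ?normc_ge0 ?supnorm_ge0.
rewrite (_ : cfun_eval _ x = c *: cfun_eval f x)// (csn_scale hr).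
by rewrite ler_wpM2l ?normc_ge0 ?supnorm_le.
Qed.

Fact supnorm_seminorm : cstar_seminorm supnorm.
Proof.
split=> [f g|c f|f g|f].
- apply: supnorm_leP => [|x]; first by rewrite addr_ge0 ?supnorm_ge0.
  by rewrite (le_trans (csn_triangle hr _ _))// lerD ?supnorm_le.
- apply/le_anti; rewrite supnorm_scale_le/=.
  have [->|c0] := eqVneq c 0; first by rewrite normc0 mul0r supnorm_ge0.
  have nc0 : 0 < normc c.
    rewrite lt_def normc_ge0 andbT; apply: contra_neq c0; exact: eq0_normc.
  rewrite -[X in _ * supnorm X](scalerK c0) mulrC -ler_pdivlMr//.
  by rewrite (le_trans (supnorm_scale_le _ _))// normcV mulrC.
- apply: supnorm_leP => [|x]; first by rewrite mulr_ge0 ?supnorm_ge0.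
  rewrite (le_trans (csn_mul hr _ _))//.
  by rewrite ler_pM ?(csn_ge0 hr) ?supnorm_le.
- apply/le_anti/andP; split.
    apply: supnorm_leP => [|x]; first by rewrite exprn_ge0 ?supnorm_ge0.
    by rewrite (csn_star hr) lerXn2r ?nnegrE ?(csn_ge0 hr) ?supnorm_ge0 ?supnorm_le.
  rewrite -ler_sqrt ?supnorm_ge0// sqrtr_sqr ger0_norm ?supnorm_ge0//.
  apply: supnorm_leP => [|x]; first exact: sqrtr_ge0.
  rewrite -(ger0_norm (csn_ge0 hr (cfun_eval f x))) -sqrtr_sqr -(csn_star hr).
  by rewrite ler_sqrt ?supnorm_ge0//; exact: (supnorm_le (star f ** f)).
Qed.

Fact supnorm_eq0 f : supnorm f = 0 -> f = 0.
Proof.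
move=> f0; apply: cfunP => x; apply: rnorm_eq0; apply/le_anti.
by rewrite -{1}f0 supnorm_le (csn_ge0 hr).
Qed.

Fact supnorm_complete (u : nat -> CXA) :
  cauchy_for supnorm u -> exists l, cvg_for supnorm u l.
Proof.
move=> cu.
have dist m n x : rnorm (cfun_eval (u m) x - cfun_eval (u n) x) <=
  supnorm (u m - u n) by exact: (supnorm_le (u m - u n)).
have /choice[l ul] x : exists y, cvg_for (@rnorm R A) (fun n => cfun_eval (u n) x) y.
  apply: rnorm_complete => e /cu[N uN]; exists N => m n Nm Nn.
  by rewrite (le_lt_trans (dist _ _ _))// uN.
have unif e : 0 < e -> exists N, forall n, (N <= n)%N ->
    forall x, rnorm (cfun_eval (u n) x - l x) <= e.
  move=> e0; have [N uN] := cu _ (divr_gt0 e0 (ltr0Sn _ 1)).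
  exists N => n Nn x; have [M uM] := ul x _ (divr_gt0 e0 (ltr0Sn _ 1)).
  rewrite (le_trans (csn_dist hr (cfun_eval (u (maxn N M)) x) _ _))// (splitr e).
  rewrite lerD//; last by rewrite ltW// uM// leq_maxr.
  by rewrite (le_trans (dist _ _ _))// ltW// uN// leq_maxl.
have cl : continuous l.
  move=> x; apply/rnorm_cvgP => e e0; rewrite near_map.
  have e3 : 0 < e / 3 by rewrite divr_gt0.
  have [N uN] := unif _ e3; near=> y.
  rewrite (le_lt_trans (csn_dist hr (cfun_eval (u N) y) _ _))//.
  have -> : e = e / 3 + (e / 3 + e / 3).
    by rewrite -[RHS]/((e / 3) *+ 3) -mulr_natr divfK// pnatr_eq0.
  rewrite ler_ltD// ?(csnBC hr (l y)) ?uN//.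
  rewrite (le_lt_trans (csn_dist hr (cfun_eval (u N) x) _ _))//.
  rewrite ltr_leD ?uN//.
  by near: y; exact: cfun_near.
exists (mkcfun cl) => e e0.
have e2 : 0 < e / 2 by rewrite divr_gt0.
have [N uN] := unif _ e2; exists N => n Nn.
rewrite (@le_lt_trans _ _ (e / 2))//; last by rewrite ltr_pdivrMr// ltr_pMr// ltr1n.
by apply: supnorm_leP; [exact: ltW|move=> x; exact: uN].
Unshelve. all: by end_near. Qed.

HB.instance Definition _ := StarAlgebra_isCStar.Build R CXA
  supnorm_seminorm supnorm_eq0 supnorm_complete.

End ContinuousFunctions.

Lemma real_cvg_uniq (R : realType) (f : nat -> R) (a b : R) :
  f n @[n --> \oo] --> a -> f n @[n --> \oo] --> b -> a = b.
Proof. by move=> fa fb; apply: (@norm_cvg_unique R R^o _ _ _ _ fa fb). Qed.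

(* The C*-algebra obtained from a C*-seminorm p on V: Cauchy sequences modulo
   null sequences. *)
Section HausdorffCompletion.
Context (R : realType) (V : starAlgType R) (p : V -> R).
Context (hp : cstar_seminorm p).
Local Open Scope quotient_scope.

Record cauchyseq := CauchySeq { cs_val :> nat -> V; cs_cauchy : cauchy_for p cs_val }.

HB.instance Definition _ := gen_eqMixin cauchyseq.
HB.instance Definition _ := gen_choiceMixin cauchyseq.

Implicit Types u v w : cauchyseq.

Definition cs_null (u : nat -> V) := cvg_for p u 0.

Lemma cs_nullD (u v : nat -> V) :
  cs_null u -> cs_null v -> cs_null (fun n => u n + v n).
Proof.
move=> u0 v0 e e0; have e2 : 0 < e / 2 by rewrite divr_gt0.
have [N uN] := u0 _ e2; have [M vM] := v0 _ e2.
exists (maxn N M) => n; rewrite geq_max => /andP[/uN un /vM vn].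
move: un vn; rewrite !subr0 => un vn.
by rewrite (le_lt_trans (csn_triangle hp _ _))// (splitr e) ltrD.
Qed.

Lemma cs_null_le (u : nat -> V) (f : nat -> V) (M : R) : 0 < M ->
  (forall n, p (u n) <= M * p (f n)) -> cs_null f -> cs_null u.
Proof.
move=> M0 ufM f0 e e0; have [N fN] := f0 _ (divr_gt0 e0 M0).
exists N => n /fN; rewrite !subr0 => fn.
by rewrite (le_lt_trans (ufM n))// mulrC -ltr_pdivlMr.
Qed.

Lemma cs_null0 (u : nat -> V) : (forall n, u n = 0) -> cs_null u.
Proof. by move=> u0 e e0; exists 0%N => n _; rewrite u0 subrr (csn0 hp). Qed.

Lemma cs_bounded u : exists2 M, 0 < M & forall n, p (u n) <= M.
Proof.
have [N uN] := cs_cauchy u ltr01.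
have [M M0 uM] : exists2 M, 0 < M & forall n, (n < N)%N -> p (u n) <= M.
  elim: N {uN} => [|N [M M0 uM]]; first by exists 1.
  exists (M + p (u N)) => [|n]; first by rewrite ltr_wpDr// (csn_ge0 hp).
  rewrite ltnS leq_eqVlt => /predU1P[->|/uM un].
    by rewrite lerDr ltW.
  by rewrite (le_trans un)// lerDl (csn_ge0 hp).
exists (M + (1 + p (u N))) => [|n].
  by rewrite ltr_wpDr// addr_ge0// (csn_ge0 hp).
have [/uM un|Nn] := ltnP n N.
  by rewrite (le_trans un)// lerDl addr_ge0 ?(csn_ge0 hp).
rewrite -{1}(subrK (u N) (u n)) (le_trans (csn_triangle hp _ _))//.
by rewrite addrA lerD2r (le_trans (ltW (uN _ _ Nn (leqnn N))))// lerDr ltW.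
Qed.

Definition cs_equiv u v : bool := `[< cs_null (fun n => u n - v n) >].

Lemma cs_equiv_refl : reflexive cs_equiv.
Proof. by move=> u; apply/asboolP/cs_null0 => n; rewrite subrr. Qed.

Lemma cs_equiv_sym : symmetric cs_equiv.
Proof.
have H u v : cs_equiv u v -> cs_equiv v u.
  move=> /asboolP uv; apply/asboolP; apply: (cs_null_le ltr01 _ uv) => n.
  by rewrite mul1r (csnBC hp).
by move=> u v; apply/idP/idP; exact: H.
Qed.

Lemma cs_equiv_trans : transitive cs_equiv.
Proof.
move=> v u w /asboolP uv /asboolP vw; apply/asboolP.
have := cs_nullD uv vw; apply: (cs_null_le ltr01) => n.
by rewrite mul1r addrA subrK.
Qed.

Definition cs_equivrel := EquivRel cs_equiv cs_equiv_refl cs_equiv_sym cs_equiv_trans.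

Definition hcompletion : Type := {eq_quot cs_equivrel}.

HB.instance Definition _ := Choice.copy hcompletion {eq_quot cs_equivrel}.
HB.instance Definition _ := EqQuotient.copy hcompletion {eq_quot cs_equivrel}.

Implicit Types x y z : hcompletion.

Definition hc_pi u : hcompletion := \pi_({eq_quot cs_equivrel}) u.
Definition hc_repr x : cauchyseq := repr (x : {eq_quot cs_equivrel}).

Lemma hc_reprK : cancel hc_repr hc_pi.
Proof. by move=> x; rewrite /hc_pi reprK. Qed.

Lemma hc_piP u v : hc_pi u = hc_pi v <-> cs_null (fun n => u n - v n).
Proof.
rewrite /hc_pi; split=> [/eqmodP/asboolP//|uv].
by apply/eqmodP/asboolP.
Qed.

Lemma hc_pi_ext u v : (forall n, u n = v n) -> hc_pi u = hc_pi v.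
Proof. by move=> uv; apply/hc_piP/cs_null0 => n; rewrite uv subrr. Qed.

Lemma hc_repr_pi u : cs_null (fun n => hc_repr (hc_pi u) n - u n).
Proof. by apply/hc_piP; rewrite hc_reprK. Qed.

Lemma hc_ind (P : hcompletion -> Prop) : (forall u, P (hc_pi u)) -> forall x, P x.
Proof. by move=> Pu x; rewrite -(hc_reprK x). Qed.

Lemma cauchy_le (u : nat -> V) (v w : cauchyseq) (M : R) : 0 < M ->
  (forall m n, p (u m - u n) <= M * (p (v m - v n) + p (w m - w n))) ->
  cauchy_for p u.
Proof.
move=> M0 uvw e e0.
have e2 : 0 < e / M / 2 by rewrite !divr_gt0.
have [N vN] := cs_cauchy v e2; have [K wK] := cs_cauchy w e2.
exists (maxn N K) => m n; rewrite !geq_max => /andP[Nm Km] /andP[Nn Kn].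
rewrite (le_lt_trans (uvw m n))// mulrC -ltr_pdivlMr// (splitr (e / M)).
by rewrite ltrD ?vN ?wK.
Qed.

Lemma cs_add_cauchy u v : cauchy_for p (fun n => u n + v n).
Proof.
apply: (@cauchy_le _ u v 1) => // m n.
by rewrite mul1r opprD addrACA (csn_triangle hp).
Qed.

Lemma cs_scale_cauchy (c : R[i]) u : cauchy_for p (fun n => c *: u n).
Proof.
have nc : 0 <= normc c by case: c => a b; exact: sqrtr_ge0.
apply: (@cauchy_le _ u u (normc c + 1)) => [|m n].
  by rewrite ltr_wpDl.
rewrite -scalerBr (csn_scale hp) mulrDr ler_wpDr// ?mulr_ge0 ?addr_ge0 ?(csn_ge0 hp)//.
by rewrite ler_wpM2r ?(csn_ge0 hp)// lerDl.
Qed.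

Lemma cs_star_cauchy u : cauchy_for p (fun n => star (u n)).
Proof.
apply: (@cauchy_le _ u u 1) => // m n.
by rewrite -starB (csn_isometric_star hp) mul1r lerDl (csn_ge0 hp).
Qed.

Lemma cs_mul_cauchy u v : cauchy_for p (fun n => u n ** v n).
Proof.
have [M M0 uM] := cs_bounded u; have [K K0 vK] := cs_bounded v.
apply: (@cauchy_le _ u v (M + K)) => [|m n]; first by rewrite addr_gt0.
rewrite smul_sub2 (le_trans (csn_triangle hp _ _))// addrC mulrDr.
rewrite lerD// (le_trans (csn_mul hp _ _))//.
  rewrite mulrC ler_wpM2r ?(csn_ge0 hp)// (le_trans (vK n))// lerDr ltW//.
by rewrite ler_wpM2r ?(csn_ge0 hp)// (le_trans (uM m))// lerDl ltW.
Qed.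

Lemma cs_const_cauchy (x : V) : cauchy_for p (fun _ => x).
Proof. by move=> e e0; exists 0%N => *; rewrite subrr (csn0 hp). Qed.

Definition cs_add u v := CauchySeq (cs_add_cauchy u v).
Definition cs_scale c u := CauchySeq (cs_scale_cauchy c u).
Definition cs_star u := CauchySeq (cs_star_cauchy u).
Definition cs_mul u v := CauchySeq (cs_mul_cauchy u v).
Definition cs_const (a : V) := CauchySeq (cs_const_cauchy a).

Definition hc_add x y := hc_pi (cs_add (hc_repr x) (hc_repr y)).
Definition hc_scale c x := hc_pi (cs_scale c (hc_repr x)).
Definition hc_star x := hc_pi (cs_star (hc_repr x)).
Definition hc_mul x y := hc_pi (cs_mul (hc_repr x) (hc_repr y)).
Definition hc_of (a : V) := hc_pi (cs_const a).

Lemma hc_addE u v : hc_add (hc_pi u) (hc_pi v) = hc_pi (cs_add u v).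
Proof.
apply/hc_piP; have := cs_nullD (hc_repr_pi u) (hc_repr_pi v).
by apply: (cs_null_le ltr01) => n; rewrite mul1r /= opprD addrACA.
Qed.

Lemma hc_scaleE c u : hc_scale c (hc_pi u) = hc_pi (cs_scale c u).
Proof.
have nc : 0 <= normc c by case: c => a b; exact: sqrtr_ge0.
apply/hc_piP; have := hc_repr_pi u.
apply: (@cs_null_le _ _ (normc c + 1)) => [|n]; first by rewrite ltr_wpDl.
by rewrite /= -scalerBr (csn_scale hp) ler_wpM2r ?(csn_ge0 hp)// lerDl.
Qed.

Lemma hc_starE u : hc_star (hc_pi u) = hc_pi (cs_star u).
Proof.
apply/hc_piP; have := hc_repr_pi u; apply: (cs_null_le ltr01) => n.
by rewrite /= -starB (csn_isometric_star hp) mul1r.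
Qed.

Lemma hc_mulE u v : hc_mul (hc_pi u) (hc_pi v) = hc_pi (cs_mul u v).
Proof.
apply/hc_piP.
have [M M0 uM] := cs_bounded (hc_repr (hc_pi u)); have [K K0 vK] := cs_bounded v.
pose f n := hc_repr (hc_pi u) n ** (hc_repr (hc_pi v) n - v n).
pose g n := (hc_repr (hc_pi u) n - u n) ** v n.
have f0 : cs_null f.
  apply: (cs_null_le M0 _ (hc_repr_pi v)) => n.
  by rewrite (le_trans (csn_mul hp _ _))// ler_wpM2r ?(csn_ge0 hp).
have g0 : cs_null g.
  apply: (cs_null_le K0 _ (hc_repr_pi u)) => n.
  by rewrite (le_trans (csn_mul hp _ _))// mulrC ler_wpM2r ?(csn_ge0 hp).
by apply: (cs_null_le ltr01 _ (cs_nullD f0 g0)) => n; rewrite mul1r -smul_sub2.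
Qed.

Fact hc_addA : associative hc_add.
Proof.
elim/hc_ind => u; elim/hc_ind => v; elim/hc_ind => w.
by rewrite !hc_addE; apply: hc_pi_ext => n; exact: addrA.
Qed.

Fact hc_addC : commutative hc_add.
Proof.
elim/hc_ind => u; elim/hc_ind => v.
by rewrite !hc_addE; apply: hc_pi_ext => n; exact: addrC.
Qed.

Fact hc_add0 : left_id (hc_of 0) hc_add.
Proof. by elim/hc_ind => u; rewrite hc_addE; apply: hc_pi_ext => n; exact: add0r. Qed.

Fact hc_addN : left_inverse (hc_of 0) (hc_scale (-1)) hc_add.
Proof.
elim/hc_ind => u; rewrite hc_scaleE hc_addE; apply: hc_pi_ext => n /=.
by rewrite scaleN1r addNr.
Qed.

HB.instance Definition _ :=
  GRing.isZmodule.Build hcompletion hc_addA hc_addC hc_add0 hc_addN.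

Lemma hc_piD u v : hc_pi u + hc_pi v = hc_pi (cs_add u v).
Proof. exact: hc_addE. Qed.

Fact hc_scaleA c d x : hc_scale c (hc_scale d x) = hc_scale (c * d) x.
Proof.
elim/hc_ind: x => u; rewrite !hc_scaleE; apply: hc_pi_ext => n.
exact: scalerA.
Qed.

Fact hc_scale1 : left_id 1 hc_scale.
Proof. by elim/hc_ind => u; rewrite hc_scaleE; apply: hc_pi_ext => n; exact: scale1r. Qed.

Fact hc_scaleDr : right_distributive hc_scale +%R.
Proof.
move=> c; elim/hc_ind => u; elim/hc_ind => v.
by rewrite !(hc_scaleE, hc_piD); apply: hc_pi_ext => n; exact: scalerDr.
Qed.

Fact hc_scaleDl x : {morph hc_scale^~ x : c d / c + d}.
Proof.
elim/hc_ind: x => u c d; rewrite !(hc_scaleE, hc_piD); apply: hc_pi_ext => n.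
exact: scalerDl.
Qed.

HB.instance Definition _ := GRing.Zmodule_isLmodule.Build R[i] hcompletion
  hc_scaleA hc_scale1 hc_scaleDr hc_scaleDl.

Lemma hc_piZ (c : R[i]) u : c *: hc_pi u = hc_pi (cs_scale c u).
Proof. exact: hc_scaleE. Qed.

Fact hc_mulA : associative hc_mul.
Proof.
elim/hc_ind => u; elim/hc_ind => v; elim/hc_ind => w.
by rewrite !hc_mulE; apply: hc_pi_ext => n; exact: smulA.
Qed.

Fact hc_mulDl : left_distributive hc_mul +%R.
Proof.
elim/hc_ind => u; elim/hc_ind => v; elim/hc_ind => w.
by rewrite !(hc_mulE, hc_piD); apply: hc_pi_ext => n; exact: smulDl.
Qed.

Fact hc_mulDr : right_distributive hc_mul +%R.
Proof.
elim/hc_ind => u; elim/hc_ind => v; elim/hc_ind => w.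
by rewrite !(hc_mulE, hc_piD); apply: hc_pi_ext => n; exact: smulDr.
Qed.

Fact hc_scale_mull (c : R[i]) x y : hc_mul (c *: x) y = c *: hc_mul x y.
Proof.
elim/hc_ind: x => u; elim/hc_ind: y => v.
by rewrite !(hc_mulE, hc_piZ); apply: hc_pi_ext => n; exact: scale_smull.
Qed.

Fact hc_scale_mulr (c : R[i]) x y : hc_mul x (c *: y) = c *: hc_mul x y.
Proof.
elim/hc_ind: x => u; elim/hc_ind: y => v.
by rewrite !(hc_mulE, hc_piZ); apply: hc_pi_ext => n; exact: scale_smulr.
Qed.

Fact hc_starD : {morph hc_star : x y / x + y}.
Proof.
elim/hc_ind => u; elim/hc_ind => v.
by rewrite !(hc_starE, hc_piD); apply: hc_pi_ext => n; exact: starD.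
Qed.

Fact hc_starZ (c : R[i]) x : hc_star (c *: x) = conjc c *: hc_star x.
Proof.
elim/hc_ind: x => u.
by rewrite !(hc_starE, hc_piZ); apply: hc_pi_ext => n; exact: starZ.
Qed.

Fact hc_starM x y : hc_star (hc_mul x y) = hc_mul (hc_star y) (hc_star x).
Proof.
elim/hc_ind: x => u; elim/hc_ind: y => v.
by rewrite !(hc_starE, hc_mulE); apply: hc_pi_ext => n; exact: starM.
Qed.

Fact hc_starK : involutive hc_star.
Proof.
elim/hc_ind => u; rewrite !hc_starE; apply: hc_pi_ext => n; exact: starK.
Qed.

HB.instance Definition _ := isStarAlgebra.Build R hcompletion hc_mulA hc_mulDl
  hc_mulDr hc_scale_mull hc_scale_mulr hc_starD hc_starZ hc_starM hc_starK.

Lemma hc_pi_star u : star (hc_pi u) = hc_pi (cs_star u).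
Proof. exact: hc_starE. Qed.

Lemma hc_piM u v : hc_pi u ** hc_pi v = hc_pi (cs_mul u v).
Proof. exact: hc_mulE. Qed.

Definition hc_norm x : R := lim (p (hc_repr x n) @[n --> \oo]).

Lemma cs_norm_cvg u : cvg (p (u n) @[n --> \oo]).
Proof.
apply/cauchy_cvgP/cauchyP => e e0; have [N uN] := cs_cauchy u e0.
exists (p (u N)); exists N => // n /= Nn.
rewrite -ball_normE/= (@le_lt_trans _ _ (p (u N - u n)))//; last by rewrite uN.
rewrite ler_norml (csn_leB hp) andbT lerNl opprB.
by rewrite (csnBC hp) (csn_leB hp).
Qed.

Arguments cs_norm_cvg : clear implicits.

Lemma hc_normE u : p (u n) @[n --> \oo] --> hc_norm (hc_pi u).
Proof.
rewrite /hc_norm; have := cs_norm_cvg (hc_repr (hc_pi u)).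
move: (lim _) => l rl; apply/cvgrPdist_lt => e e0.
have e2 : 0 < e / 2 by rewrite divr_gt0.
have [N uN] := hc_repr_pi u e2.
move/cvgrPdist_lt : rl => /(_ _ e2)[M _ rM].
exists (maxn N M) => // n /=; rewrite geq_max => /andP[/uN un /rM /= rn].
rewrite (le_lt_trans (ler_distD (p (hc_repr (hc_pi u) n)) _ _))// (splitr e).
rewrite ltrD// (le_lt_trans _ un)// subr0.
rewrite ler_norml (csn_leB hp) andbT lerNl opprB.
by rewrite (csnBC hp) (csn_leB hp).
Qed.

Arguments hc_normE : clear implicits.

Lemma hc_norm_of (a : V) : hc_norm (hc_of a) = p a.
Proof.
apply: (real_cvg_uniq (hc_normE _)) => /=; exact: cvg_cst.
Qed.

Lemma hc_norm_le u (M : R) N : (forall n, (N <= n)%N -> p (u n) <= M) ->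
  hc_norm (hc_pi u) <= M.
Proof.
move=> uM; apply: (ler_cvg_to (hc_normE u) (cvg_cst M)).
by exists N.
Qed.

Fact hc_norm_seminorm : cstar_seminorm hc_norm.
Proof.
split.
- elim/hc_ind => u; elim/hc_ind => v; rewrite hc_piD.
  apply: (ler_cvg_to (hc_normE _) (cvgD (hc_normE u) (hc_normE v))).
  by near=> n; exact: (csn_triangle hp).
- move=> c; elim/hc_ind => u; rewrite hc_piZ.
  apply: (real_cvg_uniq (hc_normE _)).
  under eq_fun do rewrite /= (csn_scale hp).
  by apply: cvgMl_tmp; exact: hc_normE.
- elim/hc_ind => u; elim/hc_ind => v; rewrite hc_piM.
  apply: (ler_cvg_to (hc_normE _) (cvgM (hc_normE u) (hc_normE v))).
  by near=> n; exact: (csn_mul hp).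
- elim/hc_ind => u; rewrite hc_pi_star hc_piM expr2.
  apply: (real_cvg_uniq (hc_normE _)).
  under eq_fun do rewrite /= (csn_star hp) expr2.
  by apply: cvgM; exact: hc_normE.
Unshelve. all: by end_near. Qed.

Fact hc_norm_eq0 x : hc_norm x = 0 -> x = 0.
Proof.
elim/hc_ind: x => u u0; apply/hc_piP => e e0.
have := hc_normE u; rewrite u0 => /cvgrPdist_lt /(_ _ e0)[N _ uN].
exists N => n /uN /=; rewrite sub0r normrN !subr0.
by rewrite ger0_norm ?(csn_ge0 hp).
Qed.

Lemma hc_ofB (a b : V) : hc_of a - hc_of b = hc_of (a - b).
Proof.
rewrite -scaleN1r hc_piZ hc_piD; apply: hc_pi_ext => n /=.
by rewrite scaleN1r.
Qed.

Lemma hc_pi_ofB u (a : V) (e : R) N : (forall n, (N <= n)%N -> p (u n - a) <= e) ->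
  hc_norm (hc_pi u - hc_of a) <= e.
Proof.
move=> uN; rewrite -scaleN1r hc_piZ hc_piD; apply: (@hc_norm_le _ _ N) => n /=.
by rewrite scaleN1r; exact: uN.
Qed.

Lemma hc_dense x (e : R) : 0 < e -> exists a, hc_norm (x - hc_of a) <= e.
Proof.
elim/hc_ind: x => u e0; have [N uN] := cs_cauchy u e0.
by exists (u N); apply: (@hc_pi_ofB _ _ _ N) => n Nn; rewrite ltW// uN.
Qed.

Fact hc_complete (s : nat -> hcompletion) :
  cauchy_for hc_norm s -> exists l, cvg_for hc_norm s l.
Proof.
move=> cs; have hn := hc_norm_seminorm.
have /choice[a sa] n : exists b, hc_norm (s n - hc_of b) <= n.+1%:R^-1.
  by apply: hc_dense; rewrite invr_gt0.
have inv_le e (N n : nat) : N.+1%:R^-1 < e -> (N <= n)%N -> n.+1%:R^-1 < e :> R.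
  move=> Ne Nn; rewrite (le_lt_trans _ Ne)//.
  by rewrite lef_pV2 ?posrE ?ltr0n// ler_nat ltnS.
have ca : cauchy_for p a.
  move=> e e0; have e3 : 0 < e / 3 by rewrite divr_gt0.
  have [N sN] := cs _ e3; have [M Me] := natSinv_lt e3.
  exists (maxn N M) => m n; rewrite !geq_max => /andP[Nm Mm] /andP[Nn Mn].
  rewrite -hc_norm_of -hc_ofB.
  have -> : e = e / 3 + (e / 3 + e / 3).
    by rewrite -[RHS]/((e / 3) *+ 3) -mulr_natr divfK// pnatr_eq0.
  rewrite (le_lt_trans (csn_dist hn (s m) _ _))// ltrD//.
    by rewrite (csnBC hn) (le_lt_trans (sa m))// (inv_le _ M).
  rewrite (le_lt_trans (csn_dist hn (s n) _ _))// ltrD ?sN//.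
  by rewrite (le_lt_trans (sa n))// (inv_le _ M).
exists (hc_pi (CauchySeq ca)) => e e0.
have e2 : 0 < e / 2 by rewrite divr_gt0.
have e4 : 0 < e / 2 / 2 by rewrite divr_gt0.
have [N aN] := ca _ e4; have [M Me] := natSinv_lt e2.
exists (maxn N M) => n; rewrite geq_max => /andP[Nn Mn].
rewrite (le_lt_trans (csn_dist hn (hc_of (a n)) _ _))// (splitr e) ltrD//.
  by rewrite (le_lt_trans (sa n))// (inv_le _ M).
rewrite (csnBC hn) (@le_lt_trans _ _ (e / 2 / 2))//.
  by apply: (@hc_pi_ofB _ _ _ N) => m Nm; rewrite ltW// aN.
by rewrite ltr_pdivrMr// ltr_pMr// ltr1n.
Qed.

HB.instance Definition _ := StarAlgebra_isCStar.Build R hcompletion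
  hc_norm_seminorm hc_norm_eq0 hc_complete.

End HausdorffCompletion.

Section FinitelySupportedMatrices.
Context (R : realType) (B : cstarAlgType R).

Definition mx_bounded (T : nat -> nat -> B) N :=
  forall i j, (N <= i)%N || (N <= j)%N -> T i j = 0.

(* Finitely supported infinite matrices over B. *)
Record finmx := FinMx {
  fm_val :> nat -> nat -> B;
  fm_fin : exists N, mx_bounded fm_val N }.

HB.instance Definition _ := gen_eqMixin finmx.
HB.instance Definition _ := gen_choiceMixin finmx.

Implicit Types S T U : finmx.

Lemma finmxP S T : (forall i j, S i j = T i j) -> S = T.
Proof.
case: S T => [S hS] [T hT] /= ST.
have {}ST : S = T by apply/funext => i; apply/funext => j.
by case: _ / ST hT => hT; congr FinMx; exact: Prop_irrelevance.
Qed.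

Lemma mx_bounded_le (T : nat -> nat -> B) N M :
  (N <= M)%N -> mx_bounded T N -> mx_bounded T M.
Proof. by move=> NM TN i j /orP[] h; apply: TN; rewrite (leq_trans NM h) ?orbT. Qed.

Definition mx_bd T : nat := projT1 (cid (fm_fin T)).

Lemma mx_bdP T : mx_bounded T (mx_bd T).
Proof. exact: projT2 (cid (fm_fin T)). Qed.

Lemma fm_zero_fin : exists N, mx_bounded (fun _ _ => 0) N.
Proof. by exists 0%N. Qed.

Lemma fm_add_fin S T : exists N, mx_bounded (fun i j => S i j + T i j) N.
Proof.
exists (maxn (mx_bd S) (mx_bd T)) => i j h.
by rewrite !(mx_bounded_le _ (@mx_bdP _) h) ?leq_maxl ?leq_maxr// addr0.
Qed.

Lemma fm_scale_fin (c : R[i]) T : exists N, mx_bounded (fun i j => c *: T i j) N.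
Proof. by exists (mx_bd T) => i j h; rewrite mx_bdP// scaler0. Qed.

Lemma fm_star_fin T : exists N, mx_bounded (fun i j => star (T j i)) N.
Proof. by exists (mx_bd T) => i j h; rewrite mx_bdP ?star0// orbC. Qed.

Lemma fm_mul_fin S T :
  exists N, mx_bounded (fun i j => \sum_(k < mx_bd S) S i k ** T k j) N.
Proof.
exists (maxn (mx_bd S) (mx_bd T)) => i j h; apply: big1 => k _.
have [Si|iS] := leqP (mx_bd S) i; first by rewrite mx_bdP ?Si// smul0l.
rewrite [T _ _]mx_bdP ?smul0r//; move: h; rewrite !geq_max leqNgt iS/=.
by move=> /andP[_ ->]; rewrite orbT.
Qed.

Lemma fm_unit_fin i0 j0 (b : B) :
  exists N, mx_bounded (fun i j => if (i == i0) && (j == j0) then b else 0) N.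
Proof.
exists (maxn i0.+1 j0.+1) => i j h; case: ifP => // /andP[/eqP ii /eqP jj].
by move: h; rewrite !geq_max ii jj !ltnn andbF.
Qed.

Definition fm_zero := FinMx fm_zero_fin.
Definition fm_add S T := FinMx (fm_add_fin S T).
Definition fm_scale c T := FinMx (fm_scale_fin c T).
Definition fm_star T := FinMx (fm_star_fin T).
Definition fm_mul S T := FinMx (fm_mul_fin S T).
(* The elementary tensor of b and the matrix unit e_(i,j). *)
Definition fm_unit i j b := FinMx (fm_unit_fin i j b).

Fact fm_addA : associative fm_add.
Proof. by move=> S T U; apply: finmxP => i j; exact: addrA. Qed.
Fact fm_addC : commutative fm_add.
Proof. by move=> S T; apply: finmxP => i j; exact: addrC. Qed.
Fact fm_add0 : left_id fm_zero fm_add.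
Proof. by move=> S; apply: finmxP => i j; exact: add0r. Qed.
Fact fm_addN : left_inverse fm_zero (fm_scale (-1)) fm_add.
Proof. by move=> S; apply: finmxP => i j /=; rewrite scaleN1r addNr. Qed.

HB.instance Definition _ :=
  GRing.isZmodule.Build finmx fm_addA fm_addC fm_add0 fm_addN.

Fact fm_scaleA c d T : fm_scale c (fm_scale d T) = fm_scale (c * d) T.
Proof. by apply: finmxP => i j; exact: scalerA. Qed.
Fact fm_scale1 : left_id 1 fm_scale.
Proof. by move=> T; apply: finmxP => i j; exact: scale1r. Qed.
Fact fm_scaleDr : right_distributive fm_scale +%R.
Proof. by move=> c S T; apply: finmxP => i j; exact: scalerDr. Qed.
Fact fm_scaleDl T : {morph fm_scale^~ T : c d / c + d}.
Proof. by move=> c d; apply: finmxP => i j; exact: scalerDl. Qed.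

HB.instance Definition _ := GRing.Zmodule_isLmodule.Build R[i] finmx
  fm_scaleA fm_scale1 fm_scaleDr fm_scaleDl.

Lemma sum_stable (f : nat -> B) N M : (forall k, (N <= k)%N -> f k = 0) ->
  (forall k, (M <= k)%N -> f k = 0) -> \sum_(k < N) f k = \sum_(k < M) f k.
Proof.
wlog NM : N M / (N <= M)%N.
  by have [NM|/ltnW MN] := leqP N M => h fN fM; [|symmetry]; apply: h.
move=> fN _; rewrite -!(big_mkord xpredT f) [RHS](@big_cat_nat _ _ _ N)//=.
rewrite [X in _ = _ + X]big_nat_cond [X in _ = _ + X]big1 ?addr0//.
by move=> k /andP[/andP[/fN]].
Qed.

Lemma fm_mulE S T N i j : mx_bounded S N \/ mx_bounded T N ->
  fm_mul S T i j = \sum_(k < N) S i k ** T k j.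
Proof.
move=> STN; apply: (@sum_stable (fun k => S i k ** T k j)) => k hk.
  by rewrite mx_bdP ?hk ?orbT// smul0l.
by case: STN => h; rewrite h ?smul0l ?smul0r ?hk ?orbT.
Qed.

Lemma smul_suml (I : Type) (r : seq I) (f : I -> B) y :
  (\sum_(k <- r) f k) ** y = \sum_(k <- r) f k ** y.
Proof.
by apply: (big_morph (smul^~ y)) => [a b|]; rewrite ?smulDl ?smul0l.
Qed.

Lemma smul_sumr (I : Type) (r : seq I) (f : I -> B) y :
  y ** (\sum_(k <- r) f k) = \sum_(k <- r) y ** f k.
Proof. by apply: (big_morph (smul y)) => [a b|]; rewrite ?smulDr ?smul0r. Qed.

Lemma star_sum (I : Type) (r : seq I) (f : I -> B) :
  star (\sum_(k <- r) f k) = \sum_(k <- r) star (f k).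
Proof. by apply: big_morph; [exact: starD|exact: star0]. Qed.

Fact fm_mulA : associative fm_mul.
Proof.
move=> S T U; apply: finmxP => i j.
have hS := @mx_bdP S; have hT := @mx_bdP T.
rewrite (fm_mulE (S := S) _ _ (or_introl hS)).
rewrite (fm_mulE (T := U) _ _ (or_intror (@mx_bdP U))).
under eq_bigr do rewrite (fm_mulE (T := U) _ _ (or_intror (@mx_bdP U))) smul_sumr.
rewrite exchange_big; apply: eq_bigr => l _.
rewrite smul_suml; apply: eq_bigr => k _; exact: smulA.
Qed.

Fact fm_mulDl : left_distributive fm_mul +%R.
Proof.
move=> S T U; apply: finmxP => i j.
rewrite [RHS]/= -![\sum_(_ < _) _]/(fm_mul _ _ i j).
rewrite !(fm_mulE (T := U) _ _ (or_intror (@mx_bdP U))) -big_split.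
by apply: eq_bigr => k _; exact: smulDl.
Qed.

Fact fm_mulDr : right_distributive fm_mul +%R.
Proof.
move=> S T U; apply: finmxP => i j.
by rewrite /= -big_split; apply: eq_bigr => k _; exact: smulDr.
Qed.

Fact fm_scale_mull (c : R[i]) S T : fm_mul (c *: S) T = c *: fm_mul S T.
Proof.
apply: finmxP => i j; rewrite [RHS]/= -![\sum_(_ < _) _]/(fm_mul _ _ i j).
rewrite !(fm_mulE (T := T) _ _ (or_intror (@mx_bdP T))) scaler_sumr.
by apply: eq_bigr => k _; exact: scale_smull.
Qed.

Fact fm_scale_mulr (c : R[i]) S T : fm_mul S (c *: T) = c *: fm_mul S T.
Proof.
apply: finmxP => i j; rewrite /= scaler_sumr.
by apply: eq_bigr => k _; exact: scale_smulr.
Qed.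

Fact fm_starD : {morph fm_star : S T / S + T}.
Proof. by move=> S T; apply: finmxP => i j; exact: starD. Qed.

Fact fm_starZ (c : R[i]) T : fm_star (c *: T) = conjc c *: fm_star T.
Proof. by apply: finmxP => i j; exact: starZ. Qed.

Fact fm_starM S T : fm_star (fm_mul S T) = fm_mul (fm_star T) (fm_star S).
Proof.
apply: finmxP => i j.
have h : mx_bounded (fm_star S) (mx_bd S).
  by move=> k l kl; rewrite /= mx_bdP ?star0// orbC.
rewrite (fm_mulE _ _ (or_intror h)) [LHS]/= star_sum.
by apply: eq_bigr => k _; exact: starM.
Qed.

Fact fm_starK : involutive fm_star.
Proof. by move=> T; apply: finmxP => i j; exact: starK. Qed.

HB.instance Definition _ := isStarAlgebra.Build R finmx fm_mulA fm_mulDl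
  fm_mulDr fm_scale_mull fm_scale_mulr fm_starD fm_starZ fm_starM fm_starK.

(* The bound on elementary tensors holds for every C*-seminorm on finmx. *)
Definition fm_admissible (p : finmx -> R) :=
  cstar_seminorm p /\ forall i j b, p (fm_unit i j b) <= rnorm b.

(* finmx is the algebraic tensor product of B with the finite-rank matrices, and
   this is its maximal C*-norm. Every M_n(B) carries only one C*-norm, so this is
   also the only C*-norm on finmx. *)
Definition fm_norm T : R := sup [set p T | p in fm_admissible].

Local Notation hr := (@rnorm_seminorm R B).

Lemma fm_admissible0 : fm_admissible (fun _ => 0).
Proof.
split=> [|i j b]; last exact: (csn_ge0 hr).
by split=> *; rewrite ?addr0 ?mulr0// expr0n.
Qed.

Lemma fm_sumE (I : Type) (r : seq I) (F : I -> finmx) i j :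
  (\sum_(k <- r) F k) i j = \sum_(k <- r) F k i j.
Proof. by apply: (big_morph (fun T => fm_val T i j)). Qed.

Lemma fm_unit_sum T :
  T = \sum_(i < mx_bd T) \sum_(j < mx_bd T) fm_unit i j (T i j).
Proof.
apply: finmxP => i j; rewrite fm_sumE.
under eq_bigr do rewrite fm_sumE /=.
have [iT|iT] := ltnP i (mx_bd T); last first.
  rewrite mx_bdP ?iT// big1// => k _; rewrite big1// => l _.
  by case: eqP => //= ik; move: iT; rewrite ik leqNgt ltn_ord.
rewrite (bigD1 (Ordinal iT))//= [X in _ + X]big1 ?addr0; last first.
  move=> k /eqP ki; rewrite big1// => l _; case: eqP => //= ik.
  by case: ki; apply/val_inj.
rewrite eqxx/=.
have [jT|jT] := ltnP j (mx_bd T); last first.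
  rewrite mx_bdP ?jT ?orbT// big1// => l _.
  by case: eqP => //= jl; move: jT; rewrite jl leqNgt ltn_ord.
rewrite (bigD1 (Ordinal jT))//= eqxx big1 ?addr0//.
move=> l /eqP lj; case: eqP => //= jl.
by case: lj; apply/val_inj.
Qed.

Lemma csn_sum (V : starAlgType R) (p : V -> R) (hp : cstar_seminorm p)
  (I : Type) (r : seq I) (F : I -> V) :
  p (\sum_(k <- r) F k) <= \sum_(k <- r) p (F k).
Proof.
elim: r => [|k r IH]; first by rewrite !big_nil (csn0 hp).
by rewrite !big_cons (le_trans (csn_triangle hp _ _))// lerD2l.
Qed.

Lemma fm_norm_has_sup T : has_sup [set p T | p in fm_admissible].
Proof.
split; first by exists 0; exists (fun _ => 0) => //; exact: fm_admissible0.
exists (\sum_(i < mx_bd T) \sum_(j < mx_bd T) rnorm (T i j)) => _ [p [hp pb] <-].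
rewrite {1}(fm_unit_sum T) (le_trans (csn_sum hp _ _))//.
by apply: ler_sum => i _; rewrite (le_trans (csn_sum hp _ _))// ler_sum.
Qed.

Lemma fm_norm_ge p T : fm_admissible p -> p T <= fm_norm T.
Proof.
by move=> hp; apply: ub_le_sup; [exact: (fm_norm_has_sup T).2|exists p].
Qed.

Lemma fm_norm_leP T M : (forall p, fm_admissible p -> p T <= M) -> fm_norm T <= M.
Proof.
by move=> h; apply: ge_sup; [exact: (fm_norm_has_sup T).1|move=> _ [p /h ? <-]].
Qed.

Lemma fm_norm_ge0 T : 0 <= fm_norm T.
Proof. exact: fm_norm_ge fm_admissible0. Qed.

Fact fm_norm_scale_le (c : R[i]) T : fm_norm (c *: T) <= normc c * fm_norm T.
Proof.
apply: fm_norm_leP => p hp; rewrite (csn_scale hp.1).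
by rewrite ler_wpM2l ?normc_ge0 ?fm_norm_ge.
Qed.

Lemma fm_norm_seminorm : cstar_seminorm fm_norm.
Proof.
split=> [S T|c T|S T|T].
- apply: fm_norm_leP => p hp.
  by rewrite (le_trans (csn_triangle hp.1 _ _))// lerD ?fm_norm_ge.
- apply/le_anti; rewrite fm_norm_scale_le/=.
  have [->|c0] := eqVneq c 0; first by rewrite normc0 mul0r fm_norm_ge0.
  have nc0 : 0 < normc c.
    rewrite lt_def normc_ge0 andbT; apply: contra_neq c0; exact: eq0_normc.
  rewrite -[X in _ * fm_norm X](scalerK c0) mulrC -ler_pdivlMr//.
  by rewrite (le_trans (fm_norm_scale_le _ _))// normcV mulrC.
- apply: fm_norm_leP => p hp; rewrite (le_trans (csn_mul hp.1 _ _))//.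
  by rewrite ler_pM ?(csn_ge0 hp.1) ?fm_norm_ge.
- apply/le_anti/andP; split.
    apply: fm_norm_leP => p hp; rewrite (csn_star hp.1).
    by rewrite lerXn2r ?nnegrE ?(csn_ge0 hp.1) ?fm_norm_ge0 ?fm_norm_ge.
  rewrite -ler_sqrt ?fm_norm_ge0// sqrtr_sqr ger0_norm ?fm_norm_ge0//.
  apply: fm_norm_leP => p hp.
  rewrite -(ger0_norm (csn_ge0 hp.1 T)) -sqrtr_sqr -(csn_star hp.1).
  by rewrite ler_sqrt ?fm_norm_ge0 ?fm_norm_ge.
Qed.

(* B (x) K, with K the compact operators on l^2(nat). *)
Definition stab : Type := hcompletion fm_norm_seminorm.

HB.instance Definition _ := CStarAlgebra.on stab.

Lemma fm_shift_fin (e : bool) T : exists N, mx_bounded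
  (fun i j => if (odd i == e) && (odd j == e) then T i./2 j./2 else 0) N.
Proof.
exists (mx_bd T).*2 => i j h; case: ifP => // _; apply: mx_bdP.
by rewrite !geq_half_double.
Qed.

Definition fm_shift e T := FinMx (fm_shift_fin e T).

Lemma fm_shiftD e S T : fm_shift e (S + T) = fm_shift e S + fm_shift e T.
Proof. by apply: finmxP => i j /=; case: ifP => //; rewrite addr0. Qed.

Lemma fm_shiftZ e (c : R[i]) T : fm_shift e (c *: T) = c *: fm_shift e T.
Proof. by apply: finmxP => i j /=; case: ifP => //; rewrite scaler0. Qed.

Lemma fm_shift_star e T : fm_shift e (star T) = star (fm_shift e T).
Proof. by apply: finmxP => i j /=; rewrite andbC; case: ifP; rewrite ?star0. Qed.

Lemma sum_double (f : nat -> B) N :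
  \sum_(k < N.*2) f k = \sum_(k < N) (f k.*2 + f k.*2.+1).
Proof.
by elim: N => [|N IH]; rewrite ?big_ord0// doubleS !big_ord_recr/= IH addrA.
Qed.

Lemma fm_shiftM2 e e' S T : fm_shift e S ** fm_shift e' T =
  if e == e' then fm_shift e (S ** T) else 0.
Proof.
have hb : mx_bounded (fm_shift e S) (mx_bd S).*2.
  by move=> i j h /=; case: ifP => // _; apply: mx_bdP; rewrite !geq_half_double.
apply: finmxP => i j; rewrite (fm_mulE _ _ (or_introl hb)).
rewrite (sum_double (fun k => fm_shift e S i k ** fm_shift e' T k j)).
have -> : (if e == e' then fm_shift e (S ** T) else 0) i j =
    if [&& e == e', odd i == e & odd j == e] then (S ** T) i./2 j./2 else 0.
  by case: (e == e').
transitivity (\sum_(k < mx_bd S) if [&& e == e', odd i == e & odd j == e]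
    then S i./2 k ** T k j./2 else 0); last first.
  by case: ifP => // _; rewrite big1.
apply: eq_bigr => k _; rewrite /= uphalf_double doubleK odd_double/=.
by case: e e' {hb} => [] []; case: (odd i); case: (odd j);
  rewrite /= ?(smul0l, smul0r, addr0, add0r).
Qed.

Lemma fm_shift_unit e i j b :
  fm_shift e (fm_unit i j b) = fm_unit (e + i.*2)%N (e + j.*2)%N b.
Proof.
have h k l : (k == e + l.*2)%N = (odd k == e) && (k./2 == l).
  apply/eqP/andP => [->|[/eqP ke /eqP <-]]; last by rewrite -ke odd_double_half.
  by rewrite oddD odd_double addbF oddb half_bit_double.
apply: finmxP => k l /=; rewrite !h.
by case: (odd k == e); case: (odd l == e); rewrite ?andbF.
Qed.

Lemma fm_norm_shift e T : fm_norm (fm_shift e T) <= fm_norm T.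
Proof.
apply: fm_norm_leP => p hp; apply: (@fm_norm_ge (fun T => p (fm_shift e T))).
split=> [|i j b]; last by rewrite fm_shift_unit hp.2.
split=> [U W|c U|U W|U].
- by rewrite fm_shiftD (csn_triangle hp.1).
- by rewrite fm_shiftZ (csn_scale hp.1).
- by have := csn_mul hp.1 (fm_shift e U) (fm_shift e W); rewrite fm_shiftM2 eqxx.
- have := csn_star hp.1 (fm_shift e U).
  by rewrite -fm_shift_star fm_shiftM2 eqxx.
Qed.

Local Notation cauchyseq := (cauchyseq fm_norm).

Lemma cs_shift_cauchy e (u : cauchyseq) :
  cauchy_for fm_norm (fun n => fm_shift e (u n)).
Proof.
move=> r /(cs_cauchy u)[N uN]; exists N => m n Nm Nn.
rewrite -scaleN1r -fm_shiftZ -fm_shiftD (le_lt_trans (fm_norm_shift _ _))//.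
by rewrite scaleN1r uN.
Qed.

Definition cs_shift e (u : cauchyseq) := CauchySeq (cs_shift_cauchy e u).

(* The endomorphism of stab B induced by e_(i,j) |-> e_(2i,2j) for e = false,
   by e_(i,j) |-> e_(2i+1,2j+1) for e = true. *)
Definition stab_shift e (x : stab) : stab :=
  hc_pi fm_norm_seminorm (cs_shift e (hc_repr x)).

Local Notation pi := (hc_pi fm_norm_seminorm).

Lemma stab_shiftE e (u : cauchyseq) : stab_shift e (pi u) = pi (cs_shift e u).
Proof.
apply/hc_piP; have := hc_repr_pi fm_norm_seminorm u.
apply: (cs_null_le ltr01) => n.
by rewrite mul1r /= -scaleN1r -fm_shiftZ -fm_shiftD scaleN1r fm_norm_shift.
Qed.

Lemma stab_shiftD e (x y : stab) :
  stab_shift e (x + y) = stab_shift e x + stab_shift e y.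
Proof.
elim/hc_ind: x => u; elim/hc_ind: y => v; rewrite hc_piD !stab_shiftE hc_piD.
by apply: hc_pi_ext => n; exact: fm_shiftD.
Qed.

Lemma stab_shiftZ e (c : R[i]) (x : stab) :
  stab_shift e (c *: x) = c *: stab_shift e x.
Proof.
elim/hc_ind: x => u; rewrite hc_piZ !stab_shiftE hc_piZ.
by apply: hc_pi_ext => n; exact: fm_shiftZ.
Qed.

Lemma stab_shift_star e (x : stab) : stab_shift e (star x) = star (stab_shift e x).
Proof.
elim/hc_ind: x => u; rewrite hc_pi_star !stab_shiftE hc_pi_star.
by apply: hc_pi_ext => n; exact: fm_shift_star.
Qed.

Lemma stab_shiftM2 e e' (x y : stab) : stab_shift e x ** stab_shift e' y =
  if e == e' then stab_shift e (x ** y) else 0.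
Proof.
elim/hc_ind: x => u; elim/hc_ind: y => v; case: (eqVneq e e') => [<-|ee].
  rewrite [pi u ** pi v]hc_piM !stab_shiftE [LHS]hc_piM.
  by apply: hc_pi_ext => n /=; rewrite fm_shiftM2 eqxx.
rewrite !stab_shiftE [LHS]hc_piM.
rewrite -[RHS]/(hc_of fm_norm_seminorm 0).
by apply: hc_pi_ext => n /=; rewrite fm_shiftM2 (negPf ee).
Qed.

(* The direct sum a (+) b in M_2(B (x) K), which is identified with B (x) K
   by interleaving the two copies of the index set. *)
Definition dsum (x y : stab) : stab := stab_shift false x + stab_shift true y.

Lemma dsumD (x y x' y' : stab) : dsum x y + dsum x' y' = dsum (x + x') (y + y').
Proof. by rewrite /dsum !stab_shiftD addrACA. Qed.

Lemma dsumZ (c : R[i]) (x y : stab) : c *: dsum x y = dsum (c *: x) (c *: y).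
Proof. by rewrite /dsum !stab_shiftZ scalerDr. Qed.

Lemma dsumN (x y : stab) : - dsum x y = dsum (- x) (- y).
Proof. by rewrite -[LHS]scaleN1r dsumZ !scaleN1r. Qed.

Lemma dsum_star (x y : stab) : star (dsum x y) = dsum (star x) (star y).
Proof. by rewrite /dsum starD !stab_shift_star. Qed.

Lemma dsumM (x y x' y' : stab) : dsum x y ** dsum x' y' = dsum (x ** x') (y ** y').
Proof.
by rewrite /dsum smulDl !smulDr !stab_shiftM2/= addr0 add0r.
Qed.

Lemma dsum0 : dsum 0 0 = 0.
Proof. by rewrite /dsum -(scale0r 0) !stab_shiftZ !scale0r addr0. Qed.

End FinitelySupportedMatrices.

Section FunctionalCalculus.
Context (R : realType) (A : cstarAlgType R).
Implicit Types a b c x y : A.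

(* Invertibility of 1 - x in the unitization, with inverse 1 - y. *)
Definition quasi_invertible x :=
  exists y, x + y - x ** y = 0 /\ x + y - y ** x = 0.

(* The spectrum computed in the unitization of A, also when A is unital. *)
Definition spectrum a : set R[i] :=
  [set l | l = 0 \/ ~ quasi_invertible (l^-1 *: a)].

Definition positive a := star a = a /\ forall l, spectrum a l -> 0 <= l.

(* a ^ n for n > 0 *)
Definition spow a (n : nat) : A := iter n.-1 (smul a) a.

(* A has no unit: the constant coefficient of P is ignored. *)
Definition spoly (P : {poly R}) a : A :=
  \sum_(1 <= n < size P) (P`_n)%:C *: spow a n.

(* c = f(a) for a self-adjoint and f continuous on the spectrum, f(0) = 0. *)
Definition is_fcalc (f : R -> R) a c :=
  exists P : nat -> {poly R}, [/\ forall n, (P n)`_0 = 0,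
    forall e : R, 0 < e -> \forall n \near \oo,
      forall t : R, spectrum a t%:C -> `|(P n).[t] - f t| < e
    & spoly (P n) a @[n --> \oo] --> c].

Definition fcalc (f : R -> R) a : A := get (is_fcalc f a).

(* (a - e)_+ *)
Definition cutdown a (e : R) : A := fcalc (fun t => Num.max (t - e) 0) a.

Definition cuntz_sub a b :=
  exists v : nat -> A, v n ** b ** star (v n) @[n --> \oo] --> a.

Definition cuntz_eq a b := cuntz_sub a b /\ cuntz_sub b a.

Definition cuntz_class a : set A := [set b | positive b /\ cuntz_eq a b].

Lemma positive0 : positive 0.
Proof.
split=> [|l [->//|]]; first exact: star0.
by case; exists 0; rewrite scaler0 smul0l addr0 subr0.
Qed.

End FunctionalCalculus.

Section CuntzSemigroup.
Context (R : realType) (B : cstarAlgType R).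

(* A class is represented by the set of its members. *)
Definition Cu : Type :=
  {C : set (stab B) | exists2 a, positive a & C = cuntz_class a}.

Implicit Types x y : Cu.

Definition cu_class (a : stab B) (pa : positive a) : Cu :=
  exist _ (cuntz_class a) (ex_intro2 _ _ a pa erefl).

(* x = [a] *)
Definition cu_rep x (a : stab B) := positive a /\ sval x = cuntz_class a.

Lemma cu_rep_ex x : exists a, cu_rep x a.
Proof. by case: x => C [a pa Ca]; exists a. Qed.

Definition cu_repr x : stab B := projT1 (cid (cu_rep_ex x)).

Lemma cu_reprP x : cu_rep x (cu_repr x).
Proof. exact: projT2 (cid (cu_rep_ex x)). Qed.

Lemma positive_dsum (a b : stab B) : positive a -> positive b -> positive (dsum a b).
Proof.
move=> [sa pa] [sb pb]; split=> [|l lab]; first by rewrite dsum_star sa sb.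
case: lab => [->//|nq]; apply: contrapT => l0; apply: nq.
have [ya [ya1 ya2]] : quasi_invertible (l^-1 *: a).
  by apply: contrapT => h; apply/l0/pa; right.
have [yb [yb1 yb2]] : quasi_invertible (l^-1 *: b).
  by apply: contrapT => h; apply/l0/pb; right.
exists (dsum ya yb).
by rewrite dsumZ !dsumM !dsumD !dsumN !dsumD ya1 ya2 yb1 yb2 dsum0.
Qed.

Definition cu_le x y :=
  exists a b, [/\ cu_rep x a, cu_rep y b & cuntz_sub a b].

Definition cu0 : Cu := cu_class (@positive0 R (stab B)).

(* [a] + [b] = [a (+) b], with chosen representatives. *)
Definition cu_add x y : Cu :=
  cu_class (positive_dsum (cu_reprP x).1 (cu_reprP y).1).

Definition cu_mul (n : nat) x : Cu := iter n (cu_add x) cu0.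

Definition cu_ll x y := exists a b, [/\ cu_rep x a, cu_rep y b &
  exists2 e, 0 < e & cuntz_sub a (cutdown b e)].

Definition cu_compact x := cu_ll x x.

Definition cu_properly_infinite x := cu_le (cu_mul 2 x) x.

Definition almost_unperforated := forall x y,
  (exists k : nat, cu_le (cu_mul k.+1 x) (cu_mul k y)) -> cu_le x y.

Definition almost_divisible := forall x' x, cu_ll x' x -> forall N : nat,
  exists y, cu_le (cu_mul N y) x /\ cu_le x' (cu_mul N.+1 y).

End CuntzSemigroup.

Arguments cu0 {R B}.

Definition pure (R : realType) (B : cstarAlgType R) :=
  almost_unperforated B /\ almost_divisible B.

Record closed_ideal (R : realType) (A : cstarAlgType R) (I : set A) : Prop := {
  ideal0 : I 0;
  idealD : forall x y, I x -> I y -> I (x + y);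
  idealZ : forall (c : R[i]) x, I x -> I (c *: x);
  ideal_mull : forall a x, I x -> I (a ** x);
  ideal_mulr : forall a x, I x -> I (x ** a);
  ideal_closed : closed I;
}.

(* q exhibits B as the quotient C*-algebra A / I. *)
Record quotient_map (R : realType) (A B : cstarAlgType R) (I : set A)
    (q : A -> B) : Prop := {
  quotD : forall x y, q (x + y) = q x + q y;
  quotZ : forall (c : R[i]) x, q (c *: x) = c *: q x;
  quotM : forall x y, q (x ** y) = q x ** q y;
  quot_star : forall x, q (star x) = star (q x);
  quot_surj : forall b, exists a, q a = b;
  quot_ker : forall a, q a = 0 <-> I a;
  quot_norm : forall a, rnorm (q a) = inf [set rnorm (a + x) | x in I];
}.

(* Lebesgue covering dimension at most n: every finite open cover has a finite
   open refinement such that no point lies in more than n + 1 of its members. *)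
Definition covering_dim_le (X : topologicalType) (n : nat) :=
  forall (I : finType) (U : I -> set X), (forall i, open (U i)) ->
    \bigcup_i U i = [set: X] ->
  exists (J : finType) (V : J -> set X), [/\ forall j, open (V j),
    \bigcup_j V j = [set: X], forall j, exists i, V j `<=` U i
    & forall x, (#|[pred j | x \in V j]| <= n.+1)%N].

Definition finite_dimensional (X : topologicalType) :=
  exists n, covering_dim_le X n.

(* Main.v *)
(* Write [b_q] for the fibre at [q] of a positive [b] in the stabilization of
   [C(X, A)], [n] for the dimension of [X], and [b'] for a small cut-down of [b].
   Almost divisibility of the fibre, applied with [N = 4 (n + 1)], gives near each
   point an element [z] below a multiple of [b'] with [N [z_q] <= [b'_q]] and, up to
   cut-downs, [[b'_q] <= (N + 1) [z_q]].  Summing such elements against a partition of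
   unity of order [n + 1] gives [g], and almost unperforation turns the first bound
   into [2 [g_q] <= [b'_q]] at every [q].  Take [y0] to be a cut-down of [g] and
   [y1 = (1 - e) b (1 - e)], where [e] is a bump function of [g] equal to [1] on the
   support of [y0].  Then [y0] and [y1] are orthogonal, their sum is below a multiple
   of [b], and [b] is below a multiple of [g + y1].
   In a fibre, [[b_q] <= [g_q] + [y1_q]] and [2 [g_q] <= [b'_q]] make the class of [b_q]
   compact and properly infinite modulo the ideal generated by [y1_q].  By hypothesis
   it vanishes there, so [[b'_q] <= k [y1_q]] for some [k]; together with
   [2 [b'_q] <= [b'_q] + 2 [y1_q]], almost unperforation gives [[b'_q] <= 3 [y1_q]].
   Fibrewise comparisons glue at the cost of a factor [n + 1], because the partition
   of unity can be coloured with [n + 1] colours so that functions of the same colour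
   have disjoint supports.  Hence [L = (N + 1) (n + 1)] works. *)

Require Import Defs.
From HB Require Import structures.
From mathcomp Require Import all_boot all_order all_algebra.
From mathcomp Require Import mathcomp_extra boolp classical_sets functions reals.
From mathcomp Require Import topology normedtype sequences.
From mathcomp Require Import complex.
From mathcomp Require realfun.
From mathcomp Require Import ring lra.

Set Implicit Arguments.
Unset Strict Implicit.
Unset Printing Implicit Defensive.

Import Order.TTheory GRing.Theory Num.Theory.
Import numFieldNormedType.Exports.
Import Normc.

Local Open Scope classical_set_scope.
Local Open Scope ring_scope.
Local Open Scope complex_scope.

(** * The unitization *)

(** Pureness and the hypothesis on quotients concern [A] only, and [C(X, A)] is not known to inherit
    them. They are therefore used in single fibres, and every global comparison is obtained by
    gluing; this is where the dimension enters [L]. The constant 4 (n + 1) arises as follows: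
    summing over n + 1 colours weakens N [z_q] <= [b'_q] to N [g_q] <= (n + 1) [b'_q], and
    unperforation reaches 2 [g_q] <= [b'_q] as soon as 2 (n + 2) <= N. The gap between b and b' is
    what produces compactness: modulo the ideal [b_q] <= [g_q], so 2 [b_q] <= [b'_q], and this
    single inequality says both compact and properly infinite. The ideal lives in [stab A] while the
    hypothesis speaks of quotients of [A]; the link is that a quotient of [stab A] is the
    stabilization of a quotient of [A]. The norm of [stab] is a supremum of C*-seminorms. Bounds for
    it come either from pulling such seminorms back or from a crude bound improved by the
    C*-identity, applied to squares or to powers. *)

Definition unz (R : realType) (A : cstarAlgType R) : Type := (R[i]^o * A)%type.

Section Unitization.
Context (R : realType) (A : cstarAlgType R).
Local Notation U := (unz A).
Local Notation hr := (@rnorm_seminorm R A).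
Implicit Types (x y z : A) (u v w : U).

HB.instance Definition _ := Choice.copy U (R[i]^o * A)%type.
HB.instance Definition _ := GRing.Lmodule.copy U (R[i]^o * A)%type.

Definition uscal u : R[i] := u.1.
Definition upart u : A := u.2.
Definition mku (l : R[i]) x : U := (l, x).
Definition uin x : U := mku 0 x.
Definition uone : U := mku 1 0.
Definition umul u v : U := mku (uscal u * uscal v)
  (uscal u *: upart v + uscal v *: upart u + upart u ** upart v).
Definition ustar u : U := mku (conjc (uscal u)) (star (upart u)).

Arguments uscal : simpl never.
Arguments upart : simpl never.

Lemma uscal_mk l x : uscal (mku l x) = l. Proof. by []. Qed.
Lemma upart_mk l x : upart (mku l x) = x. Proof. by []. Qed.

Lemma unzP u v : uscal u = uscal v -> upart u = upart v -> u = v.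
Proof. by case: u v => [a b] [c d]; rewrite /uscal /upart /= => -> ->. Qed.

Lemma uscalD u v : uscal (u + v) = uscal u + uscal v. Proof. by []. Qed.
Lemma upartD u v : upart (u + v) = upart u + upart v. Proof. by []. Qed.
Lemma uscalZ (c : R[i]) u : uscal (c *: u) = c * uscal u. Proof. by []. Qed.
Lemma upartZ (c : R[i]) u : upart (c *: u) = c *: upart u. Proof. by []. Qed.

Let uE := (uscal_mk, upart_mk, uscalD, upartD, uscalZ, upartZ).

Fact umulA : associative umul.
Proof.
move=> u v w; apply: unzP; rewrite /umul !uE ?mulrA//.
rewrite !scalerDr !smulDr !smulDl !scalerA !scale_smulr !scale_smull !smulA.
rewrite [LHS](AC (3*1*3) (1*(2*4*6)*(3*5*7))).
by rewrite ![uscal w * _]mulrC.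
Qed.

Fact umul1 : left_id uone umul.
Proof.
move=> u; apply: unzP; rewrite /umul !uE ?mul1r// scale1r scaler0 smul0l.
by rewrite !addr0.
Qed.

Fact umulr1 : right_id uone umul.
Proof.
move=> u; apply: unzP; rewrite /umul !uE ?mulr1// scale1r scaler0 smul0r.
by rewrite addr0 add0r.
Qed.

Fact umulDl : left_distributive umul +%R.
Proof.
move=> u v w; apply: unzP; rewrite /umul !uE ?mulrDl//.
rewrite scalerDl scalerDr smulDl.
by rewrite [LHS](AC (2*2*2) ((1*3*5)*(2*4*6))).
Qed.

Fact umulDr : right_distributive umul +%R.
Proof.
move=> u v w; apply: unzP; rewrite /umul !uE ?mulrDr//.
rewrite scalerDl scalerDr smulDr.
by rewrite [LHS](AC (2*2*2) ((1*3*5)*(2*4*6))).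
Qed.

Fact uone_neq0 : uone != 0.
Proof. by apply/eqP => -[] /eqP; rewrite oner_eq0. Qed.

HB.instance Definition _ := GRing.Zmodule_isNzRing.Build U
  umulA umul1 umulr1 umulDl umulDr uone_neq0.

Lemma uscalM u v : uscal (u * v) = uscal u * uscal v. Proof. by []. Qed.
Lemma upartM u v : upart (u * v) =
  uscal u *: upart v + uscal v *: upart u + upart u ** upart v.
Proof. by []. Qed.

Let uE2 := (uscalM, upartM, uE).

Fact uscaleAl (c : R[i]) u v : c *: (u * v) = (c *: u) * v.
Proof.
apply: unzP; rewrite !uE2 ?mulrA//.
by rewrite !scalerDr !scalerA scale_smull [c * uscal v]mulrC.
Qed.

HB.instance Definition _ := GRing.Lmodule_isLalgebra.Build R[i] U uscaleAl.

Fact uscaleAr (c : R[i]) u v : c *: (u * v) = u * (c *: v).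
Proof.
apply: unzP; rewrite !uE2 ?mulrA; first by rewrite [c * _]mulrC.
by rewrite !scalerDr !scalerA scale_smulr [c * uscal u]mulrC.
Qed.

HB.instance Definition _ := GRing.Lalgebra_isAlgebra.Build R[i] U uscaleAr.

Fact ustarD : {morph ustar : u v / u + v}.
Proof. by move=> u v; apply: unzP; rewrite !uE2 ?starD// rmorphD. Qed.
Fact ustarZ (c : R[i]) u : ustar (c *: u) = conjc c *: ustar u.
Proof. by apply: unzP; rewrite !uE2 ?starZ// rmorphM. Qed.
Fact ustar_mul u v : ustar (u * v) = ustar v * ustar u.
Proof.
apply: unzP; rewrite !uE2; first by rewrite rmorphM mulrC.
by rewrite !starD !starZ starM [X in X + _]addrC.
Qed.
Fact ustarK : involutive ustar.
Proof. by move=> u; apply: unzP; rewrite !uE2 ?starK// conjcK. Qed.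

HB.instance Definition _ := isStarAlgebra.Build R U umulA umulDl umulDr
  (fun c u v => esym (uscaleAl c u v)) (fun c u v => esym (uscaleAr c u v))
  ustarD ustarZ ustar_mul ustarK.

End Unitization.

Lemma normc_real (R : realType) (r : R) : normc r%:C = `|r|.
Proof. by rewrite /normc /= expr0n addr0 sqrtr_sqr. Qed.

(** Inequalities suffice: scaling by the inverse scalar reverses one of them, and
    [p x ^+ 2 <= p (star x) * p x] gives [p x <= p (star x)], hence an isometric star and equality
    in the C*-identity. *)
Lemma cstar_seminorm_le (R : realType) (V : starAlgType R) (p : V -> R) :
  (forall x, 0 <= p x) ->
  (forall x y, p (x + y) <= p x + p y) ->
  (forall (c : R[i]) x, p (c *: x) <= normc c * p x) ->
  (forall x y, p (x ** y) <= p x * p y) ->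
  (forall x, p x ^+ 2 <= p (star x ** x)) ->
  cstar_seminorm p.
Proof.
move=> p0 pD pZ pM pS.
have ps x : p x <= p (star x).
  have := le_trans (pS x) (pM _ _); rewrite expr2.
  have [->|x0] := eqVneq (p x) 0; first by rewrite p0.
  by rewrite ler_pM2r// lt_def x0 p0.
split=> // [c x|x].
- apply/le_anti; rewrite pZ/=.
  have [->|c0] := eqVneq c 0; first by rewrite normc0 mul0r.
  have nc0 : 0 < normc c.
    rewrite lt_def normc_ge0 andbT; apply: contra_neq c0; exact: eq0_normc.
  rewrite -[X in _ * p X](scalerK c0) mulrC -ler_pdivlMr//.
  by rewrite (le_trans (pZ _ _))// normcV mulrC.
- apply/le_anti; rewrite pS andbT (le_trans (pM _ _))// expr2 ler_wpM2r//.
  by rewrite -{2}(starK x) ps.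
Qed.

Lemma real_complete (R : realType) (s : nat -> R) :
  (forall e, 0 < e -> exists N, forall m n, (N <= m)%N -> (N <= n)%N ->
    `|s m - s n| < e) ->
  exists l, forall e, 0 < e -> exists N, forall n, (N <= n)%N -> `|s n - l| < e.
Proof.
move=> cs; have : cvg (s @ \oo).
  apply/cauchy_cvgP/cauchyP => e /cs[N sN]; exists (s N); exists N => // n /= Nn.
  by rewrite -ball_normE/= sN.
move=> /cvgrPdist_lt sl; exists (lim (s @ \oo)) => e /sl[N _ sN].
by exists N => n /sN; rewrite distrC.
Qed.

Lemma normc_le (R : realType) (a b : R) : normc (a +i* b) <= `|a| + `|b|.
Proof.
rewrite -[leRHS]ger0_norm ?addr_ge0// -sqrtr_sqr ler_wsqrtr//.
rewrite -(real_normK (num_real a)) -(real_normK (num_real b)).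
by rewrite sqrrD -addrA [_ *+ 2 + _]addrC addrA lerDl mulrn_wge0 ?mulr_ge0.
Qed.

Lemma Re_le_normc (R : realType) (c : R[i]) : `|complex.Re c| <= normc c.
Proof.
case: c => a b /=; rewrite -sqrtr_sqr ler_wsqrtr//.
by rewrite lerDl sqr_ge0.
Qed.

Lemma Im_le_normc (R : realType) (c : R[i]) : `|complex.Im c| <= normc c.
Proof.
case: c => a b /=; rewrite -sqrtr_sqr ler_wsqrtr//.
by rewrite lerDr sqr_ge0.
Qed.

(** * The C*-norm of the unitization and its completeness *)

Section UnitizationNorm.
Context (R : realType) (A : cstarAlgType R).
Local Notation U := (unz A).
Local Notation hr := (@rnorm_seminorm R A).
Implicit Types (x y z : A) (u v w : U).

(** Left multiplication on [A], seen as an ideal of its unitization; the operator norm of this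
    action is what satisfies the C*-identity. *)
Definition uact u y : A := uscal u *: y + upart u ** y.

Lemma uactD u v y : uact (u + v) y = uact u y + uact v y.
Proof. by rewrite /uact uscalD upartD scalerDl smulDl addrACA. Qed.

Lemma uactZ (c : R[i]) u y : uact (c *: u) y = c *: uact u y.
Proof. by rewrite /uact uscalZ upartZ scalerDr scalerA scale_smull. Qed.

Lemma uact_scale (c : R[i]) u y : uact u (c *: y) = c *: uact u y.
Proof. by rewrite /uact scalerDr !scalerA mulrC scale_smulr. Qed.

Lemma uactM u v y : uact (u * v) y = uact u (uact v y).
Proof.
rewrite /uact uscalM upartM !smulDl !scalerDr !smulDr !scale_smull !scale_smulr.
by rewrite !scalerA smulA -!addrA.
Qed.

Lemma uact_uin x y : uact (uin x) y = x ** y.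
Proof. by rewrite /uact scale0r add0r. Qed.

Definition opn u : R := sup [set rnorm (uact u y) | y in [set y | rnorm y <= 1]].

Let opn_ub u : has_ubound [set rnorm (uact u y) | y in [set y | rnorm y <= 1]].
Proof.
exists (normc (uscal u) + rnorm (upart u)) => _ [y /= y1 <-].
rewrite (le_trans (csn_triangle hr _ _))// lerD//.
  by rewrite (csn_scale hr) ler_piMr// normc_ge0.
by rewrite (le_trans (csn_mul hr _ _))// ler_piMr// (csn_ge0 hr).
Qed.

Lemma uact_le u y : rnorm (uact u y) <= opn u * rnorm y.
Proof.
have [y0|y0] := eqVneq (rnorm y) 0.
  by rewrite (rnorm_eq0 y0) /uact scaler0 smul0r addr0 (csn0 hr) mulr0.
have yp : 0 < rnorm y by rewrite lt_def y0 (csn_ge0 hr).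
have n1 : normc ((rnorm y)^-1)%:C = (rnorm y)^-1.
  by rewrite normc_real ger0_norm// invr_ge0 ltW.
rewrite -ler_pdivrMr// mulrC -{1}n1 -(csn_scale hr) -uact_scale.
apply: ub_le_sup; first exact: opn_ub.
by exists (((rnorm y)^-1)%:C *: y) => //=; rewrite (csn_scale hr) n1 mulVf.
Qed.

Lemma opn_leP u (M : R) : (forall y, rnorm (uact u y) <= M * rnorm y) -> 0 <= M ->
  opn u <= M.
Proof.
move=> uM M0; apply: ge_sup.
  by exists (rnorm (uact u 0)); exists 0 => //=; rewrite (csn0 hr).
by move=> _ [y /= y1 <-]; rewrite (le_trans (uM y))// ler_piMr.
Qed.

Lemma opn_ge0 u : 0 <= opn u.
Proof.
apply: le_trans (csn_ge0 hr (uact u 0)) _; apply: ub_le_sup; first exact: opn_ub.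
by exists 0 => //=; rewrite (csn0 hr).
Qed.

Lemma opn_seminorm : cstar_seminorm opn.
Proof.
apply: cstar_seminorm_le => [u|u v|c u|u v|u]; first exact: opn_ge0.
- apply: opn_leP => [y|]; last by rewrite addr_ge0 ?opn_ge0.
  by rewrite uactD mulrDl (le_trans (csn_triangle hr _ _))// lerD ?uact_le.
- apply: opn_leP => [y|]; last by rewrite mulr_ge0 ?opn_ge0 ?normc_ge0.
  by rewrite uactZ (csn_scale hr) -mulrA ler_wpM2l ?normc_ge0 ?uact_le.
- apply: opn_leP => [y|]; last by rewrite mulr_ge0 ?opn_ge0.
  rewrite [u ** v]/(u * v) uactM -mulrA (le_trans (uact_le _ _))//.
  by rewrite ler_wpM2l ?opn_ge0 ?uact_le.
(* With [W = uact u y], [star W ** W = star y ** uact (star u ** u) y], so the square of [|W|] is at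
   most [opn (star u ** u)] times the square of [|y|]. *)
- rewrite -[opn (_ ** _)]sqr_sqrtr ?opn_ge0// lerXn2r ?nnegrE ?opn_ge0 ?sqrtr_ge0//.
  apply: opn_leP => [y|]; last exact: sqrtr_ge0.
  rewrite -[rnorm y]ger0_norm ?(csn_ge0 hr)// -[`|rnorm y|]sqrtr_sqr.
  rewrite -sqrtrM ?opn_ge0// -[rnorm (uact _ _)]ger0_norm ?(csn_ge0 hr)//.
  rewrite -sqrtr_sqr ler_wsqrtr// -(csn_star hr).
  have -> : star (uact u y) ** uact u y = star y ** uact (star u ** u) y.
    rewrite [star u ** u]/(star u * u) uactM.
    have WE : uact u y = uscal u *: y + upart u ** y by [].
    move: (uact u y) WE => W WE; rewrite {1}WE starD starZ starM smulDl scale_smull.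
    rewrite /uact ![uscal (star u)]/(conjc (uscal u)).
    by rewrite ![upart (star u)]/(star (upart u)) smulDr scale_smulr smulA.
  rewrite (le_trans (csn_mul hr _ _))// (csn_isometric_star hr).
  rewrite (le_trans (ler_wpM2l (csn_ge0 hr _) (uact_le _ _)))//.
  by rewrite mulrCA expr2.
Qed.

(* When [A] is unital the operator norm [opn] alone vanishes on a nonzero element. *)
Definition un u : R := Num.max (normc (uscal u)) (opn u).

Lemma un_seminorm : cstar_seminorm un.
Proof.
have ho := opn_seminorm.
apply: cstar_seminorm_le => [u|u v|c u|u v|u].
- by rewrite le_max normc_ge0.
- rewrite /un ge_max; apply/andP; split.
    by rewrite uscalD (le_trans (le_normcD _ _))// lerD// le_max lexx.
  by rewrite (le_trans (csn_triangle ho _ _))// lerD// le_max lexx orbT.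
- rewrite /un ge_max uscalZ normcM (csn_scale ho).
  by rewrite !ler_wpM2l ?normc_ge0// le_max lexx ?orbT.
- rewrite /un ge_max; apply/andP; split.
    by rewrite [uscal _]uscalM normcM ler_pM ?normc_ge0// le_max lexx.
  rewrite (le_trans (csn_mul ho _ _))// ler_pM ?opn_ge0// le_max lexx orbT//.
- rewrite /un; have [_|_] := leP (normc (uscal u)) (opn u).
    by rewrite -(csn_star ho) le_max lexx orbT.
  rewrite le_max; apply/orP; left.
  have -> : uscal (star u ** u) = conjc (uscal u) * uscal u by [].
  rewrite normcM expr2.
  by case: (uscal u) => a b; rewrite /normc/= sqrrN.
Qed.

(** The lower bound comes from letting [x] act on [star x], where the C*-identity produces the
    square of the norm. *)
Lemma un_uin x : un (uin x) = rnorm x.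
Proof.
rewrite /un normc0 max_r ?opn_ge0//; apply/le_anti/andP; split.
  apply: opn_leP => [y|]; last exact: (csn_ge0 hr).
  by rewrite uact_uin (csn_mul hr).
have [x0|x0] := eqVneq (rnorm x) 0; first by rewrite x0 opn_ge0.
have := uact_le (uin x) (star x); rewrite uact_uin -{1}(starK x).
rewrite (csn_star hr) (csn_isometric_star hr) expr2 ler_pM2r//.
by rewrite lt_def x0 (csn_ge0 hr).
Qed.

Lemma uinD x y : uin (x + y) = uin x + uin y.
Proof. by apply: unzP; rewrite ?uscalD ?upartD //= addr0. Qed.

Lemma uinZ (c : R[i]) x : uin (c *: x) = c *: uin x.
Proof. by apply: unzP; rewrite ?uscalZ ?upartZ //= mulr0. Qed.

Lemma uinM x y : uin (x ** y) = uin x * uin y.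
Proof.
by apply: unzP; rewrite ?uscalM ?upartM ?uscal_mk ?upart_mk ?mul0r// !scale0r !add0r.
Qed.

Lemma uin_star x : uin (star x) = star (uin x).
Proof. by apply: unzP => //; exact: esym (conjc0 _). Qed.

Lemma uin0 : uin (0 : A) = 0. Proof. by []. Qed.

Lemma uinN x : uin (- x) = - uin x.
Proof. by rewrite -scaleN1r uinZ scaleN1r. Qed.

Lemma uinB x y : uin (x - y) = uin x - uin y.
Proof. by rewrite uinD uinN. Qed.

Lemma uin_inj : injective (@uin R A).
Proof. by move=> x y /(congr1 (@upart _ _)). Qed.

Lemma uscal_uin x : uscal (uin x) = 0. Proof. by []. Qed.

Lemma uin_upart u : uscal u = 0 -> uin (upart u) = u.
Proof. by move=> u0; apply: unzP. Qed.

Lemma unz_dec u : u = (uscal u)%:A + uin (upart u).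
Proof.
apply: unzP; rewrite ?uscalD ?upartD ?uscalZ ?upartZ ?uscal_uin ?upart_mk ?addr0 ?mulr1//.
by rewrite scaler0 add0r.
Qed.

Lemma un_eq0 u : un u = 0 -> u = 0.
Proof.
move=> u0; have l0 : uscal u = 0.
  apply: eq0_normc; apply/le_anti; rewrite normc_ge0 andbT.
  by rewrite -u0 le_max lexx.
by move: u0; rewrite -(uin_upart l0) un_uin => /rnorm_eq0 ->.
Qed.

Lemma un_scal_le u : normc (uscal u) <= un u.
Proof. by rewrite le_max lexx. Qed.

Lemma usmulE u v : u ** v = u * v. Proof. by []. Qed.

Lemma ustar1 : star (1 : U) = 1.
Proof. by apply: unzP; [exact: rmorph1|exact: star0]. Qed.

Lemma un1 : un 1 = 1.
Proof.
have : un 1 ^+ 2 = un 1.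
  by rewrite -(csn_star un_seminorm) ustar1 usmulE mulr1.
move=> /eqP; rewrite expr2 -subr_eq0 -{3}(mulr1 (un 1)) -mulrBr.
rewrite mulf_eq0 => /orP[/eqP/un_eq0/eqP|]; first by rewrite oner_eq0.
by rewrite subr_eq0 => /eqP.
Qed.

(** The norm dominates the scalar part, so the scalars converge through their real and imaginary
    parts, and what remains is Cauchy in [A]. *)
Lemma un_complete (s : nat -> U) : cauchy_for un s -> exists l, cvg_for un s l.
Proof.
have hu := un_seminorm => cs.
have scN u v : un (uscal u - uscal v)%:A = normc (uscal u - uscal v).
  by rewrite (csn_scale hu) un1 mulr1.
have usB u v : uscal (u - v) = uscal u - uscal v by [].
have [a sa] : exists a, forall e, 0 < e -> exists N, forall n, (N <= n)%N ->
    `|complex.Re (uscal (s n)) - a| < e.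
  apply: real_complete => e /cs[N sN]; exists N => m n Nm Nn.
  apply: le_lt_trans (sN m n Nm Nn); apply: le_trans (un_scal_le _).
  by apply: le_trans (Re_le_normc _); rewrite usB raddfB.
have [b sb] : exists b, forall e, 0 < e -> exists N, forall n, (N <= n)%N ->
    `|complex.Im (uscal (s n)) - b| < e.
  apply: real_complete => e /cs[N sN]; exists N => m n Nm Nn.
  apply: le_lt_trans (sN m n Nm Nn); apply: le_trans (un_scal_le _).
  by apply: le_trans (Im_le_normc _); rewrite usB raddfB.
have ca : cauchy_for (@rnorm R A) (fun n => upart (s n)).
  move=> e e0; have [N sN] := cs _ (divr_gt0 e0 (ltr0Sn _ 1)).
  exists N => m n Nm Nn; rewrite -un_uin.
  have -> : uin (upart (s m) - upart (s n)) = (s m - s n) - (uscal (s m - s n))%:A.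
    by rewrite {1}[s m - s n]unz_dec [X in _ = X - _]addrC addrK.
  rewrite (le_lt_trans (csn_triangle hu _ _))// (csnN hu) (csn_scale hu) un1 mulr1.
  by rewrite (splitr e) ltrD ?sN// (le_lt_trans (un_scal_le _)) ?sN.
have [x sx] := rnorm_complete ca.
exists (mku (a +i* b) x) => e e0.
have e3 : 0 < e / 3 by rewrite divr_gt0.
have [N1 h1] := sa _ e3; have [N2 h2] := sb _ e3; have [N3 h3] := sx _ e3.
exists (maxn N1 (maxn N2 N3)) => n; rewrite !geq_max => /and3P[/h1 k1 /h2 k2 /h3 k3].
rewrite [s n - _]unz_dec (le_lt_trans (csn_triangle hu _ _))//.
rewrite (csn_scale hu) un1 mulr1 un_uin usB.
have -> : e = e / 3 + e / 3 + e / 3 by field.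
apply: ltrD => //; apply: le_lt_trans (ltrD k1 k2).
by case: (uscal (s n)) => c d; exact: normc_le.
Qed.

End UnitizationNorm.

(** * Spectral theory and functional calculus *)

Section UnitalSpectrum.
Context (R : realType) (A : cstarAlgType R).
Local Notation U := (unz A).
Local Notation hu := (@un_seminorm R A).
Implicit Types (x y z h c : U) (r t : R).

(** Real multiples of the unit are enough to describe spectra here, since self-adjoint elements have
    no nonreal spectrum ([uinv_nonreal]). *)
Definition rs (r : R) : U := r%:C%:A.

Lemma rsD r t : rs (r + t) = rs r + rs t.
Proof. by rewrite /rs rmorphD scalerDl. Qed.
Lemma rsN r : rs (- r) = - rs r.
Proof. by rewrite /rs rmorphN scaleNr. Qed.
Lemma rsB r t : rs (r - t) = rs r - rs t.
Proof. by rewrite rsD rsN. Qed.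
Lemma rsM r t : rs (r * t) = rs r * rs t.
Proof. by rewrite /rs rmorphM -scalerA mulr_algl. Qed.
Lemma rs1 : rs 1 = 1. Proof. by rewrite /rs rmorph1 scale1r. Qed.
Lemma rs0 : rs 0 = 0. Proof. by rewrite /rs rmorph0 scale0r. Qed.
Lemma rs_scale r x : r%:C *: x = rs r * x.
Proof. by rewrite /rs mulr_algl. Qed.
Lemma rsC r x : x * rs r = rs r * x.
Proof. by rewrite /rs mulr_algr mulr_algl. Qed.
Lemma rs_comm r x : GRing.comm x (rs r). Proof. exact: rsC. Qed.
Lemma conjc_real r : conjc (r%:C) = r%:C :> R[i].
Proof. by rewrite /= oppr0. Qed.
Lemma rs_star r : star (rs r) = rs r.
Proof. by rewrite /rs starZ ustar1 conjc_real. Qed.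
Lemma un_rs r : un (rs r) = `|r|.
Proof. by rewrite /rs (csn_scale hu) un1 mulr1 normc_real. Qed.
Lemma un_rsM r x : un (rs r * x) = `|r| * un x.
Proof. by rewrite -rs_scale (csn_scale hu) normc_real. Qed.
Lemma ustarM x y : star (x * y) = star y * star x.
Proof. by rewrite -usmulE starM. Qed.
Lemma unM x y : un (x * y) <= un x * un y.
Proof. exact: (csn_mul hu). Qed.
Lemma un_ge0 x : 0 <= un x. Proof. exact: (csn_ge0 hu). Qed.
Lemma un0 : un (0 : U) = 0. Proof. exact: (csn0 hu). Qed.
Lemma unN x : un (- x) = un x. Proof. exact: (csnN hu). Qed.
Lemma unBC x y : un (x - y) = un (y - x). Proof. exact: (csnBC hu). Qed.
Lemma unD x y : un (x + y) <= un x + un y. Proof. exact: (csn_triangle hu). Qed.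
Lemma un_dist y x z : un (x - z) <= un (x - y) + un (y - z).
Proof. exact: (csn_dist hu). Qed.
Lemma un_star x : un (star x) = un x. Proof. exact: (csn_isometric_star hu). Qed.
Lemma un_starM x : un (star x * x) = un x ^+ 2. Proof. exact: (csn_star hu). Qed.
Lemma un_Mstar x : un (x * star x) = un x ^+ 2.
Proof. by rewrite -{1}(starK x) un_starM un_star. Qed.
Lemma un_sa_sqr h : star h = h -> un (h * h) = un h ^+ 2.
Proof. by move=> sh; rewrite -{1}sh un_starM. Qed.
Lemma un_exp x n : un (x ^+ n) <= un x ^+ n.
Proof.
elim: n => [|n IH]; first by rewrite !expr0 un1.
by rewrite !exprS (le_trans (unM _ _))// ler_wpM2l ?un_ge0.
Qed.

Lemma un_eq x y : (forall e, 0 < e -> un (x - y) <= e) -> x = y.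
Proof.
move=> xy; apply/eqP; rewrite -subr_eq0; apply/eqP/un_eq0/le_anti.
by rewrite un_ge0 andbT; apply/ler_addgt0Pl => e /xy; rewrite addr0.
Qed.

Definition ucvg (s : nat -> U) x := cvg_for (@un R A) s x.

Lemma ucvg_uniq s x y : ucvg s x -> ucvg s y -> x = y.
Proof.
move=> sx sy; apply: un_eq => e e0; have e2 : 0 < e / 2 by rewrite divr_gt0.
have [N hN] := sx _ e2; have [M hM] := sy _ e2.
have k1 := hN _ (leq_maxl N M); have k2 := hM _ (leq_maxr N M).
rewrite (le_trans (un_dist (s (maxn N M)) _ _))// unBC (splitr e).
by rewrite ltW// ltrD.
Qed.

Lemma ucvg_cst x : ucvg (fun=> x) x.
Proof. by move=> e e0; exists 0%N => n _; rewrite subrr un0. Qed.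

Lemma ucvg_ext s s' x : (forall n, s n = s' n) -> ucvg s x -> ucvg s' x.
Proof. by move=> ss sx e /sx[N h]; exists N => n /h; rewrite ss. Qed.

Lemma ucvg_shift s x : ucvg s x -> ucvg (fun n => s n.+1) x.
Proof. by move=> sx e /sx[N h]; exists N => n Nn; apply: h; exact: leqW. Qed.

Lemma ucvg_lip (F : U -> U) (M : R) s x :
  (forall u v, un (F u - F v) <= M * un (u - v)) -> ucvg s x -> ucvg (F \o s) (F x).
Proof.
move=> FM sx e e0.
have M0 : 0 < `|M| + 1 by rewrite ltr_wpDl.
have [N hN] := sx _ (divr_gt0 e0 M0); exists N => n /hN; rewrite ltr_pdivlMr// => h.
apply: le_lt_trans (FM _ _) (le_lt_trans _ h).
by rewrite mulrC ler_wpM2l ?un_ge0// (le_trans (ler_norm M))// lerDl.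
Qed.

Lemma ucvgD s s' x x' : ucvg s x -> ucvg s' x' -> ucvg (fun n => s n + s' n) (x + x').
Proof.
move=> sx sy e e0; have e2 : 0 < e / 2 by rewrite divr_gt0.
have [N hN] := sx _ e2; have [M hM] := sy _ e2.
exists (maxn N M) => n; rewrite geq_max => /andP[/hN k1 /hM k2].
by rewrite opprD addrACA (le_lt_trans (unD _ _))// (splitr e) ltrD.
Qed.

Lemma ucvgMl s x y : ucvg s x -> ucvg (fun n => y * s n) (y * x).
Proof.
apply: (@ucvg_lip (fun u => y * u) (un y)) => u v.
by rewrite -mulrBr unM.
Qed.

Lemma ucvgMr s x y : ucvg s x -> ucvg (fun n => s n * y) (x * y).
Proof.
apply: (@ucvg_lip (fun u => u * y) (un y)) => u v.
by rewrite -mulrBl mulrC unM.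
Qed.

Lemma ucvg_star s x : ucvg s x -> ucvg (fun n => star (s n)) (star x).
Proof.
apply: (@ucvg_lip (@star R U) 1) => u v.
by rewrite -starB un_star mul1r.
Qed.

Lemma ucvgM s s' x x' : ucvg s x -> ucvg s' x' -> ucvg (fun n => s n * s' n) (x * x').
Proof.
move=> sx sy; have [N1 hN1] := sx _ ltr01.
have M0 : 0 < un x + 1 + un x' by rewrite ltr_wpDr ?un_ge0// ltr_wpDl ?un_ge0.
move=> e e0; have e2 : 0 < e / 2 / (un x + 1 + un x') by rewrite !divr_gt0.
have [N hN] := sx _ e2; have [M hM] := sy _ e2.
exists (maxn N1 (maxn N M)) => n; rewrite !geq_max => /and3P[/hN1 k0 /hN k1 /hM k2].
rewrite -[s n * s' n]usmulE -usmulE smul_sub2 (le_lt_trans (unD _ _))// (splitr e).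
have sb : un (s n) <= un x + 1.
  by rewrite -(subrK x (s n)) (le_trans (unD _ _))// addrC lerD2l ltW.
move: k1; rewrite ltr_pdivlMr// => k1; move: k2; rewrite ltr_pdivlMr// => k2.
apply: ltrD.
  rewrite (le_lt_trans (unM _ _))// (le_lt_trans _ k2)// mulrC ler_wpM2l ?un_ge0//.
  by rewrite (le_trans sb)// lerDl un_ge0.
rewrite (le_lt_trans (unM _ _))// (le_lt_trans _ k1)// ler_wpM2l ?un_ge0//.
by rewrite lerDr addr_ge0 ?un_ge0.
Qed.

Lemma ucvg_comm s x z : (forall n, GRing.comm z (s n)) -> ucvg s x -> GRing.comm z x.
Proof.
move=> sz sx; apply: ucvg_uniq (ucvgMl z sx) _.
by apply: ucvg_ext (ucvgMr z sx) => n; rewrite sz.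
Qed.

Definition uinv x := exists y, x * y = 1 /\ y * x = 1.

Lemma uinvM x y : uinv x -> uinv y -> uinv (x * y).
Proof.
move=> [x' [xx x'x]] [y' [yy y'y]]; exists (y' * x'); split.
  by rewrite mulrA -(mulrA x) yy mulr1.
by rewrite mulrA -(mulrA y') x'x mulr1.
Qed.

(** If [z] inverts the product, [z * y] is a left inverse of [x] and [y * z] a right inverse, so the
    two agree. *)
Lemma uinv_commM x y : GRing.comm x y -> uinv (x * y) -> uinv x.
Proof.
move=> xy [z [z1 z2]].
have e1 : z * y * x = 1 by rewrite -mulrA -xy.
have e2 : x * (y * z) = 1 by rewrite mulrA.
exists (y * z); split=> //.
by have -> : y * z = z * y by rewrite -[LHS]mul1r -e1 -mulrA e2 mulr1.
Qed.

Lemma uinv_scale r x : r != 0 -> uinv x -> uinv (rs r * x).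
Proof.
move=> r0 ux; apply: uinvM ux; exists (rs r^-1).
by rewrite -!rsM mulfV// mulVf// rs1.
Qed.

Lemma uinvN x : uinv x -> uinv (- x).
Proof. by case=> y [h1 h2]; exists (- y); rewrite !mulrNN. Qed.

Lemma uinv_comm_inv x y z : x * y = 1 -> y * x = 1 -> GRing.comm z x -> GRing.comm z y.
Proof.
move=> xy yx zx; rewrite /GRing.comm -[LHS]mul1r -yx -[in RHS](mulr1 z) -xy.
by rewrite !mulrA -(mulrA y x z) -zx mulrA.
Qed.

Lemma ucauchy_geo (s : nat -> U) (C q : R) : 0 <= q -> q < 1 -> 0 <= C ->
  (forall n, un (s n.+1 - s n) <= C * q ^+ n) -> exists x, ucvg s x.
Proof.
move=> q0 q1 C0 sq; apply: un_complete.
have sqk n k : un (s (n + k)%N - s n) <= C * q ^+ n / (1 - q).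
  have q1' : 0 < 1 - q by rewrite subr_gt0.
  suff h : un (s (n + k)%N - s n) <= C * q ^+ n * ((1 - q ^+ k) / (1 - q)).
    rewrite (le_trans h)// ler_wpM2l ?mulr_ge0 ?exprn_ge0//.
    rewrite -[leRHS]mul1r ler_wpM2r ?invr_ge0 ?(ltW q1')//.
    by rewrite lerBlDr lerDl exprn_ge0.
  elim: k => [|k IH]; first by rewrite addn0 subrr un0 expr0 subrr mul0r mulr0.
  rewrite addnS (le_trans (un_dist (s (n + k)%N) _ _))//.
  rewrite (le_trans (lerD (sq _) IH))// -mulrA -mulrDr exprD -mulrA.
  rewrite ler_wpM2l// -mulrDr ler_wpM2l ?exprn_ge0//.
  rewrite -{1}(mulfK (lt0r_neq0 q1') (q ^+ k)) -mulrDl ler_wpM2r ?invr_ge0 ?(ltW q1')//.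
  by rewrite exprS; lra.
move=> e e0.
have q1' : 0 < 1 - q by rewrite subr_gt0.
have e2 : 0 < e * (1 - q) / (C + 1) / 2 by rewrite !divr_gt0 ?mulr_gt0// ltr_wpDl.
have /cvgrPdist_lt /(_ _ e2)[N _ hN] : (fun n => q ^+ n) @ \oo --> (0 : R).
  by apply: cvg_expr; rewrite ger0_norm.
have sN n : (N <= n)%N -> un (s n - s N) < e / 2.
  move=> Nn; rewrite -(subnKC Nn) (le_lt_trans (sqk _ _))//.
  rewrite ltr_pdivrMr//; have := hN N (leqnn N); rewrite /= sub0r normrN.
  rewrite ger0_norm ?exprn_ge0// => h.
  apply: (@le_lt_trans _ _ ((C + 1) * q ^+ N)).
    by rewrite ler_wpM2r ?exprn_ge0// lerDl.
  rewrite mulrC -ltr_pdivlMr ?ltr_wpDl//.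
  apply: (lt_le_trans h); rewrite le_eqVlt; apply/orP; left; apply/eqP.
  by field; rewrite gt_eqF// ltr_wpDl.
exists N => m n Nm Nn; rewrite (le_lt_trans (un_dist (s N) _ _))// (splitr e).
by rewrite ltrD ?sN// unBC sN.
Qed.

Lemma uinv_neumann x : un x < 1 -> uinv (1 - x).
Proof.
move=> x1; pose s n := \sum_(i < n) x ^+ i.
have [y sy] : exists y, ucvg s y.
  apply: (@ucauchy_geo s 1 (un x)) => // [|n]; first exact: un_ge0.
  by rewrite /s big_ord_recr /= addrAC subrr add0r mul1r un_exp.
have x0 : ucvg (fun n => 1 - x ^+ n) 1.
  move=> e e0; have /cvgrPdist_lt /(_ _ e0)[N _ hN] : (fun n => un x ^+ n) @ \oo --> (0 : R).
    by apply: cvg_expr; rewrite ger0_norm// un_ge0.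
  exists N => n /hN /=; rewrite sub0r normrN ger0_norm ?exprn_ge0 ?un_ge0// => h.
  by rewrite addrAC subrr add0r unN (le_lt_trans (un_exp _ _)).
have sE n : (1 - x) * s n = 1 - x ^+ n.
  elim: n => [|n IH]; first by rewrite /s big_ord0 mulr0 expr0 subrr.
  by rewrite /s big_ord_recr /= mulrDr IH mulrBl mul1r -exprS addrA subrK.
have sE' n : s n * (1 - x) = 1 - x ^+ n.
  rewrite -sE; apply: commr_sym; apply: commr_sum => i _.
  by apply: commrX; apply: commr_sym; apply: commrB => //; exact: commr1.
exists y; split.
  by apply: ucvg_uniq (ucvgMl (1 - x) sy) _; apply: ucvg_ext x0 => n; rewrite sE.
by apply: ucvg_uniq (ucvgMr (1 - x) sy) _; apply: ucvg_ext x0 => n; rewrite sE'.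
Qed.

End UnitalSpectrum.
Arguments rs {R A}.

(** * Real polynomials evaluated in the unitization *)

Section PolynomialCalculus.
Context (R : realType) (A : cstarAlgType R).
Local Notation U := (unz A).
Implicit Types (x y z h c : U) (r t : R) (P Q : {poly R}).

Definition pe P x : U := horner_alg x (map_poly (real_complex R) P).

Lemma peD P Q x : pe (P + Q) x = pe P x + pe Q x.
Proof. by rewrite /pe !rmorphD. Qed.
Lemma peN P x : pe (- P) x = - pe P x.
Proof. by rewrite /pe !rmorphN. Qed.
Lemma peB P Q x : pe (P - Q) x = pe P x - pe Q x.
Proof. by rewrite peD peN. Qed.
Lemma peM P Q x : pe (P * Q) x = pe P x * pe Q x.
Proof. by rewrite /pe !rmorphM. Qed.
Lemma peC r x : pe r%:P x = rs r.
Proof. by rewrite /pe map_polyC horner_algC. Qed.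
Lemma peX x : pe 'X x = x.
Proof. by rewrite /pe map_polyX horner_algX. Qed.
Lemma pe0 x : pe 0 x = 0.
Proof. by rewrite -polyC0 peC rs0. Qed.
Lemma pe1 x : pe 1 x = 1.
Proof. by rewrite -polyC1 peC rs1. Qed.
Lemma peZ r P x : pe (r *: P) x = rs r * pe P x.
Proof. by rewrite -mul_polyC peM peC. Qed.

Lemma pe_ind (T : {poly R} -> Prop) : T 0 ->
  (forall P r, T P -> T (P * 'X + r%:P)) -> forall P, T P.
Proof. by move=> T0 TS; elim/poly_ind => // P r; exact: TS. Qed.

Lemma pe_comm P x z : GRing.comm z x -> GRing.comm z (pe P x).
Proof.
move=> zx; elim/pe_ind: P => [|P r IH]; first by rewrite pe0; exact: commr0.
rewrite peD peM peC peX; apply: commrD; last exact: rs_comm.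
exact: commrM.
Qed.

Lemma pe_sa P x : star x = x -> star (pe P x) = pe P x.
Proof.
move=> sx; elim/pe_ind: P => [|P r IH]; first by rewrite pe0 star0.
rewrite peD peM peC peX starD ustarM rs_star IH sx; congr (_ + _).
exact/pe_comm/commr_refl.
Qed.

Lemma pe_intertw P x y z : z * x = y * z -> z * pe P x = pe P y * z.
Proof.
move=> zx; elim/pe_ind: P => [|P r IH]; first by rewrite !pe0 mulr0 mul0r.
by rewrite !peD !peM !peC !peX mulrDr mulrDl rsC mulrA IH -!mulrA zx.
Qed.

(** For nonnegative coefficients the value at [1] bounds the polynomial on the unit ball, both of
    the algebra and of the reals; convergence in norm can then be read off a real sequence. *)
Definition nnpoly P := forall i, 0 <= P`_i.

Lemma nnpolyD P Q : nnpoly P -> nnpoly Q -> nnpoly (P + Q).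
Proof. by move=> p q i; rewrite coefD addr_ge0. Qed.
Lemma nnpolyM P Q : nnpoly P -> nnpoly Q -> nnpoly (P * Q).
Proof. by move=> p q i; rewrite coefM sumr_ge0// => j _; rewrite mulr_ge0. Qed.
Lemma nnpolyZ r P : 0 <= r -> nnpoly P -> nnpoly (r *: P).
Proof. by move=> r0 p i; rewrite coefZ mulr_ge0. Qed.

Lemma nnpoly_un P x : nnpoly P -> un x <= 1 -> un (pe P x) <= P.[1].
Proof.
move=> p x1; elim/pe_ind: P p => [|P r IH] p; first by rewrite pe0 un0 horner0.
rewrite peD peM peC peX !hornerE (le_trans (unD _ _))// lerD//.
  rewrite (le_trans (unM _ _))// (le_trans _ (IH _)) ?ler_piMr ?un_ge0//.
  by move=> i; have := p i.+1; rewrite coefD coefMX coefC addr0.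
by rewrite un_rs ger0_norm//; have := p 0%N; rewrite coefD coefMX coefC add0r.
Qed.

Lemma nnpoly_real P t : nnpoly P -> `|t| <= 1 -> `|P.[t]| <= P.[1].
Proof.
move=> p t1; elim/pe_ind: P p => [|P r IH] p; first by rewrite !horner0 normr0.
rewrite !hornerE (le_trans (ler_normD _ _))// lerD//.
  rewrite normrM (le_trans _ (IH _)) ?ler_piMr//.
  by move=> i; have := p i.+1; rewrite coefD coefMX coefC addr0.
by rewrite ger0_norm//; have := p 0%N; rewrite coefD coefMX coefC add0r.
Qed.

Lemma nnpoly1_ge0 P : nnpoly P -> 0 <= P.[1].
Proof.
move=> p; apply: le_trans (normr_ge0 P.[1]) (nnpoly_real p _).
by rewrite normr1.
Qed.

End PolynomialCalculus.

Section SquareRootPolynomials.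
Context (R : realType).

(* [1 - sqrtp n] tends to [sqrt (1 - t)]; the coefficients increase with [n]
   and stay nonnegative, so the error is controlled by the value at [1]. *)
Fixpoint sqrtp (n : nat) : {poly R} :=
  if n is n'.+1 then 2^-1 *: ('X + sqrtp n' * sqrtp n') else 0.

Lemma sqrtp_nn n : nnpoly (sqrtp n).
Proof.
elim: n => [|n IH] /=; first by move=> i; rewrite coef0.
apply: nnpolyZ; first by rewrite invr_ge0.
by apply: nnpolyD; [move=> i; rewrite coefX ler0n|exact: nnpolyM].
Qed.

Lemma sqrtpS_nn n : nnpoly (sqrtp n.+1 - sqrtp n).
Proof.
elim: n => [|n IH].
  by rewrite /= subr0 mulr0 addr0; apply: nnpolyZ => [|i]; rewrite ?invr_ge0 ?coefX ?ler0n.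
(* A difference of squares: the recursion turns each increment into half the previous increment
   times a sum with nonnegative coefficients. *)
have -> : sqrtp n.+2 - sqrtp n.+1 =
    2^-1 *: ((sqrtp n.+1 - sqrtp n) * (sqrtp n.+1 + sqrtp n)).
  have -> : sqrtp n.+2 = 2^-1 *: ('X + sqrtp n.+1 * sqrtp n.+1) by [].
  have hS : sqrtp n.+1 = 2^-1 *: ('X + sqrtp n * sqrtp n) by [].
  move: (sqrtp n.+1) (sqrtp n) hS {IH} => S T hS.
  by rewrite [in X in _ - X]hS -scalerBr; congr (_ *: _); ring.
apply: nnpolyZ; first by rewrite invr_ge0.
by apply: nnpolyM => //; apply: nnpolyD; exact: sqrtp_nn.
Qed.

Lemma sqrtp_diff_nn n k : nnpoly (sqrtp (n + k)%N - sqrtp n).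
Proof.
elim: k => [|k IH]; first by move=> i; rewrite addn0 subrr coef0.
rewrite addnS -(subrK (sqrtp (n + k)%N) (sqrtp _.+1)) -addrA.
by apply: nnpolyD => //; exact: sqrtpS_nn.
Qed.

Lemma sqrtp1_le n : (sqrtp n).[1] <= 1.
Proof.
elim: n => [|n IH]; first by rewrite horner0.
have h0 : 0 <= (sqrtp n).[1] := nnpoly1_ge0 (sqrtp_nn n).
by rewrite /= !hornerE; nra.
Qed.

Lemma sqrtp1_cauchy (e : R) : 0 < e -> exists N, forall n, (N <= n)%N ->
  (sqrtp n).[1] - (sqrtp N).[1] < e.
Proof.
move=> e0; pose u n := (sqrtp n).[1].
have und : nondecreasing_seq u.
  apply/nondecreasing_seqP => n; rewrite -subr_ge0 -hornerN -hornerD.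
  exact: nnpoly1_ge0 (sqrtpS_nn n).
have ub : has_ubound (range u) by exists 1 => _ [n _ <-]; exact: sqrtp1_le.
have /cvgrPdist_lt /(_ _ e0)[N _ hN] := nondecreasing_cvgn und ub.
exists N => n Nn; have := hN N (leqnn N); rewrite /= distrC.
have : u n <= sup (range u) by apply: ub_le_sup => //; exists n.
have : u N <= sup (range u) by apply: ub_le_sup => //; exists N.
rewrite -/(u n) -/(u N) => h1 h2; rewrite ler0_norm ?subr_le0//; lra.
Qed.

End SquareRootPolynomials.

(** * Square roots, and invertibility at the norm of a self-adjoint element *)

Section SpectralRadius.
Context (R : realType) (A : cstarAlgType R).
Local Notation U := (unz A).
Local Notation hu := (@un_seminorm R A).
Implicit Types (x y z h c : U) (r t : R) (P Q : {poly R}).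

(** The limit [l] of [sqrtp n] at [c] is a fixed point of the recursion, [l + l = c + l * l], so
    [1 - l] squares to [1 - c]. As a limit of polynomials in [c], it commutes with everything that
    commutes with [c]. *)
Lemma sqrt_sub c : star c = c -> un c <= 1 -> exists s : U, [/\ star s = s,
  s * s = 1 - c & forall z, GRing.comm z c -> GRing.comm z s].
Proof.
move=> sc c1; pose y n := pe (sqrtp R n) c.
have [l yl] : exists l, ucvg y l.
  apply: un_complete => e e0.
  have [N hN] := sqrtp1_cauchy (divr_gt0 e0 (ltr0Sn R 1)).
  have k n : (N <= n)%N -> un (y n - y N) < e / 2.
    move=> Nn; rewrite /y -peB (le_lt_trans (nnpoly_un _ c1))//.
      by rewrite -(subnKC Nn); exact: sqrtp_diff_nn.
    by rewrite !hornerE hN.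
  exists N => m n Nm Nn; rewrite (le_lt_trans (un_dist (y N) _ _))// (splitr e).
  by apply: ltrD; [exact: k|rewrite unBC; exact: k].
have el : l = rs 2^-1 * (c + l * l).
  apply: ucvg_uniq (ucvg_shift yl) _.
  apply: ucvg_ext (ucvgMl (rs 2^-1) (ucvgD (ucvg_cst c) (ucvgM yl yl))) => n.
  by rewrite /y /= peZ peD peX peM.
have el2 : l + l = c + l * l.
  by rewrite {1 2}el -mulrDl -rsD -[RHS]mul1r -rs1; congr (rs _ * _); field.
have sl : star l = l.
  apply: ucvg_uniq (ucvg_star yl) _.
  by apply: ucvg_ext yl => n; rewrite /y pe_sa.
exists (1 - l); split.
- by rewrite starB ustar1 sl.
- have -> : (1 - l) * (1 - l) = 1 - l + (l * l - l).
    by rewrite mulrBl mul1r mulrBr mulr1 opprB.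
  have -> : l * l = l + l - c by rewrite el2 addrAC subrr add0r.
  by rewrite [l + l - c]addrAC addrK addrA subrK.
- move=> z zc; apply: commrB; first exact: commr1.
  by apply: ucvg_comm yl => n; exact: pe_comm.
Qed.

Lemma rsMM (a b : R) x y : (rs a * x) * (rs b * y) = rs (a * b) * (x * y).
Proof. by rewrite -!rs_scale -scalerAl -scalerAr scalerA -rmorphM. Qed.

Lemma rsA (a b : R) x : rs a * (rs b * x) = rs (a * b) * x.
Proof. by rewrite mulrA rsM. Qed.

(** [u = h + i z] satisfies [star u * u = k], so its norm is known from the C*-identity, and [h] is
    its real part. This replaces an appeal to positivity, which is not yet available. *)
Lemma un_pythagoras h z (k : R) : star h = h -> star z = z -> GRing.comm h z ->
  h * h + z * z = rs k -> un h ^+ 2 <= `|k|.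
Proof.
move=> sh sz hz hk; pose i : R[i] := 0 +i* 1; pose u := h + i *: z.
have ci : conjc i = - i by apply/eqP; rewrite eq_complex /= oppr0 !eqxx.
have ii : i * i = -1.
  by apply/eqP; rewrite eq_complex /= !mul0r mulr0 mulr1 oppr0 add0r addr0 !eqxx.
have uu : star u * u = rs k.
  rewrite /u starD starZ sh sz [conjc i]ci scaleNr mulrBl !mulrDr.
  rewrite -!scalerAr -!scalerAl scalerA ii scaleN1r hz.
  by rewrite opprD opprK addrA addrK -hk.
have un_u : un u ^+ 2 = `|k| by rewrite -un_starM uu un_rs.
have : un h <= un u.
  have -> : h = rs 2^-1 * (u + star u).
    rewrite /u starD starZ sh sz [conjc i]ci scaleNr addrACA subrr addr0.
    by rewrite mulrDr -mulrDl -rsD -{1}[h]mul1r -rs1; congr (rs _ * _); field.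
  rewrite un_rsM (le_trans (ler_wpM2l _ (unD _ _)))// un_star ger0_norm ?invr_ge0//.
  lra.
by move=> /(lerXn2r 2) -/(_ (un_ge0 _) (un_ge0 _)); rewrite un_u.
Qed.

(** For [k] at least [|h|^2], let [z] be the root of [k - h^2]. Then [h^2 + z^2 = k] bounds [|z|^2]
    by [k], and [1 + h^2 = (1 + k) - z^2] is invertible by the Neumann series. *)
Lemma uinv_1Dsqr h : star h = h -> uinv (1 + h * h).
Proof.
move=> sh; pose k := Num.max (un h ^+ 2) 1.
have k1 : 1 <= k by rewrite le_max lexx orbT.
have k0 : 0 < k := lt_le_trans ltr01 k1.
pose c := rs k^-1 * (h * h).
have sc : star c = c by rewrite /c ustarM rs_star ustarM sh rsC.
have c1 : un c <= 1.
  rewrite /c un_rsM ger0_norm ?invr_ge0 ?(ltW k0)// un_sa_sqr// mulrC ler_pdivrMr//.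
  by rewrite mul1r le_max lexx.
have [t [st tt tc]] := sqrt_sub sc c1.
have ht : GRing.comm h t.
  by apply: tc; rewrite /c; apply: commrM; [exact: rs_comm|apply: commrM].
have ktt : rs k * (t * t) = rs k - h * h.
  by rewrite tt /c mulrBr mulr1 rsA mulfV ?gt_eqF// rs1 mul1r.
pose z := rs (Num.sqrt k) * t.
have sz : star z = z by rewrite /z ustarM rs_star st rsC.
have zz : z * z = rs k * (t * t).
  by rewrite /z rsMM -expr2 sqr_sqrtr// ltW.
have uz : un z ^+ 2 <= `|k|.
  apply: (@un_pythagoras z h) => //; last by rewrite zz ktt subrK.
  by apply: commr_sym; apply: commrM => //; exact: rs_comm.
have -> : 1 + h * h = rs (1 + k) * (1 - rs (1 + k)^-1 * (z * z)).
  rewrite mulrBr mulr1 rsA mulfV ?gt_eqF ?ltr_wpDl// rs1 mul1r.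
  by rewrite zz ktt rsD rs1 opprB addrA addrAC addrK.
apply: uinv_scale; first by rewrite gt_eqF// ltr_wpDl.
apply: uinv_neumann; rewrite un_rsM un_sa_sqr// gtr0_norm ?invr_gt0 ?ltr_wpDl//.
rewrite mulrC ltr_pdivrMr ?ltr_wpDl// mul1r (le_lt_trans uz)//.
by rewrite gtr0_norm// ltrDr.
Qed.

(* If both were invertible, [c = h^2] normalized to norm [1] would satisfy
   [c + w^2 = kappa / (1 + kappa)] with [kappa = |k^2|], [k = h (1 - c)^(-1/2)],
   and [w = ((kappa - k^2) (1 - c) / (1 + kappa))^(1/2)], so [|c| < 1]. *)
Lemma uinv_norm_sa h : star h = h -> uinv (rs (un h) - h) ->
  uinv (rs (un h) + h) -> False.
Proof.
move=> sh0; set r := un h => iB iD.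
have [r0|r0] := eqVneq r 0.
  have h0 : h = 0 by apply: un_eq0.
  by case: iB => y [+ _]; rewrite r0 h0 rs0 subrr mul0r => /eqP; rewrite eq_sym oner_eq0.
have rp : 0 < r by rewrite lt_def r0 un_ge0.
pose g := rs r^-1 * h.
have sg : star g = g by rewrite /g ustarM rs_star sh0 rsC.
have ug : un g = 1.
  by rewrite /g un_rsM ger0_norm ?invr_ge0 ?(ltW rp)// -/r mulVf.
pose c := g * g.
have sc : star c = c by rewrite /c ustarM sg.
have uc : un c = 1 by rewrite un_sa_sqr// ug expr1n.
have ic : uinv (1 - c).
  have -> : 1 - c = (1 - g) * (1 + g).
    by rewrite mulrBl mul1r mulrDr mulr1 opprD addrA addrK.
  apply: uinvM.
    have -> : 1 - g = rs r^-1 * (rs r - h) by rewrite mulrBr -rsM mulVf// rs1.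
    by apply: uinv_scale => //; rewrite invr_eq0.
  have -> : 1 + g = rs r^-1 * (rs r + h) by rewrite mulrDr -rsM mulVf// rs1.
  by apply: uinv_scale => //; rewrite invr_eq0.
have [s [ss s2 sC]] : exists s : U, [/\ star s = s, s * s = 1 - c
    & forall z, GRing.comm z c -> GRing.comm z s].
  by apply: sqrt_sub => //; rewrite uc.
have [s' [ss' s's]] : uinv s by apply: (@uinv_commM _ _ s s) => //; rewrite s2.
have ss's : star s' = s'.
  rewrite -[LHS]mulr1 -ss' mulrA; have -> : star s' * s = 1.
    by rewrite -{1}ss -ustarM ss' ustar1.
  by rewrite mul1r.
have gs : GRing.comm g s by apply: sC; apply: commrM.
have gs' : GRing.comm g s' by apply: uinv_comm_inv gs.
have ssc : GRing.comm s s' by rewrite /GRing.comm ss' s's.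
pose k := g * s'.
have sk : star k = k by rewrite /k ustarM ss's sg gs'.
have sk_comm : GRing.comm s k.
  by apply: commrM => //; exact: commr_sym.
have gk : GRing.comm g k by apply: commrM.
have kk : k * k * (1 - c) = c.
  have ks : k * s = g by rewrite /k -mulrA s's mulr1.
  by rewrite -s2 mulrA -(mulrA k k s) ks -gk -mulrA ks.
pose ka := Num.max (un k ^+ 2) 1.
have ka0 : 0 < ka by rewrite (lt_le_trans ltr01)// le_max lexx orbT.
pose d := rs ka^-1 * (k * k).
have sd : star d = d by rewrite /d ustarM rs_star ustarM sk rsC.
have d1 : un d <= 1.
  rewrite /d un_rsM ger0_norm ?invr_ge0 ?(ltW ka0)// un_sa_sqr// mulrC ler_pdivrMr//.
  by rewrite mul1r le_max lexx.
have [t [st t2 tC]] := sqrt_sub sd d1.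
have kdC z : GRing.comm z k -> GRing.comm z d.
  by move=> zk; apply: commrM; [exact: rs_comm|exact: commrM].
have gt : GRing.comm g t by apply/tC/kdC.
have sT : GRing.comm s t by apply/tC/kdC.
have ka1 : 0 < 1 + ka by rewrite ltr_wpDl.
pose th := ka / (1 + ka).
have th0 : 0 <= th by rewrite divr_ge0 ?ltW.
pose w := rs (Num.sqrt th) * (t * s).
have sw : star w = w by rewrite /w ustarM rs_star ustarM ss st rsC sT.
have gw : GRing.comm g w.
  by apply: commrM; [exact: rs_comm|exact: commrM].
have ww : w * w = rs th * ((1 - d) * (1 - c)).
  rewrite -t2 -s2 /w rsMM -expr2 sqr_sqrtr//; congr (_ * _).
  by rewrite !mulrA; congr (_ * _); rewrite -!mulrA sT.
have thE : th = 1 - (1 + ka)^-1 by rewrite /th; field; rewrite gt_eqF.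
have tkE : th * ka^-1 = (1 + ka)^-1 by rewrite /th; field; rewrite !gt_eqF.
have key : g * g + w * w = rs th.
  have -> : w * w = rs th * ((1 - c) - rs ka^-1 * c).
    by rewrite ww; congr (_ * _); rewrite mulrBl mul1r; congr (_ - _); rewrite /d -mulrA kk.
  rewrite mulrBr rsA tkE thE mulrBr mulr1 rsB rs1 mulrBl mul1r -/c.
  move: (rs _ * c) (1 - rs _) => Y X.
  by rewrite opprB -[X + _ - Y]addrA [Y - c - Y]addrAC subrr sub0r addrCA subrr addr0.
have q0 : 0 < (1 + ka)^-1 by rewrite invr_gt0.
have := un_pythagoras sg sw gw key.
by rewrite ug expr1n ger0_norm// thE; lra.
Qed.

End SpectralRadius.

(** * Real spectrum and spectral mapping for polynomials *)

Section Spectrum.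
Context (R : realType) (A : cstarAlgType R).
Local Notation U := (unz A).
Implicit Types (x y z h c : U) (r t : R) (P Q : {poly R}).

Definition Sp x t := ~ uinv (rs t - x).

Lemma uinv_1 : uinv (1 : U).
Proof. by exists 1; rewrite mulr1. Qed.

Lemma Sp_le x t : Sp x t -> `|t| <= un x.
Proof.
move=> xt; rewrite leNgt; apply/negP => h; apply: xt.
have t0 : t != 0 by apply: contraTneq h => ->; rewrite normr0 -leNgt un_ge0.
have -> : rs t - x = rs t * (1 - rs t^-1 * x).
  by rewrite mulrBr mulr1 rsA mulfV// rs1 mul1r.
apply: uinv_scale => //; apply: uinv_neumann.
by rewrite un_rsM normfV mulrC ltr_pdivrMr ?normr_gt0// mul1r.
Qed.

Lemma Sp_norm x : star x = x -> Sp x (un x) \/ Sp x (- un x).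
Proof.
move=> sx; have [h|h] := pselect (uinv (rs (un x) - x)); last by left.
right=> h2; apply: (uinv_norm_sa sx h).
by move/uinvN : h2; rewrite rsN opprD !opprK.
Qed.

Lemma Sp_nonempty x : star x = x -> exists t, Sp x t.
Proof. by move=> /Sp_norm[]; eexists; eassumption. Qed.

(** For [l = a + i b] the product of [l - x] with its conjugate is [b^2 (1 + h^2)], where
    [h = (a - x) / b] is self-adjoint. *)
Lemma uinv_nonreal x (l : R[i]) : star x = x -> complex.Im l != 0 ->
  uinv (l%:A - x).
Proof.
case: l => a b /= sx b0.
pose h := rs b^-1 * (rs a - x).
have sh : star h = h by rewrite /h ustarM starB !rs_star sx rsC.
have i0 : uinv (rs (b * b) * (1 + h * h)).
  by apply: uinv_scale (uinv_1Dsqr sh); rewrite mulf_neq0.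
pose i : R[i] := 0 +i* 1.
have ii : i * i = -1.
  by apply/eqP; rewrite eq_complex /= !mul0r mulr0 mulr1 oppr0 add0r addr0 !eqxx.
have lE : (a +i* b) = a%:C + i * b%:C.
  by apply/eqP; rewrite eq_complex /= !mul0r !mulr0 mul1r ?oppr0 ?subrr ?addr0 ?add0r !eqxx.
pose v : U := i *: rs b.
have lA : (a +i* b)%:A - x = (rs a - x) + v :> U.
  by rewrite lE scalerDl -scalerA addrAC.
rewrite lA; apply: (@uinv_commM _ _ _ ((rs a - x) - v)).
  apply: commrB; last first.
    by rewrite /v /GRing.comm -scalerAl -scalerAr rsC.
  by apply: commr_sym; apply: commrD => //; rewrite /v /GRing.comm -scalerAl -scalerAr rsC.
suff -> : (rs a - x + v) * (rs a - x - v) = rs (b * b) * (1 + h * h) by [].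
rewrite [rs (b * b) * (1 + _)]mulrDr mulr1 /h rsMM rsA.
have -> : b * b * (b^-1 * b^-1) = 1 by field.
have vv : v * v = - rs (b * b).
  by rewrite /v -scalerAl -scalerAr scalerA ii scaleN1r rsM.
rewrite rs1 mul1r; move: (rs a - x) => w.
have wv : w * v = v * w by rewrite /v -scalerAl -scalerAr rsC.
by rewrite mulrBr !mulrDl vv wv opprD opprK addrA addrK addrC.
Qed.

(** Factor [P - l] over the complex numbers: at a nonreal root the linear factor is invertible by
    [uinv_nonreal], and a real root lies off the spectrum by hypothesis. *)
Lemma Sp_pe x P l : star x = x -> (forall t, Sp x t -> P.[t] != l) ->
  uinv (pe P x - rs l).
Proof.
move=> sx h; pose Q := map_poly (real_complex R) (P - l%:P).
have QE : horner_alg x Q = pe P x - rs l by rewrite -[LHS]/(pe _ x) peB peC.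
have PQ t : Q.[t%:C] = (P.[t] - l)%:C by rewrite horner_map hornerD hornerN hornerC.
(* The spectrum is nonempty, which excludes that [P] is constantly [l]. *)
have Q0 : Q != 0.
  have [t /h Pt] := Sp_nonempty sx; apply: contra_neq Pt => Q0.
  by move: (PQ t); rewrite Q0 horner0 => /esym/complexI/eqP; rewrite subr_eq0 => /eqP.
have [s sE] := closed_field_poly_normal Q.
have lc : lead_coef Q != 0 by rewrite lead_coef_eq0.
rewrite -QE sE linearZ/= rmorph_prod/= mulr_algl.
have : uinv (\prod_(w <- s) horner_alg x ('X - w%:P)).
  have : {in s, forall w, root Q w}.
    move=> w ws; rewrite sE rootZ//.
    by rewrite root_prod_XsubC.
  elim: (s) => [|w s' IH] hs; first by rewrite big_nil; exact: uinv_1.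
  rewrite big_cons; apply: uinvM; last first.
    by apply: IH => v vs; apply: hs; rewrite inE vs orbT.
  have /hs : w \in w :: s' by rewrite inE eqxx.
  rewrite rmorphB/= horner_algX horner_algC => rz.
  rewrite -opprB; apply: uinvN.
  have [w0|w0] := eqVneq (complex.Im w) 0; last exact: uinv_nonreal.
  have wE : w = (complex.Re w)%:C by case: (w) w0 => a b /= ->.
  have [//|nw] := pselect (uinv (w%:A - x)).
  rewrite wE in nw; have /eqP := h _ nw.
  by move: rz; rewrite wE /root PQ => /eqP/complexI/eqP; rewrite subr_eq0 => /eqP.
move=> [y [y1 y2]]; exists ((lead_coef Q)^-1 *: y); split.
  by rewrite -scalerAl -scalerAr scalerA mulfV// scale1r.
by rewrite -scalerAl -scalerAr scalerA mulVf// scale1r.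
Qed.

(** Up to sign, the norm of [pe P x] belongs to its spectrum ([Sp_norm]), hence is a value of [P] on
    the spectrum of [x]. No spectral radius formula is involved. *)
Lemma un_pe_le x P (M : R) : star x = x -> (forall t, Sp x t -> `|P.[t]| <= M) ->
  un (pe P x) <= M.
Proof.
move=> sx h; have [t xt] := Sp_nonempty sx.
have M0 : 0 <= M := le_trans (normr_ge0 _) (h t xt).
rewrite leNgt; apply/negP => hM.
have key (l : R) : `|l| = un (pe P x) -> uinv (pe P x - rs l).
  move=> lE; apply: Sp_pe => // u /h; apply: contraTneq => ->.
  by rewrite lE -ltNge.
have [k|k] := Sp_norm (pe_sa P sx); apply: k.
  by rewrite -opprB; apply/uinvN/key; rewrite ger0_norm ?un_ge0.
by rewrite -opprB; apply/uinvN/key; rewrite normrN ger0_norm ?un_ge0.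
Qed.

End Spectrum.

(** * Functions approximable by polynomials on bounded intervals *)

Section PolynomiallyApproximable.
Context (R : realType).
Implicit Types (f g : R -> R) (P Q : {poly R}) (r e t : R).

(* The class of functions to which the functional calculus is applied: it contains
   every continuous function, and membership is proved without Weierstrass' theorem. *)
Definition pap f := forall r e, 0 < e ->
  exists P, forall t, `|t| <= r -> `|P.[t] - f t| <= e.

Lemma pap_ext f g : (forall t, f t = g t) -> pap f -> pap g.
Proof. by move=> fg hf r e /(hf r)[P hP]; exists P => t /hP; rewrite fg. Qed.

Lemma pap_poly P : pap (fun t => P.[t]).
Proof. by move=> r e e0; exists P => t _; rewrite subrr normr0 ltW. Qed.

Lemma pap_cst c : pap (fun=> c).
Proof. by apply: pap_ext (pap_poly c%:P) => t; rewrite hornerC. Qed.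

Lemma pap_id : pap (fun t => t).
Proof. by apply: pap_ext (pap_poly 'X) => t; rewrite hornerX. Qed.

Lemma pap_lim f : (forall r e, 0 < e -> exists g, pap g /\
  forall t, `|t| <= r -> `|g t - f t| <= e) -> pap f.
Proof.
move=> h r e e0; have e2 : 0 < e / 2 by rewrite divr_gt0.
have [g [hg gf]] := h r _ e2; have [P hP] := hg r _ e2.
exists P => t tr; rewrite (le_trans (ler_distD (g t) _ _))// (splitr e).
by rewrite lerD ?gf ?hP.
Qed.

Lemma poly_bound P r : exists2 K, 0 <= K & forall t, `|t| <= r -> `|P.[t]| <= K.
Proof.
elim/poly_ind: P => [|P c [K K0 hK]].
  by exists 0 => // t _; rewrite horner0 normr0.
exists (K * `|r| + `|c|) => [|t tr]; first by rewrite addr_ge0 ?mulr_ge0.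
rewrite !hornerE (le_trans (ler_normD _ _))// lerD// normrM ler_pM ?hK//.
by rewrite (le_trans tr)// ler_norm.
Qed.

Lemma pap_bound f r : pap f -> exists2 K, 0 <= K & forall t, `|t| <= r -> `|f t| <= K.
Proof.
move=> /(_ r _ ltr01)[P hP]; have [K K0 hK] := poly_bound P r.
exists (K + 1) => [|t tr]; first by rewrite addr_ge0.
rewrite -(subrK P.[t] (f t)) (le_trans (ler_normD _ _))// [K + 1]addrC lerD ?hK//.
by rewrite distrC hP.
Qed.

Lemma poly_lipschitz P r : exists2 K, 0 <= K & forall s t, `|s| <= r -> `|t| <= r ->
  `|P.[s] - P.[t]| <= K * `|s - t|.
Proof.
elim/poly_ind: P => [|P c [K K0 hK]].
  by exists 0 => // s t _ _; rewrite !horner0 subrr normr0 mul0r.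
have [M M0 hM] := poly_bound P r.
exists (K * `|r| + M) => [|s t sr tr]; first by rewrite addr_ge0 ?mulr_ge0.
rewrite !hornerE opprD addrACA subrr addr0.
have -> : P.[s] * s - P.[t] * t = (P.[s] - P.[t]) * s + P.[t] * (s - t) by ring.
rewrite (le_trans (ler_normD _ _))// [leRHS]mulrDl !normrM lerD//; last first.
  by rewrite ler_wpM2r// hM.
rewrite mulrAC ler_pM ?hK//.
by rewrite (le_trans sr)// ler_norm.
Qed.

Lemma pap_comp f g : pap f -> pap g -> pap (fun t => g (f t)).
Proof.
move=> hf hg r e e0; have e2 : 0 < e / 2 by rewrite divr_gt0.
have [M M0 fM] := pap_bound r hf.
have [Q hQ] := hg (M + 1) _ e2; have [K K0 hK] := poly_lipschitz Q (M + 1).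
have d0 : 0 < Num.min 1 (e / 2 / (K + 1)).
  by rewrite lt_min ltr01 divr_gt0// ltr_wpDl.
have [P hP] := hf r _ d0; exists (Q \Po P) => t tr; rewrite horner_comp.
have /hP := tr; rewrite le_min => /andP[P1 P2].
have fM1 : `|f t| <= M + 1 by rewrite (le_trans (fM _ tr))// lerDl.
rewrite (le_trans (ler_distD Q.[f t] _ _))// (splitr e) lerD ?hQ//.
have PM1 : `|P.[t]| <= M + 1.
  by rewrite -(subrK (f t) P.[t]) (le_trans (ler_normD _ _))// [M + 1]addrC lerD ?fM.
rewrite (le_trans (hK _ _ _ _))//.
have := P2; rewrite ler_pdivlMr ?ltr_wpDl// => /(le_trans _) -> //.
by rewrite mulrC ler_wpM2l// lerDl.
Qed.

Lemma papD f g : pap f -> pap g -> pap (fun t => f t + g t).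
Proof.
move=> hf hg r e e0; have e2 : 0 < e / 2 by rewrite divr_gt0.
have [P hP] := hf r _ e2; have [Q hQ] := hg r _ e2.
exists (P + Q) => t tr; rewrite hornerD opprD addrACA (splitr e).
by rewrite (le_trans (ler_normD _ _))// lerD ?hP ?hQ.
Qed.

Lemma papZ c f : pap f -> pap (fun t => c * f t).
Proof.
move=> hf; apply: pap_ext (pap_comp hf (pap_poly (c *: 'X))) => t.
by rewrite !hornerE.
Qed.

Lemma papN f : pap f -> pap (fun t => - f t).
Proof. by move=> /(papZ (-1)); apply: pap_ext => t; rewrite mulN1r. Qed.

Lemma papB f g : pap f -> pap g -> pap (fun t => f t - g t).
Proof. by move=> hf hg; apply: papD => //; exact: papN. Qed.

Lemma pap_sqr f : pap f -> pap (fun t => f t * f t).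
Proof.
move=> hf; apply: pap_ext (pap_comp hf (pap_poly ('X * 'X))) => t.
by rewrite !hornerE.
Qed.

Lemma papM f g : pap f -> pap g -> pap (fun t => f t * g t).
Proof.
move=> hf hg.
have := papZ 4^-1 (papB (pap_sqr (papD hf hg)) (pap_sqr (papB hf hg))).
by apply: pap_ext => t; field.
Qed.

(** At [s = 1] the increment of the recursion is half the square of the error, so a small increment
    forces a small error. For other [s], [y = 1 - sqrt (1 - s)] is a fixed point, and induction
    keeps the error at [s] below the error at [1]. *)
Lemma sqrtp_approx e : 0 < e -> exists n, forall s, 0 <= s <= 1 ->
  `|1 - (sqrtp R n).[s] - Num.sqrt (1 - s)| <= e.
Proof.
move=> e0; have e2 : 0 < e ^+ 2 / 2 by rewrite divr_gt0 ?exprn_gt0.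
have [n hn] := sqrtp1_cauchy e2; exists n.
have nn m : 0 <= (sqrtp R m).[1] <= 1 by rewrite sqrtp1_le nnpoly1_ge0//; exact: sqrtp_nn.
have d1 : 1 - (sqrtp R n).[1] <= e.
  have := hn n.+1 (leqnSn n); rewrite /= !hornerE.
  move: (nn n); set q := (sqrtp R n).[1] => /andP[q0 q1] h.
  rewrite -[leLHS]ger0_norm ?subr_ge0// -[e]ger0_norm ?(ltW e0)//.
  by rewrite -ler_sqr ?nnegrE// !real_normK ?num_real//; nra.
move=> s s01; have /andP[s0 s1] := s01; rewrite (le_trans _ d1)//.
pose y := 1 - Num.sqrt (1 - s).
have sq0 := sqrtr_ge0 (1 - s).
have sq1 : Num.sqrt (1 - s) <= 1.
  by rewrite -[leRHS]sqrtr1 ler_wsqrtr// lerBlDr lerDl.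
have sq2 : Num.sqrt (1 - s) ^+ 2 = 1 - s by rewrite sqr_sqrtr// subr_ge0.
have yE : y = 2^-1 * (s + y * y) by rewrite /y; nra.
have y01 : 0 <= y <= 1 by rewrite /y; apply/andP; split; lra.
suff h : 0 <= y - (sqrtp R n).[s] <= 1 - (sqrtp R n).[1] /\ 0 <= (sqrtp R n).[s].
  have -> : 1 - (sqrtp R n).[s] - Num.sqrt (1 - s) = y - (sqrtp R n).[s].
    by rewrite /y; ring.
  by case: h => /andP[h1 h2] _; rewrite ger0_norm.
elim: (n) => [|m [IH IH0]]; first by rewrite /= !horner0 !subr0.
have := nn m; have nm1 := nnpoly_real (sqrtp_nn R m).
have /nm1 : `|s| <= 1 by rewrite ger0_norm.
rewrite /= !hornerE ger0_norm//.
move: IH IH0; set a := (sqrtp R m).[s]; set b := (sqrtp R m).[1].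
move=> /andP[i1 i2] i3 ab /andP[b0 b1]; have /andP[y0 y1] := y01.
split; last nra.
have -> : y - 2^-1 * (s + a * a) = 2^-1 * ((y - a) * (y + a)) by rewrite {1}yE; ring.
have -> : 1 - 2^-1 * (1 + b * b) = 2^-1 * ((1 - b) * (1 + b)) by field.
apply/andP; split; first by rewrite mulr_ge0 ?invr_ge0// mulr_ge0// addr_ge0.
rewrite ler_wpM2l ?invr_ge0//; apply: ler_pM => //; first exact: addr_ge0.
exact: lerD.
Qed.

(** Rests on [|t| = k * sqrt (1 - (1 - (t / k)^2))], valid for [k > 0]; taking [k] at least [|t|]
    keeps the inner argument in the unit interval. *)
Lemma pap_abs f : pap f -> pap (fun t => `|f t|).
Proof.
move=> hf; apply: (@pap_comp f (fun t => `|t|)) => //.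
apply: pap_lim => r e e0; pose k := `|r| + 1.
have k0 : 0 < k by rewrite ltr_wpDl.
have [n hn] := sqrtp_approx (divr_gt0 e0 k0).
exists (fun t => k * (1 - (sqrtp R n).[1 - (t / k) * (t / k)])); split.
  apply: papZ; apply: papB; first exact: pap_cst.
  apply: (@pap_comp (fun t => 1 - (t / k) * (t / k)) (fun t => (sqrtp R n).[t])); last exact: pap_poly.
  apply: papB; first exact: pap_cst.
  by apply: pap_sqr; apply: papM; [exact: pap_id|exact: pap_cst].
move=> t tr; have tk : `|t / k| <= 1.
  rewrite normrM normfV (gtr0_norm k0) ler_pdivrMr// mul1r (le_trans tr)//.
  by rewrite (le_trans (ler_norm r))// lerDl.
have t2 : 0 <= t / k * (t / k) <= 1.
  by rewrite -expr2 sqr_ge0/= -real_normK ?num_real// expr_le1.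
have /hn : 0 <= 1 - t / k * (t / k) <= 1 by case/andP: t2 => *; apply/andP; split; lra.
rewrite subKr -expr2 sqrtr_sqr ler_pdivlMr// => h; apply: le_trans h.
move: (1 - _) => a.
have -> : k * a - `|t| = (a - `|t / k|) * k.
  by rewrite normrM normfV (gtr0_norm k0); field; rewrite gt_eqF.
by rewrite normrM (gtr0_norm k0).
Qed.

Lemma pap_max f g : pap f -> pap g -> pap (fun t => Num.max (f t) (g t)).
Proof.
move=> hf hg; have := papZ 2^-1 (papD (papD hf hg) (pap_abs (papB hf hg))).
by apply: pap_ext => t; rewrite [RHS]maxr_absE mulrC.
Qed.

Lemma pap_min f g : pap f -> pap g -> pap (fun t => Num.min (f t) (g t)).
Proof.
move=> hf hg; have := papN (pap_max (papN hf) (papN hg)).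
by apply: pap_ext => t; rewrite -oppr_min opprK.
Qed.

Lemma pap_sqrt f : pap f -> pap (fun t => Num.sqrt (f t)).
Proof.
move=> hf; apply: (@pap_comp f Num.sqrt) => //.
apply: pap_lim => r e e0; pose k := `|r| + 1.
have k0 : 0 < k by rewrite ltr_wpDl.
have sk0 : 0 < Num.sqrt k by rewrite sqrtr_gt0.
have [n hn] := sqrtp_approx (divr_gt0 e0 sk0).
exists (fun t => Num.sqrt k * (1 - (sqrtp R n).[1 - Num.max t 0 / k])); split.
  apply: papZ; apply: papB; first exact: pap_cst.
  apply: (@pap_comp (fun t => 1 - Num.max t 0 / k) (fun t => (sqrtp R n).[t])); last exact: pap_poly.
  apply: papB; first exact: pap_cst.
  apply: papM; last exact: pap_cst.
  by apply: pap_max; [exact: pap_id|exact: pap_cst].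
move=> t tr; set m := Num.max t 0.
have m0 : 0 <= m by rewrite le_max lexx orbT.
have mk : 0 <= m / k <= 1.
  rewrite divr_ge0 ?(ltW k0)//= ler_pdivrMr// mul1r ge_max (ltW k0) andbT.
  by rewrite (le_trans (ler_norm _))// (le_trans tr)// (le_trans (ler_norm r))// lerDl.
have /hn : 0 <= 1 - m / k <= 1 by case/andP: mk => *; apply/andP; split; lra.
rewrite subKr ler_pdivlMr// => h; apply: le_trans h.
move: (1 - _) => a; have sm : Num.sqrt m = Num.sqrt t.
  by rewrite /m; have [t0|t0] := leP t 0; rewrite // sqrtr0 ler0_sqrtr.
have -> : Num.sqrt k * a - Num.sqrt t = (a - Num.sqrt (m / k)) * Num.sqrt k.
  rewrite mulrBl -sqrtrM ?divr_ge0 ?(ltW k0)// divfK ?gt_eqF// sm.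
  by rewrite mulrC.
by rewrite normrM (gtr0_norm sk0).
Qed.

(** The geometric series of [1 / m] in powers of [1 - m / k], whose ratio is at most [1 - eta / k]
    for [m] between [eta] and [k]. *)
Lemma pap_inv f (eta : R) : 0 < eta -> pap f -> pap (fun t => (Num.max (f t) eta)^-1).
Proof.
move=> eta0 hf; apply: (@pap_comp f (fun t => (Num.max t eta)^-1)) => //.
apply: pap_lim => r e e0; pose k := `|r| + eta.
have k0 : 0 < k by rewrite ltr_wpDl.
pose q := 1 - eta / k.
have q0 : 0 <= q by rewrite subr_ge0 ler_pdivrMr// mul1r lerDr.
have q1 : q < 1 by rewrite ltrBlDr ltrDl divr_gt0.
have /cvgrPdist_lt /(_ _ (mulr_gt0 e0 eta0))[n _ /(_ n (leqnn n))] :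
    (fun n => q ^+ n) @ \oo --> (0 : R) by apply: cvg_expr; rewrite ger0_norm.
rewrite /= sub0r normrN ger0_norm ?exprn_ge0// => hq.
pose P : {poly R} := k^-1 *: \sum_(i < n) (1 - k^-1 *: 'X) ^+ i.
exists (fun t => P.[Num.max t eta]); split.
  apply: (@pap_comp (fun t => Num.max t eta) (fun t => P.[t])); last exact: pap_poly.
  by apply: pap_max; [exact: pap_id|exact: pap_cst].
move=> t tr; set m := Num.max t eta.
have m0 : eta <= m by rewrite le_max lexx orbT.
have m1 : m <= k.
  rewrite ge_max lerDr normr_ge0 andbT.
  by rewrite (le_trans (ler_norm _))// (le_trans tr)// (le_trans (ler_norm r))// lerDl ltW.
have mp : 0 < m := lt_le_trans eta0 m0.
have PE : P.[m] - m^-1 = - (m^-1 * (1 - m / k) ^+ n).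
  rewrite /P hornerZ horner_sum.
  under eq_bigr do rewrite horner_exp !hornerE.
  have := subrX1 (1 - m / k) n; rewrite -/(m / k).
  rewrite [k^-1 * m]mulrC => h.
  have -> : \sum_(i < n) (1 - m / k) ^+ i = (1 - (1 - m / k) ^+ n) * (k / m).
    have -> : 1 - (1 - m / k) ^+ n = - ((1 - m / k - 1) * (\sum_(i < n) (1 - m / k) ^+ i)).
      by rewrite -h opprB.
    by field; rewrite !gt_eqF.
  by field; rewrite !gt_eqF.
have u0 : 0 <= 1 - m / k by rewrite subr_ge0 ler_pdivrMr// mul1r.
have uq : 1 - m / k <= q by rewrite lerD2l lerN2 ler_wpM2r// invr_ge0 ltW.
rewrite PE normrN normrM ger0_norm ?invr_ge0 ?(ltW mp)// ger0_norm ?exprn_ge0//.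
rewrite mulrC ler_pdivrMr// (le_trans (lerXn2r n u0 q0 uq))//.
by rewrite (le_trans (ltW hq))// ler_wpM2l// ltW.
Qed.

End PolynomiallyApproximable.

(** * Functional calculus in the unitization *)

Section FunctionalCalculusUnital.
Context (R : realType) (A : cstarAlgType R).
Local Notation U := (unz A).
Implicit Types (x y z h c : U) (r t : R) (P Q : {poly R}) (f g : R -> R).

(** The approximation is demanded on the spectrum only, so the result depends only on the values of
    [f] there; [un_pe_le] then gives uniqueness. *)
Definition isfc f x y := forall e, 0 < e -> exists P,
  (forall t, Sp x t -> `|P.[t] - f t| <= e) /\ un (pe P x - y) <= e.

Definition fc f x : U := xget 0 (isfc f x).

Lemma isfc_uniq f x y y' : star x = x -> isfc f x y -> isfc f x y' -> y = y'.
Proof.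
move=> sx hy hy'; apply: un_eq => e e0; have e4 : 0 < e / 4 by rewrite divr_gt0.
have [P [P1 P2]] := hy _ e4; have [Q [Q1 Q2]] := hy' _ e4.
have PQ : un (pe P x - pe Q x) <= e / 4 + e / 4.
  rewrite -peB; apply: un_pe_le => // t xt; rewrite hornerD hornerN.
  by rewrite (le_trans (ler_distD (f t) _ _))// lerD ?P1// distrC Q1.
rewrite (le_trans (un_dist (pe P x) _ _))//.
have -> : e = e / 4 + (e / 4 + e / 4 + e / 4) by field.
rewrite lerD//; first by rewrite unBC.
by rewrite (le_trans (un_dist (pe Q x) _ _))// lerD.
Qed.

Lemma isfc_ex f x : star x = x -> pap f -> exists y, isfc f x y.
Proof.
move=> sx hf.
have /choice[P hP] n : exists P, forall t, `|t| <= un x -> `|P.[t] - f t| <= n.+1%:R^-1.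
  by apply: hf; rewrite invr_gt0.
have inv_le e (N n : nat) : N.+1%:R^-1 < e -> (N <= n)%N -> n.+1%:R^-1 < e :> R.
  move=> Ne Nn; rewrite (le_lt_trans _ Ne)//.
  by rewrite lef_pV2 ?posrE ?ltr0n// ler_nat ltnS.
have [y hy] : exists y, ucvg (fun n => pe (P n) x) y.
  apply: un_complete => e e0; have [N hN] := natSinv_lt (divr_gt0 e0 (ltr0Sn R 1)).
  exists N => m n /(inv_le _ _ _ hN) hm /(inv_le _ _ _ hN) hn.
  rewrite -peB; apply: le_lt_trans (_ : m.+1%:R^-1 + n.+1%:R^-1 < _); last first.
    by rewrite (splitr e) ltrD.
  apply: un_pe_le => // t /Sp_le xt; rewrite hornerD hornerN.
  by rewrite (le_trans (ler_distD (f t) _ _))// lerD ?hP// distrC hP.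
exists y => e e0; have [N hN] := hy _ e0; have [M hM] := natSinv_lt e0.
exists (P (maxn N M)); split; last by rewrite ltW// hN// leq_maxl.
move=> t /Sp_le /hP h; rewrite (le_trans (h _))// ltW//.
by rewrite (inv_le _ M)// leq_maxr.
Qed.

Lemma fcP f x : star x = x -> pap f -> isfc f x (fc f x).
Proof. by move=> sx /(isfc_ex sx)[y hy]; apply: xgetPex; exists y. Qed.

Lemma fc_uniq f x y : star x = x -> pap f -> isfc f x y -> fc f x = y.
Proof. by move=> sx hf; apply: isfc_uniq => //; exact: fcP. Qed.

Lemma fc_poly P x : star x = x -> fc (fun t => P.[t]) x = pe P x.
Proof.
move=> sx; apply: fc_uniq => // [|e e0]; first exact: pap_poly.
exists P; split=> [t _|]; first by rewrite subrr normr0 ltW.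
by rewrite subrr un0 ltW.
Qed.

Lemma fc_ext f g x : star x = x -> pap f -> pap g ->
  (forall t, Sp x t -> f t = g t) -> fc f x = fc g x.
Proof.
move=> sx hf hg fg; apply: fc_uniq => // e e0.
have [P [P1 P2]] := fcP sx hg e0; exists P; split=> // t xt.
by rewrite fg// P1.
Qed.

Lemma fc_cst k x : star x = x -> fc (fun=> k) x = rs k.
Proof.
move=> sx; rewrite -(peC k x) -fc_poly//; congr fc.
by apply/funext => t; rewrite hornerC.
Qed.

Lemma fc_id x : star x = x -> fc (fun t => t) x = x.
Proof.
move=> sx; rewrite -{2}(peX x) -fc_poly//; congr fc.
by apply/funext => t; rewrite hornerX.
Qed.

Lemma fc_le f x (M : R) : star x = x -> pap f ->
  (forall t, Sp x t -> `|f t| <= M) -> un (fc f x) <= M.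
Proof.
move=> sx hf h; apply/ler_addgt0Pr => e e0.
have e2 : 0 < e / 2 by rewrite divr_gt0.
have [P [P1 P2]] := fcP sx hf e2.
rewrite -(subrK (pe P x) (fc f x)) (le_trans (unD _ _))// unBC (splitr e).
rewrite addrA addrC lerD//; apply: un_pe_le => // t xt.
rewrite -(subrK (f t) P.[t]) (le_trans (ler_normD _ _))// addrC lerD ?h//.
exact: P1.
Qed.

Lemma fcD f g x : star x = x -> pap f -> pap g ->
  fc (fun t => f t + g t) x = fc f x + fc g x.
Proof.
move=> sx hf hg; apply: fc_uniq => // [|e e0]; first exact: papD.
have e2 : 0 < e / 2 by rewrite divr_gt0.
have [P [P1 P2]] := fcP sx hf e2; have [Q [Q1 Q2]] := fcP sx hg e2.
exists (P + Q); split=> [t xt|].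
  by rewrite hornerD opprD addrACA (le_trans (ler_normD _ _))// (splitr e) lerD ?P1 ?Q1.
by rewrite peD opprD addrACA (le_trans (unD _ _))// (splitr e) lerD.
Qed.

Lemma fcM f g x : star x = x -> pap f -> pap g ->
  fc (fun t => f t * g t) x = fc f x * fc g x.
Proof.
move=> sx hf hg; apply: fc_uniq => // [|e e0]; first exact: papM.
have [K K0 fK] := pap_bound (un x) hf.
have [L L0 gL] := pap_bound (un x) hg.
have fK' t : Sp x t -> `|f t| <= K by move=> /Sp_le/fK.
have gL' t : Sp x t -> `|g t| <= L by move=> /Sp_le/gL.
have D0 : 0 < 1 + K + L by rewrite ltr_wpDr// ltr_wpDr.
pose d := Num.min 1 (e / (1 + K + L)).
have d0 : 0 < d by rewrite lt_min ltr01 divr_gt0.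
have d1 : d <= 1 by rewrite ge_min lexx.
have de : (1 + K + L) * d <= e.
  by rewrite mulrC -ler_pdivlMr// ge_min lexx orbT.
have [P [P1 P2]] := fcP sx hf d0; have [Q [Q1 Q2]] := fcP sx hg d0.
have bnd (a b a' b' : R) : 0 <= a -> 0 <= a' -> 0 <= b' -> 0 <= b ->
    a <= K + 1 -> b <= d -> a' <= d -> b' <= L -> a * b + a' * b' <= e.
  move=> a0 a0' b0' b0 aK bd ad bL; apply: le_trans de.
  have : a * b <= (K + 1) * d by rewrite ler_pM.
  have : a' * b' <= d * L by rewrite ler_pM.
  by nra.
exists (P * Q); split=> [t xt|].
  rewrite hornerM.
  have -> : P.[t] * Q.[t] - f t * g t = P.[t] * (Q.[t] - g t) + (P.[t] - f t) * g t by ring.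
  rewrite (le_trans (ler_normD _ _))// !normrM; apply: bnd; rewrite ?Q1 ?P1 ?gL'//.
  rewrite -(subrK (f t) P.[t]) (le_trans (ler_normD _ _))// addrC lerD ?fK'//.
  by rewrite (le_trans (P1 _ xt)).
rewrite peM -usmulE -[fc f x * _]usmulE smul_sub2 (le_trans (unD _ _))//.
have fcK : un (fc f x) <= K by exact: fc_le.
have fcL : un (fc g x) <= L by exact: fc_le.
apply: le_trans (lerD (unM _ _) (unM _ _)) _; apply: bnd; rewrite ?un_ge0//.
rewrite -(subrK (fc f x) (pe P x)) (le_trans (unD _ _))// addrC lerD//.
exact: le_trans P2 d1.
Qed.

Lemma fcZ k f x : star x = x -> pap f -> fc (fun t => k * f t) x = rs k * fc f x.
Proof. by move=> sx hf; rewrite fcM// ?fc_cst//; exact: pap_cst. Qed.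

Lemma fcN f x : star x = x -> pap f -> fc (fun t => - f t) x = - fc f x.
Proof.
move=> sx hf; rewrite -mulN1r -rs1 -rsN -fcZ//; congr fc.
by apply/funext => t; rewrite mulN1r.
Qed.

Lemma fcB f g x : star x = x -> pap f -> pap g ->
  fc (fun t => f t - g t) x = fc f x - fc g x.
Proof. by move=> sx hf hg; rewrite fcD ?fcN//; exact: papN. Qed.

Lemma fc_near f g x e : star x = x -> pap f -> pap g ->
  (forall t, Sp x t -> `|f t - g t| <= e) -> un (fc f x - fc g x) <= e.
Proof. by move=> sx hf hg h; rewrite -fcB//; apply: fc_le => //; exact: papB. Qed.

Lemma fc_approx f x e : star x = x -> pap f -> 0 < e ->
  exists P, un (fc f x - pe P x) <= e.
Proof. by move=> sx hf /(fcP sx hf)[P [_ h]]; exists P; rewrite unBC. Qed.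

Lemma fc_sa f x : star x = x -> pap f -> star (fc f x) = fc f x.
Proof.
move=> sx hf; apply: un_eq => e e0; have e2 : 0 < e / 2 by rewrite divr_gt0.
have [P hP] := fc_approx sx hf e2.
rewrite (le_trans (un_dist (pe P x) _ _))// (splitr e) lerD//; last by rewrite unBC.
by rewrite -(pe_sa P sx) -starB un_star.
Qed.

(** One polynomial serves on an interval containing both spectra. The case of interest takes a
    function of [star y * y] across [y] to the same function of [y * star y]. *)
Lemma fc_intertw f x y z : star x = x -> star y = y -> pap f ->
  z * x = y * z -> z * fc f x = fc f y * z.
Proof.
move=> sx sy hf zx; apply: un_eq => e e0.
pose d := e / 2 / (un z + 1).
have z0 : 0 < un z + 1 by rewrite ltr_wpDl ?un_ge0.
have d0 : 0 < d by rewrite !divr_gt0.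
have [P hP] := hf (Num.max (un x) (un y)) _ (divr_gt0 d0 (ltr0Sn R 1)).
have dz : un z * d <= e / 2.
  by rewrite /d mulrA ler_pdivrMr// mulrC ler_wpM2l ?lerDl// divr_ge0 ?(ltW e0).
have app w : star w = w -> un w <= Num.max (un x) (un y) -> un (fc f w - pe P w) <= d.
  move=> sw wm; rewrite -fc_poly// fc_near//; first exact: pap_poly.
  move=> t /Sp_le tw; rewrite distrC (le_trans (hP _ (le_trans tw wm)))//.
  by rewrite ler_pdivrMr// ler_peMr ?(ltW d0)// ler1n.
rewrite (le_trans (un_dist (z * pe P x) _ _))// (splitr e) lerD//.
  rewrite -mulrBr (le_trans (unM _ _))// (le_trans _ dz)// ler_wpM2l ?un_ge0//.
  by rewrite app// le_max lexx.
rewrite (pe_intertw P zx) -mulrBl (le_trans (unM _ _))// (le_trans _ dz)//.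
rewrite mulrC ler_wpM2l ?un_ge0// unBC app//.
by rewrite le_max lexx orbT.
Qed.

Lemma fc_comp f g x : star x = x -> pap f -> pap g ->
  fc g (fc f x) = fc (fun t => g (f t)) x.
Proof.
move=> sx hf hg; have sf := fc_sa sx hf.
have gf := pap_comp hf hg.
have [K K0 fK] := pap_bound (un x) hf.
apply: un_eq => e e0; have e2 : 0 < e / 2 by rewrite divr_gt0.
have [Q hQ] := hg (Num.max K (un (fc f x))) _ e2.
have QE : fc (fun t => Q.[f t]) x = pe Q (fc f x).
  elim/pe_ind: (Q) => [|P r IH].
    rewrite pe0 -rs0 -(fc_cst 0 sx); congr fc.
    by apply/funext => t; rewrite horner0.
  rewrite peD peM peC peX -IH -(fc_cst r sx) -fcM//; last first.
    exact: (pap_comp hf (pap_poly P)).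
  rewrite -fcD//; last 2 first.
  - by apply: papM => //; exact: (pap_comp hf (pap_poly P)).
  - exact: pap_cst.
  by congr fc; apply/funext => t; rewrite !hornerE.
rewrite (le_trans (un_dist (pe Q (fc f x)) _ _))// (splitr e) lerD//.
  rewrite -fc_poly// fc_near//; first exact: pap_poly.
  by move=> t /Sp_le tf; rewrite distrC hQ// le_max tf orbT.
rewrite -QE fc_near//; first exact: (pap_comp hf (pap_poly Q)).
by move=> t /Sp_le /fK tf; rewrite hQ// le_max tf.
Qed.

End FunctionalCalculusUnital.

(** * Positivity and Cuntz comparison *)

Section Positivity.
Context (R : realType) (A : cstarAlgType R).
Local Notation U := (unz A).
Implicit Types (x y z h c : U) (r t : R) (P Q : {poly R}) (f g : R -> R).

Definition psd x := star x = x /\ forall t, Sp x t -> 0 <= t.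

Definition ple x y := psd (y - x).

Lemma psd_sa x : psd x -> star x = x. Proof. by case. Qed.

(** For [t < 0], [t - y^2] is [t] times [1 + (y / k)^2] with [k^2 = - t], hence invertible. *)
Lemma psd_sqr y : star y = y -> psd (y * y).
Proof.
move=> sy; split=> [|t]; first by rewrite ustarM sy.
apply: contra_notT; rewrite -ltNge => t0.
pose k := Num.sqrt (- t); have k0 : 0 < k by rewrite sqrtr_gt0 oppr_gt0.
have kk : k * k = - t by rewrite -expr2 sqr_sqrtr// oppr_ge0 ltW.
have s1 : star (rs k^-1 * y) = rs k^-1 * y by rewrite ustarM rs_star sy rsC.
have -> : rs t - y * y = rs t * (1 + (rs k^-1 * y) * (rs k^-1 * y)).
  rewrite mulrDr mulr1 rsMM rsA -invfM kk invrN mulrN mulfV ?lt_eqF//.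
  by rewrite rsN rs1 mulN1r.
by apply: uinv_scale (uinv_1Dsqr s1); rewrite lt_eqF.
Qed.

Lemma psd_fc f x : star x = x -> pap f -> (forall t, Sp x t -> 0 <= f t) -> psd (fc f x).
Proof.
move=> sx hf f0; have hs := pap_sqrt hf.
have -> : fc f x = fc (fun t => Num.sqrt (f t)) x * fc (fun t => Num.sqrt (f t)) x.
  rewrite -fcM//; apply: fc_ext => //; first exact: papM.
  by move=> t /f0 ft; rewrite -expr2 sqr_sqrtr.
by apply: psd_sqr; exact: fc_sa.
Qed.

Definition usqrt x := fc Num.sqrt x.

Lemma pap_sqrt_id : pap (Num.sqrt : R -> R). Proof. exact: pap_sqrt (@pap_id R). Qed.

Lemma psd_usqrt x : psd x -> psd (usqrt x).
Proof. by case=> sx h; apply: psd_fc => // [|t _]; [exact: pap_sqrt_id|exact: sqrtr_ge0]. Qed.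

Lemma usqrtK x : psd x -> usqrt x * usqrt x = x.
Proof.
case=> sx h; rewrite -fcM; try exact: pap_sqrt_id; last exact: sx.
rewrite -[RHS](fc_id sx); apply: fc_ext => //; [|exact: pap_id|].
  by apply: papM; exact: pap_sqrt_id.
by move=> t /h t0; rewrite -expr2 sqr_sqrtr.
Qed.

Lemma usqrt_sa x : psd x -> star (usqrt x) = usqrt x.
Proof. by move=> /psd_usqrt[]. Qed.

Lemma psd_near x t : psd x -> un x <= t -> un (rs t - x) <= t.
Proof.
move=> [sx h] xt; have t0 := le_trans (un_ge0 x) xt.
have -> : rs t - x = fc (fun s => t - s) x.
  by rewrite fcB ?fc_cst ?fc_id//; [exact: pap_cst|exact: pap_id].
apply: fc_le => // [|s xs]; first by apply: papB; [exact: pap_cst|exact: pap_id].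
have := Sp_le xs; have := h _ xs => s0; rewrite ger0_norm// => sx'.
by rewrite ger0_norm ?lerBlDr ?lerDl// subr_ge0 (le_trans sx').
Qed.

Lemma Sp_subl x t s : Sp x s -> Sp (rs t - x) (t - s).
Proof.
apply: contra_not => h; rewrite -opprB; apply: uinvN.
by move: h; rewrite rsB opprB [_ + (x - _)]addrC addrA subrK.
Qed.

(** With [psd_near] this is a criterion for positivity in terms of norms. Unlike the spectrum it
    behaves well under addition, whence [psdD]. *)
Lemma near_psd x t : star x = x -> un (rs t - x) <= t -> psd x.
Proof.
move=> sx h; split=> // s xs.
have := le_trans (Sp_le (Sp_subl (t := t) xs)) h; rewrite ler_norml; lra.
Qed.

Lemma psdD x y : psd x -> psd y -> psd (x + y).
Proof.
move=> px py; apply: (@near_psd _ (un x + un y)).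
  by rewrite starD !psd_sa.
rewrite rsD opprD addrACA (le_trans (unD _ _))// lerD//; exact: psd_near.
Qed.

Lemma psdZ r x : 0 <= r -> psd x -> psd (rs r * x).
Proof.
move=> r0 [sx h]; have [->|rn] := eqVneq r 0.
  rewrite rs0 mul0r -(mul0r 0); apply: psd_sqr; exact: star0.
split=> [|t]; first by rewrite ustarM rs_star sx rsC.
apply: contra_notT; rewrite -ltNge => t0.
have -> : rs t - rs r * x = rs r * (rs (t / r) - x).
  by rewrite mulrBr -rsM mulrCA mulfV// mulr1.
apply: uinv_scale => //; apply: contrapT => /h.
by rewrite pmulr_lge0 ?invr_gt0 ?lt_def ?rn// leNgt t0.
Qed.

Lemma psd0 : psd 0.
Proof. by rewrite -(mul0r 0); apply: psd_sqr; exact: star0. Qed.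

Lemma psd_un_sub x r : star x = x -> un x <= r -> psd (rs r - x).
Proof.
move=> sx xr; apply: (@near_psd _ r); first by rewrite starB rs_star sx.
by rewrite subKr.
Qed.

Lemma psd_ubound a r : psd a -> psd (rs r - a) -> un a <= r.
Proof.
move=> pa h; have [k|k] := Sp_norm (psd_sa pa).
  by have := h.2 _ (Sp_subl (t := r) k); rewrite subr_ge0.
have := pa.2 _ k; rewrite oppr_ge0 => a0.
have [t at_] := Sp_nonempty (psd_sa pa).
have := h.2 _ (Sp_subl (t := r) at_); have := pa.2 _ at_.
by move=> t0; rewrite subr_ge0 => tr; rewrite (le_trans a0)// (le_trans t0).
Qed.

Lemma psd_antisym x : psd x -> psd (- x) -> x = 0.
Proof.
move=> px nx; apply: un_eq0; apply/le_anti; rewrite un_ge0 andbT.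
by apply: psd_ubound => //; rewrite rs0 sub0r.
Qed.

Lemma ple_trans y x z : ple x y -> ple y z -> ple x z.
Proof. by move=> xy yz; rewrite /ple -(subrK y z) -addrA; exact: psdD. Qed.

Lemma ple_refl x : ple x x. Proof. by rewrite /ple subrr; exact: psd0. Qed.

Lemma pleD x y z w : ple x y -> ple z w -> ple (x + z) (y + w).
Proof. by move=> xy zw; rewrite /ple opprD addrACA; exact: psdD. Qed.

Lemma ple_un x y : psd x -> ple x y -> un x <= un y.
Proof.
move=> px xy; apply: psd_ubound => //; apply: (@ple_trans y) => //.
apply: psd_un_sub => //; rewrite -(subrK x y) starD.
by rewrite (psd_sa xy) (psd_sa px).
Qed.

Lemma jacobson x y : uinv (1 - x * y) -> uinv (1 - y * x).
Proof.
move=> [z [z1 z2]]; exists (1 + y * z * x).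
have e1 : z - x * y * z = 1 by rewrite -{1}(mul1r z) -mulrBl.
have e2 : z - z * (x * y) = 1 by rewrite -{1}(mulr1 z) -mulrBr.
split.
  rewrite mulrDr mulr1 mulrBl mul1r.
  have -> : y * z * x - y * x * (y * z * x) = y * (z - x * y * z) * x.
    by rewrite mulrBr mulrBl !mulrA.
  by rewrite e1 mulr1 subrK.
rewrite mulrDl mul1r mulrBr mulr1.
have -> : y * z * x - y * z * x * (y * x) = y * (z - z * (x * y)) * x.
  by rewrite mulrBr mulrBl !mulrA.
by rewrite e2 mulr1 subrK.
Qed.

Lemma psd_Mstar_star x : psd (x * star x) -> psd (star x * x).
Proof.
move=> [_ h]; split=> [|t]; first by rewrite ustarM starK.
have [->//|t0 xt] := eqVneq t 0; apply: h; apply: contra_not xt.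
have E (y z : U) : rs t - y * z = rs t * (1 - (rs t^-1 * y) * z).
  by rewrite mulrBr mulr1 -mulrA rsA mulfV// rs1 mul1r.
move=> i; rewrite E; apply: uinv_scale => //.
rewrite -mulrA -rsC -mulrA rsC; apply: jacobson.
have -> : rs t^-1 * x * star x = rs t^-1 * (x * star x) by rewrite mulrA.
have -> : 1 - rs t^-1 * (x * star x) = rs t^-1 * (rs t - x * star x).
  by rewrite mulrBr -rsM mulVf// rs1.
by apply: uinv_scale => //; rewrite invr_eq0.
Qed.

(** Let [n] be the negative part of [star x * x] and [y = x * n]; then [star y * y = - n^3].
    Splitting [y] into self-adjoint parts shows [y * star y] to be positive, hence so is
    [star y * y] ([psd_Mstar_star]). Being also negative it vanishes, and [n = 0]. *)
Lemma psd_starM x : psd (star x * x).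
Proof.
pose b := star x * x; have sb : star b = b by rewrite /b ustarM starK.
pose neg (t : R) := Num.max (- t) 0.
have hneg : pap neg by apply: pap_max; [exact: papN (@pap_id R)|exact: pap_cst].
pose n := fc neg b.
have pn : psd n by apply: psd_fc => // t _; rewrite le_max lexx orbT.
have sn := psd_sa pn.
have nb : n * b = - (n * n).
  rewrite -{1}(fc_id sb) /n -!fcM//; last exact: pap_id.
  rewrite -fcN//; last exact: papM.
  congr fc; apply/funext => t; rewrite /neg; case: leP => ?; first by rewrite !mul0r oppr0.
  by rewrite mulrNN mulNr.
pose y := x * n.
have yy : star y * y = - (n * n * n).
  rewrite /y ustarM sn -mulrA [star x * _]mulrA -/b mulrA nb.
  by rewrite mulNr.
have nnn : psd (n * n * n).
  have -> : n * n * n = fc (fun t => neg t * neg t * neg t) b.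
    by rewrite !fcM//; exact: papM.
  apply: psd_fc => // [|t _]; first by apply: papM => //; exact: papM.
  by rewrite !mulr_ge0// /neg le_max lexx orbT.
pose i : R[i] := 0 +i* 1.
have ci : conjc i = - i by apply/eqP; rewrite eq_complex /= oppr0 !eqxx.
have ii : i * i = -1.
  by apply/eqP; rewrite eq_complex /= !mul0r mulr0 mulr1 oppr0 add0r addr0 !eqxx.
have yy' : psd (y * star y).
  pose p := y + star y; pose q := i *: (y - star y).
  have sp : star p = p by rewrite /p starD starK addrC.
  have sq : star q = q by rewrite /q starZ starB starK [conjc i]ci scaleNr -scalerN opprB.
  have E : y * star y + y * star y = p * p + q * q + (n * n * n + n * n * n).
    have -> : n * n * n = - (star y * y) by rewrite yy opprK.
    have -> : q * q = - ((y - star y) * (y - star y)).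
      by rewrite /q -scalerAl -scalerAr scalerA ii scaleN1r.
    rewrite /p; move: (star y) => s.
    rewrite !mulrDl !mulrDr !mulNr !mulrN !opprD !opprK.
    rewrite [RHS](AC ((2*2)*(2*2)*2) ((2*6)*((1*5)*(4*8))*((3*9)*(7*10)))).
    by rewrite /= !subrr !addr0.
  have -> : y * star y = rs 2^-1 * (y * star y + y * star y).
    rewrite [RHS]mulrDr -[RHS]mulrDl -rsD.
    by have -> : 2^-1 + 2^-1 = 1 :> R by [field]; rewrite rs1 mul1r.
  rewrite E; apply: psdZ; first by rewrite invr_ge0.
  apply: psdD; last exact: psdD.
  by apply: psdD; exact: psd_sqr.
have yy0 : star y * y = 0.
  by apply: psd_antisym; [exact: psd_Mstar_star|rewrite yy opprK].
have n0 : n = 0.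
  have : un (n * n * n * n) = 0.
    by move: yy0; rewrite yy => /eqP; rewrite oppr_eq0 => /eqP ->; rewrite mul0r un0.
  rewrite -mulrA un_sa_sqr ?ustarM ?sn// un_sa_sqr// -exprM => /eqP.
  by rewrite expf_eq0/= => /eqP/un_eq0.
have -> : star x * x = fc (fun t => Num.max t 0) b.
  transitivity (fc (fun t => t) b + fc neg b).
    by rewrite -/n n0 addr0 fc_id.
  rewrite -fcD//; last exact: pap_id.
  congr fc; apply/funext => t; rewrite /neg.
  by case: (leP t 0) => t0; case: leP => t1; lra.
apply: psd_fc => // [|t _]; last by rewrite le_max lexx orbT.
by apply: pap_max; [exact: pap_id|exact: pap_cst].
Qed.

Lemma psd_Mstar x : psd (x * star x).
Proof. by rewrite -{1}(starK x); exact: psd_starM. Qed.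

Lemma psd_conj a x : psd a -> psd (x * a * star x).
Proof.
move=> pa; have -> : x * a * star x = (x * usqrt a) * star (x * usqrt a).
  by rewrite ustarM (usqrt_sa pa) !mulrA -(mulrA x (usqrt a)) usqrtK.
exact: psd_Mstar.
Qed.

Lemma ple_conj a b x : ple a b -> ple (x * a * star x) (x * b * star x).
Proof. by move=> ab; rewrite /ple -mulrBl -mulrBr; exact: psd_conj. Qed.

Lemma pleZ r a b : 0 <= r -> ple a b -> ple (rs r * a) (rs r * b).
Proof. by move=> r0 ab; rewrite /ple -mulrBr; exact: psdZ. Qed.

Lemma ple_near a b e : star a = a -> star b = b -> un (a - b) <= e -> ple a (b + rs e).
Proof.
move=> sa sb h; rewrite /ple addrAC addrC -opprB; apply: psd_un_sub => //.
by rewrite starB sa sb.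
Qed.

Lemma psd_sumr (I : Type) (s : seq I) (F : I -> U) :
  (forall i, psd (F i)) -> psd (\sum_(i <- s) F i).
Proof.
move=> h; elim: s => [|i s IH]; first by rewrite big_nil; exact: psd0.
by rewrite big_cons; apply: psdD.
Qed.

Definition tcut e (t : R) := Num.max (t - e) 0.

Lemma pap_tcut e : pap (tcut e).
Proof.
apply: pap_max; last exact: pap_cst.
by apply: papB; [exact: pap_id|exact: pap_cst].
Qed.

Lemma tcut_ge0 e t : 0 <= tcut e t. Proof. by rewrite le_max lexx orbT. Qed.

Lemma fc_ple f g x : star x = x -> pap f -> pap g ->
  (forall t, Sp x t -> f t <= g t) -> ple (fc f x) (fc g x).
Proof.
move=> sx hf hg fg; rewrite /ple -fcB//; apply: psd_fc => // [|t /fg].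
  exact: papB.
by rewrite subr_ge0.
Qed.

End Positivity.

(** * Agreement with spectrum, positivity and cut-downs in [A] *)

Section NonunitalCalculus.
Context (R : realType) (A : cstarAlgType R).
Local Notation U := (unz A).
Implicit Types (a b c x y : A) (r t : R) (P Q : {poly R}) (f g : R -> R).

Lemma uin_sa a : star a = a -> star (uin a) = uin a.
Proof. by move=> sa; rewrite -uin_star sa. Qed.

Lemma uscal_pe P a : uscal (pe P (uin a)) = (P.[0])%:C.
Proof.
elim/pe_ind: P => [|P r IH]; first by rewrite pe0 horner0.
rewrite peD peM peX peC uscalD uscalM uscal_uin mulr0 add0r.
by rewrite !hornerE [rs r]/(_ *: _) uscalZ mulr1.
Qed.

Lemma Sp_uin0 a : Sp (uin a) 0.
Proof.
move=> [y [+ _]]; rewrite rs0 sub0r mulNr => /(congr1 (@uscal _ _)).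
rewrite -mulNr -uinN uscalM uscal_uin mul0r => /esym/eqP.
by rewrite oner_eq0.
Qed.

Lemma uscal_fc f a : star a = a -> pap f -> uscal (fc f (uin a)) = (f 0)%:C.
Proof.
move=> /uin_sa sa hf; apply/eqP; rewrite -subr_eq0; apply/eqP/eq0_normc/le_anti.
rewrite normc_ge0 andbT; apply/ler_addgt0Pl => e e0; rewrite addr0.
have e2 : 0 < e / 2 by rewrite divr_gt0.
have [P [P1 P2]] := fcP sa hf e2.
rewrite -(subrK (uscal (pe P (uin a))) (uscal _)) -addrA.
rewrite (le_trans (le_normcD _ _))// (splitr e) lerD//.
  by rewrite (le_trans (un_scal_le (fc f (uin a) - pe P (uin a))))// unBC.
by rewrite uscal_pe -rmorphB normc_real P1//; exact: Sp_uin0.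
Qed.

Definition fcA f a : A := upart (fc f (uin a)).

Lemma uin_fcA f a : star a = a -> pap f -> f 0 = 0 -> uin (fcA f a) = fc f (uin a).
Proof. by move=> sa hf f0; apply: uin_upart; rewrite uscal_fc// f0. Qed.

Lemma uscal_inv1 (u v : U) : u * v = 1 -> uscal u * uscal v = 1.
Proof. by rewrite -uscalM => ->. Qed.

(** An inverse of [1 - uin x] has scalar part [1], so it is again of the form [1 - uin z]; the two
    equations for [z] are those of quasi-invertibility. *)
Lemma quasi_invertibleP (l : R[i]) a : l != 0 ->
  quasi_invertible (l^-1 *: a) <-> uinv (l%:A - uin a).
Proof.
move=> l0; set x := l^-1 *: a.
have xE : l%:A - uin a = l *: (1 - uin x).
  by rewrite scalerBr -uinZ scalerA mulfV// scale1r.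
have inv1 (u : U) : uinv (l *: u) <-> uinv u.
  split=> -[v [v1 v2]].
    by exists (l *: v); split; [rewrite -scalerAr scalerAl|rewrite -scalerAl scalerAr].
  exists (l^-1 *: v); rewrite -!scalerAl -!scalerAr !scalerA.
  by rewrite mulfV// mulVf// !scale1r.
have E (y z : A) : (1 - uin y) * (1 - uin z) = 1 - uin (y + z - y ** z).
  rewrite mulrBl mul1r mulrBr mulr1 uinB uinD uinM -addrA -opprD addrA.
  by rewrite [uin z + _]addrC.
rewrite xE inv1; split=> -[y [y1 y2]].
  exists (1 - uin y); rewrite !E y1; split; first by rewrite uin0 subr0.
  by rewrite [y + x]addrC y2 uin0 subr0.
have sy : uscal y = 1.
  have := uscal_inv1 y1; rewrite (_ : uscal (1 - uin x) = 1) ?mul1r//.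
  by rewrite -[uscal _]/(1 - 0) subr0.
have yE : y = 1 - uin (- upart y).
  by rewrite uinN opprK {1}(unz_dec y) sy scale1r.
move: y1 y2; rewrite yE !E => y1 y2.
exists (- upart y); split; apply: uin_inj.
  by move/eqP: y1; rewrite eq_sym -subr_eq0 subKr => /eqP.
by rewrite [x + _]addrC; move/eqP: y2; rewrite eq_sym -subr_eq0 subKr => /eqP.
Qed.

Lemma realC_neq0 t : t != 0 -> t%:C != 0 :> R[i].
Proof. by apply: contra_neq => /complexI. Qed.

Lemma spectrum_Sp a t : Sp (uin a) t -> spectrum a t%:C.
Proof.
move=> at_; have [->|t0] := eqVneq t 0; first by left.
by right; rewrite quasi_invertibleP// realC_neq0.
Qed.

Lemma positiveP a : positive a <-> psd (uin a).
Proof.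
split=> [[sa h]|[sa h]].
  split=> [|t /spectrum_Sp/h]; first exact: uin_sa.
  by rewrite ler0c.
split=> [|l]; first by apply: uin_inj; rewrite uin_star.
have [-> //|l0] := eqVneq l 0; case=> [->//|]; rewrite quasi_invertibleP// => nl.
have [i0|i0] := eqVneq (complex.Im l) 0; last by case: nl; exact: uinv_nonreal.
have lE : l = (complex.Re l)%:C by case: (l) i0 => u v /= ->.
by rewrite lE ler0c; apply: h; rewrite /Sp /rs -lE.
Qed.

Lemma pe_sum P (x : U) : pe P x = \sum_(i < size P) rs P`_i * x ^+ i.
Proof.
rewrite -{1}[P]coefK poly_def.
have : forall n (F : nat -> R), pe (\sum_(i < n) F i *: 'X^i) x = \sum_(i < n) rs (F i) * x ^+ i.
  move=> n F; elim: n => [|n IH]; first by rewrite !big_ord0 pe0.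
  rewrite !big_ord_recr/= peD IH peZ; congr (_ + _ * _).
  by elim: n {IH} => [|n IH]; rewrite ?expr0 ?pe1// !exprS peM IH peX.
by apply.
Qed.

Lemma uin_spow a n : uin (spow a n.+1) = uin a ^+ n.+1.
Proof.
elim: n => [|n IH]; first by rewrite expr1.
by rewrite [spow _ _]/(a ** spow a n.+1) uinM IH [RHS]exprS.
Qed.

Lemma uin_sum (I : Type) (s : seq I) (F : I -> A) :
  uin (\sum_(i <- s) F i) = \sum_(i <- s) uin (F i).
Proof. by apply: (big_morph (@uin R A)) => //; exact: uinD. Qed.

Lemma uin_spoly P a : P`_0 = 0 -> uin (spoly P a) = pe P (uin a).
Proof.
move=> P0; rewrite pe_sum /spoly uin_sum.
rewrite -(big_mkord xpredT (fun i => rs P`_i * uin a ^+ i)).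
have [->|Pn] := eqVneq (size P) 0%N; first by rewrite !big_nil.
rewrite [RHS]big_ltn ?lt0n// P0 rs0 mul0r add0r.
apply: eq_big_nat => -[|i]// _.
by rewrite uinZ uin_spow rs_scale.
Qed.

Lemma is_fcalc_isfc f a c : is_fcalc f a c -> isfc f (uin a) (uin c).
Proof.
move=> [P [P0 Pf /rnorm_cvg_for Pc]] e e0.
have [N1 _ h1] := Pf e e0; have [N2 h2] := Pc e e0.
exists (P (maxn N1 N2)); split=> [t /spectrum_Sp at_|].
  by rewrite ltW//; apply: h1 at_ => /=; exact: leq_maxl.
by rewrite -uin_spoly// -uinB un_uin ltW// h2// leq_maxr.
Qed.

Lemma isfc_is_fcalc f a c : star a = a -> pap f -> f 0 = 0 ->
  uin c = fc f (uin a) -> is_fcalc f a c.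
Proof.
move=> sa hf f0 cE; have usa := uin_sa sa.
have /choice[P hP] n : exists P, P`_0 = 0 /\ forall t, `|t| <= un (uin a) ->
    `|P.[t] - f t| <= n.+1%:R^-1.
  have n0 : 0 < n.+1%:R^-1 / 2 :> R by rewrite divr_gt0 ?invr_gt0.
  have [Q hQ] := hf (un (uin a)) _ n0.
  have Q0 : `|Q.[0]| <= n.+1%:R^-1 / 2.
    by have := hQ 0; rewrite normr0 un_ge0 f0 subr0; exact.
  (* The constant term may not be kept in [A]; since [f 0 = 0] it is within the error, and dropping
     it explains the halved tolerance. *)
  exists (Q - Q.[0]%:P); split=> [|t /hQ h].
    by rewrite coefB coefC /= -horner_coef0 subrr.
  rewrite hornerD hornerN hornerC addrAC (le_trans (ler_normB _ _))//.
  by rewrite [leRHS]splitr lerD.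
have inv_le e (N n : nat) : N.+1%:R^-1 < e -> (N <= n)%N -> n.+1%:R^-1 < e :> R.
  move=> Ne Nn; rewrite (le_lt_trans _ Ne)//.
  by rewrite lef_pV2 ?posrE ?ltr0n// ler_nat ltnS.
have spE t : spectrum a t%:C -> `|t| <= un (uin a).
  case=> [/complexI ->|h]; first by rewrite normr0 un_ge0.
  have [->|t0] := eqVneq t 0; first by rewrite normr0 un_ge0.
  by apply: Sp_le; rewrite /Sp /rs -quasi_invertibleP// realC_neq0.
exists P; split=> [n|e e0|]; first by case: (hP n).
  have [N hN] := natSinv_lt e0; exists N => // n /= Nn t /spE/(hP n).2 h.
  exact: le_lt_trans h (inv_le _ _ _ hN Nn).
apply/rnorm_cvg_for => e e0; have [N hN] := natSinv_lt e0.
exists N => n Nn; rewrite -un_uin uinB uin_spoly ?(hP n).1// cE.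
rewrite -fc_poly//; apply: le_lt_trans (inv_le _ _ _ hN Nn).
by apply: fc_near => // [|t /Sp_le/(hP n).2]; first exact: pap_poly.
Qed.

Lemma uin_fcalc f a : star a = a -> pap f -> f 0 = 0 ->
  uin (fcalc f a) = fc f (uin a).
Proof.
move=> sa hf f0; apply: (@isfc_uniq _ _ f (uin a)); first exact: uin_sa.
  apply: is_fcalc_isfc; apply: xgetPex; exists (fcA f a).
  by apply: isfc_is_fcalc => //; exact: uin_fcA.
by apply: fcP => //; exact: uin_sa.
Qed.

Lemma uin_cutdown a e : star a = a -> 0 <= e ->
  uin (cutdown a e) = fc (tcut e) (uin a).
Proof.
move=> sa e0; rewrite uin_fcalc//; first exact: pap_tcut.
by rewrite sub0r; apply/max_idPr; rewrite oppr_le0.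
Qed.

End NonunitalCalculus.

(** * Cuntz comparison of positive elements *)

Section CuntzComparison.
Context (R : realType) (A : cstarAlgType R).
Local Notation U := (unz A).
Implicit Types (a b c x y v w : A) (u : U) (e d r t : R).

Lemma cuntz_subP a b : cuntz_sub a b <->
  forall e, 0 < e -> exists v, un (uin (v ** b ** star v) - uin a) < e.
Proof.
split=> [[v /rnorm_cvg_for h] e /h[N /(_ N (leqnn N))]|h].
  by rewrite -un_uin uinB; exists (v N).
have /choice[v hv] (n : nat) : exists v, un (uin (v ** b ** star v) - uin a) < n.+1%:R^-1.
  by apply: h; rewrite invr_gt0.
exists v; apply/rnorm_cvg_for => e /natSinv_lt[N hN]; exists N => n Nn.
rewrite -un_uin uinB (lt_trans (hv n))// (le_lt_trans _ hN)//.
by rewrite lef_pV2 ?posrE ?ltr0n// ler_nat ltnS.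
Qed.

Lemma uin_ideal u (u' : U) a : exists b, uin b = u * uin a * u'.
Proof.
by exists (upart (u * uin a * u')); rewrite uin_upart// !uscalM uscal_uin mulr0 mul0r.
Qed.

Lemma uin_conj u a : exists b, uin b = u * uin a * star u.
Proof. exact: uin_ideal. Qed.

(** Conjugators from the unitization are allowed: multiplying by [fc f (uin b)] with
    [f = min 1 (t / d)] moves the conjugator into [A] and changes [b] by at most [d]. *)
Lemma cuntz_unit a b : psd (uin b) ->
  (forall e, 0 < e -> exists u, un (u * uin b * star u - uin a) < e) -> cuntz_sub a b.
Proof.
move=> pb h; have sb := psd_sa pb; apply/cuntz_subP => e e0.
have e2 : 0 < e / 2 by rewrite divr_gt0.
have [u hu] := h _ e2.
pose k := un u * un u + 1; have k0 : 0 < k by rewrite ltr_wpDl// mulr_ge0 ?un_ge0.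
pose d := e / 2 / k; have d0 : 0 < d by rewrite !divr_gt0.
pose f (t : R) := Num.min 1 (Num.max t 0 / d).
have hf : pap f.
  apply: pap_min; first exact: pap_cst.
  apply: papM; last exact: pap_cst.
  by apply: pap_max; [exact: pap_id|exact: pap_cst].
have sF := fc_sa sb hf.
have bsa : star b = b by apply: uin_inj; rewrite uin_star.
have f0 : f 0 = 0.
  by rewrite /f maxxx mul0r; apply/min_idPr.
pose F := fc f (uin b).
have [v vE] : exists v, uin v = u * F.
  have := uin_ideal u 1 (fcA f b); rewrite mulr1 uin_fcA//.
exists v; rewrite !uinM uin_star vE ustarM sF.
have -> : u * F * uin b * (F * star u) = u * (F * uin b * F) * star u by rewrite !mulrA.
have FbF : un (F * uin b * F - uin b) <= d.
  have pid := @pap_id R; have hft := papM hf pid; have hff := papM hft hf.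
  rewrite -{1 2}(fc_id sb) /F -!fcM//.
  apply: fc_near => //.
  move=> t /pb.2 t0; rewrite /f max_l//.
  have [td|td] := leP 1 (t / d).
    by rewrite mul1r mulr1 subrr normr0 ltW.
  have q0 : 0 <= t / d by rewrite divr_ge0// ltW.
  have td' : t < d by move: td; rewrite ltr_pdivrMr// mul1r.
  rewrite mulrAC distrC ger0_norm.
    have : 0 <= t / d * (t / d) * t by rewrite mulr_ge0// mulr_ge0.
    lra.
  by rewrite subr_ge0 ler_piMl//; nra.
rewrite (le_lt_trans (un_dist (u * uin b * star u) _ _))// (splitr e) ler_ltD//.
rewrite -mulrBl -mulrBr (le_trans (unM _ _))// un_star.
rewrite (le_trans (ler_wpM2r (un_ge0 _) (unM _ _)))// mulrAC.
apply: (@le_trans _ _ (k * d)).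
  by rewrite ler_pM ?mulr_ge0 ?un_ge0// lerDl.
by rewrite mulrC /d divfK ?gt_eqF.
Qed.

Lemma cuntz_refl a : psd (uin a) -> cuntz_sub a a.
Proof.
move=> pa; apply: cuntz_unit => // e e0; exists 1.
by rewrite mul1r ustar1 mulr1 subrr un0.
Qed.

Lemma cuntz_conj u a b : psd (uin b) -> uin a = u * uin b * star u -> cuntz_sub a b.
Proof.
by move=> pb aE; apply: cuntz_unit => // e e0; exists u; rewrite aE subrr un0.
Qed.

Lemma cuntz_trans b a c : cuntz_sub a b -> cuntz_sub b c -> cuntz_sub a c.
Proof.
move=> /cuntz_subP ab /cuntz_subP bc; apply/cuntz_subP => e e0.
have e2 : 0 < e / 2 by rewrite divr_gt0.
have [v hv] := ab _ e2.
pose k := un (uin v) * un (uin v) + 1.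
have k0 : 0 < k by rewrite ltr_wpDl// mulr_ge0 ?un_ge0.
have [w hw] := bc _ (divr_gt0 e2 k0).
exists (v ** w); rewrite starM.
have -> : v ** w ** c ** (star w ** star v) = v ** (w ** c ** star w) ** star v.
  by rewrite !smulA.
rewrite (le_lt_trans (un_dist (uin (v ** b ** star v)) _ _))// (splitr e) ler_ltD//.
rewrite -uinB -smulBl -smulBr !uinM uin_star (le_trans (unM _ _))// un_star.
rewrite (le_trans (ler_wpM2r (un_ge0 _) (unM _ _)))// mulrAC.
apply: (@le_trans _ _ (k * (e / 2 / k))); last by rewrite mulrC divfK ?gt_eqF.
rewrite ler_pM ?mulr_ge0 ?un_ge0//; first by rewrite lerDl.
by rewrite uinB ltW.
Qed.

Lemma cuntz_lim a b : (forall e, 0 < e -> exists2 a', cuntz_sub a' b & un (uin a - uin a') < e) ->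
  cuntz_sub a b.
Proof.
move=> h; apply/cuntz_subP => e e0; have e2 : 0 < e / 2 by rewrite divr_gt0.
have [a' /cuntz_subP a'b aa'] := h _ e2; have [v hv] := a'b _ e2; exists v.
by rewrite (le_lt_trans (un_dist (uin a') _ _))// (splitr e) ltrD// unBC.
Qed.

(** Conjugate [b] by [s G], where [s] is the root of [a] and [G = (b + tau)^(-1/2)]. As
    [G b G = 1 - tau G^2], the error is [tau] times [s G^2 s], whose norm is that of [G a G], at
    most that of [G b G], hence at most [1]. *)
Lemma cuntz_ple a b : psd (uin a) -> psd (uin b) -> ple (uin a) (uin b) -> cuntz_sub a b.
Proof.
move=> pa pb ab; apply: cuntz_unit => // e e0.
pose tau := e / 2; have t0 : 0 < tau by rewrite divr_gt0.
have sb := psd_sa pb.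
pose g (t : R) := (Num.max (Num.sqrt (Num.max t 0 + tau)) (Num.sqrt tau))^-1.
have st0 : 0 < Num.sqrt tau by rewrite sqrtr_gt0.
have hg : pap g.
  apply: pap_inv => //; apply: pap_sqrt; apply: papD; last exact: pap_cst.
  by apply: pap_max; [exact: pap_id|exact: pap_cst].
have gg t : 0 <= t -> g t * g t = (t + tau)^-1.
  move=> tp; rewrite /g (max_l tp) max_l; last by rewrite ler_wsqrtr// lerDr.
  by rewrite -invfM -expr2 sqr_sqrtr// addr_ge0// ltW.
pose G := fc g (uin b); have sG : star G = G by exact: fc_sa.
pose s := usqrt (uin a); have ss : star s = s by exact: usqrt_sa.
have pid := @pap_id R; have pgg := papM hg hg.
exists (s * G).
have -> : s * G * uin b * star (s * G) - uin a = - (rs tau * ((s * G) * star (s * G))).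
  have h1 : G * uin b * G = 1 - rs tau * (G * G).
    have -> : G * uin b * G = fc (fun t => 1 - tau * (g t * g t)) (uin b).
      have h1 := papM hg pid; have h2 := papM h1 hg.
      rewrite -{1}(fc_id sb) /G -!fcM//.
      apply: fc_ext => //.
        by apply: papB; [exact: pap_cst|exact: papZ].
      move=> t /pb.2 tp; rewrite mulrAC gg//; field.
      by rewrite gt_eqF// ltr_wpDl.
    rewrite fcB//; [|exact: pap_cst|exact: papZ].
    by rewrite fcZ// fcM// fc_cst// rs1.
  have sbs : s * G * uin b * star (s * G) = s * (G * uin b * G) * s.
    by rewrite ustarM sG ss !mulrA.
  have sgs : s * G * star (s * G) = s * (G * G) * s.
    by rewrite ustarM sG ss !mulrA.
  rewrite sbs sgs h1 mulrBr mulr1 mulrBl usqrtK//.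
  rewrite addrAC subrr add0r; congr (- _).
  by rewrite !mulrA rsC.
rewrite unN un_rsM gtr0_norm// un_Mstar -un_starM.
have le1 : un (star (s * G) * (s * G)) <= 1.
  have -> : star (s * G) * (s * G) = G * uin a * star G.
    by rewrite ustarM sG ss -!mulrA [s * (s * G)]mulrA usqrtK// .
  rewrite (le_trans (ple_un (psd_conj _ pa) (ple_conj G ab)))// sG.
  have h1 := papM hg pid; have h2 := papM h1 hg.
  rewrite -{1}(fc_id sb) /G -!fcM//.
  apply: fc_le => // t /pb.2 tp.
  have tt : 0 < t + tau by rewrite ltr_wpDl.
  rewrite mulrAC gg// mulrC ger0_norm ?divr_ge0 ?(ltW tt)//.
  by rewrite ler_pdivrMr// mul1r lerDl ltW.
rewrite (le_lt_trans (ler_wpM2l (ltW t0) le1))// mulr1 /tau; lra.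
Qed.

Lemma psd_cutdown a e : psd (uin a) -> 0 <= e -> psd (uin (cutdown a e)).
Proof.
move=> pa e0; have sa := psd_sa pa.
rewrite uin_cutdown//; last by apply: uin_inj; rewrite uin_star.
by apply: psd_fc => // [|t _]; [exact: pap_tcut|exact: tcut_ge0].
Qed.

Lemma psd_uin_sa a : psd (uin a) -> star a = a.
Proof. by move=> /psd_sa sa; apply: uin_inj; rewrite uin_star. Qed.

Lemma cutdown_ple a e : psd (uin a) -> 0 <= e -> ple (uin (cutdown a e)) (uin a).
Proof.
move=> pa e0; have sa := psd_sa pa.
rewrite uin_cutdown ?psd_uin_sa// -{2}(fc_id sa).
apply: fc_ple => //; [exact: pap_tcut|exact: pap_id|].
by move=> t /pa.2 t0; rewrite /tcut ge_max t0 andbT lerBlDr lerDl.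
Qed.

Lemma ple_cutdown a e : psd (uin a) -> 0 <= e ->
  ple (uin a) (uin (cutdown a e) + rs e).
Proof.
move=> pa e0; have sa := psd_sa pa.
rewrite uin_cutdown ?psd_uin_sa// -{1}(fc_id sa) -(fc_cst e sa).
rewrite -fcD//; [|exact: pap_tcut|exact: pap_cst].
apply: fc_ple => //; [exact: pap_id|apply: papD; [exact: pap_tcut|exact: pap_cst]|].
by move=> t /pa.2 t0; rewrite -lerBlDr /tcut le_max lexx.
Qed.

Lemma cutdownD a e d : psd (uin a) -> 0 <= e -> 0 <= d ->
  cutdown (cutdown a e) d = cutdown a (e + d).
Proof.
move=> pa e0 d0; have sa := psd_sa pa; apply: uin_inj.
rewrite uin_cutdown//; last exact/psd_uin_sa/psd_cutdown.
rewrite !uin_cutdown ?addr_ge0 ?psd_uin_sa// fc_comp//; try exact: pap_tcut.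
congr fc; apply/funext => t; rewrite /tcut.
by case: (leP (t - e)) => h1; case: leP => h2; case: leP => h3; lra.
Qed.

Lemma cutdown0 a : psd (uin a) -> cutdown a 0 = a.
Proof.
move=> pa; have sa := psd_sa pa; apply: uin_inj; rewrite uin_cutdown ?psd_uin_sa//.
rewrite -[RHS](fc_id sa); apply: fc_ext => //; [exact: pap_tcut|exact: pap_id|].
by move=> t /pa.2 t0; rewrite /tcut subr0 max_l.
Qed.

Lemma un_cutdown a e : psd (uin a) -> 0 <= e -> un (uin a - uin (cutdown a e)) <= e.
Proof.
move=> pa e0; have sa := psd_sa pa.
rewrite uin_cutdown ?psd_uin_sa// -{1}(fc_id sa).
apply: fc_near => //; [exact: pap_id|exact: pap_tcut|].
move=> t /pa.2 t0; rewrite /tcut; have [h|h] := leP t e.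
  by rewrite max_r ?subr_le0// subr0 ger0_norm.
by rewrite max_l ?subr_ge0 ?(ltW h)// subKr ger0_norm.
Qed.

(** Conjugating [a - e <= b] by [F = f(a)], with [f^2] a steep ramp that vanishes up to [e], puts
    [F (a - e) F] below [F b F]; it is positive and within [d / 2] of the cut-down of [a]. *)
Lemma cuntz_cut a b e : psd (uin a) -> psd (uin b) -> 0 <= e ->
  ple (uin a) (uin b + rs e) -> cuntz_sub (cutdown a e) b.
Proof.
move=> pa pb e0 ab; have sa := psd_sa pa; have pid := @pap_id R.
apply: cuntz_lim => d d0; have d2 : 0 < d / 2 by rewrite divr_gt0.
pose f (t : R) := Num.sqrt (Num.min 1 (tcut e t / (d / 2))).
have hf : pap f.
  apply: pap_sqrt; apply: pap_min; first exact: pap_cst.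
  by apply: papM; [exact: pap_tcut|exact: pap_cst].
have ff t : f t * f t = Num.min 1 (tcut e t / (d / 2)).
  rewrite -expr2 sqr_sqrtr// le_min ler01/= divr_ge0 ?tcut_ge0//.
  exact: ltW.
have f0 t : t <= e -> f t = 0.
  move=> te; rewrite /f /tcut (max_r (y := 0)) ?subr_le0// mul0r.
  by rewrite (min_r (x := 1))// sqrtr0.
pose h t := f t * (t - e) * f t.
have pte : pap (fun t => t - e) by apply: papB => //; exact: pap_cst.
have ph : pap h by apply: papM => //; exact: papM.
have hge t : 0 <= h t.
  rewrite /h; have [te|te] := leP t e; first by rewrite f0// mul0r mulr0.
  by rewrite !mulr_ge0 ?sqrtr_ge0// subr_ge0 ltW.
have h0 : h 0 = 0 by rewrite /h f0// mulr0.
have hE : uin (fcA h a) = fc h (uin a) by rewrite uin_fcA ?psd_uin_sa.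
pose F := fc f (uin a); have sF : star F = F by exact: fc_sa.
have [c cE] := uin_conj F b.
exists (fcA h a).
  apply: (@cuntz_trans c); last exact: cuntz_conj cE.
  apply: cuntz_ple; [by rewrite hE; apply: psd_fc|by rewrite cE; exact: psd_conj|].
  rewrite hE cE /h !fcM//; last by apply: papM.
  rewrite fcB// ?fc_id ?fc_cst//; last exact: pap_cst.
  rewrite -/F -{2}sF; apply: ple_conj.
  by move: ab; rewrite /ple opprB addrA.
rewrite hE uin_cutdown ?psd_uin_sa//; apply: le_lt_trans (_ : d / 2 < d); last lra.
apply: fc_near => //; first exact: pap_tcut.
move=> t _; rewrite /h mulrAC ff.
have [te|te] := leP t e.
  rewrite /tcut (max_r (y := 0)) ?subr_le0// mul0r (min_r (x := 1))// mul0r subrr normr0.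
  exact: ltW.
have cE' : tcut e t = t - e by rewrite /tcut max_l// subr_ge0 ltW.
rewrite cE'; set s := t - e; have s0 : 0 < s by rewrite subr_gt0.
have [k|k] := leP 1 (s / (d / 2)); first by rewrite mul1r subrr normr0 ltW.
have sd : s < d / 2 by move: k; rewrite ltr_pdivrMr// mul1r.
have k0 : 0 <= s / (d / 2) by rewrite divr_ge0// ltW.
by rewrite ger0_norm; nra.
Qed.

(** If conjugation of [b] by [v] approximates [a] within [e / 2], replacing [b] by its cut-down at
    [d] costs at most [d |v|^2], which is kept below [e / 2]. *)
Lemma cuntz_room a b e : psd (uin a) -> psd (uin b) -> 0 < e -> cuntz_sub a b ->
  exists2 d, 0 < d & cuntz_sub (cutdown a e) (cutdown b d).
Proof.
move=> pa pb e0 /cuntz_subP ab; have e2 : 0 < e / 2 by rewrite divr_gt0.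
have [v hv] := ab _ e2.
pose k := un (uin v) * un (uin v) + 1.
have k0 : 0 < k by rewrite ltr_wpDl// mulr_ge0 ?un_ge0.
pose d := e / 2 / k; have d0 : 0 < d by rewrite !divr_gt0.
exists d => //; pose b' := cutdown b d.
have pb' : psd (uin b') by apply: psd_cutdown => //; exact: ltW.
have [c cE] := uin_conj (uin v) b'.
apply: (@cuntz_trans c); last exact: cuntz_conj cE.
have pc : psd (uin c) by rewrite cE; exact: psd_conj.
apply: cuntz_cut => //; first exact: ltW.
have h1 : ple (uin a) (uin (v ** b ** star v) + rs (e / 2)).
  apply: ple_near; [exact: psd_sa| |by rewrite unBC ltW].
  by rewrite !uinM uin_star; apply: psd_sa; apply: psd_conj.
apply: ple_trans h1 _; rewrite {2}(splitr e) rsD addrA; apply: pleD; last exact: ple_refl.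
rewrite !uinM uin_star cE.
apply: ple_trans (ple_conj (uin v) (ple_cutdown pb (ltW d0))) _.
rewrite mulrDr mulrDl; apply: pleD; first exact: ple_refl.
rewrite rsC -mulrA; apply: psd_un_sub.
  by rewrite !ustarM rs_star starK rsC.
rewrite un_rsM gtr0_norm// (le_trans (ler_wpM2l (ltW d0) (unM _ _)))// un_star.
apply: (@le_trans _ _ (d * k)); last by rewrite /d divfK ?gt_eqF.
by rewrite ler_wpM2l ?(ltW d0)// lerDl.
Qed.

Lemma cuntz_sqr a : psd (uin a) -> cuntz_sub a (a ** a).
Proof.
move=> pa; have sa := psd_sa pa.
have paa : psd (uin (a ** a)) by rewrite uinM; exact: psd_sqr.
apply: cuntz_unit => // e e0; have e2 : 0 < e / 2 by rewrite divr_gt0.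
(* [f^2 t^2] equals [t] above [e / 2] and lies between [0] and [t] below it, so conjugating [a^2] by
   [f(a)] returns [a] up to [e / 2]. *)
pose f (t : R) := Num.sqrt t * (Num.max t (e / 2))^-1.
have pid := @pap_id R.
have hf : pap f by apply: papM; [exact: pap_sqrt|exact: pap_inv].
have h1 := papM pid pid; have h2 := papM hf h1; have h3 := papM h2 hf.
exists (fc f (uin a)); rewrite fc_sa// uinM -{2 3 5}(fc_id sa) -!fcM//.
apply: le_lt_trans (_ : e / 2 < e); last lra.
apply: fc_near => // t /pa.2 t0.
rewrite /f; have sq : Num.sqrt t * Num.sqrt t = t by rewrite -expr2 sqr_sqrtr.
have E (k : R) : k != 0 -> Num.sqrt t / k * (t * t) * (Num.sqrt t / k) = t * (t / k) ^+ 2.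
  by move=> k0; rewrite -[X in _ = X * _]sq; field.
have [h|h] := leP t (e / 2).
  rewrite E ?gt_eqF//.
  have q0 : 0 <= t / (e / 2) by rewrite divr_ge0// ltW.
  have q1 : t / (e / 2) <= 1 by rewrite ler_pdivrMr// mul1r.
  rewrite distrC ger0_norm.
    have : 0 <= t * (t / (e / 2)) ^+ 2 by rewrite mulr_ge0// exprn_ge0.
    lra.
  by rewrite subr_ge0 ler_piMr// expr_le1.
have t0' : 0 < t := lt_trans e2 h.
by rewrite E ?gt_eqF// divff ?gt_eqF// expr1n mulr1 subrr normr0 ltW.
Qed.

Lemma cuntz_sqr_le a : psd (uin a) -> cuntz_sub (a ** a) a.
Proof.
move=> pa; apply: (@cuntz_conj (usqrt (uin a))) => //.
rewrite usqrt_sa// uinM; have := usqrtK pa; move: (usqrt (uin a)) => s <-.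
by rewrite !mulrA.
Qed.

(** [star y ** y] is below its square, and the square is the conjugate of [y ** star y] by
    [star y]. *)
Lemma cuntz_star_swap y : cuntz_sub (star y ** y) (y ** star y).
Proof.
have p1 : psd (uin (star y ** y)) by rewrite uinM uin_star; exact: psd_starM.
have p2 : psd (uin (y ** star y)) by rewrite uinM uin_star; exact: psd_Mstar.
apply: (@cuntz_trans _ _ _ (cuntz_sqr p1)).
apply: (@cuntz_conj (uin (star y))) => //.
by rewrite -uin_star starK -!uinM !smulA.
Qed.

(** With [f^2 t] equal to the cut-down function at [e], the element [w = y f(star y ** y)] has
    [star w ** w] and [w ** star w] equal to the two cut-downs, which reduces to the uncut case. *)
Lemma cuntz_star_swap_cut y e : 0 < e ->
  cuntz_sub (cutdown (star y ** y) e) (cutdown (y ** star y) e).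
Proof.
move=> e0.
have p1 : psd (uin (star y ** y)) by rewrite uinM uin_star; exact: psd_starM.
have p2 : psd (uin (y ** star y)) by rewrite uinM uin_star; exact: psd_Mstar.
have s1 := psd_sa p1; have s2 := psd_sa p2; have pid := @pap_id R.
have t1 := psd_uin_sa p1; have t2 := psd_uin_sa p2.
pose f (t : R) := Num.sqrt (tcut e t * (Num.max t e)^-1).
have hf : pap f by apply: pap_sqrt; apply: papM; [exact: pap_tcut|exact: pap_inv].
have ff t : f t * f t * t = tcut e t.
  rewrite -expr2 sqr_sqrtr; last first.
    by rewrite mulr_ge0 ?tcut_ge0// invr_ge0 le_max (ltW e0) orbT.
  have [te|te] := leP t e; last by rewrite divfK// gt_eqF// (lt_trans e0).
  by rewrite /tcut (max_r (y := 0)) ?subr_le0// !mul0r.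
have [w wE] : exists w, uin w = uin y * fc f (uin (star y ** y)).
  have [w wE] := uin_ideal 1 (fc f (uin (star y ** y))) y.
  by exists w; rewrite wE mul1r.
have F1 := fc_sa s1 hf.
have inter : uin y * uin (star y ** y) = uin (y ** star y) * uin y.
  by rewrite -!uinM smulA.
have w1 : star w ** w = cutdown (star y ** y) e.
  apply: uin_inj; rewrite uin_cutdown ?(ltW e0)// uinM uin_star wE ustarM F1.
  rewrite mulrA -[_ * star (uin y) * uin y]mulrA -uin_star -uinM.
  have h1 := papM hf pid; have h2 := papM h1 hf.
  rewrite -{2}(fc_id s1) -!fcM//.
  by congr fc; apply/funext => t; rewrite -ff mulrAC.
have w2 : w ** star w = cutdown (y ** star y) e.
  apply: uin_inj; rewrite uin_cutdown ?(ltW e0)// uinM uin_star wE ustarM F1.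
  rewrite mulrA -[_ * fc f _ * fc f _]mulrA -fcM//.
  rewrite (fc_intertw s1 s2 (papM hf hf) inter) -mulrA -uin_star -uinM.
  have h1 := papM hf hf; have h2 := papM h1 pid.
  rewrite -{2}(fc_id s2) -fcM//.
  by congr fc; apply/funext => t; rewrite -ff.
by rewrite -w1 -w2; exact: cuntz_star_swap.
Qed.

Lemma cuntz_scale r a : 0 <= r -> psd (uin a) -> cuntz_sub (r%:C *: a) a.
Proof.
move=> r0 pa; apply: (@cuntz_conj (rs (Num.sqrt r))) => //.
rewrite rs_star rsC rsA -expr2 sqr_sqrtr//.
by rewrite uinZ rs_scale.
Qed.

Lemma cuntz_sub0 a : cuntz_sub a 0 -> a = 0.
Proof.
move=> /cuntz_subP h; apply: uin_inj; apply: un_eq => e /h[v].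
by rewrite smul0r smul0l unBC => /ltW.
Qed.

Lemma cuntz_0sub b : cuntz_sub 0 b.
Proof.
apply/cuntz_subP => e e0; exists 0.
by rewrite !smul0l uin0 subrr un0.
Qed.

Lemma cuntz_cut_mono a e d : psd (uin a) -> 0 <= d -> d <= e ->
  cuntz_sub (cutdown a e) (cutdown a d).
Proof.
move=> pa d0 de; have ed : 0 <= e - d by rewrite subr_ge0.
have -> : cutdown a e = cutdown (cutdown a d) (e - d).
  by rewrite cutdownD// addrC subrK.
have pd := psd_cutdown pa d0.
by apply: cuntz_ple => //; [exact: psd_cutdown|exact: cutdown_ple].
Qed.

(* With [m = sum p'_i p_i^*], [m^* m] and [m m^*] are the squares of the two sums. *)
Lemma cuntz_orthogonal_sums n (p p' : 'I_n -> A) :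
  (forall i j, i != j -> star (p i) ** p j = 0) ->
  (forall i j, i != j -> star (p' i) ** p' j = 0) ->
  (forall i, star (p i) ** p i = star (p' i) ** p' i) ->
  cuntz_sub (\sum_i p i ** star (p i)) (\sum_i p' i ** star (p' i)).
Proof.
move=> op op' pp.
have sq (q r : 'I_n -> A) : (forall i j, i != j -> star (q i) ** q j = 0) ->
    (forall i, star (q i) ** q i = star (r i) ** r i) ->
    (star (\sum_i (r i ** star (q i))) = \sum_i (q i ** star (r i))) /\
    ((\sum_i (r i ** star (q i))) ** (\sum_i (q i ** star (r i))) =
    \sum_i (r i ** (star (r i) ** r i) ** star (r i))).
  move=> oq qr; split.
    by rewrite star_sum; apply: eq_bigr => i _; rewrite starM starK.
  rewrite smul_suml; apply: eq_bigr => i _.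
  rewrite smul_sumr (bigD1 i)//= big1 ?addr0 => [|j ji].
    by rewrite -qr !smulA.
  by rewrite -!smulA [star (q i) ** (q j ** _)]smulA oq 1?eq_sym// smul0l smul0r.
have [sm mm] := sq p p' op pp.
have [_ mm'] := sq p' p op' (fun i => esym (pp i)).
have [_ PP] := sq p p op (fun=> erefl).
have [_ QQ] := sq p' p' op' (fun=> erefl).
set P := \sum_i p i ** star (p i) in PP *; set Q := \sum_i p' i ** star (p' i) in QQ *.
have psdS (q : 'I_n -> A) : psd (uin (\sum_i q i ** star (q i))).
  by rewrite uin_sum; apply: psd_sumr => i; rewrite uinM uin_star; exact: psd_Mstar.
apply: (cuntz_trans (cuntz_sqr (psdS p))).
apply: cuntz_trans (cuntz_sqr_le (psdS p')).
rewrite -/P -/Q PP QQ -mm -mm' -sm.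
exact: cuntz_star_swap.
Qed.

End CuntzComparison.

(** * Homomorphisms and stabilization *)

Section StarHomomorphisms.
Context (R : realType).

Record shom (A B : cstarAlgType R) (phi : A -> B) : Prop := {
  shomD : forall x y, phi (x + y) = phi x + phi y;
  shomZ : forall (c : R[i]) x, phi (c *: x) = c *: phi x;
  shomM : forall x y, phi (x ** y) = phi x ** phi y;
  shom_star : forall x, phi (star x) = star (phi x);
  shom_norm : forall x, rnorm (phi x) <= rnorm x;
}.

Context (A B : cstarAlgType R) (phi : A -> B) (hphi : shom phi).
Implicit Types (a b x y : A) (e d : R).

Lemma shom0 : phi 0 = 0.
Proof. by rewrite -(scale0r 0) (shomZ hphi) scale0r. Qed.

Lemma shomN x : phi (- x) = - phi x.
Proof. by rewrite -scaleN1r (shomZ hphi) scaleN1r. Qed.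

Lemma shomB x y : phi (x - y) = phi x - phi y.
Proof. by rewrite (shomD hphi) shomN. Qed.

Lemma shom_sum (I : Type) (s : seq I) (F : I -> A) :
  phi (\sum_(i <- s) F i) = \sum_(i <- s) phi (F i).
Proof. by apply: (big_morph phi); [exact: shomD|exact: shom0]. Qed.

Lemma shom_spoly (P : {poly R}) a : phi (spoly P a) = spoly P (phi a).
Proof.
rewrite /spoly shom_sum; apply: eq_bigr => n _; rewrite (shomZ hphi); congr (_ *: _).
by rewrite /spow; elim: n.-1 => //= m IH; rewrite (shomM hphi) IH.
Qed.

Lemma shom_un x : un (uin (phi x)) <= un (uin x).
Proof. by rewrite !un_uin shom_norm. Qed.

Lemma poly0_approx (f : R -> R) (r e : R) : pap f -> f 0 = 0 -> 0 <= r -> 0 < e ->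
  exists P : {poly R}, P`_0 = 0 /\ forall t, `|t| <= r -> `|P.[t] - f t| <= e.
Proof.
move=> hf f0 r0 e0; have e2 : 0 < e / 2 by rewrite divr_gt0.
have [Q hQ] := hf r _ e2.
have Q0 : `|Q.[0]| <= e / 2 by have := hQ 0; rewrite normr0 f0 subr0; exact.
exists (Q - Q.[0]%:P); split=> [|t /hQ h].
  by rewrite coefB coefC /= -horner_coef0 subrr.
rewrite hornerD hornerN hornerC addrAC (le_trans (ler_normB _ _))//.
by rewrite [leRHS]splitr lerD.
Qed.

Lemma shom_fcA (f : R -> R) a : star a = a -> pap f -> f 0 = 0 ->
  phi (fcA f a) = fcA f (phi a).
Proof.
move=> sa hf f0; have sb : star (phi a) = phi a by rewrite -(shom_star hphi) sa.
apply: uin_inj; apply: un_eq => e e0; have e2 : 0 < e / 2 by rewrite divr_gt0.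
have [P [P0 hP]] := poly0_approx hf f0 (un_ge0 (uin a)) e2.
rewrite (le_trans (un_dist (uin (spoly P (phi a))) _ _))// (splitr e) lerD//.
  rewrite -shom_spoly -uinB -shomB (le_trans (shom_un _))// uinB.
  rewrite uin_fcA// uin_spoly// -fc_poly ?uin_sa//.
  apply: fc_near => //; [exact: uin_sa|exact: pap_poly|].
  by move=> t /Sp_le/hP; rewrite distrC.
rewrite uin_fcA// uin_spoly// -fc_poly ?uin_sa//.
apply: fc_near => //; [exact: uin_sa|exact: pap_poly|].
by move=> t /Sp_le h; apply: hP; exact: le_trans h (shom_un _).
Qed.

Lemma cutdown_fcA (C : cstarAlgType R) (a : C) e : star a = a -> 0 <= e ->
  cutdown a e = fcA (tcut e) a.
Proof.
move=> sa e0; apply: uin_inj; rewrite uin_cutdown// uin_fcA//; first exact: pap_tcut.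
by rewrite /tcut sub0r; apply/max_idPr; rewrite oppr_le0.
Qed.

Lemma shom_cutdown a e : star a = a -> 0 <= e ->
  phi (cutdown a e) = cutdown (phi a) e.
Proof.
move=> sa e0; rewrite !cutdown_fcA//; last by rewrite -(shom_star hphi) sa.
rewrite shom_fcA//; first exact: pap_tcut.
by rewrite /tcut sub0r; apply/max_idPr; rewrite oppr_le0.
Qed.

Definition ssqrt (C : cstarAlgType R) (a : C) : C := fcA Num.sqrt a.

Lemma uin_ssqrt (C : cstarAlgType R) (a : C) : star a = a -> uin (ssqrt a) = usqrt (uin a).
Proof. by move=> sa; apply: uin_fcA => //; [exact: pap_sqrt_id|exact: sqrtr0]. Qed.

Lemma ssqrtK (C : cstarAlgType R) (a : C) : psd (uin a) -> ssqrt a ** ssqrt a = a.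
Proof.
by move=> pa; apply: uin_inj; rewrite uinM uin_ssqrt ?psd_uin_sa// usqrtK.
Qed.

Lemma ssqrt_sa (C : cstarAlgType R) (a : C) : psd (uin a) -> star (ssqrt a) = ssqrt a.
Proof.
move=> pa; apply: uin_inj; rewrite uin_star uin_ssqrt ?psd_uin_sa//.
exact: usqrt_sa.
Qed.

Lemma psd_uin_sqr (C : cstarAlgType R) (a : C) : star a = a -> psd (uin (a ** a)).
Proof. by move=> sa; rewrite uinM; apply: psd_sqr; exact: uin_sa. Qed.

Lemma shom_psd a : psd (uin a) -> psd (uin (phi a)).
Proof.
move=> pa; rewrite -(ssqrtK pa) (shomM hphi); apply: psd_uin_sqr.
by rewrite -(shom_star hphi) ssqrt_sa.
Qed.

Lemma shom_cuntz a b : cuntz_sub a b -> cuntz_sub (phi a) (phi b).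
Proof.
move=> /cuntz_subP h; apply/cuntz_subP => e /h[v hv]; exists (phi v).
rewrite -(shom_star hphi) -!(shomM hphi) -uinB -shomB (le_lt_trans (shom_un _))//.
by rewrite uinB.
Qed.

End StarHomomorphisms.

(** * Maps between completions and functoriality of the stabilization *)

Section CompletionMap.
Context (R : realType) (V W : starAlgType R) (p : V -> R) (q : W -> R).
Context (hp : cstar_seminorm p) (hq : cstar_seminorm q).
Local Notation cV := (cauchyseq p).

(** Products and star are left out so that the row maps [fm_row] and multiplication by functions
    [fm_cmul], which are not homomorphisms, extend in the same way. *)
Record bounded_additive (F : V -> W) : Prop := {
  baB : forall x y, F (x - y) = F x - F y;
  ba_bound : exists2 M, 0 <= M & forall x, q (F x) <= M * p x;
}.

Context (F : V -> W) (hF : bounded_additive F).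

Lemma hc_map_cauchy (u : cV) : cauchy_for q (fun n => F (u n)).
Proof.
have [M M0 FM] := ba_bound hF; move=> e e0.
have M1 : 0 < M + 1 by rewrite ltr_wpDl.
have [N uN] := cs_cauchy u (divr_gt0 e0 M1).
exists N => m n Nm Nn; rewrite -(baB hF) (le_lt_trans (FM _))//.
have := uN m n Nm Nn; rewrite ltr_pdivlMr// => h; apply: le_lt_trans h.
by rewrite mulrC ler_wpM2l ?(csn_ge0 hp)// lerDl.
Qed.

Definition hc_mapseq (u : cV) : cauchyseq q := CauchySeq (hc_map_cauchy u).

Definition hc_map (x : hcompletion hp) : hcompletion hq :=
  hc_pi hq (hc_mapseq (hc_repr x)).

Lemma hc_mapE (u : cV) : hc_map (hc_pi hp u) = hc_pi hq (hc_mapseq u).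
Proof.
have [M M0 FM] := ba_bound hF.
apply/hc_piP => e e0; have M1 : 0 < M + 1 by rewrite ltr_wpDl.
have [N uN] := hc_repr_pi hp u (divr_gt0 e0 M1).
exists N => n /uN; rewrite !subr0 /= -(baB hF) => h.
rewrite (le_lt_trans (FM _))//; move: h; rewrite ltr_pdivlMr// => h.
by apply: le_lt_trans h; rewrite mulrC ler_wpM2l ?(csn_ge0 hp)// lerDl.
Qed.

Lemma hc_map_of (a : V) : hc_map (hc_of hp a) = hc_of hq (F a).
Proof. by rewrite hc_mapE; apply: hc_pi_ext. Qed.

Lemma rnorm_hc (x : hcompletion hp) : rnorm x = hc_norm x.
Proof. by []. Qed.

Lemma hc_map_norm (M : R) x : (forall x, q (F x) <= M * p x) ->
  hc_norm (hc_map x) <= M * hc_norm x.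
Proof.
move=> FM; elim/hc_ind: x => u; rewrite hc_mapE.
have h : (fun n => M * p (u n)) @ \oo --> M * hc_norm (hc_pi hp u).
  by apply: cvgMl_tmp; exact: hc_normE.
apply: (ler_cvg_to (@hc_normE _ _ _ hq _) h).
by near=> n; exact: FM.
Unshelve. all: by end_near. Qed.

Lemma hc_mapD x y : hc_map (x + y) = hc_map x + hc_map y.
Proof.
elim/hc_ind: x => u; elim/hc_ind: y => v; rewrite hc_piD !hc_mapE hc_piD.
apply: hc_pi_ext => n /=.
have F0 : F 0 = 0 by rewrite -(subrr 0) (baB hF) subrr.
have FN z : F (- z) = - F z by rewrite -sub0r (baB hF) F0 sub0r.
by rewrite -[v n in LHS]opprK (baB hF) FN opprK.
Qed.

Lemma hc_mapZ (FZ : forall (c : R[i]) x, F (c *: x) = c *: F x) (c : R[i]) x :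
  hc_map (c *: x) = c *: hc_map x.
Proof.
elim/hc_ind: x => u; rewrite hc_piZ !hc_mapE hc_piZ.
by apply: hc_pi_ext => n; exact: FZ.
Qed.

Lemma hc_mapM (FM : forall x y, F (x ** y) = F x ** F y) x y :
  hc_map (x ** y) = hc_map x ** hc_map y.
Proof.
elim/hc_ind: x => u; elim/hc_ind: y => v.
rewrite [hc_pi _ u ** _]hc_piM !hc_mapE [RHS]hc_piM.
by apply: hc_pi_ext => n; exact: FM.
Qed.

Lemma hc_map_star (FS : forall x, F (star x) = star (F x)) x :
  hc_map (star x) = star (hc_map x).
Proof.
elim/hc_ind: x => u; rewrite hc_pi_star !hc_mapE hc_pi_star.
by apply: hc_pi_ext => n; exact: FS.
Qed.

End CompletionMap.

Section StabilizationMap.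
Context (R : realType) (B B' : cstarAlgType R) (phi : B -> B') (hphi : shom phi).
Implicit Types (S T : finmx B).

Lemma fm_map_fin T : exists N, mx_bounded (fun i j => phi (T i j)) N.
Proof. by exists (mx_bd T) => i j h; rewrite mx_bdP// (shom0 hphi). Qed.

Definition fm_map T : finmx B' := FinMx (fm_map_fin T).

Lemma fm_mapB S T : fm_map (S - T) = fm_map S - fm_map T.
Proof.
by apply: finmxP => i j; rewrite [LHS]/= (shomD hphi) !scaleN1r (shomN hphi) /= scaleN1r.
Qed.
Lemma fm_mapD S T : fm_map (S + T) = fm_map S + fm_map T.
Proof. by apply: finmxP => i j; exact: (shomD hphi). Qed.
Lemma fm_mapZ (c : R[i]) T : fm_map (c *: T) = c *: fm_map T.
Proof. by apply: finmxP => i j; exact: (shomZ hphi). Qed.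
Lemma fm_mapM S T : fm_map (S ** T) = fm_map S ** fm_map T.
Proof.
apply: finmxP => i j.
have hb : mx_bounded (fm_map S) (mx_bd S).
  by move=> k l h /=; rewrite mx_bdP// (shom0 hphi).
rewrite (fm_mulE _ _ (or_introl hb)) /= (shom_sum hphi).
by apply: eq_bigr => k _; rewrite (shomM hphi).
Qed.
Lemma fm_map_star T : fm_map (star T) = star (fm_map T).
Proof. by apply: finmxP => i j; exact: (shom_star hphi). Qed.
Lemma fm_map_unit i j b : fm_map (fm_unit i j b) = fm_unit i j (phi b).
Proof. by apply: finmxP => k l /=; case: ifP => // _; exact: (shom0 hphi). Qed.

(** The norm being the supremum of the admissible seminorms, their stability under pullback is
    exactly contractivity of the induced map. *)
Lemma fm_map_admissible p : fm_admissible p -> fm_admissible (fun T => p (fm_map T)).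
Proof.
move=> [hp pu]; split=> [|i j b]; last first.
  by rewrite fm_map_unit (le_trans (pu _ _ _))// (shom_norm hphi).
split=> [S T|c T|S T|T].
- by rewrite fm_mapD (csn_triangle hp).
- by rewrite fm_mapZ (csn_scale hp).
- by rewrite fm_mapM (csn_mul hp).
- by rewrite fm_mapM fm_map_star (csn_star hp).
Qed.

Lemma fm_map_norm T : fm_norm (fm_map T) <= fm_norm T.
Proof.
apply: fm_norm_leP => p /fm_map_admissible hp.
exact: (@fm_norm_ge _ _ (fun T => p (fm_map T))).
Qed.

Lemma fm_map_ba : bounded_additive (@fm_norm R B) (@fm_norm R B') fm_map.
Proof. by split; [exact: fm_mapB|exists 1 => // T; rewrite mul1r fm_map_norm]. Qed.

Definition stab_map : stab B -> stab B' :=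
  @hc_map _ _ _ _ _ (fm_norm_seminorm B) (fm_norm_seminorm B') _ fm_map_ba.

Lemma stab_map_shom : shom (stab_map : stab B -> stab B').
Proof.
split=> [x y|c x|x y|x|x].
- exact: hc_mapD.
- by apply: hc_mapZ; exact: fm_mapZ.
- by apply: hc_mapM; exact: fm_mapM.
- by apply: hc_map_star; exact: fm_map_star.
- rewrite !rnorm_hc -[leRHS]mul1r; apply: hc_map_norm => T.
  by rewrite mul1r fm_map_norm.
Qed.

Lemma stab_map_shift e x : stab_map (stab_shift e x) = stab_shift e (stab_map x).
Proof.
elim/hc_ind: x => u.
rewrite stab_shiftE /stab_map hc_mapE hc_mapE stab_shiftE.
by apply: hc_pi_ext => n; apply: finmxP => i j /=; case: ifP => // _; exact: (shom0 hphi).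
Qed.

Lemma stab_map_dsum x y : stab_map (dsum x y) = dsum (stab_map x) (stab_map y).
Proof. by rewrite /dsum (shomD stab_map_shom) !stab_map_shift. Qed.

End StabilizationMap.

(** * Two isometries with orthogonal ranges *)

Section RowIsometries.
Context (R : realType) (B : cstarAlgType R).
Implicit Types (S T : finmx B) (x y : stab B) (e : bool).

Lemma fm_row_fin e T : exists N, mx_bounded
  (fun i j => if odd i == e then T i./2 j else 0) N.
Proof.
exists (mx_bd T).*2 => i j h; case: ifP => // _; apply: mx_bdP.
case/orP: h => h; first by rewrite geq_half_double h.
by rewrite (leq_trans _ h) ?orbT// -addnn leq_addr.
Qed.

(* Left multiplication by the isometry sending the [i]-th basis vector to the
   [(2i+e)]-th one. *)
Definition fm_row e T := FinMx (fm_row_fin e T).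

Lemma fm_rowD e S T : fm_row e (S + T) = fm_row e S + fm_row e T.
Proof. by apply: finmxP => i j /=; case: ifP; rewrite ?addr0. Qed.
Lemma fm_rowZ e (c : R[i]) T : fm_row e (c *: T) = c *: fm_row e T.
Proof. by apply: finmxP => i j /=; case: ifP; rewrite ?scaler0. Qed.
Lemma fm_rowB e S T : fm_row e (S - T) = fm_row e S - fm_row e T.
Proof. by rewrite -scaleN1r fm_rowD fm_rowZ scaleN1r. Qed.

Lemma fm_row_starM e e' S T : star (fm_row e S) ** fm_row e' T =
  if e == e' then star S ** T else 0.
Proof.
have hb : mx_bounded (fm_row e' T) (mx_bd T).*2.
  move=> i j h /=; case: ifP => // _; apply: mx_bdP.
  case/orP: h => h; first by rewrite geq_half_double h.
  by rewrite (leq_trans _ h) ?orbT// -addnn leq_addr.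
apply: finmxP => i j; rewrite [LHS](fm_mulE _ _ (or_intror hb)).
rewrite (sum_double (fun k => (star (fm_row e S)) i k ** fm_row e' T k j)).
have -> : (if e == e' then star S ** T else 0) i j =
    if e == e' then (star S ** T) i j else 0 by case: (e == e').
rewrite [(star S ** T) _ _](fm_mulE _ _ (or_intror (@mx_bdP _ _ T))).
case: ifP => [/eqP <-|ee].
  apply: eq_bigr => k _ /=; rewrite uphalf_double doubleK odd_double/=.
  by case: e {hb} => /=; rewrite ?star0 ?smul0l ?add0r ?addr0.
rewrite big1// => k _ /=; rewrite uphalf_double doubleK odd_double/=.
by case: e e' {hb} ee => [] [] //= _; rewrite ?star0 ?smul0l ?smul0r ?addr0.
Qed.

Lemma fm_rowM_star e S T : fm_row e S ** star (fm_row e T) = fm_shift e (S ** star T).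
Proof.
apply: finmxP => i j.
rewrite [LHS](@sum_stable _ _ (fun k => fm_row e S i k ** star (fm_row e T) k j) _ (mx_bd S)).
- rewrite [RHS]/=; case: ifP => [/andP[/eqP ie /eqP je]|h].
    by apply: eq_bigr => k _; rewrite /= ie je eqxx.
  apply: big1 => k _ /=; case: eqP h => [_|]; last by rewrite smul0l.
  by case: eqP => //= _ _; rewrite star0 smul0r.
- by move=> k hk; rewrite mx_bdP ?smul0l// hk orbT.
- by move=> k hk /=; case: ifP => _; rewrite ?smul0l// [S _ _]mx_bdP ?smul0l// hk orbT.
Qed.

Lemma fm_row_norm e T : fm_norm (fm_row e T) = fm_norm T.
Proof.
have h := fm_norm_seminorm B.
apply/eqP; rewrite -(@eqrXn2 _ 2) ?fm_norm_ge0//.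
by rewrite -!(csn_star h) fm_row_starM eqxx.
Qed.

Lemma fm_row_ba e : bounded_additive (@fm_norm R B) (@fm_norm R B) (fm_row e).
Proof. by split; [exact: fm_rowB|exists 1 => // T; rewrite mul1r fm_row_norm]. Qed.

Definition stab_row e : stab B -> stab B :=
  @hc_map _ _ _ _ _ (fm_norm_seminorm B) (fm_norm_seminorm B) _ (fm_row_ba e).

Lemma stab_row_starM e e' x y : star (stab_row e x) ** stab_row e' y =
  if e == e' then star x ** y else 0.
Proof.
elim/hc_ind: x => u; elim/hc_ind: y => v.
rewrite /stab_row !hc_mapE !hc_pi_star.
have -> : (if e == e' then hc_pi (fm_norm_seminorm B) (cs_star (fm_norm_seminorm B) u) **
    hc_pi (fm_norm_seminorm B) v else 0) =
  if e == e' then hc_pi (fm_norm_seminorm B) (cs_mul (fm_norm_seminorm B)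
     (cs_star (fm_norm_seminorm B) u) v)
  else hc_of (fm_norm_seminorm B) 0.
  by case: ifP => // _; exact: hc_piM.
rewrite [LHS]hc_piM; case: ifP => ee.
  by apply: hc_pi_ext => n /=; rewrite fm_row_starM ee.
by apply: hc_pi_ext => n /=; rewrite fm_row_starM ee.
Qed.

Lemma stab_rowM_star e x y : stab_row e x ** star (stab_row e y) = stab_shift e (x ** star y).
Proof.
elim/hc_ind: x => u; elim/hc_ind: y => v.
rewrite /stab_row !hc_mapE !hc_pi_star [X in stab_shift e X]hc_piM stab_shiftE.
rewrite [LHS]hc_piM.
by apply: hc_pi_ext => n /=; rewrite fm_rowM_star.
Qed.

End RowIsometries.

Lemma parallelogram (R : realType) (C : cstarAlgType R) (u v : C) :
  (u + v) ** star (u + v) + (u - v) ** star (u - v) =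
  2%:C *: (u ** star u + v ** star v).
Proof.
have -> : 2%:C = 1 + 1 :> R[i] by rewrite -rmorphD.
rewrite scalerDl scale1r starD starB smulBl !smulDl !smulBr !smulDr.
move: (u ** star u) (u ** star v) (v ** star u) (v ** star v) => a b c d.
rewrite !opprB [LHS](AC ((2*2)*(2*2)) ((1*5*(4*7))*((2*6)*(3*8)))) /=.
by rewrite !subrr !addr0 addrACA.
Qed.

Lemma psd_Mstar_uin (R : realType) (C : cstarAlgType R) (x : C) : psd (uin (x ** star x)).
Proof. by rewrite uinM uin_star; exact: psd_Mstar. Qed.

Lemma psd_starM_uin (R : realType) (C : cstarAlgType R) (x : C) : psd (uin (star x ** x)).
Proof. by rewrite uinM uin_star; exact: psd_starM. Qed.

Lemma psdD_uin (R : realType) (C : cstarAlgType R) (x y : C) :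
  psd (uin x) -> psd (uin y) -> psd (uin (x + y)).
Proof. by rewrite uinD; exact: psdD. Qed.

Lemma psd_uin0 (R : realType) (C : cstarAlgType R) : psd (uin (0 : C)).
Proof. exact: psd0. Qed.

(* A C*-algebra with two isometries with orthogonal ranges in its multiplier
   algebra: [arow e] is left multiplication by the [e]-th one, [ash e] is the
   endomorphism it implements. *)
Structure ampAlg (R : realType) := AmpAlg {
  ampC :> cstarAlgType R;
  ash : bool -> ampC -> ampC;
  arow : bool -> ampC -> ampC;
  ashD : forall e x y, ash e (x + y) = ash e x + ash e y;
  ashZ : forall e (c : R[i]) x, ash e (c *: x) = c *: ash e x;
  ash_star : forall e x, ash e (star x) = star (ash e x);
  ashM2 : forall e e' x y, ash e x ** ash e' y = if e == e' then ash e (x ** y) else 0;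
  ash_norm : forall e x, rnorm (ash e x) <= rnorm x;
  arow_starM : forall e e' x y,
    star (arow e x) ** arow e' y = if e == e' then star x ** y else 0;
  arowM_star : forall e x y, arow e x ** star (arow e y) = ash e (x ** star y);
}.

(** * Direct sums up to Cuntz comparison *)

Section DirectSums.
Context (R : realType) (S : ampAlg R).
Implicit Types (a b c x y p q : S) (e d : R).

Definition asum x y : S := ash false x + ash true y.

Lemma asumD x y x' y' : asum x y + asum x' y' = asum (x + x') (y + y').
Proof. by rewrite /asum !ashD addrACA. Qed.

Lemma asumZ (k : R[i]) x y : k *: asum x y = asum (k *: x) (k *: y).
Proof. by rewrite /asum !ashZ scalerDr. Qed.

Lemma asumN x y : - asum x y = asum (- x) (- y).
Proof. by rewrite -[LHS]scaleN1r asumZ !scaleN1r. Qed.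

Lemma asum_star x y : star (asum x y) = asum (star x) (star y).
Proof. by rewrite /asum starD !ash_star. Qed.

Lemma asumM x y x' y' : asum x y ** asum x' y' = asum (x ** x') (y ** y').
Proof. by rewrite /asum smulDl !smulDr !ashM2/= addr0 add0r. Qed.

Lemma asum0 : asum 0 0 = 0.
Proof. by rewrite /asum -(scale0r 0) !ashZ !scale0r addr0. Qed.

Lemma ash_sqr (s : bool) x : star x = x ->
  ash s (x ** x) = arow s x ** star (arow s x).
Proof. by move=> sx; rewrite arowM_star sx. Qed.

(** Roots pushed into orthogonal ranges: for [x = halfl a], [star x ** x] is [a] itself and
    [x ** star x] its copy in one corner. This is the shape that [cuntz_orthogonal_sums]
    compares. *)
Definition halfl a := arow false (ssqrt a).
Definition halfr b := arow true (ssqrt b).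

Lemma asumE a b : psd (uin a) -> psd (uin b) ->
  asum a b = halfl a ** star (halfl a) + halfr b ** star (halfr b).
Proof.
move=> pa pb; rewrite /asum -{1}(ssqrtK pa) -{1}(ssqrtK pb).
by rewrite !ash_sqr// ssqrt_sa.
Qed.

Lemma halflM a : psd (uin a) -> star (halfl a) ** halfl a = a.
Proof. by move=> pa; rewrite arow_starM eqxx ssqrt_sa// ssqrtK. Qed.
Lemma halfrM a : psd (uin a) -> star (halfr a) ** halfr a = a.
Proof. by move=> pa; rewrite arow_starM eqxx ssqrt_sa// ssqrtK. Qed.
Lemma halfl_Mstar a : psd (uin a) -> halfl a ** star (halfl a) = ash false a.
Proof. by move=> pa; rewrite -ash_sqr ?ssqrt_sa// ssqrtK. Qed.
Lemma halfr_Mstar a : psd (uin a) -> halfr a ** star (halfr a) = ash true a.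
Proof. by move=> pa; rewrite -ash_sqr ?ssqrt_sa// ssqrtK. Qed.
Lemma half_lr a b : star (halfl a) ** halfr b = 0.
Proof. by rewrite arow_starM. Qed.
Lemma half_rl a b : star (halfr a) ** halfl b = 0.
Proof. by rewrite arow_starM. Qed.

Lemma psd_asum a b : psd (uin a) -> psd (uin b) -> psd (uin (asum a b)).
Proof.
by move=> pa pb; rewrite asumE//; apply: psdD_uin; exact: psd_Mstar_uin.
Qed.

Lemma un_asum x y : un (uin (asum x y)) <= un (uin x) + un (uin y).
Proof.
rewrite /asum uinD (le_trans (unD _ _))// !un_uin.
by rewrite lerD ?ash_norm.
Qed.

Lemma asumB x y x' y' : asum x y - asum x' y' = asum (x - x') (y - y').
Proof. by rewrite asumN asumD. Qed.

Lemma cuntz_asum a b a' b' : cuntz_sub a a' -> cuntz_sub b b' ->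
  cuntz_sub (asum a b) (asum a' b').
Proof.
move=> /cuntz_subP ha /cuntz_subP hb; apply/cuntz_subP => e e0.
have e2 : 0 < e / 2 by rewrite divr_gt0.
have [v hv] := ha _ e2; have [w hw] := hb _ e2.
exists (asum v w); rewrite asum_star !asumM -uinB asumB.
by rewrite (le_lt_trans (un_asum _ _))// (splitr e) !uinB ltrD.
Qed.

Lemma spoly_asum (P : {poly R}) a b : spoly P (asum a b) = asum (spoly P a) (spoly P b).
Proof.
rewrite /spoly; elim: (index_iota _ _) => [|n s IH].
  by rewrite !big_nil asum0.
rewrite !big_cons IH -asumD -asumZ; congr (_ *: _ + _).
by rewrite /spow; elim: n.-1 => //= m ->; rewrite asumM.
Qed.

Lemma asum_fcA (f : R -> R) a b : star a = a -> star b = b -> pap f -> f 0 = 0 ->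
  fcA f (asum a b) = asum (fcA f a) (fcA f b).
Proof.
move=> sa sb hf f0; have sab : star (asum a b) = asum a b by rewrite asum_star sa sb.
apply: uin_inj; apply: un_eq => e e0; have e4 : 0 < e / 4 by rewrite divr_gt0.
pose r := un (uin a) + un (uin b).
have r0 : 0 <= r by rewrite addr_ge0 ?un_ge0.
have [P [P0 hP]] := poly0_approx hf f0 r0 e4.
have app c : star c = c -> un (uin c) <= r -> un (uin (fcA f c) - uin (spoly P c)) <= e / 4.
  move=> sc cr; rewrite uin_fcA// uin_spoly// -fc_poly ?uin_sa//.
  apply: fc_near => //; [exact: uin_sa|exact: pap_poly|].
  by move=> t /Sp_le h; rewrite distrC hP// (le_trans h).
rewrite (le_trans (un_dist (uin (spoly P (asum a b))) _ _))//.
apply: (@le_trans _ _ (e / 4 + (e / 4 + e / 4))); last lra.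
rewrite lerD//; first by apply: app => //; exact: un_asum.
rewrite spoly_asum -uinB asumB (le_trans (un_asum _ _))// !uinB !(unBC (uin (spoly _ _))).
by rewrite lerD// app// /r ?lerDl ?lerDr un_ge0.
Qed.

Lemma asum_cutdown a b e : star a = a -> star b = b -> 0 <= e ->
  cutdown (asum a b) e = asum (cutdown a e) (cutdown b e).
Proof.
move=> sa sb e0; rewrite !cutdown_fcA//; last by rewrite asum_star sa sb.
rewrite asum_fcA//; first exact: pap_tcut.
by rewrite /tcut sub0r; apply/max_idPr; rewrite oppr_le0.
Qed.

Lemma cuntz_orthogonal2 p q p' q' : star p ** q = 0 -> star p' ** q' = 0 ->
  star p ** p = star p' ** p' -> star q ** q = star q' ** q' ->
  cuntz_sub (p ** star p + q ** star q) (p' ** star p' + q' ** star q').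
Proof.
move=> pq pq' pp qq; pose f (i : 'I_2) := if i == 0 then p else q.
pose g (i : 'I_2) := if i == 0 then p' else q'.
have qp : star q ** p = 0 by rewrite -[LHS]starK starM starK pq star0.
have qp' : star q' ** p' = 0 by rewrite -[LHS]starK starM starK pq' star0.
have := @cuntz_orthogonal_sums _ _ 2 f g; rewrite !big_ord_recl !big_ord0 !addr0; apply.
- by move=> [[|[|//]] ?] [[|[|//]] ?].
- by move=> [[|[|//]] ?] [[|[|//]] ?].
- by move=> [[|[|//]] ?].
Qed.

Lemma cuntz_asumC a b : psd (uin a) -> psd (uin b) -> cuntz_sub (asum a b) (asum b a).
Proof.
move=> pa pb; rewrite !asumE// [X in cuntz_sub _ X]addrC.
apply: cuntz_orthogonal2; rewrite ?half_lr ?half_rl//.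
  by rewrite halflM// halfrM.
by rewrite halflM// halfrM.
Qed.

Lemma ash_Mstar (s : bool) x :
  ash s (x ** star x) = arow s x ** star (arow s x).
Proof. by rewrite arowM_star. Qed.

(** Both bracketings are sums of [x ** star x] over three elements with orthogonal ranges; the
    corresponding [star x ** x] coincide, so only the ranges differ. *)
Lemma asumA_forms a b c : psd (uin a) -> psd (uin b) -> psd (uin c) ->
  let p (i : 'I_3) := if i == 0 then arow false (halfl a)
     else if i == 1 then arow false (halfr b) else halfr c in
  let q (i : 'I_3) := if i == 0 then halfl a
     else if i == 1 then arow true (halfl b) else arow true (halfr c) in
  [/\ asum (asum a b) c = \sum_i p i ** star (p i),
      asum a (asum b c) = \sum_i q i ** star (q i),
      forall i j, i != j -> star (p i) ** p j = 0,
      forall i j, i != j -> star (q i) ** q j = 0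
    & forall i, star (p i) ** p i = star (q i) ** q i].
Proof.
move=> pa pb pc p q; split.
- rewrite !big_ord_recl big_ord0 addr0 /p /= addrA.
  rewrite -(ash_Mstar false (halfl a)) -(ash_Mstar false (halfr b)).
  by rewrite -ashD -asumE// halfr_Mstar.
- rewrite !big_ord_recl big_ord0 addr0 /q /=.
  rewrite -(ash_Mstar true (halfl b)) -(ash_Mstar true (halfr c)).
  by rewrite -ashD -asumE// halfl_Mstar.
- move=> [[|[|[|//]]] ?] [[|[|[|//]]] ?] //= _; rewrite /p /= arow_starM//=.
    exact: half_lr.
  exact: half_rl.
- move=> [[|[|[|//]]] ?] [[|[|[|//]]] ?] //= _; rewrite /q /= arow_starM//=.
    exact: half_lr.
  exact: half_rl.
- move=> [[|[|[|//]]] ?]; rewrite /p /q /= ?arow_starM /= ?halflM// ?halfrM//.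
Qed.

Lemma cuntz_asumA a b c : psd (uin a) -> psd (uin b) -> psd (uin c) ->
  cuntz_sub (asum (asum a b) c) (asum a (asum b c)) /\
  cuntz_sub (asum a (asum b c)) (asum (asum a b) c).
Proof.
move=> pa pb pc; have [-> -> op oq pq] := asumA_forms pa pb pc.
by split; apply: cuntz_orthogonal_sums.
Qed.

Lemma ash0 (s : bool) : ash s (0 : S) = 0.
Proof. by have := ashZ s 0 (0 : S); rewrite !scale0r. Qed.

Lemma cuntz_asum0 a : psd (uin a) -> cuntz_sub (asum a 0) a /\ cuntz_sub a (asum a 0).
Proof.
move=> pa; have -> : asum a 0 = halfl a ** star (halfl a).
  by rewrite /asum ash0 addr0 -{1}(ssqrtK pa) ash_sqr// ssqrt_sa.
have h1 := cuntz_star_swap (star (halfl a)); rewrite starK halflM// in h1.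
by have h2 := cuntz_star_swap (halfl a); rewrite halflM// in h2.
Qed.

(** [x = halfl a + halfr b] has [star x ** x = a + b], while the parallelogram law bounds
    [x ** star x] by twice the direct sum. *)
Lemma cuntz_add_asum a b : psd (uin a) -> psd (uin b) -> cuntz_sub (a + b) (asum a b).
Proof.
move=> pa pb; have pab := psd_asum pa pb.
pose x := halfl a + halfr b.
have xx : star x ** x = a + b.
  by rewrite /x starD smulDl !smulDr half_lr half_rl addr0 add0r halflM// halfrM.
rewrite -xx; apply: (cuntz_trans (cuntz_star_swap x)).
have h2 : cuntz_sub (2%:C *: asum a b) (asum a b) by apply: cuntz_scale.
apply: cuntz_trans h2; apply: cuntz_ple; first exact: psd_Mstar_uin.
  by rewrite uinZ rs_scale; apply: psdZ.
rewrite asumE// -parallelogram /ple -uinB addrC addKr.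
exact: psd_Mstar_uin.
Qed.

Lemma asum_orth p q : star p ** q = 0 ->
  cuntz_sub (asum (p ** star p) (q ** star q)) (p ** star p + q ** star q) /\
  cuntz_sub (p ** star p + q ** star q) (asum (p ** star p) (q ** star q)).
Proof.
move=> pq; have p1 := psd_starM_uin p; have p2 := psd_starM_uin q.
have sp x : cuntz_sub (x ** star x) (star x ** x).
  by have := cuntz_star_swap (star x); rewrite starK.
split; last by apply: cuntz_add_asum; exact: psd_Mstar_uin.
apply: (@cuntz_trans _ _ (asum (star p ** p) (star q ** q))).
  by apply: cuntz_asum; exact: sp.
rewrite asumE//; apply: cuntz_orthogonal2; rewrite ?half_lr ?halflM ?halfrM//.
Qed.

Definition amul k a : S := iter k (asum a) 0.

Lemma psd_amul k a : psd (uin a) -> psd (uin (amul k a)).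
Proof. by move=> pa; elim: k => [|k IH]; [exact: psd_uin0|exact: psd_asum]. Qed.

Lemma cuntz_amul k a b : cuntz_sub a b -> cuntz_sub (amul k a) (amul k b).
Proof.
move=> ab; elim: k => [|k IH]; first exact: cuntz_0sub.
exact: cuntz_asum.
Qed.

Lemma cutdown_0 e : 0 <= e -> cutdown (0 : S) e = 0.
Proof.
move=> e0; have p0 : psd (uin (0 : S)) := psd_uin0 S.
apply: uin_inj; apply: psd_antisym; first exact: psd_cutdown.
by rewrite -sub0r -uin0; exact: cutdown_ple.
Qed.

Lemma amul_cutdown k a e : psd (uin a) -> 0 <= e ->
  cutdown (amul k a) e = amul k (cutdown a e).
Proof.
move=> pa e0; elim: k => [|k IH]; first exact: cutdown_0.
rewrite [amul k.+1 a]/(asum a (amul k a)) asum_cutdown ?IH//.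
  exact: psd_uin_sa.
by apply: psd_uin_sa; exact: psd_amul.
Qed.

Lemma cuntz_sum_amul (n : nat) (F : nat -> S) b : psd (uin b) ->
  (forall i, psd (uin (F i))) -> (forall i, cuntz_sub (F i) b) ->
  cuntz_sub (\sum_(i < n) F i) (amul n b).
Proof.
move=> pb pF Fb; elim: n => [|n IH]; first by rewrite big_ord0; exact: cuntz_0sub.
have pS : psd (uin (\sum_(i < n) F i)).
  by rewrite uin_sum; apply: psd_sumr => i; exact: pF.
rewrite big_ord_recr /= addrC; apply: (cuntz_trans (cuntz_add_asum (pF n) pS)).
exact: cuntz_asum.
Qed.

End DirectSums.

(** * The Cuntz semigroup as a monoid *)

Section StabilizationAmplified.
Context (R : realType) (B : cstarAlgType R).

Lemma stab_shift_norm (s : bool) (x : stab B) : rnorm (stab_shift s x) <= rnorm x.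
Proof.
rewrite !rnorm_hc; elim/hc_ind: x => u; rewrite stab_shiftE.
apply: (ler_cvg_to (@hc_normE _ _ _ _ _) (@hc_normE _ _ _ _ _)).
by near=> n; exact: fm_norm_shift.
Unshelve. all: by end_near. Qed.

Definition stab_amp : ampAlg R := @AmpAlg R (stab B) (@stab_shift R B) (@stab_row R B)
  (@stab_shiftD R B) (@stab_shiftZ R B) (@stab_shift_star R B) (@stab_shiftM2 R B)
  stab_shift_norm (@stab_row_starM R B) (@stab_rowM_star R B).

End StabilizationAmplified.

Section CuntzClasses.
Context (R : realType) (C : cstarAlgType R).
Implicit Types (a b c : C).

Lemma cuntz_class_eq a b : cuntz_sub a b -> cuntz_sub b a -> cuntz_class a = cuntz_class b.
Proof.
move=> ab ba; apply/seteqP; split=> c [pc [h1 h2]]; split=> //; split.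
- exact: cuntz_trans ba h1.
- exact: cuntz_trans h2 ab.
- exact: cuntz_trans ab h1.
- exact: cuntz_trans h2 ba.
Qed.

Lemma cuntz_class_sub a b : psd (uin b) -> cuntz_class a = cuntz_class b ->
  cuntz_sub a b /\ cuntz_sub b a.
Proof.
move=> pb ab; have : cuntz_class a b.
  by rewrite ab; split; [apply/positiveP|split; exact: cuntz_refl].
by case=> _ [].
Qed.

End CuntzClasses.

Section CuntzMonoid.
Context (R : realType) (B : cstarAlgType R).
Local Notation S := (stab_amp B).
Implicit Types (x y z : Cu B) (a b c : S).

Lemma cu_rep_psd x a : cu_rep x a -> psd (uin a).
Proof. by move=> [/positiveP]. Qed.

Lemma cu_rep_sub x a b : cu_rep x a -> cu_rep x b -> cuntz_sub a b.
Proof.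
move=> ra rb; have [] // := @cuntz_class_sub _ S a b (cu_rep_psd rb).
by rewrite -ra.2 -rb.2.
Qed.

Lemma cu_rep_class a (pa : positive a) : cu_rep (cu_class pa) a.
Proof. by split. Qed.

Lemma cu_eq x y a b : cu_rep x a -> cu_rep y b -> cuntz_sub a b -> cuntz_sub b a -> x = y.
Proof.
move=> [_ xa] [_ yb] ab ba; apply: eq_sig_hprop; first by move=> *; exact: Prop_irrelevance.
by rewrite xa yb; exact: cuntz_class_eq.
Qed.

Lemma cu_rep_eq x a b : cu_rep x a -> psd (uin b) -> cuntz_sub a b -> cuntz_sub b a ->
  cu_rep x b.
Proof.
move=> [pa xa] pb ab ba; split; first exact/positiveP.
by rewrite xa; exact: cuntz_class_eq.
Qed.

Lemma cu_leP x y a b : cu_rep x a -> cu_rep y b -> cu_le x y <-> cuntz_sub a b.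
Proof.
move=> ra rb; split=> [[a' [b' [ra' rb' ab]]]|ab]; last by exists a, b.
apply: (cuntz_trans (cu_rep_sub ra ra')).
exact: cuntz_trans ab (cu_rep_sub rb' rb).
Qed.

(** Way-below may be tested on any representatives because a change of representative on the right
    keeps some cut-down, by [cuntz_room]. *)
Lemma cu_llP x y a b : cu_rep x a -> cu_rep y b ->
  cu_ll x y <-> exists2 e, 0 < e & cuntz_sub a (cutdown b e).
Proof.
move=> ra rb; split=> [[a' [b' [ra' rb' [e e0 ab]]]]|h]; last by exists a, b.
have h := cu_rep_sub rb' rb.
have [d d0 hd] := cuntz_room (cu_rep_psd rb') (cu_rep_psd rb) e0 h.
by exists d => //; apply: (cuntz_trans (cu_rep_sub ra ra')); exact: cuntz_trans ab hd.
Qed.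

Lemma cu_add_rep x y a b : cu_rep x a -> cu_rep y b -> cu_rep (cu_add x y) (asum a b).
Proof.
move=> ra rb; have rx := cu_reprP x; have ry := cu_reprP y.
apply: (@cu_rep_eq _ (asum (cu_repr x : S) (cu_repr y : S))); first exact: cu_rep_class.
- by apply: psd_asum; [exact: cu_rep_psd ra|exact: cu_rep_psd rb].
- by apply: cuntz_asum; [exact: cu_rep_sub rx ra|exact: cu_rep_sub ry rb].
- by apply: cuntz_asum; [exact: cu_rep_sub ra rx|exact: cu_rep_sub rb ry].
Qed.

Lemma cu0_rep : cu_rep (@cu0 R B) (0 : S).
Proof. exact: cu_rep_class. Qed.

Fact cu_addC : commutative (@cu_add R B).
Proof.
move=> x y; have rx := cu_reprP x; have ry := cu_reprP y.
have px := cu_rep_psd rx; have py := cu_rep_psd ry.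
apply: (cu_eq (cu_add_rep rx ry) (cu_add_rep ry rx)); exact: cuntz_asumC.
Qed.

Fact cu_addA : associative (@cu_add R B).
Proof.
move=> x y z; have rx := cu_reprP x; have ry := cu_reprP y; have rz := cu_reprP z.
have px := cu_rep_psd rx; have py := cu_rep_psd ry; have pz := cu_rep_psd rz.
have [h1 h2] := cuntz_asumA px py pz.
exact: (cu_eq (cu_add_rep rx (cu_add_rep ry rz)) (cu_add_rep (cu_add_rep rx ry) rz)).
Qed.

Fact cu_add0 : left_id (@cu0 R B) (@cu_add R B).
Proof.
move=> x; rewrite cu_addC; have rx := cu_reprP x.
have [h1 h2] := cuntz_asum0 (cu_rep_psd rx).
exact: (cu_eq (cu_add_rep rx cu0_rep) rx).
Qed.

HB.instance Definition _ := gen_eqMixin (Cu B).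
HB.instance Definition _ := gen_choiceMixin (Cu B).
HB.instance Definition _ := GRing.isNmodule.Build (Cu B) cu_addA cu_addC cu_add0.

Lemma cu_mulE k x : cu_mul k x = x *+ k.
Proof.
elim: k => [|k IH]; first by rewrite mulr0n.
by rewrite mulrS -IH.
Qed.

Lemma cu_mul_rep k x a : cu_rep x a -> cu_rep (x *+ k) (amul k a).
Proof.
move=> ra; rewrite -cu_mulE; elim: k => [|k IH]; first exact: cu0_rep.
exact: cu_add_rep.
Qed.

Lemma cu_le_refl x : cu_le x x.
Proof.
by have rx := cu_reprP x; exact: (cu_leP rx rx).2 (cu_rep_sub rx rx).
Qed.

Lemma cu_le_trans y x z : cu_le x y -> cu_le y z -> cu_le x z.
Proof.
have rx := cu_reprP x; have ry := cu_reprP y; have rz := cu_reprP z.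
move=> /(cu_leP rx ry) xy /(cu_leP ry rz) yz; apply/(cu_leP rx rz).
exact: cuntz_trans xy yz.
Qed.

Lemma cu_leD x y x' y' : cu_le x x' -> cu_le y y' -> cu_le (x + y) (x' + y').
Proof.
have rx := cu_reprP x; have ry := cu_reprP y.
have rx' := cu_reprP x'; have ry' := cu_reprP y'.
move=> /(cu_leP rx rx') xy /(cu_leP ry ry') yz.
apply/(cu_leP (cu_add_rep rx ry) (cu_add_rep rx' ry')); exact: cuntz_asum.
Qed.

Lemma cu_le0x x : cu_le 0 x.
Proof. by have rx := cu_reprP x; apply/(cu_leP cu0_rep rx); exact: cuntz_0sub. Qed.

Lemma cu_le_addr x y : cu_le x (x + y).
Proof. by rewrite -{1}(addr0 x); apply: cu_leD; [exact: cu_le_refl|exact: cu_le0x]. Qed.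

Lemma cu_leMn x y k : cu_le x y -> cu_le (x *+ k) (y *+ k).
Proof.
move=> xy; elim: k => [|k IH]; first by rewrite !mulr0n; exact: cu_le_refl.
by rewrite !mulrS; exact: cu_leD.
Qed.

Lemma cu_leMn2 x m n : (m <= n)%N -> cu_le (x *+ m) (x *+ n).
Proof. by move=> mn; rewrite -(subnKC mn) mulrnDr; exact: cu_le_addr. Qed.

Lemma almost_unperforatedP : almost_unperforated B ->
  forall x y k, cu_le (x *+ k.+1) (y *+ k) -> cu_le x y.
Proof. by move=> h x y k xy; apply: h; exists k; rewrite !cu_mulE. Qed.

(** Iterating the first inequality gives [(m + 1) x <= x + 2 m y]. At [m = k] the remaining [x] is
    absorbed by [k y], so [(k + 1) x <= k (3 y)], and unperforation applies. *)
Lemma cu_le_cancel x y k : almost_unperforated B ->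
  cu_le (x *+ 2) (x + y *+ 2) -> cu_le x (y *+ k) -> cu_le x (y *+ 3).
Proof.
move=> hu xy xk.
have step m : cu_le (x *+ m.+1) (x + y *+ (2 * m)).
  elim: m => [|m IH]; first by rewrite muln0 mulr0n addr0 mulr1n; exact: cu_le_refl.
  rewrite mulrSr; apply: (@cu_le_trans (x + y *+ (2 * m) + x)).
    by apply: cu_leD => //; exact: cu_le_refl.
  have -> : x + y *+ (2 * m.+1) = x + y *+ 2 + y *+ (2 * m).
    by rewrite mulnS [y *+ _]mulrnDr addrA.
  rewrite addrAC -mulr2n.
  by apply: cu_leD => //; exact: cu_le_refl.
apply: (almost_unperforatedP hu (k := k)).
apply: cu_le_trans (step k) _.
have -> : (y *+ 3) *+ k = y *+ k + y *+ (2 * k).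
  by rewrite -mulrnA -mulrnDr; congr (_ *+ _); rewrite mulSn mulnC.
by apply: cu_leD => //; exact: cu_le_refl.
Qed.

Lemma almost_divisible_amul a e N : almost_divisible B -> psd (uin a) -> 0 < e ->
  exists c, [/\ psd (uin c), cuntz_sub (amul N c) a & cuntz_sub (cutdown a e) (amul N.+1 c)].
Proof.
move=> hd pa e0; have pc := psd_cutdown pa (ltW e0).
have /positiveP pa' := pa; have /positiveP pc' := pc.
have ra := cu_rep_class pa'; have rc := cu_rep_class pc'.
have ll : cu_ll (cu_class pc') (cu_class pa').
  by apply/(cu_llP rc ra); exists e => //; exact: cuntz_refl.
have [y [y1 y2]] := hd _ _ ll N; rewrite !cu_mulE in y1 y2.
have ry := cu_reprP y; exists (cu_repr y); split; first exact: cu_rep_psd ry.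
  by apply/(cu_leP (cu_mul_rep _ ry) ra).
by apply/(cu_leP rc (cu_mul_rep _ ry)).
Qed.

End CuntzMonoid.

(** * Partitions of unity and continuous functions *)

Section PartitionsOfUnity.
Context (R : realType) (X : metricType R).
Implicit Types (x y : X) (V : set X).

Definition bumpset V x : set R :=
  [set r | r = 1 \/ exists2 y, ~ V y & r = Num.min 1 (mdist x y)].

(* [min 1 (dist x (~` V))], equal to [1] when [V] is the whole space *)
Definition bump V x : R := inf (bumpset V x).

Lemma bumpset_lb V x : lbound (bumpset V x) 0.
Proof. by move=> r [->|[y _ ->]]; rewrite ?ler01// le_min ler01 mdist_ge0. Qed.

Lemma bumpset1 V x : bumpset V x 1. Proof. by left. Qed.

Lemma bump_le V x r : bumpset V x r -> bump V x <= r.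
Proof. by apply: ge_inf; exists 0; exact: bumpset_lb. Qed.

Lemma bump_ge V x r : lbound (bumpset V x) r -> r <= bump V x.
Proof. by move=> h; apply: lb_le_inf => //; exists 1; exact: bumpset1. Qed.

Lemma bump_ge0 V x : 0 <= bump V x.
Proof. by apply: bump_ge; exact: bumpset_lb. Qed.

Lemma bump_le1 V x : bump V x <= 1.
Proof. by apply: bump_le; exact: bumpset1. Qed.

Lemma bump_out V x : ~ V x -> bump V x = 0.
Proof.
move=> Vx; apply/le_anti; rewrite bump_ge0 andbT; apply: bump_le; right.
by exists x => //; rewrite mdistxx; apply/esym/min_idPr.
Qed.

Lemma bump_gt0 V x : open V -> V x -> 0 < bump V x.
Proof.
move=> oV Vx; have /nbhs_ballP[e e0 eV] : nbhs x V by apply: open_nbhs_nbhs.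
apply: (@lt_le_trans _ _ (Num.min 1 e)); first by rewrite lt_min ltr01.
apply: bump_ge => r [->|[y Vy ->]]; first by rewrite ge_min lexx.
rewrite le_min ge_min lexx/= ge_min; apply/orP; right.
rewrite leNgt; apply/negP => h; apply: Vy; apply: eV.
by rewrite ballEmdist.
Qed.

Lemma bump_lip V x y : bump V x - bump V y <= mdist x y.
Proof.
rewrite lerBlDr -lerBlDl; apply: bump_ge => r; rewrite lerBlDr => -[->|[z Vz ->]].
  by rewrite (le_trans (bump_le1 _ _))// lerDl mdist_ge0.
apply: (@le_trans _ _ (Num.min 1 (mdist x z))); first by apply: bump_le; right; exists z.
have := metric_triangle x y z; have := mdist_ge0 x y.
by have [h1|h1] := leP 1 (mdist x z); have [h2|h2] := leP 1 (mdist y z); lra.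
Qed.

Lemma bump_continuous V : continuous (bump V : X -> R).
Proof.
move=> x; apply/cvgrPdist_lt => e e0.
have : nbhs x (ball x e) by exact: nbhsx_ballx.
apply: filterS => y; rewrite ballEmdist/= => xy.
rewrite (le_lt_trans _ xy)// ler_norml bump_lip andbT lerNl opprB.
by rewrite metric_sym bump_lip.
Qed.

Lemma continuous_prod (I : Type) (s : seq I) (F : I -> X -> R) :
  (forall i, continuous (F i)) -> continuous (fun x => \prod_(i <- s) F i x).
Proof.
move=> h; elim: s => [|i s IH] x.
  by rewrite (_ : (fun x => _) = cst 1); [exact: cst_continuous|apply/funext => y; rewrite big_nil].
rewrite (_ : (fun x => _) = (fun x => F i x * \prod_(i <- s) F i x)).
  by apply: cvgM; [exact: h|exact: IH].
by apply/funext => y; rewrite big_cons.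
Qed.

Lemma continuous_sumr (I : Type) (s : seq I) (F : I -> X -> R) :
  (forall i, continuous (F i)) -> continuous (fun x => \sum_(i <- s) F i x).
Proof.
move=> h; elim: s => [|i s IH] x.
  by rewrite (_ : (fun x => _) = cst 0); [exact: cst_continuous|apply/funext => y; rewrite big_nil].
rewrite (_ : (fun x => _) = (fun x => F i x + \sum_(i <- s) F i x)).
  by apply: cvgD; [exact: h|exact: IH].
by apply/funext => y; rewrite big_cons.
Qed.

Lemma continuous_max0 (f : X -> R) : continuous f -> continuous (fun x => Num.max 0 (f x)).
Proof.
move=> cf x; apply/cvgrPdist_lt => e e0; have /cvgrPdist_lt/(_ _ e0) := cf x.
apply: filterS => y; apply: le_lt_trans.
by rewrite /Num.max; case: ifP; case: ifP; rewrite ?subrr ?normr0// => h1 h2;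
  rewrite ler_norml; apply/andP; split; rewrite ?ler_norml; case: (ler0P (f x - f y)); lra.
Qed.

Record ufun := Ufun {
  uf :> X -> R;
  uf_cont : continuous uf;
  uf_01 : forall x, 0 <= uf x <= 1;
}.

Lemma partition_normalize (J : finType) (f : J -> X -> R) :
  (forall j, continuous (f j)) -> (forall j x, 0 <= f j x) ->
  (forall x, exists j, 0 < f j x) ->
  exists h : J -> ufun, (forall j x, h j x != 0 -> 0 < f j x) /\
    forall x, \sum_j h j x = 1.
Proof.
move=> cf f0 fp; pose s x := \sum_j f j x.
have s0 x : 0 < s x.
  have [j jx] := fp x; rewrite /s (bigD1 j)//=; apply: ltr_wpDr => //.
  by apply: sumr_ge0 => i _; exact: f0.
have cs : continuous s by exact: continuous_sumr.
have ch j : continuous (fun x => f j x / s x).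
  move=> x; apply: cvgM; first exact: cf.
  by apply: cvgV; [rewrite gt_eqF|exact: cs].
have h01 j x : 0 <= f j x / s x <= 1.
  rewrite divr_ge0 ?(ltW (s0 x))//= ler_pdivrMr// mul1r /s (bigD1 j)//= lerDl.
  by rewrite sumr_ge0// => i _; exact: f0.
exists (fun j => Ufun (ch j) (h01 j)); split=> [j x /= h|x /=].
  rewrite lt_def f0 andbT; apply: contraNneq h => ->; by rewrite mul0r.
by rewrite -mulr_suml -/(s x) mulfV// gt_eqF.
Qed.

Lemma partition_of_unity (J : finType) (V : J -> set X) : (forall j, open (V j)) ->
  \bigcup_j V j = [set: X] ->
  exists h : J -> ufun, (forall j x, h j x != 0 -> V j x) /\
    forall x, \sum_j h j x = 1.
Proof.
move=> oV cV.
have [|||h [h1 h2]] := @partition_normalize J (fun j => bump (V j)).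
- by move=> j; exact: bump_continuous.
- by move=> j x; exact: bump_ge0.
- move=> x; have : (\bigcup_j V j) x by rewrite cV.
  by move=> [j _ jx]; exists j; exact: bump_gt0.
exists h; split=> // j x /h1; apply: contraPP => /bump_out ->.
by rewrite ltxx.
Qed.

(* The sets [W_s = {x | h_j x > h_k x for j in s, k not in s}] with [#|s|] fixed
   are pairwise disjoint, so the cardinal of [s] is a colour. *)
Lemma colored_partition (n : nat) (J : finType) (V : J -> set X) :
  (forall j, open (V j)) -> \bigcup_j V j = [set: X] ->
  (forall x, (#|[pred j | x \in V j]| <= n.+1)%N) ->
  exists (K : finType) (h : K -> ufun) (col : K -> 'I_n.+1),
  [/\ forall x, \sum_k h k x = 1,
      forall k, (exists x, h k x != 0) -> exists j, forall x, h k x != 0 -> V j x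
    & forall k k' x, k != k' -> col k = col k' -> h k x * h k' x = 0].
Proof.
move=> oV cV ord.
pose b j := bump (V j).
(* The factors [b j] keep the support inside each [V j] with [j] in [s]; cardinals outside the range
   from [1] to [n.+1] are switched off, so that they do not need a colour of their own. *)
pose mu (s : {set J}) x : R := if (0 < #|s| <= n.+1)%N then
  \prod_(j <- enum s) (b j x * \prod_(k <- enum (~: s)) Num.max 0 (b j x - b k x)) else 0.
have cmu s : continuous (mu s).
  have [hs|/negPf hs] := boolP (0 < #|s| <= n.+1)%N; last first.
    by rewrite /mu hs => x; exact: cvg_cst.
  rewrite /mu hs; apply: continuous_prod => j x; apply: cvgM; first exact: bump_continuous.
  apply: continuous_prod => k; apply: continuous_max0 => y.
  by apply: cvgB; exact: bump_continuous.
have m0 j k x : 0 <= Num.max 0 (b j x - b k x) by rewrite le_max lexx.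
have mu0 s x : 0 <= mu s x.
  rewrite /mu; case: ifP => // _; apply: prodr_ge0 => j _.
  by rewrite mulr_ge0 ?bump_ge0//; apply: prodr_ge0.
have mup s x j : mu s x != 0 -> j \in s -> b j x != 0 /\
    forall k, k \notin s -> b k x < b j x.
  rewrite /mu; case: ifP => [_|_]; last by rewrite eqxx.
  rewrite prodf_seq_neq0 => /allP h js.
  have /h : j \in enum s by rewrite mem_enum.
  rewrite /= mulf_eq0 negb_or => /andP[-> ]; rewrite prodf_seq_neq0 => /allP g.
  split=> // k ks; have /g : k \in enum (~: s) by rewrite mem_enum finset.inE.
  by rewrite /= /Num.max; case: ifP => [|_]; rewrite ?eqxx// subr_gt0.
have mux x : exists s, 0 < mu s x.
  (* For this choice the functions with index outside [s] vanish at [x], so every difference in the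
     product is a positive [b j x]. *)
  pose s : {set J} := finset (fun j => b j x != 0).
  have [j0 _ jx] : (\bigcup_j V j) x by rewrite cV.
  have bs : j0 \in s by rewrite /s finset.inE gt_eqF// bump_gt0.
  exists s; rewrite lt_def mu0 andbT /mu.
  have -> : (0 < #|s| <= n.+1)%N.
    apply/andP; split; first by apply/card_gt0P; exists j0.
    apply: leq_trans (ord x); apply: subset_leq_card; apply/fintype.subsetP => j.
    rewrite /s !finset.inE => h.
    have Vj : V j x by apply: contrapT => /bump_out bj; rewrite /b bj eqxx in h.
    by apply/mem_set.
  rewrite prodf_seq_neq0; apply/allP => j; rewrite mem_enum => js /=.
  have bj : b j x != 0 by move: js; rewrite /s finset.inE.
  rewrite mulf_neq0// prodf_seq_neq0; apply/allP => k; rewrite mem_enum /s !finset.inE negbK => /eqP bk.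
  by rewrite /= bk subr0 max_r ?bump_ge0.
have [h [h1 h2]] := partition_normalize cmu mu0 mux.
(* The remainder only makes the colour total: where [mu s] is nonzero, [#|s|.-1] is already below
   [n.+1]. *)
have hcol (s : {set J}) : (#|s|.-1 %% n.+1 < n.+1)%N by rewrite ltn_mod.
exists {set J}, h, (fun s => Ordinal (hcol s)); split=> // [s [x0 hx0]|s t x st sct].
  have [j js] : exists j, j \in s.
    apply/card_gt0P; move: (h1 _ _ hx0); rewrite /mu; case: ifP => [/andP[]//|].
    by rewrite ltxx.
  exists j => x /h1; rewrite lt_def => /andP[mx _].
  have [bj _] := mup _ _ _ mx js; apply: contrapT => /bump_out b0.
  by rewrite /b b0 eqxx in bj.
apply/eqP; rewrite mulf_eq0; apply/negPn/negP; rewrite negb_or => /andP[hs ht].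
have size (u : {set J}) : h u x != 0 -> (0 < #|u| <= n.+1)%N.
  by move=> /h1; rewrite /mu; case: ifP => //; rewrite ltxx.
have [s0 s1] := andP (size _ hs); have [t0 t1] := andP (size _ ht).
have cst : #|s| = #|t|.
  move/(congr1 val): sct => /=; rewrite !modn_small ?prednK//.
  by move=> /(congr1 S); rewrite !prednK.
(* Distinct sets of equal size each have an element outside the other; these two elements give
   opposite strict inequalities at [x]. *)
have [j js jt] : exists2 j, j \in s & j \notin t.
  apply/subsetPn; apply: contra st => sub.
  by rewrite eqEcard sub cst leqnn.
have [k kt ks] : exists2 k, k \in t & k \notin s.
  apply/subsetPn; apply: contra st => sub.
  by rewrite eq_sym eqEcard sub cst leqnn.
have mus : mu s x != 0 by rewrite gt_eqF// h1.
have mut : mu t x != 0 by rewrite gt_eqF// h1.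
have [_ /(_ _ ks) e1] := mup _ _ _ mus js.
have [_ /(_ _ jt) e2] := mup _ _ _ mut kt.
by have := lt_trans e1 e2; rewrite ltxx.
Qed.

End PartitionsOfUnity.

Section RealTricks.
Context (R : realType).

(** The supremum [s] satisfies [s^2 <= c s]. A crude uniform bound, needed for [s] to exist, thus
    becomes the sharp one. *)
Lemma le_of_squares (I : Type) (F : I -> R) (c : R) : 0 <= c -> (forall i, 0 <= F i) ->
  (exists M, forall i, F i <= M) -> (forall i, exists j, F i ^+ 2 <= c * F j) ->
  forall i, F i <= c.
Proof.
move=> c0 F0 [M FM] Fsq i; pose s := sup (range F).
have ub : has_ubound (range F) by exists M => _ [j _ <-].
have Fs j : F j <= s by apply: ub_le_sup => //; exists j.
have s0 : 0 <= s := le_trans (F0 i) (Fs i).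
have h : s <= Num.sqrt (c * s).
  apply: ge_sup; first by exists (F i); exists i.
  move=> _ [j _ <-]; have [k hk] := Fsq j.
  rewrite -[leLHS]ger0_norm// -sqrtr_sqr ler_wsqrtr// (le_trans hk)//.
  exact: ler_wpM2l.
apply: (le_trans (Fs i)).
have : s ^+ 2 <= c * s by rewrite -[leRHS]sqr_sqrtr ?mulr_ge0// lerXn2r ?nnegrE ?sqrtr_ge0.
have [->//|sn] := eqVneq s 0.
by rewrite expr2 ler_pM2r// lt_def sn.
Qed.

(** The constant [K] disappears since powers of [y / x] tend to [0] when [y < x]. Combined with the
    C*-identity, which computes norms of iterated squares, it removes the number of summands from an
    estimate. *)
Lemma le_of_powers (x y K : R) : 0 <= x -> 0 <= y ->
  (forall j, x ^+ (2 ^ j) <= K * y ^+ (2 ^ j)) -> x <= y.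
Proof.
move=> x0 y0 h; rewrite leNgt; apply/negP => yx.
have xp : 0 < x := le_lt_trans y0 yx.
pose z := y / x; have z0 : 0 <= z by rewrite divr_ge0.
have z1 : z < 1 by rewrite ltr_pdivrMr// mul1r.
have K0 : 0 < `|K| + 1 by rewrite ltr_wpDl.
have /cvgrPdist_lt/(_ _ (divr_gt0 ltr01 K0))[N _ hN] : (fun n => z ^+ n) @ \oo --> (0 : R).
  by apply: cvg_expr; rewrite ger0_norm.
have := hN (2 ^ N)%N (ltnW (ltn_expl N (ltnSn 1))).
rewrite /= sub0r normrN ger0_norm ?exprn_ge0// ltr_pdivlMr// => h1.
have : x ^+ (2 ^ N) <= K * z ^+ (2 ^ N) * x ^+ (2 ^ N).
  by rewrite -mulrA -exprMn /z divfK ?gt_eqF.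
rewrite -[leLHS]mul1r ler_pM2r ?exprn_gt0// => h3.
have : K * z ^+ (2 ^ N) < 1.
  apply: le_lt_trans h1; rewrite mulrC ler_wpM2l ?exprn_ge0//.
  by rewrite (le_trans (ler_norm K))// lerDl.
by rewrite ltNge h3.
Qed.

End RealTricks.

Section CompletionMaps.
Context (R : realType) (V : starAlgType R) (p : V -> R) (hp : cstar_seminorm p).

Lemma hc_ofD (a b : V) : hc_of hp (a + b) = hc_of hp a + hc_of hp b.
Proof. by rewrite hc_piD; apply: hc_pi_ext. Qed.
Lemma hc_ofZ (c : R[i]) (a : V) : hc_of hp (c *: a) = c *: hc_of hp a.
Proof. by rewrite hc_piZ; apply: hc_pi_ext. Qed.
Lemma hc_ofM (a b : V) : hc_of hp (a ** b) = hc_of hp a ** hc_of hp b.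
Proof. by rewrite [RHS]hc_piM; apply: hc_pi_ext. Qed.
Lemma hc_of_star (a : V) : hc_of hp (star a) = star (hc_of hp a).
Proof. by rewrite hc_pi_star; apply: hc_pi_ext. Qed.

Lemma hc_of_sum (I : Type) (s : seq I) (F : I -> V) :
  hc_of hp (\sum_(i <- s) F i) = \sum_(i <- s) hc_of hp (F i).
Proof. by apply: (big_morph (hc_of hp)); [exact: hc_ofD|]. Qed.

Lemma hc_approx (x : hcompletion hp) (e : R) : 0 < e -> exists a, rnorm (x - hc_of hp a) <= e.
Proof. exact: hc_dense. Qed.

Lemma rnorm_hc_of (a : V) : rnorm (hc_of hp a) = p a.
Proof. exact: hc_norm_of. Qed.

End CompletionMaps.

Lemma cstar_seminorm_comp (R : realType) (V W : starAlgType R) (p : W -> R) (f : V -> W) :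
  cstar_seminorm p -> (forall x y, f (x + y) = f x + f y) ->
  (forall (c : R[i]) x, f (c *: x) = c *: f x) ->
  (forall x y, f (x ** y) = f x ** f y) -> (forall x, f (star x) = star (f x)) ->
  cstar_seminorm (p \o f).
Proof.
move=> hp fD fZ fM fs; split=> [x y|c x|x y|x] /=.
- by rewrite fD (csn_triangle hp).
- by rewrite fZ (csn_scale hp).
- by rewrite fM (csn_mul hp).
- by rewrite fM fs (csn_star hp).
Qed.

Lemma fm_norm_unit (R : realType) (B : cstarAlgType R) i j (b : B) :
  fm_norm (fm_unit i j b) <= rnorm b.
Proof. by apply: fm_norm_leP => p [_ h]. Qed.

Section UfunOperations.
Context (R : realType) (X : metricType R).
Implicit Types (h k : ufun X).

Lemma ufunM_cont h k : continuous (fun x => h x * k x).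
Proof. by move=> x; apply: cvgM; exact: uf_cont. Qed.
Lemma ufunM_01 h k x : 0 <= h x * k x <= 1.
Proof.
have /andP[h0 h1] := uf_01 h x; have /andP[k0 k1] := uf_01 k x.
by rewrite mulr_ge0//= mulr_ile1.
Qed.
Definition ufunM h k := Ufun (@ufunM_cont h k) (ufunM_01 h k).

Lemma ufun1_cont : continuous (fun _ : X => 1 : R).
Proof. by move=> x; exact: cvg_cst. Qed.
Lemma ufun1_01 (x : X) : 0 <= (1 : R) <= 1. Proof. by rewrite ler01 lexx. Qed.
Definition ufun1 := Ufun ufun1_cont ufun1_01.

Lemma ufun_sqrt_cont h : continuous (fun x => Num.sqrt (h x)).
Proof.
move=> x; apply: (@continuous_comp _ _ _ (h : X -> R) (@Num.sqrt R)); first exact: uf_cont.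
exact: realfun.sqrt_continuous.
Qed.
Lemma ufun_sqrt_01 h x : 0 <= Num.sqrt (h x) <= 1.
Proof.
have /andP[h0 h1] := uf_01 h x.
by rewrite sqrtr_ge0/= -[leRHS]sqrtr1 ler_wsqrtr.
Qed.
Definition ufun_sqrt h := Ufun (@ufun_sqrt_cont h) (ufun_sqrt_01 h).

End UfunOperations.

(** * Multiplying matrices over [C(X, A)] by scalar functions *)

Section ContinuousFields.
Context (R : realType) (X : metricType R) (cX : compact [set: X]) (A : cstarAlgType R).
Local Notation C := (cfun cX A).
Local Notation D := (stab C).
Local Notation S := (stab A).
Implicit Types (f g : C) (h k : ufun X) (q : X) (T : D).

Lemma eval_shom q : shom (fun f : C => cfun_eval f q).
Proof. by split=> // f; exact: supnorm_le. Qed.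

Lemma const_cts (a : A) : continuous (fun _ : X => a).
Proof. by move=> x; exact: cvg_cst. Qed.
Definition cconst (a : A) : C := mkcfun cX (@const_cts a).

Lemma cconst_shom : shom cconst.
Proof.
split=> [a b|c a|a b|a|a]; [exact: cfunP..|].
by apply: (@supnorm_leP _ _ cX _ (cconst a)) => //; exact: (csn_ge0 (@rnorm_seminorm R A)).
Qed.

Lemma cmul_cts h f : continuous (fun x => (h x)%:C *: cfun_eval f x).
Proof.
have hr := @rnorm_seminorm R A.
move=> x; apply/rnorm_cvgP => e e0; rewrite near_map.
have e2 : 0 < e / 2 by rewrite divr_gt0.
have M0 : 0 < rnorm (cfun_eval f x) + 1 by rewrite ltr_wpDl// (csn_ge0 hr).
have hx : \forall y \near x, `|h x - h y| < e / 2 / (rnorm (cfun_eval f x) + 1).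
  by have /cvgrPdist_lt := @uf_cont _ _ h x; apply; rewrite divr_gt0.
near=> y.
have -> : (h y)%:C *: cfun_eval f y - (h x)%:C *: cfun_eval f x =
    (h y)%:C *: (cfun_eval f y - cfun_eval f x) + (h y - h x)%:C *: cfun_eval f x.
  by rewrite rmorphB scalerBr scalerBl addrA subrK.
rewrite (le_lt_trans (csn_triangle hr _ _))// (splitr e) !(csn_scale hr) !normc_real.
apply: ltrD.
  have /andP[h0 h1] := uf_01 h y; rewrite ger0_norm//.
  apply: (@le_lt_trans _ _ (rnorm (cfun_eval f y - cfun_eval f x))).
    by rewrite ler_piMl// (csn_ge0 hr).
  by near: y; exact: cfun_near.
apply: (@le_lt_trans _ _ (`|h y - h x| * (rnorm (cfun_eval f x) + 1))).
  by rewrite ler_wpM2l// lerDl.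
by rewrite -ltr_pdivlMr// distrC; near: y.
Unshelve. all: by end_near. Qed.

Definition cmul h f : C := mkcfun cX (@cmul_cts h f).

Lemma cmul_norm h f : rnorm (cmul h f) <= rnorm f.
Proof.
apply: (@supnorm_leP _ _ cX _ (cmul h f)) => [|x]; first exact: (csn_ge0 (@rnorm_seminorm R C)).
rewrite [cfun_eval _ _]/(_ *: _) (csn_scale (@rnorm_seminorm R A)) normc_real.
have /andP[h0 h1] := uf_01 h x; rewrite ger0_norm//.
apply: le_trans (supnorm_le f x).
by rewrite ler_piMl// (csn_ge0 (@rnorm_seminorm R A)).
Qed.

Lemma cmulD h f g : cmul h (f + g) = cmul h f + cmul h g.
Proof. by apply: cfunP => x; exact: scalerDr. Qed.
Lemma cmulZ h (c : R[i]) f : cmul h (c *: f) = c *: cmul h f.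
Proof. by apply: cfunP => x; rewrite [LHS]scalerA [RHS]scalerA mulrC. Qed.
Lemma cmul0 h : cmul h 0 = 0.
Proof. by apply: cfunP => x; exact: scaler0. Qed.
Lemma cmulMl h f g : cmul h (f ** g) = cmul h f ** g.
Proof. by apply: cfunP => x; exact: esym (scale_smull _ _ _). Qed.
Lemma cmulMr h f g : cmul h (f ** g) = f ** cmul h g.
Proof. by apply: cfunP => x; exact: esym (scale_smulr _ _ _). Qed.
Lemma cmul_star h f : cmul h (star f) = star (cmul h f).
Proof. by apply: cfunP => x; rewrite [RHS]starZ conjc_real. Qed.
Lemma cmul_cmul h k f : cmul h (cmul k f) = cmul (ufunM h k) f.
Proof. by apply: cfunP => x; rewrite [LHS]scalerA -rmorphM. Qed.

Definition fm_cmul_fin h (T : finmx C) : exists N, mx_bounded (fun i j => cmul h (T i j)) N.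
Proof. by exists (mx_bd T) => i j hij; rewrite mx_bdP// cmul0. Qed.

Definition fm_cmul h (T : finmx C) : finmx C := FinMx (fm_cmul_fin h T).

Lemma fm_cmulD h (T U : finmx C) : fm_cmul h (T + U) = fm_cmul h T + fm_cmul h U.
Proof. by apply: finmxP => i j; exact: cmulD. Qed.
Lemma fm_cmulZ h (c : R[i]) (T : finmx C) : fm_cmul h (c *: T) = c *: fm_cmul h T.
Proof. by apply: finmxP => i j; exact: cmulZ. Qed.
Lemma fm_cmulMl h (T U : finmx C) : fm_cmul h (T ** U) = fm_cmul h T ** U.
Proof.
apply: finmxP => i j; rewrite [RHS](fm_mulE _ _ (or_intror (@mx_bdP _ _ U))).
rewrite [LHS]/= -[\sum_(l < _) _]/((T ** U) i j) (fm_mulE _ _ (or_intror (@mx_bdP _ _ U))).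
rewrite (big_morph (cmul h) (cmulD h) (cmul0 h)).
by apply: eq_bigr => l _; exact: cmulMl.
Qed.
Lemma fm_cmulMr h (T U : finmx C) : fm_cmul h (T ** U) = T ** fm_cmul h U.
Proof.
apply: finmxP => i j; rewrite [LHS]/= (big_morph (cmul h) (cmulD h) (cmul0 h)).
by apply: eq_bigr => l _; exact: cmulMr.
Qed.
Lemma fm_cmul_star h (T : finmx C) : fm_cmul h (star T) = star (fm_cmul h T).
Proof. by apply: finmxP => i j; exact: cmul_star. Qed.
Lemma fm_cmul_cmul h k (T : finmx C) : fm_cmul h (fm_cmul k T) = fm_cmul (ufunM h k) T.
Proof. by apply: finmxP => i j; exact: cmul_cmul. Qed.

(** An admissible seminorm [p] carries no information on multipliers. But the C*-identity bounds
    [p (h T) ^+ 2] by [p T * p (h^2 T)], and the entries bound [p (h T)] uniformly in [h], so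
    [le_of_squares] applies to the family of all [h]. *)
Lemma fm_cmul_norm h (T : finmx C) : fm_norm (fm_cmul h T) <= fm_norm T.
Proof.
apply: fm_norm_leP => p hp; apply: le_trans (fm_norm_ge T hp).
apply: (@le_of_squares _ _ (fun h => p (fm_cmul h T))) => [|k||k].
- exact: (csn_ge0 hp.1).
- exact: (csn_ge0 hp.1).
- exists (\sum_(i < mx_bd T) \sum_(j < mx_bd T) rnorm (T i j)) => k.
  have E : fm_cmul k T = \sum_(i < mx_bd T) \sum_(j < mx_bd T) fm_unit i j (cmul k (T i j)).
    rewrite {1}(fm_unit_sum T); have F0 : fm_cmul k 0 = 0.
      by apply: finmxP => i j; exact: cmul0.
    rewrite (big_morph (fm_cmul k) (fm_cmulD k) F0); apply: eq_bigr => i _.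
    rewrite (big_morph (fm_cmul k) (fm_cmulD k) F0); apply: eq_bigr => j _.
    by apply: finmxP => a b /=; case: ifP => // _; exact: cmul0.
  rewrite E (le_trans (csn_sum hp.1 _ _))//; apply: ler_sum => i _.
  rewrite (le_trans (csn_sum hp.1 _ _))//; apply: ler_sum => j _.
  by rewrite (le_trans (hp.2 _ _ _))// cmul_norm.
- exists (ufunM k k); rewrite -(csn_star hp.1) -fm_cmul_cmul -fm_cmul_star.
  rewrite -fm_cmulMl fm_cmulMr (le_trans (csn_mul hp.1 _ _))//.
  by rewrite (csn_isometric_star hp.1).
Qed.

Lemma fm_cmul_ba h : bounded_additive (@fm_norm R C) (@fm_norm R C) (fm_cmul h).
Proof.
split; last by exists 1 => // T; rewrite mul1r fm_cmul_norm.
by move=> T U; rewrite -scaleN1r fm_cmulD fm_cmulZ scaleN1r.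
Qed.

End ContinuousFields.

Lemma seminorm_hc_of (R : realType) (V : starAlgType R) (p : V -> R) (hp : cstar_seminorm p)
    (B : cstarAlgType R) (phi : hcompletion hp -> B) (r : B -> R) :
  shom phi -> cstar_seminorm r -> cstar_seminorm (fun a => r (phi (hc_of hp a))).
Proof.
move=> hphi hr.
have := @cstar_seminorm_comp R V B r (fun a => phi (hc_of hp a)); apply=> //.
- by move=> a b; rewrite hc_ofD (shomD hphi).
- by move=> c a; rewrite hc_ofZ (shomZ hphi).
- by move=> a b; rewrite hc_ofM (shomM hphi).
- by move=> a; rewrite hc_of_star (shom_star hphi).
Qed.

(** * Fibre norms, and the norm as the supremum over the fibres *)

Section ContinuousFieldNorm.
Context (R : realType) (X : metricType R) (cX : compact [set: X]) (A : cstarAlgType R).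
Local Notation C := (cfun cX A).
Local Notation D := (stab C).
Local Notation S := (stab A).
Local Notation hD := (@rnorm_seminorm R D).
Local Notation hS := (@rnorm_seminorm R S).
Implicit Types (f g : C) (h k : ufun X) (q : X) (T : D).

Definition ev q : D -> S := stab_map (eval_shom cX A q).
Definition kappa : S -> D := stab_map (cconst_shom cX A).
Definition hmul h : D -> D :=
  @hc_map _ _ _ _ _ (fm_norm_seminorm C) (fm_norm_seminorm C) _ (fm_cmul_ba cX A h).

Lemma ev_shom q : shom (ev q). Proof. exact: stab_map_shom. Qed.
Lemma kappa_shom : shom kappa. Proof. exact: stab_map_shom. Qed.

Lemma ev_kappa q (y : S) : ev q (kappa y) = y.
Proof.
elim/hc_ind: y => u; rewrite /kappa /stab_map hc_mapE /ev /stab_map hc_mapE.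
by apply: hc_pi_ext => n; exact: finmxP.
Qed.

Lemma hmulD h (T U : D) : hmul h (T + U) = hmul h T + hmul h U.
Proof. exact: hc_mapD. Qed.

Lemma hmulN h (T : D) : hmul h (- T) = - hmul h T.
Proof.
rewrite -scaleN1r -[RHS]scaleN1r; apply: (@hc_mapZ _ _ _ _ _ (fm_norm_seminorm C)).
exact: fm_cmulZ.
Qed.

Lemma hmulZ h (c : R[i]) (T : D) : hmul h (c *: T) = c *: hmul h T.
Proof. by apply: (@hc_mapZ _ _ _ _ _ (fm_norm_seminorm C)); exact: fm_cmulZ. Qed.

Lemma hmulB h (T U : D) : hmul h (T - U) = hmul h T - hmul h U.
Proof. by rewrite hmulD hmulN. Qed.

Lemma hmul_norm h (T : D) : rnorm (hmul h T) <= rnorm T.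
Proof.
rewrite !rnorm_hc -[leRHS]mul1r; apply: hc_map_norm => U.
by rewrite mul1r fm_cmul_norm.
Qed.

Lemma hmulMl h (T U : D) : hmul h (T ** U) = hmul h T ** U.
Proof.
elim/hc_ind: T => u; elim/hc_ind: U => v.
rewrite [hc_pi _ u ** _]hc_piM /hmul !hc_mapE [RHS]hc_piM.
by apply: hc_pi_ext => n; exact: fm_cmulMl.
Qed.

Lemma hmulMr h (T U : D) : hmul h (T ** U) = T ** hmul h U.
Proof.
elim/hc_ind: T => u; elim/hc_ind: U => v.
rewrite [hc_pi _ u ** _]hc_piM /hmul !hc_mapE [RHS]hc_piM.
by apply: hc_pi_ext => n; exact: fm_cmulMr.
Qed.

Lemma hmul_star h (T : D) : hmul h (star T) = star (hmul h T).
Proof.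
elim/hc_ind: T => u; rewrite hc_pi_star /hmul !hc_mapE hc_pi_star.
by apply: hc_pi_ext => n; exact: fm_cmul_star.
Qed.

Lemma hmul_hmul h k (T : D) : hmul h (hmul k T) = hmul (ufunM h k) T.
Proof.
elim/hc_ind: T => u; rewrite /hmul !hc_mapE.
by apply: hc_pi_ext => n; exact: fm_cmul_cmul.
Qed.

Lemma hmul_ext h k (T : D) : (forall x, h x = k x) -> hmul h T = hmul k T.
Proof.
move=> hk; elim/hc_ind: T => u; rewrite /hmul !hc_mapE.
apply: hc_pi_ext => n; apply: finmxP => i j; apply: cfunP => x.
by rewrite [LHS]/(_ *: _) [RHS]/(_ *: _) hk.
Qed.

Lemma hmul_of h (T : finmx C) :
  hmul h (hc_of (fm_norm_seminorm C) T) = hc_of (fm_norm_seminorm C) (fm_cmul h T).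
Proof. exact: hc_map_of. Qed.

Lemma ev_hmul q h (T : D) : ev q (hmul h T) = (h q)%:C *: ev q T.
Proof.
elim/hc_ind: T => u; rewrite /hmul hc_mapE /ev /stab_map !hc_mapE hc_piZ.
by apply: hc_pi_ext => n; exact: finmxP.
Qed.

Lemma hmul1 (T : D) : hmul (ufun1 X) T = T.
Proof.
elim/hc_ind: T => u; rewrite /hmul !hc_mapE.
apply: hc_pi_ext => n; apply: finmxP => i j; apply: cfunP => x.
exact: scale1r.
Qed.

Lemma rnorm_eq (V : cstarAlgType R) (x y : V) : (forall e, 0 < e -> rnorm (x - y) <= e) -> x = y.
Proof.
move=> h; apply: uin_inj; apply: un_eq => e /h.
by rewrite -un_uin uinB.
Qed.

Lemma hmul_sum1 (J : finType) (g : J -> ufun X) (T : D) :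
  (forall x, \sum_j g j x = 1) -> \sum_j hmul (g j) T = T.
Proof.
move=> g1; have hn := @rnorm_seminorm R D.
have fin (U : finmx C) : \sum_j fm_cmul (g j) U = U.
  apply: finmxP => a b; rewrite fm_sumE; apply: cfunP => x.
  have -> : cfun_eval (\sum_j fm_cmul (g j) U a b) x =
      \sum_j cfun_eval (fm_cmul (g j) U a b) x.
    by apply: (big_morph (fun f : C => cfun_eval f x)).
  have -> : \sum_j cfun_eval (fm_cmul (g j) U a b) x =
      \sum_j (g j x)%:C *: cfun_eval (U a b) x by [].
  by rewrite -scaler_suml -rmorph_sum g1 scale1r.
apply: rnorm_eq => e e0; pose K : R := #|J|%:R + 1.
have K0 : 0 < K by rewrite ltr_wpDl.
have [U hU] := hc_approx T (divr_gt0 e0 K0).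
set U' := hc_of _ U in hU.
have -> : \sum_j hmul (g j) T - T = \sum_j hmul (g j) (T - U') - (T - U').
  have -> : \sum_j hmul (g j) (T - U') = \sum_j hmul (g j) T - U'.
    rewrite (eq_bigr (fun j => hmul (g j) T - hmul (g j) U')); last first.
      by move=> j _; rewrite hmulB.
    rewrite big_split/= sumrN; congr (_ - _).
    by rewrite (eq_bigr _ (fun j _ => hmul_of (g j) U)) -hc_of_sum fin.
  by rewrite opprB addrA subrK.
rewrite (le_trans (csn_triangle hn _ _))// (csnN hn).
apply: (@le_trans _ _ (#|J|%:R * (e / K) + e / K)); last first.
  rewrite -{2}(mul1r (e / K)) -mulrDl -/K mulrCA mulfV ?gt_eqF//.
  by rewrite mulr1.
rewrite lerD// (le_trans (csn_sum hn _ _))//.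
apply: (@le_trans _ _ (\sum_(j : J) e / K)).
  by apply: ler_sum => j _; rewrite (le_trans (hmul_norm _ _)).
by rewrite sumr_const mulr_natl; exact: lexx.
Qed.

(* The quotient norm at the point [q]; its value depends on [ev q T] only, and
   maximality of the norm of [stab A] bounds it by the norm there. *)
Definition nq q T : R := inf [set r | exists h, h q = 1 /\ r = rnorm (hmul h T)].

Lemma nq_has_inf q T : has_inf [set r | exists h, h q = 1 /\ r = rnorm (hmul h T)].
Proof.
split; first by exists (rnorm T); exists (ufun1 X); rewrite hmul1.
by exists 0 => _ [h [_ ->]]; exact: (csn_ge0 hD).
Qed.

Lemma nq_le q T h : h q = 1 -> nq q T <= rnorm (hmul h T).
Proof. by move=> hq; apply: ge_inf; [case: (nq_has_inf q T)|exists h]. Qed.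

Lemma nq_ge q T r : (forall h, h q = 1 -> r <= rnorm (hmul h T)) -> r <= nq q T.
Proof.
move=> H; apply: lb_le_inf; first by case: (nq_has_inf q T).
by move=> _ [h [hq ->]]; exact: H.
Qed.

Lemma nq_ge0 q T : 0 <= nq q T.
Proof. by apply: nq_ge => h _; exact: (csn_ge0 hD). Qed.

Lemma nq_lt q T e : nq q T < e -> exists h, h q = 1 /\ rnorm (hmul h T) < e.
Proof.
move=> ne; have [_ [h [hq ->]] he] := inf_adherent (eps := e - nq q T)
  ltac:(by rewrite subr_gt0) (nq_has_inf q T).
by exists h; split=> //; move: he; rewrite -/(nq q T) addrC subrK.
Qed.

Lemma nq_le_norm q T : nq q T <= rnorm T.
Proof. by rewrite -{2}(hmul1 T); exact: nq_le. Qed.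

Lemma nq_approx q T e : 0 < e -> exists h, h q = 1 /\ rnorm (hmul h T) < nq q T + e.
Proof. by move=> e0; apply: nq_lt; rewrite ltrDl. Qed.

Lemma nq_seminorm q : cstar_seminorm (nq q).
Proof.
have mul1 h k : h q = 1 -> k q = 1 -> ufunM h k q = 1.
  by move=> /= -> ->; rewrite mulr1.
apply: cstar_seminorm_le => [T|T U|c T|T U|T]; first exact: nq_ge0.
- apply/ler_addgt0Pr => e e0; have e2 : 0 < e / 2 by rewrite divr_gt0.
  have [h [hq hT]] := nq_approx q T e2; have [k [kq kU]] := nq_approx q U e2.
  apply: le_trans (nq_le _ (mul1 _ _ hq kq)) _.
  rewrite hmulD (le_trans (csn_triangle hD _ _))//.
  have h1 : rnorm (hmul (ufunM h k) T) <= rnorm (hmul h T).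
    rewrite (hmul_ext (k := ufunM k h)); last by move=> x; rewrite /= mulrC.
    by rewrite -hmul_hmul hmul_norm.
  have h2 : rnorm (hmul (ufunM h k) U) <= rnorm (hmul k U).
    by rewrite -hmul_hmul hmul_norm.
  by lra.
- apply/ler_addgt0Pr => e e0.
  have M0 : 0 < normc c + 1 by rewrite ltr_wpDl// normc_ge0.
  have [h [hq hT]] := nq_approx q T (divr_gt0 e0 M0).
  apply: le_trans (nq_le _ hq) _; rewrite hmulZ (csn_scale hD).
  apply: (@le_trans _ _ (normc c * (nq q T + e / (normc c + 1)))).
    by rewrite ler_wpM2l ?normc_ge0// ltW.
  rewrite mulrDr lerD2l mulrA ler_pdivrMr// mulrC ler_wpM2l ?(ltW e0)//.
  by rewrite lerDl.
- suff H : forall a b, nq q T < a -> nq q U < b -> nq q (T ** U) <= a * b.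
    apply/ler_addgt0Pr => e e0.
    have M0 : 0 < nq q T + nq q U + 1 by rewrite ltr_wpDl// addr_ge0// nq_ge0.
    pose d := Num.min 1 (e / (nq q T + nq q U + 1)).
    have d0 : 0 < d by rewrite lt_min ltr01 divr_gt0.
    have d1 : d <= 1 by rewrite ge_min lexx.
    have de : d * (nq q T + nq q U + 1) <= e by rewrite -ler_pdivlMr// ge_min lexx orbT.
    apply: le_trans (H (nq q T + d) (nq q U + d) _ _) _; rewrite ?ltrDl//.
    have := nq_ge0 q T; have := nq_ge0 q U; nra.
  move=> a b /nq_lt[h [hq hT]] /nq_lt[k [kq kU]].
  apply: le_trans (nq_le _ (mul1 _ _ hq kq)) _.
  rewrite -hmul_hmul hmulMr hmulMl (le_trans (csn_mul hD _ _))//.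
  by rewrite ler_pM ?(csn_ge0 hD)// ltW.
- apply: nq_ge => h hq.
  have sq : ufun_sqrt h q = 1 by rewrite /= hq sqrtr1.
  have -> : hmul h (star T ** T) = star (hmul (ufun_sqrt h) T) ** hmul (ufun_sqrt h) T.
    rewrite -hmul_star -hmulMl -hmulMr hmul_hmul; apply: hmul_ext => x /=.
    by have /andP[h0 _] := uf_01 h x; rewrite -expr2 sqr_sqrtr.
  rewrite (csn_star hD) lerXn2r ?nnegrE ?nq_ge0 ?(csn_ge0 hD)//.
  exact: nq_le.
Qed.

Lemma kappa_of (T : finmx A) : kappa (hc_of (fm_norm_seminorm A) T) =
  hc_of (fm_norm_seminorm C) (fm_map (cconst_shom cX A) T).
Proof. exact: hc_map_of. Qed.

Lemma ev_of q (T : finmx C) : ev q (hc_of (fm_norm_seminorm C) T) =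
  hc_of (fm_norm_seminorm A) (fm_map (eval_shom cX A q) T).
Proof. exact: hc_map_of. Qed.

(** Pulled back along constant fields, [nq q] is an admissible seminorm on matrices over [A], hence
    at most the maximal one. *)
Lemma nq_kappa q (y : S) : nq q (kappa y) <= rnorm y.
Proof.
have hn := nq_seminorm q.
have adm : fm_admissible (fun T : finmx A => nq q (kappa (hc_of (fm_norm_seminorm A) T))).
  split=> [|i j b].
    exact: (seminorm_hc_of kappa_shom hn).
  rewrite (le_trans (nq_le_norm _ _))// (le_trans (shom_norm kappa_shom _))//.
  by rewrite rnorm_hc_of fm_norm_unit.
apply/ler_addgt0Pr => e e0; have e2 : 0 < e / 2 by rewrite divr_gt0.
have [T hT] := hc_approx y e2; set T' := hc_of _ T in hT.
have -> : kappa y = kappa T' + kappa (y - T').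
  by rewrite -(shomD kappa_shom) addrC subrK.
rewrite (le_trans (csn_triangle hn _ _))//.
have h1 : nq q (kappa T') <= rnorm T' by rewrite rnorm_hc_of; exact: (fm_norm_ge T adm).
have h2 : nq q (kappa (y - T')) <= e / 2.
  by rewrite (le_trans (nq_le_norm _ _))// (le_trans (shom_norm kappa_shom _)).
have h3 : rnorm T' <= rnorm y + rnorm (y - T').
  rewrite -{1}(subKr y T') (le_trans (csn_triangle hS _ _))// (csnN hS)//.
by lra.
Qed.

Lemma bump_at q f e : 0 < e -> cfun_eval f q = 0 ->
  exists h : ufun X, h q = 1 /\ rnorm (cmul h f) <= e.
Proof.
move=> e0 fq; have hr := @rnorm_seminorm R A.
pose u x := Num.max 0 (1 - rnorm (cfun_eval f x) / e).
have cu : continuous u.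
  apply: continuous_max0 => x; apply: cvgB; first exact: cvg_cst.
  apply: cvgMr_tmp; apply/cvgrPdist_lt => d d0; near=> y.
  rewrite distrC (@le_lt_trans _ _ (rnorm (cfun_eval f y - cfun_eval f x)))//.
    rewrite ler_norml (csn_leB hr) andbT lerNl opprB.
    by rewrite (csnBC hr) (csn_leB hr).
  by near: y; exact: cfun_near.
have u01 x : 0 <= u x <= 1.
  rewrite /u le_max lexx/= ge_max ler01/= lerBlDr lerDl.
  by rewrite divr_ge0 ?(csn_ge0 hr)// ltW.
exists (Ufun cu u01); split=> /=.
  by rewrite /u fq (csn0 hr) mul0r subr0; apply/max_idPr.
apply: (@supnorm_leP _ _ cX _ (cmul (Ufun cu u01) f)) => [|x]; first exact: ltW.
rewrite [cfun_eval _ _]/((u x)%:C *: _) (csn_scale hr) normc_real.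
have /andP[u0 u1] := u01 x; rewrite ger0_norm//.
have n0 := csn_ge0 hr (cfun_eval f x).
have [h|h] := leP (rnorm (cfun_eval f x)) e.
  by rewrite (le_trans _ h)// ler_piMl.
rewrite /u max_l ?mul0r ?(ltW e0)// subr_le0 ler_pdivlMr// mul1r ltW//.
Unshelve. all: by end_near. Qed.

Lemma nq_ker q (T : finmx C) : (forall i j, cfun_eval (T i j) q = 0) ->
  nq q (hc_of (fm_norm_seminorm C) T) = 0.
Proof.
move=> Tq; have hn := nq_seminorm q; apply/le_anti; rewrite nq_ge0 andbT.
rewrite {1}(fm_unit_sum T) hc_of_sum (le_trans (csn_sum hn _ _))//.
rewrite big1// => i _; apply/le_anti; rewrite (csn_ge0 hn) andbT.
rewrite hc_of_sum (le_trans (csn_sum hn _ _))//.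
rewrite big1// => j _; apply/le_anti; rewrite (csn_ge0 hn) andbT.
apply/ler_addgt0Pr => e e0; rewrite add0r.
have [h [hq hf]] := bump_at e0 (Tq i j).
apply: le_trans (nq_le _ hq) _; rewrite hmul_of rnorm_hc_of.
have -> : fm_cmul h (fm_unit i j (T i j)) = fm_unit i j (cmul h (T i j)).
  by apply: finmxP => a b /=; case: ifP => // _; exact: cmul0.
by rewrite (le_trans (fm_norm_unit _ _ _)).
Qed.

(** Subtract from [T] the constant field with the same value at [q]. The difference vanishes at [q];
    on finite matrices [nq q] then vanishes by [nq_ker], and a finite matrix approximates [T]. *)
Lemma nq_ev q (T : D) : nq q T <= rnorm (ev q T).
Proof.
have hn := nq_seminorm q; apply/ler_addgt0Pr => e e0.
have e2 : 0 < e / 2 by rewrite divr_gt0.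
have [U hU] := hc_approx T e2; set U' := hc_of _ U in hU.
pose phi x := x - kappa (ev q x).
have phiD x y : phi (x + y) = phi x + phi y.
  by rewrite /phi (shomD (ev_shom q)) (shomD kappa_shom) opprD addrACA.
have TE : T = kappa (ev q T) + (phi U' + phi (T - U')).
  by rewrite -phiD [U' + _]addrC subrK /phi addrC subrK.
rewrite [X in nq q X]TE.
apply: le_trans (csn_triangle hn _ _) _; apply: lerD; first exact: nq_kappa.
apply: le_trans (csn_triangle hn _ _) _.
have -> : nq q (phi U') = 0.
  rewrite /phi /U' ev_of kappa_of hc_ofB; apply: nq_ker => i j.
  rewrite [LHS]/(cfun_eval (U i j) q + (-1) *: cfun_eval (U i j) q).
  by rewrite scaleN1r; exact: subrr.
rewrite add0r (splitr e); apply: le_trans (csn_triangle hn _ _) _.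
rewrite (csnN hn); apply: lerD; first exact: le_trans (nq_le_norm _ _) hU.
apply: le_trans (nq_kappa _ _) _.
exact: le_trans (shom_norm (ev_shom q) _) hU.
Qed.

(** [nq_ev] yields [h] with [h q = 1] and [|h T| < e]. The strict inequality leaves room to pass to
    [h / max r h], which is [1] wherever [h >= r] and enlarges the norm by at most [1 / r]. *)
Lemma ev_lt_near q (T : D) e : rnorm (ev q T) < e ->
  exists h : ufun X, (\forall x \near q, h x = 1) /\ rnorm (hmul h T) < e.
Proof.
move=> Te; have [h [hq hT]] := nq_lt (le_lt_trans (nq_ev q T) Te).
have e0 : 0 < e := le_lt_trans (csn_ge0 hS _) Te.
pose m := rnorm (hmul h T); have m0 : 0 <= m := csn_ge0 hD _.
(* Chosen so that [m / r < e] although [r < 1]. *)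
pose r := ((m + e) / 2) / e.
have r0 : 0 < r by rewrite /r !divr_gt0// ltr_wpDl.
have r1 : r < 1 by rewrite /r ltr_pdivrMr// mul1r -/m in hT *; lra.
have mr : m / r < e.
  have E : r * e = (m + e) / 2 by rewrite /r divfK// gt_eqF.
  by rewrite ltr_pdivrMr// mulrC E; rewrite -/m in hT; lra.
have cmax : continuous (fun x => Num.max r (h x)).
  move=> x; rewrite (_ : (fun x => _) = (fun x => Num.max 0 (h x - r) + r)).
    apply: cvgD; last exact: cvg_cst.
    apply: (@continuous_max0 _ _ (fun x => h x - r)) => y.
    by apply: cvgB; [exact: uf_cont|exact: cvg_cst].
  apply/funext => y; have [k|k] := leP r (h y).
    by rewrite max_r ?subr_ge0// subrK.
  by rewrite max_l ?subr_le0 ?(ltW k)// add0r.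
have mp x : 0 < Num.max r (h x) by rewrite lt_max r0.
have cv : continuous (fun x => r / Num.max r (h x)).
  move=> x; apply: cvgM; first exact: cvg_cst.
  by apply: cvgV; [rewrite gt_eqF|exact: cmax].
have v01 x : 0 <= r / Num.max r (h x) <= 1.
  rewrite divr_ge0 ?(ltW r0) ?(ltW (mp x))//= ler_pdivrMr// mul1r le_max lexx//.
have cw : continuous (fun x => h x / Num.max r (h x)).
  move=> x; apply: cvgM; first exact: uf_cont.
  by apply: cvgV; [rewrite gt_eqF|exact: cmax].
have w01 x : 0 <= h x / Num.max r (h x) <= 1.
  have /andP[h0 _] := uf_01 h x.
  rewrite divr_ge0 ?(ltW (mp x))//= ler_pdivrMr// mul1r le_max lexx orbT//.
pose w := Ufun cw w01; pose v := Ufun cv v01.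
exists w; split.
  have /cvgrPdist_lt/(_ (1 - r)) := @uf_cont _ _ h q; rewrite subr_gt0 => /(_ r1).
  apply: filterS => x; rewrite hq => hx /=.
  have rx : r < h x by move: hx; rewrite ltr_norml; lra.
  by rewrite max_r ?(ltW rx)// mulfV// gt_eqF// (lt_trans r0).
have -> : hmul w T = (r^-1)%:C *: hmul v (hmul h T).
  rewrite hmul_hmul; elim/hc_ind: (T) => u; rewrite /hmul !hc_mapE hc_piZ.
  apply: hc_pi_ext => n; apply: finmxP => i j; apply: cfunP => x.
  rewrite [LHS]/((h x / Num.max r (h x))%:C *: _).
  apply: etrans (_ : ((r^-1)%:C * (r / Num.max r (h x) * h x)%:C) *: cfun_eval (u n i j) x = _);
    last exact: esym (scalerA _ _ _).
  rewrite -rmorphM; congr (_%:C *: _); field; rewrite !gt_eqF//.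
rewrite (csn_scale hD) normc_real gtr0_norm ?invr_gt0// mulrC.
apply: le_lt_trans mr; rewrite ler_wpM2r ?invr_ge0 ?(ltW r0)//.
exact: hmul_norm.
Qed.

Lemma ev_lt_open (T : D) e : open [set q | rnorm (ev q T) < e].
Proof.
rewrite openE => q /= /ev_lt_near[h [h1 hT]].
apply: filterS h1 => x hx /=; apply: le_lt_trans hT.
have -> : ev x T = ev x (hmul h T) by rewrite ev_hmul hx scale1r.
exact: shom_norm (ev_shom x) _.
Qed.

Lemma open_cover_compact (U : X -> set X) : (forall q, \forall x \near q, U q x) ->
  exists s : seq X, forall x, exists2 q, q \in s & (U q)^° x.
Proof.
move=> hU.
(* The filter of sets of finite sequences that contain every sequence extending a given one, for the
   near-covering form of compactness. *)
pose F : set_system (seq X) := [set W : set (seq X) | exists s0 : seq X, forall s, {subset s0 <= s} -> W s].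
have FF : Filter F.
  split=> [|P Q [s hs] [t ht]|P Q PQ [s hs]]; first by exists [::].
    exists (s ++ t) => r sr; split; [apply: hs|apply: ht] => x xs;
      by apply: sr; rewrite mem_cat xs ?orbT.
  by exists s => r /hs /PQ.
have /compact_near_coveringP/(_ _ F (fun s x => exists2 q, q \in s & (U q)^° x) FF) := cX.
case=> [x _|s hs].
  exists ((U x)^°, [set t : seq X | x \in t]) => /= [|[y s] /= [Uy xs]]; last by exists x.
  split; last by exists [:: x] => s; apply; rewrite mem_head.
  by apply: nbhs_interior; exact: hU.
by exists s => x; apply: hs.
Qed.

(** Locally [T] has norm below [e + d] after multiplication by a function equal to [1] on a patch.
    Summing over a partition of unity costs the number of patches; applied to iterated squares of
    [star T ** T], that number is removed by [le_of_powers]. *)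
Lemma ev_norm_le (T : D) e : 0 <= e -> (forall q, rnorm (ev q T) <= e) -> rnorm T <= e.
Proof.
move=> e0 hT; apply/ler_addgt0Pr => d d0; set e' := e + d.
have e'0 : 0 < e' by rewrite ltr_wpDl.
have /choice[h hh] q : exists h : ufun X, (\forall x \near q, h x = 1) /\ rnorm (hmul h T) < e'.
  by apply: ev_lt_near; rewrite (le_lt_trans (hT q))// ltrDl.
have [s hs] := open_cover_compact (fun q => (hh q).1).
have [||g [g1 g2]] := @partition_of_unity _ X (seq_sub s)
    (fun j => [set x | h (ssval j) x = 1]^°).
- by move=> j; exact: open_interior.
- apply/seteqP; split=> // x _; have [q qs qx] := hs x.
  by exists (SeqSub qs).
pose W := star T ** T.
pose pw (y : D) := fix pw n := if n is m.+1 then pw m ** pw m else y.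
have sW : star W = W by rewrite /W starM starK.
have pw_norm n : rnorm (pw W n) = rnorm W ^+ (2 ^ n) /\ star (pw W n) = pw W n.
  elim: n => [|n [IH1 IH2]] /=; first by rewrite expn0 expr1.
  split; last by rewrite starM IH2.
  by rewrite -{1}IH2 (csn_star hD) IH1 -exprM expnS mulnC.
pose V q := star (hmul (h q) T) ** hmul (h q) T.
have V_norm q n : rnorm (pw (V q) n) <= (e' ^+ 2) ^+ (2 ^ n).
  elim: n => [|n IH] /=.
    have Vq : rnorm (V q) = rnorm (hmul (h q) T) ^+ 2 by exact: (csn_star hD).
    have n0 : 0 <= rnorm (hmul (h q) T) := csn_ge0 hD _.
    by rewrite expn0 expr1 Vq lerXn2r ?nnegrE ?(ltW e'0)// ltW//; exact: (hh q).2.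
  rewrite (le_trans (csn_mul hD _ _))// expnS mulnC exprM expr2.
  by rewrite ler_pM ?(csn_ge0 hD).
have gpw (j : seq_sub s) n : hmul (g j) (pw W n) = hmul (g j) (pw (V (ssval j)) n).
  elim: n => [|n IH] /=.
    rewrite /V -hmul_star -hmulMl -hmulMr !hmul_hmul; apply: hmul_ext => x /=.
    have [g0|gx] := eqVneq (g j x) 0; first by rewrite g0 !mul0r.
    have hx : h (ssval j) x = 1 := (@interior_subset _ [set y | h (ssval j) y = 1] x (g1 j x gx)).
    by rewrite hx !mulr1.
  by rewrite hmulMl IH -hmulMl hmulMr IH -hmulMr.
have WK : rnorm W <= e' ^+ 2.
  apply: (@le_of_powers _ _ _ #|{: seq_sub s}|%:R); first exact: (csn_ge0 hD).
    by rewrite exprn_ge0// ltW.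
  move=> n; rewrite -(pw_norm n).1 -(hmul_sum1 (pw W n) g2).
  rewrite (le_trans (csn_sum hD _ _))//.
  apply: (@le_trans _ _ (\sum_(j : seq_sub s) (e' ^+ 2) ^+ (2 ^ n))).
    apply: ler_sum => j _; rewrite gpw (le_trans (hmul_norm _ _))//.
  by rewrite sumr_const mulr_natl; exact: lexx.
move: WK; rewrite (csn_star hD) => WK.
by rewrite -(@ler_pXn2r _ 2) ?nnegrE ?(csn_ge0 hD) ?(ltW e'0).
Qed.

End ContinuousFieldNorm.

(** * Quotients and ideals *)

Section ApproximateUnit.
Context (R : realType) (A : cstarAlgType R).
Local Notation hA := (@rnorm_seminorm R A).

(** With [h = star x ** x], the element [e] is [h / (h + t^2)], and the error is governed by
    [s (t^2 / (s + t^2))^2 <= t^2]. The factorization through [h] places [e] in every closed ideal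
    containing [x]. *)
Lemma approx_unit (x : A) (t : R) : 0 < t -> exists (e : A) (y : unz A),
  [/\ star e = e, uin e = uin (star x ** x) * y, un (1 - uin e) <= 1
    & rnorm (x - x ** e) <= t].
Proof.
move=> t0; pose h := uin (star x ** x); have t2 : 0 < t ^+ 2 by rewrite exprn_gt0.
have ph : psd h by exact: psd_starM_uin.
have sh := psd_sa ph.
pose g (s : R) := (Num.max (s + t ^+ 2) (t ^+ 2))^-1.
have hg : pap g by apply: pap_inv => //; apply: papD; [exact: pap_id|exact: pap_cst].
have gE s : 0 <= s -> g s = (s + t ^+ 2)^-1 by move=> s0; rewrite /g max_l// lerDr.
have hf : pap (fun s => s * g s) by apply: papM => //; exact: pap_id.
have hf1 : pap (fun s => 1 - s * g s) by apply: papB => //; exact: pap_cst.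
have E : h * fc g h = fc (fun s => s * g s) h.
  by rewrite fcM// ?fc_id//; exact: pap_id.
have [e he] : exists e : A, uin e = h * fc g h.
  by have [e he] := uin_ideal 1 (fc g h) (star x ** x); exists e; rewrite he mul1r.
have E1 : 1 - uin e = fc (fun s => 1 - s * g s) h.
  by rewrite he E fcB ?fc_cst ?rs1//; exact: pap_cst.
have f1 s : Sp h s -> 0 <= 1 - s * g s <= 1 /\ s * (1 - s * g s) ^+ 2 <= t ^+ 2.
  move=> /ph.2 s0; have d0 : 0 < s + t ^+ 2 by rewrite ltr_wpDl.
  have -> : 1 - s * g s = t ^+ 2 / (s + t ^+ 2).
    by rewrite gE//; field; rewrite gt_eqF.
  set r := _ / _; have r0 : 0 <= r by rewrite divr_ge0 ?ltW.
  have r1 : r <= 1 by rewrite ler_pdivrMr// mul1r lerDr.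
  rewrite r0 r1; split=> //.
  have rE : r * (s + t ^+ 2) = t ^+ 2 by rewrite divfK// gt_eqF.
  have : s * r <= t ^+ 2 by rewrite -rE mulrDr mulrC lerDl mulr_ge0// ltW.
  have : s * r * r <= s * r by rewrite ler_piMr// mulr_ge0.
  move=> h1 h2; have -> : s * r ^+ 2 = s * r * r by rewrite expr2 mulrA.
  exact: le_trans h1 h2.
exists e, (fc g h); split=> //.
- by apply: uin_inj; rewrite uin_star he E fc_sa.
- rewrite E1; apply: fc_le => // s /f1[/andP[h0 h1] _].
  by rewrite ger0_norm.
- rewrite -un_uin uinB uinM -[uin x in X in X - _]mulr1 -mulrBr.
  rewrite -(@ler_pXn2r _ 2) ?nnegrE ?un_ge0 ?(ltW t0)// -un_starM ustarM.
  have -> : star (1 - uin e) = 1 - uin e by rewrite E1 fc_sa.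
  rewrite mulrA -(mulrA _ _ (uin x)) -uin_star -uinM -/h E1.
  have hid := @pap_id R; have hm := papM hf1 hid.
  rewrite -[X in _ * X * _](fc_id sh) -!fcM//; apply: fc_le => //; first exact: papM.
  move=> s hs; have [/andP[h0 h1] h2] := f1 s hs; have s0 := ph.2 _ hs.
  by rewrite ger0_norm ?mulr_ge0// mulrAC mulrC -expr2.
Qed.

End ApproximateUnit.

(** * The quotient C*-algebra *)

Section QuotientAlgebra.
Context (R : realType) (A : cstarAlgType R) (I : set A) (hI : closed_ideal I).
Local Notation hA := (@rnorm_seminorm R A).
Implicit Types a x y : A.

Lemma ideal_lim a : (forall e, 0 < e -> exists2 x, I x & rnorm (a - x) < e) -> I a.
Proof.
move=> H; have /choice[u hu] n : exists x, I x /\ rnorm (a - x) < n.+1%:R^-1.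
  by have [|x ? ?] := H n.+1%:R^-1; [rewrite invr_gt0|exists x].
apply: (@closed_cvg _ _ \oo _ u I (ideal_closed hI) _ a).
  by exists 0%N => // n _; exact: (hu n).1.
apply/rnorm_cvg_for => e /natSinv_lt[N hN]; exists N => n Nn.
rewrite (csnBC hA) (lt_le_trans (hu n).2)// (le_trans _ (ltW hN))//.
by rewrite lef_pV2 ?posrE ?ltr0n// ler_nat ltnS.
Qed.

Lemma idealN x : I x -> I (- x).
Proof. by move=> hx; rewrite -scaleN1r; exact: (idealZ hI). Qed.

Lemma ideal_unz x y (u : unz A) : I x -> uin y = uin x * u -> I y.
Proof.
move=> hx hy; have -> : y = uscal u *: x + x ** upart u.
  apply: uin_inj; rewrite hy; apply: unzP; first by rewrite uscalM mul0r.
  by rewrite upartM uscal_uin scale0r add0r.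
by apply: (idealD hI); [exact: (idealZ hI)|exact: (ideal_mulr hI)].
Qed.

Definition qn a : R := inf [set rnorm (a + x) | x in I].

Lemma qn_has_inf a : has_inf [set rnorm (a + x) | x in I].
Proof.
split; first by exists (rnorm (a + 0)); exists 0 => //; exact: (ideal0 hI).
by exists 0 => _ [x _ <-]; exact: (csn_ge0 hA).
Qed.

Lemma qn_le a x : I x -> qn a <= rnorm (a + x).
Proof. by move=> hx; apply: ge_inf; [case: (qn_has_inf a)|exists x]. Qed.

Lemma qn_ge a r : (forall x, I x -> r <= rnorm (a + x)) -> r <= qn a.
Proof.
move=> H; apply: lb_le_inf; first by case: (qn_has_inf a).
by move=> _ [x hx <-]; exact: H.
Qed.

Lemma qn_lt a e : qn a < e -> exists2 x, I x & rnorm (a + x) < e.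
Proof.
move=> ne; have [_ [x hx <-] he] := inf_adherent (eps := e - qn a)
  ltac:(by rewrite subr_gt0) (qn_has_inf a).
by exists x => //; apply: lt_le_trans he _; rewrite -/(qn a) addrC subrK.
Qed.

Lemma qn_ge0 a : 0 <= qn a.
Proof. by apply: qn_ge => x _; exact: (csn_ge0 hA). Qed.

Lemma qn_le_norm a : qn a <= rnorm a.
Proof. by rewrite -{2}(addr0 a); apply: qn_le; exact: (ideal0 hI). Qed.

Lemma qn_approx a e : 0 < e -> exists2 x, I x & rnorm (a + x) < qn a + e.
Proof. by move=> e0; apply: qn_lt; rewrite ltrDl. Qed.

Lemma qn_seminorm : cstar_seminorm qn.
Proof.
apply: cstar_seminorm_le => [a|a b|c a|a b|a]; first exact: qn_ge0.
- apply/ler_addgt0Pr => e e0; have e2 : 0 < e / 2 by rewrite divr_gt0.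
  have [x hx ax] := qn_approx a e2; have [y hy by_] := qn_approx b e2.
  apply: le_trans (qn_le _ (idealD hI hx hy)) _.
  rewrite addrACA; apply: le_trans (csn_triangle hA _ _) _; lra.
- apply/ler_addgt0Pr => e e0.
  have M0 : 0 < normc c + 1 by rewrite ltr_wpDl// normc_ge0.
  have [x hx ax] := qn_approx a (divr_gt0 e0 M0).
  apply: le_trans (qn_le _ (idealZ hI c hx)) _; rewrite -scalerDr (csn_scale hA).
  apply: (@le_trans _ _ (normc c * (qn a + e / (normc c + 1)))).
    by rewrite ler_wpM2l ?normc_ge0// ltW.
  rewrite mulrDr lerD2l mulrA ler_pdivrMr// mulrC ler_wpM2l ?(ltW e0)//.
  by rewrite lerDl.
- suff H : forall r s, qn a < r -> qn b < s -> qn (a ** b) <= r * s.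
    apply/ler_addgt0Pr => e e0.
    have M0 : 0 < qn a + qn b + 1 by rewrite ltr_wpDl// addr_ge0// qn_ge0.
    pose d := Num.min 1 (e / (qn a + qn b + 1)).
    have d0 : 0 < d by rewrite lt_min ltr01 divr_gt0.
    have d1 : d <= 1 by rewrite ge_min lexx.
    have de : d * (qn a + qn b + 1) <= e by rewrite -ler_pdivlMr// ge_min lexx orbT.
    apply: le_trans (H (qn a + d) (qn b + d) _ _) _; rewrite ?ltrDl//.
    have := qn_ge0 a; have := qn_ge0 b; nra.
  move=> r s /qn_lt[x hx ax] /qn_lt[y hy by_].
  have hxy : I (a ** y + x ** b + x ** y).
    by do !apply: (idealD hI); [exact: (ideal_mull hI)|exact: (ideal_mulr hI)..].
  apply: le_trans (qn_le _ hxy) _.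
  have -> : a ** b + (a ** y + x ** b + x ** y) = (a + x) ** (b + y).
    by rewrite smulDl !smulDr !addrA.
  apply: le_trans (csn_mul hA _ _) _.
  by rewrite ler_pM ?(csn_ge0 hA)// ltW.
(* For [x] in the ideal choose an approximate unit [u] of [x] inside the ideal. Then
   [qn a <= |a (1 - u)|], and its square is at most [|star a ** a + x|] plus the small norm of
   [x (1 - u)]. *)
- apply: qn_ge => x hx; apply/ler_addgt0Pr => e e0.
  have [u [y [su uE u1 hu]]] := approx_unit x e0.
  have Iu : I u.
    by apply: ideal_unz uE; apply: (ideal_mull hI).
  have h1 : qn a <= rnorm (a - a ** u).
    by apply: qn_le; apply: idealN; exact: (ideal_mull hI).
  apply: (@le_trans _ _ (rnorm (a - a ** u) ^+ 2)).
    by rewrite lerXn2r ?nnegrE ?qn_ge0 ?(csn_ge0 hA).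
  have [w wE] : exists w, w = 1 - uin u by exists (1 - uin u).
  rewrite -wE in u1; have sw : star w = w by rewrite wE starB ustar1 -uin_star su.
  have E b : uin (b - b ** u) = uin b * w by rewrite uinB uinM wE mulrBr mulr1.
  rewrite -un_uin -un_starM E ustarM sw.
  have -> : w * star (uin a) * (uin a * w) =
      w * uin (star a ** a + x) * w - w * (uin x * w).
    by rewrite uinD uinM uin_star mulrDr mulrDl !mulrA addrK.
  apply: le_trans (csn_triangle (@un_seminorm R A) _ _) _; rewrite unN; apply: lerD.
    apply: le_trans (unM _ _) _; rewrite -[leRHS]mulr1.
    apply: ler_pM => //; rewrite ?un_ge0//; apply: le_trans (unM _ _) _.
    by rewrite un_uin ler_piMl// (csn_ge0 hA).
  apply: le_trans (unM _ _) _; rewrite -E un_uin -[leRHS]mul1r.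
  by apply: ler_pM; rewrite ?un_ge0 ?(csn_ge0 hA).
Qed.

Lemma qn_eq0 a : qn a = 0 <-> I a.
Proof.
split=> [a0|ha].
  apply: ideal_lim => e e0; have [|x hx ax] := @qn_lt a e; first by rewrite a0.
  by exists (- x); [exact: idealN|rewrite opprK].
apply/le_anti; rewrite qn_ge0 andbT; apply: le_trans (qn_le a (idealN ha)) _.
by rewrite subrr (csn0 hA).
Qed.

(** A Hausdorff completion for the quotient seminorm; that completing adds no new points is
    [qmap_surj]. *)
Definition quot : cstarAlgType R := hcompletion qn_seminorm.
Definition qmap : A -> quot := hc_of qn_seminorm.

Lemma rnorm_qmap a : rnorm (qmap a) = qn a.
Proof. exact: rnorm_hc_of. Qed.

Lemma qmap_shom : shom qmap.
Proof.
split=> [a b|c a|a b|a|a]; [exact: hc_ofD|exact: hc_ofZ|exact: hc_ofM|exact: hc_of_star|].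
by rewrite rnorm_qmap qn_le_norm.
Qed.

Lemma qmap_ker a : qmap a = 0 <-> I a.
Proof.
rewrite -qn_eq0 -rnorm_qmap; split=> [->|]; last exact: rnorm_eq0.
exact: (csn0 (@rnorm_seminorm R quot)).
Qed.

Lemma qmap_lift b (r : R) : rnorm b < r -> exists a, rnorm a < r /\ rnorm (b - qmap a) < r / 2.
Proof.
move=> br; have hQ := @rnorm_seminorm R quot.
pose d := Num.min (r / 3) ((r - rnorm b) / 2).
have r0 : 0 < r := le_lt_trans (csn_ge0 hQ b) br.
have d0 : 0 < d by rewrite lt_min !divr_gt0// subr_gt0.
have d1 : d <= r / 3 by rewrite ge_min lexx.
have d2 : d <= (r - rnorm b) / 2 by rewrite ge_min lexx orbT.
have [a ha] := hc_approx b d0; rewrite -/(qmap a) in ha.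
have : qn a < r.
  rewrite -rnorm_qmap; have := csn_leB hQ (qmap a) b; rewrite (csnBC hQ); lra.
move=> /qn_lt[x hx ax]; exists (a + x); split=> //.
have -> : qmap (a + x) = qmap a by rewrite (shomD qmap_shom) (proj2 (qmap_ker x) hx) addr0.
by apply: le_lt_trans ha _; lra.
Qed.

(** Successive approximation: each lift at least halves the remaining error, and [qmap_lift] keeps
    its norm below the current error bound, so the partial sums converge in [A]. *)
Lemma qmap_surj b : exists a, qmap a = b.
Proof.
have hQ := @rnorm_seminorm R quot.
pose C := rnorm b + 1; have C0 : 0 < C by rewrite ltr_wpDl// (csn_ge0 hQ).
pose r n := C / 2 ^+ n; have r0 n : 0 < r n by rewrite divr_gt0// exprn_gt0.
have r1 n : r n.+1 = r n / 2 by rewrite /r exprS invfM mulrAC mulrA.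
have /choice[F hF] (p : nat * quot) : exists a : A, rnorm p.2 < r p.1 ->
    rnorm a < r p.1 /\ rnorm (p.2 - qmap a) < r p.1 / 2.
  have [h|h] := boolP (rnorm p.2 < r p.1); last by exists 0.
  by have [a ha] := qmap_lift h; exists a.
pose s := fix s n : A := if n is m.+1 then s m + F (m, b - qmap (s m)) else 0.
have hs n : rnorm (b - qmap (s n)) < r n.
  elim: n => [|n IH] /=.
    by rewrite (shom0 qmap_shom) subr0 /r expr0 divr1 /C ltrDl.
  have [_ h] := hF (n, b - qmap (s n)) IH.
  by rewrite (shomD qmap_shom) opprD addrA r1.
have ds m n : rnorm (s (n + m)%N - s n) <= 2 * r n - 2 * r (n + m)%N.
  elim: m => [|m IH]; first by rewrite addn0 !subrr (csn0 hA).
  rewrite addnS /= addrAC r1; apply: le_trans (csn_triangle hA _ _) _.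
  have [h _] := hF ((n + m)%N, b - qmap (s (n + m)%N)) (hs _).
  rewrite /= in h; lra.
have rlim e : 0 < e -> exists N, forall n, (N <= n)%N -> r n < e.
  move=> e0; have /cvgrPdist_lt/(_ _ (divr_gt0 e0 C0))[N _ hN] :
      (fun n => (2^-1 : R) ^+ n) @ \oo --> (0 : R).
    by apply: cvg_expr; rewrite ger0_norm; lra.
  exists N => n /hN; rewrite /= sub0r normrN ger0_norm ?exprn_ge0 ?invr_ge0//.
  by rewrite ltr_pdivlMr// mulrC exprVn.
have [a ha] : exists a, cvg_for (@rnorm R A) s a.
  apply: rnorm_complete.
  move=> e e0; have e2 : 0 < e / 4 by rewrite divr_gt0.
  have [N hN] := rlim _ e2; exists N => m n Nm Nn.
  apply: le_lt_trans (csn_dist hA (s N) _ _) _; rewrite (csnBC hA (s N)).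
  have := ds (m - N)%N N; have := ds (n - N)%N N; rewrite !subnKC//.
  have := hN N (leqnn N); have := r0 m; have := r0 n; lra.
exists a; apply: rnorm_eq => e e0; have e2 : 0 < e / 2 by rewrite divr_gt0.
have [N hN] := ha _ e2; have [M hM] := rlim _ e2; pose n := maxn N M.
have h1 := hN n (leq_maxl _ _); have h2 := hM n (leq_maxr _ _); have h3 := hs n.
apply: le_trans (csn_dist hQ (qmap (s n)) _ _) _.
rewrite -(shomB qmap_shom) (csnBC hQ _ b).
have := shom_norm qmap_shom (a - s n); rewrite (csnBC hA); lra.
Qed.

Lemma qmap_quotient : quotient_map I qmap.
Proof.
have hq := qmap_shom; split; [exact: shomD|exact: shomZ|exact: shomM|exact: shom_star| | |].
- exact: qmap_surj.
- exact: qmap_ker.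
- exact: rnorm_qmap.
Qed.

End QuotientAlgebra.

Section KernelComparison.
Context (R : realType) (A B C : cstarAlgType R) (phi : A -> B) (psi : A -> C).
Hypotheses (hphi : shom phi) (hpsi : shom psi).

Lemma cutdown_eq0 (V : cstarAlgType R) (a : V) e :
  psd (uin a) -> rnorm a <= e -> cutdown a e = 0.
Proof.
move=> pa ae; have sa := psd_sa pa; have e0 := le_trans (csn_ge0 (@rnorm_seminorm R V) a) ae.
apply: rnorm_eq => d d0; rewrite subr0 -un_uin uin_cutdown ?psd_uin_sa//.
apply: fc_le => //; first exact: pap_tcut.
move=> t /Sp_le; rewrite un_uin => ht; rewrite /tcut max_r ?normr0 ?(ltW d0)//.
by rewrite subr_le0 (le_trans (ler_norm t))// (le_trans ht).
Qed.

(** For [h = star a ** a], the cut-down of [h] at the level [|phi h|] is killed by [phi], hence by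
    [psi], so [|psi h|] is at most that level. Norms of images thus depend on kernels only. *)
Lemma shom_ker_le a : (forall a, phi a = 0 -> psi a = 0) -> rnorm (psi a) <= rnorm (phi a).
Proof.
move=> ker; have hB := @rnorm_seminorm R B; have hC := @rnorm_seminorm R C.
rewrite -(@ler_pXn2r _ 2) ?nnegrE ?(csn_ge0 hB) ?(csn_ge0 hC)//.
rewrite -(csn_star hB) -(csn_star hC).
rewrite -(shom_star hphi) -(shomM hphi) -(shom_star hpsi) -(shomM hpsi).
set h := star a ** a; have ph : psd (uin h) by exact: psd_starM_uin.
have e0 : 0 <= rnorm (phi h) by exact: (csn_ge0 hB).
have c0 : phi (cutdown h (rnorm (phi h))) = 0.
  rewrite (shom_cutdown hphi)// ?psd_uin_sa//.
  by apply: cutdown_eq0 => //; exact: shom_psd.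
move: (ker _ c0); rewrite (shom_cutdown hpsi) ?psd_uin_sa// => c1.
have := un_cutdown (shom_psd hpsi ph) e0.
by rewrite c1 uin0 subr0 un_uin.
Qed.

End KernelComparison.

Lemma rnorm_star (R : realType) (V : cstarAlgType R) (x : V) : rnorm (x ** star x) = rnorm x ^+ 2.
Proof.
rewrite -{1}(starK x) (csn_star (@rnorm_seminorm R V)).
by rewrite (csn_isometric_star (@rnorm_seminorm R V)).
Qed.

Lemma shom_norm_starM (R : realType) (V W : cstarAlgType R) (phi : V -> W) (hphi : shom phi) x :
  rnorm (phi (star x ** x)) = rnorm (phi x) ^+ 2.
Proof. by rewrite (shomM hphi) (shom_star hphi) (csn_star (@rnorm_seminorm R W)). Qed.

Lemma shom_norm_Mstar (R : realType) (V W : cstarAlgType R) (phi : V -> W) (hphi : shom phi) x :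
  rnorm (phi (x ** star x)) = rnorm (phi x) ^+ 2.
Proof. by rewrite (shomM hphi) (shom_star hphi) rnorm_star. Qed.

Lemma shom_norm_star (R : realType) (V W : cstarAlgType R) (phi : V -> W) (hphi : shom phi) x :
  rnorm (phi (star x)) = rnorm (phi x).
Proof. by rewrite (shom_star hphi) (csn_isometric_star (@rnorm_seminorm R W)). Qed.

(** * Matrix units in the stabilization *)

Section Corner.
Context (R : realType) (A : cstarAlgType R).
Local Notation S := (stab A).
Local Notation hA := (@rnorm_seminorm R A).
Local Notation fmo := (hc_of (fm_norm_seminorm A)).

Definition elem i j (a : A) : S := fmo (fm_unit i j a).

Lemma fm_unit_mull i j a (T : finmx A) r s :
  (fm_unit i j a ** T) r s = if r == i then a ** T j s else 0.
Proof.
have hb : mx_bounded (fm_unit i j a) (maxn i j).+1.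
  move=> p q h /=; case: ifP => // /andP[/eqP pi /eqP qj].
  by move: h; rewrite pi qj !ltnNge leq_maxl leq_maxr.
rewrite (fm_mulE _ _ (or_introl hb)).
have hj : (j < (maxn i j).+1)%N by rewrite ltnS leq_maxr.
rewrite (bigD1 (Ordinal hj))//= big1 ?addr0 => [|p hp]; last first.
  have [E|_] := eqVneq (p : nat) j; last by rewrite andbF smul0l.
  by move: hp; rewrite -val_eqE /= E eqxx.
by rewrite eqxx andbT; case: (r == i); rewrite ?smul0l.
Qed.

Lemma fm_unitM i j k l (a b : A) :
  fm_unit i j a ** fm_unit k l b = if j == k then fm_unit i l (a ** b) else 0.
Proof.
apply: finmxP => r s; rewrite fm_unit_mull.
have [->|/negPf jk] := eqVneq j k; rewrite /= ?eqxx ?jk ?smul0r ?if_same//.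
by case: (r == i) => //=; case: (s == l); rewrite ?smul0r.
Qed.

Lemma fm_unit_star i j (a : A) : star (fm_unit i j a) = fm_unit j i (star a).
Proof. by apply: finmxP => r s /=; rewrite andbC; case: ifP; rewrite ?star0. Qed.

Lemma elemD i j a b : elem i j (a + b) = elem i j a + elem i j b.
Proof.
rewrite /elem -hc_ofD; congr (hc_of _ _); apply: finmxP => r s /=.
by case: ifP; rewrite ?addr0.
Qed.

Lemma elemZ i j (c : R[i]) a : elem i j (c *: a) = c *: elem i j a.
Proof.
rewrite /elem -hc_ofZ; congr (hc_of _ _); apply: finmxP => r s /=.
by case: ifP; rewrite ?scaler0.
Qed.

Lemma elemM i j k a b : elem i j a ** elem j k b = elem i k (a ** b).
Proof. by rewrite /elem -hc_ofM fm_unitM eqxx. Qed.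

Lemma elem_star i j a : star (elem i j a) = elem j i (star a).
Proof. by rewrite /elem -hc_of_star fm_unit_star. Qed.

Lemma elemMstar i j a : elem i j a ** star (elem i j a) = elem i i (a ** star a).
Proof. by rewrite elem_star elemM. Qed.

Lemma elem_starM i j a : star (elem i j a) ** elem i j a = elem j j (star a ** a).
Proof. by rewrite elem_star elemM. Qed.

(** The C*-identity, used once on each side, moves row and column index independently. *)
Lemma shom_elem_norm (V : cstarAlgType R) (phi : S -> V) i j a : shom phi ->
  rnorm (phi (elem i j a)) = rnorm (phi (elem 0 0 a)).
Proof.
move=> hphi; have hV := @rnorm_seminorm R V.
apply: (@pexpIrn _ 2); rewrite ?nnegrE; [by []|exact: (csn_ge0 hV)..|].
rewrite -(shom_norm_Mstar hphi) elemMstar -(elemMstar i 0) (shom_norm_Mstar hphi).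
by rewrite -(shom_norm_starM hphi) elem_starM -(elem_starM 0 0) (shom_norm_starM hphi).
Qed.

Lemma elem_norm i j a : rnorm (elem i j a) <= rnorm a.
Proof. by rewrite rnorm_hc_of; exact: fm_norm_unit. Qed.

Lemma corner_shom : shom (elem 0 0).
Proof.
split=> [a b|c a|a b|a|a]; [exact: elemD|exact: elemZ|by rewrite elemM|by rewrite elem_star|].
exact: elem_norm.
Qed.

Lemma elem_entry i j (T : finmx A) a b :
  elem 0 i a ** fmo T ** elem j 0 b = elem 0 0 (a ** T i j ** b).
Proof.
rewrite /elem -!hc_ofM; congr (hc_of _ _).
apply: finmxP => r s; rewrite -smulA fm_unit_mull.
have -> : (T ** fm_unit j 0 b) i s = if s == 0%N then T i j ** b else 0.
  apply: (can_inj starK).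
  rewrite -[LHS]/((star (T ** fm_unit j 0 b) : finmx A) s i).
  rewrite starM fm_unit_star fm_unit_mull /=.
  by case: ifP => _; rewrite ?star0// starM.
by rewrite /=; case: (r == _); case: (s == _); rewrite /= ?smul0r ?smulA.
Qed.

End Corner.
Section PowersOfMatrices.
Context (R : realType) (A : cstarAlgType R).

Lemma mx_boundedM (T U : finmx A) N : mx_bounded T N -> mx_bounded U N -> mx_bounded (T ** U) N.
Proof.
move=> hT hU i j ij; rewrite (fm_mulE _ _ (or_introl hT)) big1// => k _.
by case/orP: ij => h; [rewrite hT ?h// smul0l|rewrite hU ?h ?orbT// smul0r].
Qed.

Lemma sum_delta (f : nat -> A) r N :
  \sum_(i < N) (if r == i :> nat then f i else 0) = if (r < N)%N then f r else 0.
Proof.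
elim: N => [|N IH]; first by rewrite big_ord0.
rewrite big_ord_recr /= IH [in RHS]ltnS [in RHS]leq_eqVlt.
by have [->|rN] := eqVneq r N; rewrite /= ?ltnn ?add0r ?addr0.
Qed.

Lemma fm_unit_sum_bounded (T : finmx A) N : mx_bounded T N ->
  T = \sum_(i < N) \sum_(j < N) fm_unit i j (T i j).
Proof.
move=> hT; apply: finmxP => r s; rewrite fm_sumE.
rewrite (eq_bigr (fun i : 'I_N => if r == i :> nat then
  (if (s < N)%N then T i s else 0) else 0)) => [|i _]; last first.
  rewrite fm_sumE /=; case: (r == i) => /=; last by rewrite big1.
  exact: (sum_delta (fun j => T i j)).
rewrite (sum_delta (fun i => if (s < N)%N then T i s else 0)).
by have [|h] := ltnP r N; [have [|h] := ltnP s N|]; rewrite // hT ?h ?orbT.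
Qed.

Fixpoint pow2 (V : starAlgType R) (y : V) n := if n is m.+1 then pow2 y m ** pow2 y m else y.

Lemma pow2_star (V : starAlgType R) (y : V) n : star y = y -> star (pow2 y n) = pow2 y n.
Proof. by move=> sy; elim: n => //= n IH; rewrite starM IH. Qed.

Lemma pow2_norm (V : starAlgType R) (p : V -> R) (y : V) n : cstar_seminorm p -> star y = y ->
  p (pow2 y n) = p y ^+ (2 ^ n).
Proof.
move=> hp sy; elim: n => [|n IH] /=; first by rewrite expn0 expr1.
by rewrite -{1}(pow2_star n sy) (csn_star hp) IH -exprM expnS mulnC.
Qed.

End PowersOfMatrices.

(** * Closed ideals and quotients of the stabilization *)

Section KernelIdeal.
Context (R : realType) (A B : cstarAlgType R) (phi : A -> B) (hphi : shom phi).
Local Notation hA := (@rnorm_seminorm R A).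
Local Notation hB := (@rnorm_seminorm R B).

Lemma closed_rnorm (I : set A) :
  (forall a, (forall e, 0 < e -> exists2 x, I x & rnorm (x - a) < e) -> I a) -> closed I.
Proof.
move=> H a ha; apply: H => e e0.
have /rnorm_cvgP/(_ e e0) : nbhs a --> a by exact: cvg_id.
by move=> /ha[x [hx hax]]; exists x.
Qed.

Lemma ker_closed_ideal : closed_ideal [set a | phi a = 0].
Proof.
split=> /= [|x y hx hy|c x hx|a x hx|a x hx|].
- exact: shom0.
- by rewrite (shomD hphi) hx hy addr0.
- by rewrite (shomZ hphi) hx scaler0.
- by rewrite (shomM hphi) hx smul0r.
- by rewrite (shomM hphi) hx smul0l.
- apply: closed_rnorm => a h; apply: rnorm_eq => e /h[x /= hx xa]; rewrite -hx.
  rewrite -(shomB hphi) (le_trans (shom_norm hphi _))// (csnBC hA); exact: ltW.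
Qed.

End KernelIdeal.

Opaque quot qmap.

Section StableQuotient.
Context (R : realType) (A : cstarAlgType R).
Local Notation S := (stab A).
Context (J : set S) (hJ : closed_ideal J).
Local Notation fmo := (hc_of (fm_norm_seminorm A)).
Local Notation hA := (@rnorm_seminorm R A).
Local Notation hS := (@rnorm_seminorm R S).

Local Notation pi := (qmap hJ).
Let hpi : shom pi := qmap_shom hJ.
Local Notation hC := (@rnorm_seminorm R (quot hJ)).

Lemma corner_quot_shom : shom (fun a : A => pi (elem 0 0 a)).
Proof.
have hc := corner_shom A; split=> [a b|c a|a b|a|a].
- by rewrite (shomD hc) (shomD hpi).
- by rewrite (shomZ hc) (shomZ hpi).
- by rewrite (shomM hc) (shomM hpi).
- by rewrite (shom_star hc) (shom_star hpi).
- by rewrite (le_trans (shom_norm hpi _))// (shom_norm hc).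
Qed.

(** A closed ideal of [stab A] is the stabilization of an ideal of [A]; this is that ideal, and
    [stab_quot_ker] makes the correspondence precise. *)
Definition corner_ideal : set A := [set a | pi (elem 0 0 a) = 0].
Definition corner_idealP : closed_ideal corner_ideal := ker_closed_ideal corner_quot_shom.
Local Notation q := (qmap corner_idealP).
Local Notation B := (quot corner_idealP).
Let hq : shom q := qmap_shom corner_idealP.
Definition stab_quot : S -> stab B := stab_map hq.
Lemma stab_quot_shom : shom stab_quot. Proof. exact: stab_map_shom. Qed.
Local Notation theta := stab_quot.

Lemma rnorm_q i j a : rnorm (q a) = rnorm (pi (elem i j a)).
Proof.
have E : rnorm (q a) = rnorm (pi (elem 0 0 a)).
  apply/le_anti; rewrite (shom_ker_le corner_quot_shom hq) => [|b hb]/=; last exact/qmap_ker.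
  by rewrite (shom_ker_le hq corner_quot_shom)// => b /qmap_ker.
by rewrite E (shom_elem_norm i j a hpi).
Qed.

(** Without a unit the entry [a] is isolated by compressing [T] with [star a] on both sides. This
    bounds [|q a|^4] by [|q a|^3] times the norm of [T] in the quotient, and the powers cancel. *)
Lemma rnorm_q_entry (T : finmx A) i j : rnorm (q (T i j)) <= rnorm (pi (fmo T)).
Proof.
set a := T i j; have [a0|an] := eqVneq (rnorm (q a)) 0; first by rewrite a0 (csn_ge0 hC).
have q0 : 0 < rnorm (q a) by rewrite lt_def an (csn_ge0 (@rnorm_seminorm R B)).
have h4 : rnorm (q (star a ** a ** star a ** a)) = rnorm (q a) ^+ 4.
  rewrite -smulA -{1}(starK (star a ** a)) starM starK (shom_norm_starM hq).
  by rewrite (shom_norm_starM hq) -exprM.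
have h3 : rnorm (q (star a ** a ** star a)) <= rnorm (q a) ^+ 2 * rnorm (pi (fmo T)).
  rewrite (rnorm_q 0 0) -(elem_entry i j T (star a) (star a)) (shomM hpi).
  apply: le_trans (csn_mul hC _ _) _; rewrite -(rnorm_q j 0) (shom_norm_star hq).
  rewrite expr2 -mulrA [X in _ <= _ * X]mulrC mulrA.
  apply: ler_pM; [exact: (csn_ge0 hC)|exact: ltW| |exact: lexx].
  rewrite (shomM hpi); apply: le_trans (csn_mul hC _ _) _.
  by rewrite -(rnorm_q 0 i) (shom_norm_star hq).
have : rnorm (q a) ^+ 4 <= rnorm (q a) ^+ 2 * rnorm (pi (fmo T)) * rnorm (q a).
  rewrite -h4 (shomM hq); apply: le_trans (csn_mul (@rnorm_seminorm R B) _ _) _.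
  by rewrite ler_wpM2r// ltW.
rewrite mulrAC -exprSr (exprSr _ 3) ler_pM2l ?exprn_gt0//.
Qed.

Lemma theta_of T : theta (fmo T) = hc_of (fm_norm_seminorm B) (fm_map hq T).
Proof. exact: hc_map_of. Qed.

Lemma fm_map_bound (T : finmx A) N : mx_bounded T N ->
  fm_norm (fm_map hq T) <= (N * N)%:R * rnorm (pi (fmo T)).
Proof.
move=> hT; apply: fm_norm_leP => p [hp pu].
have hT' : mx_bounded (fm_map hq T) N by move=> i j h; rewrite /= hT// (shom0 hq).
rewrite (fm_unit_sum_bounded hT'); apply: le_trans (csn_sum hp _ _) _.
apply: (@le_trans _ _ (\sum_(i < N) N%:R * rnorm (pi (fmo T)))); last first.
  by rewrite sumr_const card_ord mulrnA -mulrnAl.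
apply: ler_sum => i _; apply: le_trans (csn_sum hp _ _) _.
apply: (@le_trans _ _ (\sum_(j < N) rnorm (pi (fmo T)))); last first.
  by rewrite sumr_const card_ord mulr_natl.
by apply: ler_sum => j _; apply: le_trans (pu _ _ _) _; exact: rnorm_q_entry.
Qed.

(* [fm_map_bound] applied to the powers of [T^* T], whose size stays [N]. *)
Lemma fm_map_le (T : finmx A) : fm_norm (fm_map hq T) <= rnorm (pi (fmo T)).
Proof.
have hn := fm_norm_seminorm B; have n0 := csn_ge0 hn (fm_map hq T).
have p0 := csn_ge0 hC (pi (fmo T)).
rewrite -(@ler_pXn2r _ 2) ?nnegrE// -(csn_star hn) -(csn_star hC).
rewrite -fm_map_star -fm_mapM -(shom_star hpi) -(shomM hpi).
rewrite -[star (fmo T)]hc_of_star -[_ ** fmo T]hc_ofM.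
set W := star T ** T; have sW : star W = W by rewrite /W starM starK.
have [N hN] : exists N, mx_bounded W N by exists (mx_bd W); exact: mx_bdP.
have hpw n : mx_bounded (pow2 W n) N by elim: n => //= n IH; exact: mx_boundedM.
apply: (@le_of_powers _ _ _ (N * N)%:R); rewrite ?(csn_ge0 hn) ?(csn_ge0 hC)// => n.
have hmap : cstar_seminorm (fun T => fm_norm (fm_map hq T)).
  have := @cstar_seminorm_comp R (finmx A) (finmx B) (@fm_norm R B) (fm_map hq); apply=> //.
  - exact: fm_mapD.
  - exact: fm_mapZ.
  - exact: fm_mapM.
  - exact: fm_map_star.
rewrite -(pow2_norm n hmap sW) -(pow2_norm n (seminorm_hc_of hpi hC) sW).
exact: fm_map_bound.
Qed.

Lemma pi_fmo_eq0 (T : finmx A) : fm_map hq T = 0 -> pi (fmo T) = 0.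
Proof.
move=> hT; apply: rnorm_eq => e e0; rewrite subr0.
have hp := seminorm_hc_of hpi hC; apply: le_trans (ltW e0).
rewrite {1}(fm_unit_sum T); apply: le_trans (csn_sum hp _ _) _; apply: sumr_le0 => i _.
apply: le_trans (csn_sum hp _ _) _; apply: sumr_le0 => j _.
rewrite -[fmo _]/(elem i j (T i j)) -(rnorm_q i j) -[q _]/(fm_map hq T i j) hT.
by rewrite (csn0 (@rnorm_seminorm R B)).
Qed.

Lemma fm_lift_ex : exists l : B -> A, l 0 = 0 /\ forall b, q (l b) = b.
Proof.
have /choice[f hf] b : exists a, q a = b := qmap_surj b.
exists (fun b => f b - f 0); split=> [|b]; first by rewrite subrr.
by rewrite (shomB hq) !hf subr0.
Qed.

(** An entrywise lift makes the norm of the quotient of [stab A] a function on matrices over [B]. It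
    does not depend on the lift, since both maps kill the same matrices, so it is an admissible
    seminorm and lies below the maximal one. *)
Lemma fm_map_ge (T : finmx A) : rnorm (pi (fmo T)) <= fm_norm (fm_map hq T).
Proof.
have [l [l0 lK]] := fm_lift_ex.
have fin (U : finmx B) : exists N, mx_bounded (fun i j => l (U i j)) N.
  by exists (mx_bd U) => i j h; rewrite mx_bdP.
pose L (U : finmx B) : finmx A := FinMx (fin U).
have LK U : fm_map hq (L U) = U by apply: finmxP => i j; exact: lK.
pose p U := rnorm (pi (fmo (L U))).
have hp := seminorm_hc_of hpi hC.
have pE (V : finmx A) : p (fm_map hq V) = rnorm (pi (fmo V)).
  have : pi (fmo (L (fm_map hq V) - V)) = 0 by apply: pi_fmo_eq0; rewrite fm_mapB LK subrr.
  by rewrite -hc_ofB (shomB hpi) => /eqP; rewrite subr_eq0 /p => /eqP ->.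
rewrite -pE; apply: (@fm_norm_ge _ _ p); split; last first.
  move=> i j b; rewrite -(lK b) -(fm_map_unit hq) pE.
  by rewrite -[fmo _]/(elem i j (l b)) -(rnorm_q i j).
have surj U : exists V, U = fm_map hq V by exists (L U).
split=> [U V|c U|U V|U].
- have [U' ->] := surj U; have [V' ->] := surj V.
  by rewrite -fm_mapD (pE (U' + V')) (pE U') (pE V'); exact: (csn_triangle hp).
- have [U' ->] := surj U; rewrite -fm_mapZ (pE (c *: U')) (pE U').
  exact: (csn_scale hp).
- have [U' ->] := surj U; have [V' ->] := surj V.
  by rewrite -fm_mapM (pE (U' ** V')) (pE U') (pE V'); exact: (csn_mul hp).
- have [U' ->] := surj U.
  rewrite -fm_map_star -fm_mapM (pE (star U' ** U')) (pE U'); exact: (csn_star hp).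
Qed.

Lemma stab_quot_norm w : rnorm (theta w) = rnorm (pi w).
Proof.
have hB := @rnorm_seminorm R (stab B); have ht := stab_quot_shom.
have E T : rnorm (theta (fmo T)) = rnorm (pi (fmo T)).
  by rewrite theta_of rnorm_hc_of; apply/le_anti; rewrite fm_map_le fm_map_ge.
apply/eqP; rewrite -subr_eq0 -normr_le0; apply/ler_addgt0Pr => e e0; rewrite add0r.
have e2 : 0 < e / 2 by rewrite divr_gt0.
have [T hT] := hc_approx w e2; set T' := fmo T in hT.
have h1 : rnorm (theta (w - T')) <= e / 2 := le_trans (shom_norm ht _) hT.
have h2 : rnorm (pi (w - T')) <= e / 2 := le_trans (shom_norm hpi _) hT.
rewrite (shomB ht) in h1; rewrite (shomB hpi) in h2.
have k1 := csn_leB hB (theta w) (theta T'); have k2 := csn_leB hB (theta T') (theta w).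
have k3 := csn_leB hC (pi w) (pi T'); have k4 := csn_leB hC (pi T') (pi w).
have k5 := csnBC hB (theta T') (theta w); have k6 := csnBC hC (pi T') (pi w).
have E' := E T; rewrite -/T' in E'; rewrite k5 in k2; rewrite k6 in k4.
rewrite E' in k1 k2; clear - h1 h2 k1 k2 k3 k4.
move: (rnorm (theta w)) (rnorm (pi w)) (rnorm (pi T')) h1 h2 k1 k2 k3 k4 => x y z.
move: (rnorm _) (rnorm _) => r s h1 h2 k1 k2 k3 k4; rewrite ler_norml; lra.
Qed.

Lemma stab_quot_ker w : theta w = 0 <-> J w.
Proof.
rewrite -(qmap_ker hJ); split=> h; apply: rnorm_eq => e e0; rewrite subr0.
  by rewrite -stab_quot_norm h (csn0 (@rnorm_seminorm R (stab B))) ltW.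
by rewrite stab_quot_norm h (csn0 hC) ltW.
Qed.

End StableQuotient.

Section GeneratedIdeal.
Context (R : realType) (S : cstarAlgType R) (g : S).
Local Notation hS := (@rnorm_seminorm R S).

Definition sandwich (s : seq (S * S)) : S := \sum_(p <- s) p.1 ** g ** p.2.

Definition gen_ideal : set S :=
  [set x | forall e, 0 < e -> exists s, rnorm (x - sandwich s) < e].

Lemma gen_ideal_map (F : S -> S) (G : seq (S * S) -> seq (S * S)) (M : R) x :
  0 <= M -> (forall x y, F (x - y) = F x - F y) -> (forall x, rnorm (F x) <= M * rnorm x) ->
  (forall s, F (sandwich s) = sandwich (G s)) -> gen_ideal x -> gen_ideal (F x).
Proof.
move=> M0 FB FM FG hx e e0; have M1 : 0 < M + 1 by rewrite ltr_wpDl.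
have [s hs] := hx _ (divr_gt0 e0 M1); exists (G s); rewrite -FG -FB.
apply: le_lt_trans (FM _) _; move: hs; rewrite ltr_pdivlMr// => hs.
apply: le_lt_trans hs; rewrite mulrC; apply: ler_pM => //; first exact: (csn_ge0 hS).
by rewrite lerDl.
Qed.

Lemma gen_idealP : closed_ideal gen_ideal.
Proof.
have mapE (f : S -> S) (h : S * S -> S * S) s :
    (forall x y, f (x + y) = f x + f y) -> f 0 = 0 ->
    (forall p, f (p.1 ** g ** p.2) = (h p).1 ** g ** (h p).2) ->
    f (sandwich s) = sandwich (map h s).
  move=> fD f0 fh; rewrite /sandwich big_map (big_morph f fD f0).
  by apply: eq_bigr => p _; exact: fh.
split=> [e e0|x y hx hy e e0|c x|a x|a x|].
- by exists [::]; rewrite /sandwich big_nil subr0 (csn0 hS).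
- have e2 : 0 < e / 2 by rewrite divr_gt0.
  have [s hs] := hx _ e2; have [t ht] := hy _ e2; exists (s ++ t).
  rewrite /sandwich big_cat opprD addrACA (splitr e).
  by apply: le_lt_trans (csn_triangle hS _ _) _; apply: ltrD.
- apply: (@gen_ideal_map _ (map (fun p => (c *: p.1, p.2))) (normc c)).
  + exact: normc_ge0.
  + exact: scalerBr.
  + by move=> y; rewrite (csn_scale hS).
  + move=> s; apply: (mapE _ (fun p => (c *: p.1, p.2))); [exact: scalerDr|exact: scaler0|].
    by move=> p; rewrite /= !scale_smull.
- apply: (@gen_ideal_map _ (map (fun p => (a ** p.1, p.2))) (rnorm a)).
  + exact: (csn_ge0 hS).
  + exact: smulBr.
  + exact: (csn_mul hS).
  + move=> s; apply: (mapE _ (fun p => (a ** p.1, p.2))); [exact: smulDr|exact: smul0r|].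
    by move=> p; rewrite /= !smulA.
- apply: (@gen_ideal_map (fun x => x ** a) (map (fun p => (p.1, p.2 ** a))) (rnorm a)).
  + exact: (csn_ge0 hS).
  + by move=> y z; exact: smulBl.
  + by move=> y; rewrite mulrC; exact: (csn_mul hS).
  + move=> s; apply: (mapE (fun x => x ** a) (fun p => (p.1, p.2 ** a))).
    * by move=> y z; exact: smulDl.
    * exact: smul0l.
    * by move=> p; rewrite /= !smulA.
- apply: closed_rnorm => x h e e0; have e2 : 0 < e / 2 by rewrite divr_gt0.
  have [y hy yx] := h _ e2; have [s hs] := hy _ e2; exists s; rewrite (splitr e).
  apply: le_lt_trans (csn_dist hS y _ _) _; rewrite (csnBC hS x y).
  exact: ltrD.
Qed.

Lemma gen_ideal_sandwich u v : gen_ideal (u ** g ** v).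
Proof.
move=> e e0; exists [:: (u, v)].
by rewrite /sandwich big_seq1 subrr (csn0 hS).
Qed.

Hypothesis pg : psd (uin g).

(** Each summand is positivity of the conjugate of [g] by [u - star v]: twice the real part of
    [u g v] is at most [u g (star u) + (star v) g v]. *)
Lemma sandwich_ple s : ple (uin (sandwich s) + star (uin (sandwich s)))
  (\sum_(p <- s) (uin p.1 * uin g * star (uin p.1) + star (uin p.2) * uin g * uin p.2)).
Proof.
have sg := psd_sa pg; rewrite /sandwich; elim: s => [|p s IH].
  by rewrite !big_nil uin0 star0 addr0 /ple subrr; exact: psd0.
rewrite !big_cons uinD starD addrACA; apply: pleD => //.
rewrite /ple !uinM; move: (uin p.1) (uin p.2) => u v.
have -> : u * uin g * star u + star v * uin g * v - (u * uin g * v + star (u * uin g * v)) =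
    (u - star v) * uin g * star (u - star v).
  rewrite !ustarM sg starB starK !mulrBl !mulrBr !mulrA opprB opprD.
  rewrite -!addrA; congr (_ + _); rewrite addrC -!addrA; congr (_ + _).
  by rewrite addrC.
exact: psd_conj.
Qed.

End GeneratedIdeal.

Section IdealComparison.
Context (R : realType) (S : ampAlg R) (g : S).
Hypothesis pg : psd (uin g).

Definition sandwich_bound (s : seq (S * S)) : S :=
  \sum_(p <- s) (p.1 ** g ** star p.1 + star p.2 ** g ** p.2).

Lemma conj_psd (u : S) : psd (uin (u ** g ** star u)).
Proof. by rewrite !uinM uin_star; exact: psd_conj. Qed.

Lemma cuntz_sandwich_bound s : psd (uin (sandwich_bound s)) /\
  exists k, cuntz_sub (sandwich_bound s) (amul k g).
Proof.
rewrite /sandwich_bound; elim: s => [|p s [IH1 [k IH2]]].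
  by rewrite big_nil; split; [exact: psd_uin0|exists 0; exact: cuntz_0sub].
rewrite big_cons -addrA.
have p1 := conj_psd p.1; have := conj_psd (star p.2); rewrite starK => p2.
have p3 := psdD_uin p2 IH1; split; first exact: psdD_uin.
exists k.+2; apply: (cuntz_trans (cuntz_add_asum p1 p3)); apply: cuntz_asum.
  by apply: (cuntz_conj (u := uin p.1)) => //; rewrite !uinM uin_star.
apply: (cuntz_trans (cuntz_add_asum p2 IH1)); apply: cuntz_asum => //.
by apply: (cuntz_conj (u := star (uin p.2))) => //; rewrite !uinM uin_star starK.
Qed.

Lemma cuntz_gen_ideal w e : psd (uin w) -> gen_ideal g w -> 0 < e ->
  exists k, cuntz_sub (cutdown w e) (amul k g).
Proof.
move=> pw hw e0; have e2 : 0 < e / 2 by rewrite divr_gt0.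
have [s hs] := hw _ e2; have [pb [k hk]] := cuntz_sandwich_bound s.
exists k; apply: cuntz_trans hk; apply: cuntz_cut => //; first exact: ltW.
have sw := psd_sa pw; set f := uin (sandwich g s).
have wf : un (uin w - f) <= e / 2 by rewrite /f -uinB un_uin ltW.
(* Passing to [2 w] lets the sandwich sum be paired with its adjoint, whose sum is bounded by a
   positive element; the two errors [e / 2] add up to [e]. *)
apply: (@ple_trans _ _ (uin w + uin w)); first by rewrite /ple addrK.
apply: (@ple_trans _ _ (f + star f + rs e)).
  apply: ple_near; rewrite ?starD ?sw ?starK//; first by rewrite addrC.
  rewrite opprD addrACA (splitr e); apply: le_trans (unD _ _) _; apply: lerD => //.
  by rewrite -{1}sw -starB un_star.
apply: pleD; last by rewrite /ple subrr; exact: psd0.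
suff -> : uin (sandwich_bound s) = \sum_(p <- s)
    (uin p.1 * uin g * star (uin p.1) + star (uin p.2) * uin g * uin p.2).
  exact: sandwich_ple.
by rewrite uin_sum; apply: eq_bigr => p _; rewrite uinD !uinM !uin_star.
Qed.

End IdealComparison.

Section FullElements.
Context (R : realType) (A : cstarAlgType R).
Local Notation S := (stab_amp A).

Lemma stab_map_amul (B : cstarAlgType R) (phi : A -> B) (hphi : shom phi) k (x : S) :
  stab_map hphi (amul k x) = amul k (stab_map hphi x : stab_amp B).
Proof.
elim: k => [|k IH]; first exact: (shom0 (stab_map_shom hphi)).
rewrite [amul k.+1 _]/(dsum (x : stab A) (amul k x)) stab_map_dsum.
by rewrite [RHS]/(dsum (stab_map hphi x) _) IH.
Qed.

(* Modulo the ideal generated by [g] the class of [b] is compact and properly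
   infinite, hence zero. *)
Lemma cuntz_full (b z g : S) d e :
  ~ (exists (I : set A) (B : cstarAlgType R) (q : A -> B),
      [/\ closed_ideal I, quotient_map I q
        & exists z : Cu B, [/\ z <> cu0, cu_compact z & cu_properly_infinite z]]) ->
  psd (uin b) -> psd (uin z) -> psd (uin g) -> 0 < d -> 0 < e ->
  cuntz_sub b (asum z g) -> cuntz_sub (amul 2 z) (cutdown b d) ->
  exists k, cuntz_sub (cutdown b e) (amul k g).
Proof.
move=> noquot pb pz pg d0 e0 bzg zb; apply: cuntz_gen_ideal => //.
pose hJ := gen_idealP (g : stab A); apply/(stab_quot_ker hJ).
have ht := stab_quot_shom hJ; set th := stab_quot hJ in ht *.
(* The ideal is spanned by products [u g v], so for want of a unit only the cube of [g] is visibly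
   inside; the C*-identity applied twice recovers [g]. *)
have tg : th g = 0.
  have g3 : th (g ** g ** g) = 0 by apply/(stab_quot_ker hJ); exact: gen_ideal_sandwich.
  have sg := psd_uin_sa pg; have hT := @rnorm_seminorm R (stab (quot (corner_idealP hJ))).
  have t4 : th (star (star g ** g) ** (star g ** g)) = 0.
    rewrite starM starK sg smulA (shomM ht) -[g ** g ** g]/(g ** g ** g) g3.
    exact: smul0l.
  apply: rnorm_eq => r r0; rewrite subr0.
  have := shom_norm_starM ht (star g ** g); rewrite t4 (csn0 hT) (shom_norm_starM ht).
  by move/esym/eqP; rewrite !expf_eq0/= => /eqP ->; exact: ltW.
have ptb := shom_psd ht pb; have ptz := shom_psd ht pz.
have le1 : cuntz_sub (th b) (th z).
  have := shom_cuntz ht bzg; rewrite [asum z g]/(dsum (z : stab A) g) /th /stab_quot stab_map_dsum -/(stab_quot hJ) -/th tg.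
  move=> h; apply: cuntz_trans h _.
    exact: (@cuntz_asum0 R (stab_amp _) (th z) ptz).1.
have le2 : cuntz_sub (amul 2 (th z : stab_amp _)) (cutdown (th b) d).
  have := shom_cuntz ht zb; rewrite (shom_cutdown ht) ?psd_uin_sa ?(ltW d0)//.
  by rewrite /th /stab_quot stab_map_amul.
(* This comparison is compactness and proper infiniteness in one: the class itself is below twice
   the class, and the cut-down is below [th b]. *)
have le3 : cuntz_sub (amul 2 (th b : stab_amp _)) (cutdown (th b) d).
  by apply: cuntz_trans le2; exact: cuntz_amul.
have /positiveP pth := ptb; have rep := cu_rep_class pth.
have rep2 := cu_mul_rep 2 rep.
have b0 : cu_class pth = cu0.
  apply: contrapT => nz; apply: noquot.
  exists (corner_ideal hJ), (quot (corner_idealP hJ)), (qmap (corner_idealP hJ)).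
  split; [exact: corner_idealP|exact: qmap_quotient|exists (cu_class pth); split=> //].
    apply/(cu_llP rep rep); exists d => //; apply: cuntz_trans le3.
    by apply/(cu_leP rep rep2); rewrite -{1}(mulr1n (cu_class pth)); exact: cu_leMn2.
  rewrite /cu_properly_infinite cu_mulE; apply/(cu_leP rep2 rep).
  apply: cuntz_trans le3 _; apply: cuntz_ple => //; first exact: (psd_cutdown ptb (ltW d0)).
  exact: (cutdown_ple ptb (ltW d0)).
rewrite b0 in rep; apply: cuntz_sub0; exact: cu_rep_sub rep (@cu0_rep _ _).
Qed.

End FullElements.

(** * Gluing and halving *)

(* A trivial continuous field of C*-algebras over [X] with fibre [S] and section
   algebra [D]. *)
Structure ampField (R : realType) (X : metricType R) (fS fD : ampAlg R) := AmpField {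
  fev : X -> fD -> fS;
  fcst : fS -> fD;
  fmul : ufun X -> fD -> fD;
  fev_shom : forall q, shom (fev q);
  fev_cst : forall q y, fev q (fcst y) = y;
  fev_mul : forall q h y, fev q (fmul h y) = (h q)%:C *: fev q y;
  fev_lt_open : forall y (e : R), open [set q | rnorm (fev q y) < e];
  fev_norm_le : forall y (e : R), 0 <= e -> (forall q, rnorm (fev q y) <= e) -> rnorm y <= e;
  fev_asum : forall q x y, fev q (asum x y) = asum (fev q x) (fev q y);
}.

Lemma shom_conj (R : realType) (A B : cstarAlgType R) (phi : A -> B) (hphi : shom phi) a b :
  phi (a ** b ** star a) = phi a ** phi b ** star (phi a).
Proof. by rewrite !(shomM hphi) (shom_star hphi). Qed.

(** * Gluing fibrewise comparisons *)

Section Gluing.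
Context (R : realType) (X : metricType R) (cX : compact [set: X]) (S D : ampAlg R) (T : ampField X S D).
Context (n : nat) (dimX : covering_dim_le X n).
Local Notation ev := (@fev R X S D T).
Local Notation kappa := (@fcst R X S D T).
Local Notation hmul := (@fmul R X S D T).
Local Notation hS := (@rnorm_seminorm R S).

Lemma colored_cover (U : X -> set X) : (forall q, \forall x \near q, U q x) ->
  exists (K : finType) (h : K -> ufun X) (col : K -> 'I_n.+1) (c : K -> X),
  [/\ forall x, \sum_k h k x = 1, forall k x, h k x != 0 -> U (c k) x
    & forall k k' x, k != k' -> col k = col k' -> h k x * h k' x = 0].
Proof.
move=> hU; have [[x0 _]|noX] := pselect (exists x : X, True); last first.
  exists void, (fun=> ufun1 X), (fun=> ord0), (of_void X).
  by split=> [x|[]|[]]; case: noX; exists x.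
have [s hs] := open_cover_compact cX hU.
have [||J [V [oV cV VU ord]]] := @dimX _ (fun j : seq_sub s => (U (ssval j))^°).
- by move=> j; exact: open_interior.
- apply/seteqP; split=> // x _; have [q qs qx] := hs x.
  by exists (SeqSub qs).
have [K [h [col [h1 hV hd]]]] := colored_partition oV cV ord.
have /choice[c hc] k : exists c : X, forall x, h k x != 0 -> U c x.
  have [hk|hk] := pselect (exists x, h k x != 0); last first.
    by exists x0 => x hx; case: hk; exists x.
  have [j hj] := hV k hk; have [i hi] := VU j.
  by exists (ssval i) => x /hj /hi; exact: interior_subset.
by exists K, h, col, c.
Qed.

Lemma color_cases (K : finType) (col : K -> 'I_n.+1) (a : K -> R) c :
  (forall k k', k != k' -> col k = col k' -> a k * a k' = 0) ->
  (forall k, col k = c -> a k = 0) \/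
  exists k0, [/\ col k0 = c, a k0 != 0 & forall k, col k = c -> k != k0 -> a k = 0].
Proof.
move=> hd; have [[k0 [k1 k2]]|no] := pselect (exists k0, col k0 = c /\ a k0 != 0); last first.
  by left=> k kc; apply: contrapT => /eqP ak; apply: no; exists k.
right; exists k0; split=> // k kc kk0.
have /eqP := hd k k0 kk0 (etrans kc (esym k1)).
by rewrite mulf_eq0 (negPf k2) orbF => /eqP.
Qed.

Lemma ev_sum q (I : Type) (s : seq I) (P : pred I) (F : I -> D) :
  ev q (\sum_(i <- s | P i) F i) = \sum_(i <- s | P i) ev q (F i).
Proof.
apply: (big_morph (ev q)); [exact: (shomD (fev_shom _ _))|exact: (shom0 (fev_shom _ _))].
Qed.

(** Conjugators of one colour are added up as [W i], weighted by roots of the partition. Disjoint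
    supports exclude cross terms, so the sum over colours of [W i ** g ** star (W i)] is the convex
    combination of the local conjugates, within [e] of [f]. Only the [n.+1] colours are paid for. *)
Lemma gluing (f g : D) e : psd (uin f) -> psd (uin g) -> 0 < e ->
  (forall q, cuntz_sub (ev q f) (ev q g)) -> cuntz_sub (cutdown f e) (amul n.+1 g).
Proof.
move=> pf pg e0 fg; have hev q := fev_shom T q.
have /choice[v hv] q : exists v : S, rnorm (v ** ev q g ** star v - ev q f) < e.
  by have /cuntz_subP/(_ e e0)[v hv] := fg q; exists v; rewrite -un_uin uinB.
pose G q : D := kappa (v q) ** g ** star (kappa (v q)) - f.
have Gev q x : ev x (G q) = v q ** ev x g ** star (v q) - ev x f.
  by rewrite /G (shomB (hev x)) (shom_conj (hev x)) fev_cst.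
have [|K [h [col [c [h1 hU hd]]]]] := @colored_cover (fun q => [set x | rnorm (ev x (G q)) < e]).
  move=> q; apply: open_nbhs_nbhs; split; first exact: fev_lt_open.
  by rewrite /= Gev.
pose W (i : 'I_n.+1) : D := \sum_(k | col k == i) hmul (ufun_sqrt (h k)) (kappa (v (c k))).
pose F : D := \sum_(i < n.+1) W i ** g ** star (W i).
have WgW i : psd (uin (W i ** g ** star (W i))) by exact: conj_psd.
have pF : psd (uin F) by rewrite uin_sum; apply: psd_sumr => i; exact: WgW.
have evW x i : ev x (W i) = \sum_(k | col k == i) (Num.sqrt (h k x))%:C *: v (c k).
  by rewrite ev_sum; apply: eq_bigr => k _; rewrite fev_mul fev_cst.
have evWgW x i : ev x (W i ** g ** star (W i)) =
    \sum_(k | col k == i) (h k x)%:C *: (v (c k) ** ev x g ** star (v (c k))).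
  rewrite (shom_conj (hev x)) evW.
  have [h0|[k0 [k1 k2 k3]]] := @color_cases K col (fun k => h k x) i (fun k k' => hd k k' x).
    rewrite !big1 ?smul0l// => k /eqP ki; rewrite h0// ?sqrtr0 ?scale0r//.
  have E (L : K -> S) : (forall k, col k = i -> k != k0 -> L k = 0) ->
      \sum_(k | col k == i) L k = L k0.
    move=> hL; rewrite (bigD1 k0) ?k1//= big1 ?addr0// => k /andP[/eqP ki kk].
    exact: hL.
  rewrite !E => [|k ki kk|k ki kk]; last 2 first.
  - by rewrite k3// scale0r.
  - by rewrite k3// sqrtr0 scale0r.
  rewrite starZ conjc_real !scale_smull scale_smulr scalerA -rmorphM -expr2 sqr_sqrtr//.
  by have /andP[] := uf_01 (h k0) x.
have evF x : ev x F = \sum_k (h k x)%:C *: (v (c k) ** ev x g ** star (v (c k))).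
  rewrite ev_sum (eq_bigr _ (fun i _ => evWgW x i)).
  by rewrite [RHS](partition_big col predT).
have Ff : rnorm (F - f) <= e.
  apply: (@fev_norm_le _ _ _ _ T) => [|x]; first exact: ltW.
  have -> : ev x (F - f) = \sum_k (h k x)%:C *: ev x (G (c k)).
    rewrite (shomB (hev x)) evF -[ev x f]scale1r -(rmorph1 (real_complex R)) -(h1 x).
    rewrite rmorph_sum scaler_suml -sumrB; apply: eq_bigr => k _.
    by rewrite Gev scalerBr.
  apply: le_trans (csn_sum hS _ _) _; rewrite -[leRHS]mul1r -(h1 x) mulr_suml.
  apply: ler_sum => k _; rewrite (csn_scale hS) normc_real.
  have /andP[hk0 _] := uf_01 (h k) x; rewrite ger0_norm//.
  have [->|hk] := eqVneq (h k x) 0; first by rewrite !mul0r.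
  by rewrite ler_wpM2l// ltW//; exact: hU.
apply: (@cuntz_trans _ _ F).
  apply: cuntz_cut => //; first exact: ltW.
  by apply: ple_near; rewrite ?(psd_sa pf) ?(psd_sa pF)// -uinB un_uin (csnBC (@rnorm_seminorm R _)).
pose F' (i : nat) : D := W (inord i) ** g ** star (W (inord i)).
have -> : F = \sum_(i < n.+1) F' i by apply: eq_bigr => i _; rewrite /F' inord_val.
apply: cuntz_sum_amul => // i; first exact: WgW.
by apply: (cuntz_conj (u := uin (W (inord i)))) => //; rewrite !uinM uin_star.
Qed.

End Gluing.

(** * Cut-down estimates and orthogonal complements *)

Section CutComparison.
Context (R : realType) (A : cstarAlgType R).
Local Notation U := (unz A).
Implicit Types (x y z w : U) (a b : A).

Lemma ple_scale x r s : psd x -> r <= s -> ple (rs r * x) (rs s * x).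
Proof. by move=> px rs_; rewrite /ple -mulrBl -rsB; apply: psdZ => //; rewrite subr_ge0. Qed.

Lemma ple_rs x : star x = x -> ple x (rs (un x)).
Proof. by move=> sx; exact: psd_un_sub. Qed.

Lemma ple_conjD x y z : psd z ->
  ple ((x + y) * z * star (x + y)) (rs 2 * (x * z * star x + y * z * star y)).
Proof.
move=> pz; rewrite /ple.
suff -> : rs 2 * (x * z * star x + y * z * star y) - (x + y) * z * star (x + y) =
    (x - y) * z * star (x - y) by exact: psd_conj.
apply/eqP; rewrite subr_eq; apply/eqP.
have -> : rs 2 = 1 + 1 :> U by rewrite -rs1 -rsD.
have E (u v s t : U) : (1 + 1) * (u + v) = (u - s + (- t + v)) + (u + s + (t + v)).
  have -> : u - s + (- t + v) = u + v - (s + t).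
    by rewrite opprD -!addrA; congr (u + _); rewrite addrA addrC.
  have -> : u + s + (t + v) = u + v + (s + t).
    by rewrite -!addrA; congr (u + _); rewrite addrA addrC.
  by rewrite mulrDl mul1r [RHS]addrACA addNr addr0.
rewrite (E _ _ (x * z * star y) (y * z * star x)) !starD starN.
by rewrite !mulrDl !mulrDr !mulNr !mulrN opprK.
Qed.

Lemma cuntz_cut2 a b r s : psd (uin a) -> psd (uin b) -> 0 <= r -> 0 <= s ->
  ple (uin a) (uin b + rs r) -> cuntz_sub (cutdown a (r + s)) (cutdown b s).
Proof.
move=> pa pb r0 s0 ab; apply: cuntz_cut => //; [exact: psd_cutdown|exact: addr_ge0|].
apply: ple_trans ab _; rewrite [r + s]addrC rsD addrA.
by apply: pleD; [exact: ple_cutdown|exact: ple_refl].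
Qed.

Lemma cuntz_near2 a b r s : psd (uin a) -> psd (uin b) -> 0 <= r -> 0 <= s ->
  rnorm (a - b) <= r -> cuntz_sub (cutdown a (r + s)) (cutdown b s).
Proof.
move=> pa pb r0 s0 ab; apply: cuntz_cut2 => //.
by apply: ple_near; rewrite ?psd_sa// -uinB un_uin.
Qed.

Lemma cuntz_near a b r : psd (uin a) -> psd (uin b) -> 0 <= r ->
  rnorm (a - b) <= r -> cuntz_sub (cutdown a r) b.
Proof.
move=> pa pb r0 ab; have := cuntz_near2 pa pb r0 (lexx 0) ab.
by rewrite addr0 (cutdown0 pb).
Qed.

Lemma cuntz_cut_scale a b k s : psd (uin a) -> psd (uin b) -> 0 < k -> 0 <= s ->
  ple (uin a) (rs k * uin b) -> cuntz_sub (cutdown a (k * s)) (cutdown b s).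
Proof.
move=> pa pb k0 s0 ab; have pc := psd_cutdown pb s0.
apply: (@cuntz_trans _ _ (k%:C *: cutdown b s)); last exact: cuntz_scale (ltW k0) pc.
apply: cuntz_cut => //; first by rewrite uinZ rs_scale; apply: psdZ => //; exact: ltW.
  by rewrite mulr_ge0// ltW.
apply: ple_trans ab _; rewrite uinZ rs_scale rsM -mulrDr.
by apply: pleZ; [exact: ltW|exact: ple_cutdown].
Qed.

(* In the proof [E] is a bump function of [g] equal to [1] on the support of [p], and
   [q] is the square root of [a] multiplied by [1 - E]. *)
Lemma complement a g r c : psd (uin a) -> psd (uin g) -> 0 < r -> 0 <= c ->
  ple (uin g) (rs c * uin a) ->
  exists (p q : A) (M K : R), [/\ p ** star p = cutdown g r, star p ** q = 0, 0 <= M /\ 0 <= K,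
    ple (uin (p ** star p + q ** star q)) (rs M * uin a)
    & ple (uin a) (rs K * uin (g + q ** star q))].
Proof.
move=> pa pg r0 c0 gc; have sg := psd_sa pg; have sa := psd_sa pa; have pid := @pap_id R.
pose f1 (t : R) := r^-1 * Num.min t r; pose f (t : R) := Num.sqrt (tcut r t).
have hf : pap f by apply: pap_sqrt; exact: pap_tcut.
have h1 : pap f1 by apply: papZ; apply: pap_min => //; exact: pap_cst.
have hw : pap (fun t => 1 - f1 t) by apply: papB => //; exact: pap_cst.
have f0 : f 0 = 0 by rewrite /f /tcut sub0r max_r ?sqrtr0// oppr_le0 ltW.
pose E := fc f1 (uin g); pose w := fc (fun t => 1 - f1 t) (uin g).
have wE : w + E = 1 by rewrite /w fcB ?fc_cst ?rs1 ?subrK//; exact: pap_cst.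
have sE : star E = E by exact: fc_sa.
have sw : star w = w by exact: fc_sa.
pose p := fcA f g; have up : uin p = fc f (uin g) by apply: uin_fcA => //; exact: psd_uin_sa.
have [q uq] : exists q, uin q = w * usqrt (uin a).
  have [q uq] := uin_ideal w 1 (ssqrt a); exists q.
  by rewrite uq mulr1 uin_ssqrt// psd_uin_sa.
have qq : uin (q ** star q) = w * uin a * star w.
  rewrite uinM uin_star uq ustarM (usqrt_sa pa).
  have := usqrtK pa; move: (usqrt (uin a)) => s <-; by rewrite !mulrA.
have pp : p ** star p = cutdown g r.
  apply: uin_inj; rewrite uinM uin_star up fc_sa// -fcM// uin_cutdown ?psd_uin_sa ?(ltW r0)//.
  apply: fc_ext => //; [exact: papM|exact: pap_tcut|move=> t _].
  by rewrite -expr2 sqr_sqrtr// /tcut le_max lexx orbT.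
(* [E] has norm at most [1] and [E <= g / r], so [E a E <= |a| E^2 <= (|a| / r) g]. *)
pose kap := un (uin a) / r; have k0 : 0 <= kap by rewrite divr_ge0 ?un_ge0// ltW.
have EaE : ple (E * uin a * star E) (rs kap * uin g).
  apply: ple_trans (ple_conj E (ple_rs sa)) _.
  rewrite rsC -mulrA sE /kap rsM -mulrA; apply: pleZ; first exact: un_ge0.
  have -> : rs r^-1 * uin g = fc (fun t => r^-1 * t) (uin g) by rewrite fcZ// fc_id.
  rewrite -fcM//; apply: fc_ple => //; [exact: papM|exact: papZ|].
  move=> t /pg.2 t0; have i0 : 0 <= r^-1 by rewrite invr_ge0 ltW.
  have m0 : 0 <= Num.min t r by rewrite le_min t0 ltW.
  have m1 : Num.min t r <= t by rewrite ge_min lexx.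
  have m2 : r^-1 * Num.min t r <= 1 by rewrite mulrC ler_pdivrMr// mul1r ge_min lexx orbT.
  rewrite /f1; apply: (@le_trans _ _ (1 * (r^-1 * Num.min t r))).
    by rewrite ler_wpM2r// mulr_ge0.
  by rewrite mul1r ler_wpM2l.
have pQ : psd (w * uin a * star w) by exact: psd_conj.
(* Since [w + E = 1], conjugation by a sum is at most twice the sum of conjugations. From
   [w = 1 - E], [w a w] is below [2 (1 + kap c) a], and the cut-down of [g] below [c a]; conversely
   [a] is below [2 (w a w + kap g)]. *)
exists p, q, (c + 2 * (1 + kap * c)), (2 * (1 + kap)).
split; first exact: pp.
- apply: uin_inj; rewrite uinM uin_star up fc_sa// uq mulrA -fcM//.
  rewrite (fc_ext (g := fun=> 0)) ?fc_cst ?rs0 ?mul0r ?uin0//; [exact: papM|exact: pap_cst|].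
  move=> t _; rewrite /f /f1; have [tr|tr] := leP t r.
    by rewrite /tcut max_r ?subr_le0// sqrtr0 mul0r.
  by rewrite mulVf ?gt_eqF// subrr mulr0.
- have kc : 0 <= kap * c by rewrite mulr_ge0.
  by split; lra.
- rewrite uinD pp qq rsD mulrDl; apply: pleD.
    by apply: ple_trans gc; apply: cutdown_ple => //; exact: ltW.
  have -> : w = 1 + - E by rewrite -wE addrK.
  apply: ple_trans (ple_conjD 1 (- E) pa) _; rewrite -rsA; apply: pleZ => //.
  rewrite ustar1 mul1r mulr1 starN mulNr mulrNN rsD rs1 mulrDl mul1r.
  apply: pleD; first exact: ple_refl.
  by apply: ple_trans EaE _; rewrite -rsA; exact: (pleZ k0 gc).
- have -> : uin a = (w + E) * uin a * star (w + E) by rewrite wE ustar1 mul1r mulr1.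
  apply: ple_trans (ple_conjD w E pa) _; rewrite -rsA; apply: pleZ => //.
  rewrite uinD qq addrC mulrDr; apply: pleD.
    by apply: ple_trans EaE _; apply: ple_scale => //; rewrite lerDr.
  by rewrite -{1}[w * _ * _]mul1r -rs1; apply: ple_scale => //; rewrite lerDl.
Qed.

End CutComparison.

Lemma amul0 (R : realType) (S : ampAlg R) k : amul k (0 : S) = 0.
Proof. by elim: k => // k IH; rewrite [LHS]/(asum 0 (amul k 0)) IH; exact: asum0. Qed.

Section ClassOf.
Context (R : realType) (B : cstarAlgType R).
Local Notation S := (stab_amp B).
Implicit Types (a b : S).

Definition cl a : Cu B := if pselect (positive a) is left pa then cu_class pa else 0.

Lemma cl_rep a : psd (uin a) -> cu_rep (cl a) a.
Proof. by move=> /positiveP pa; rewrite /cl; case: pselect => // pa'; exact: cu_rep_class. Qed.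

Lemma cl_le a b : psd (uin a) -> psd (uin b) -> cu_le (cl a) (cl b) <-> cuntz_sub a b.
Proof. by move=> pa pb; apply: cu_leP; exact: cl_rep. Qed.

Lemma cl_amul k a : psd (uin a) -> cl (amul k a) = cl a *+ k.
Proof.
move=> pa; have pk := psd_amul k pa.
apply: (cu_eq (cl_rep pk) (cu_mul_rep k (cl_rep pa))); exact: cuntz_refl.
Qed.

Lemma cl_asum a b : psd (uin a) -> psd (uin b) -> cl (asum a b) = cl a + cl b.
Proof.
move=> pa pb; have pab := psd_asum pa pb.
apply: (cu_eq (cl_rep pab) (cu_add_rep (cl_rep pa) (cl_rep pb))); exact: cuntz_refl.
Qed.

Lemma cl_sum (I : Type) (s : seq I) (F : I -> S) (x : Cu B) (k : nat) :
  (forall i, psd (uin (F i))) -> (forall i, cu_le (cl (F i) *+ k) x) ->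
  cu_le (cl (\sum_(i <- s) F i) *+ k) (x *+ size s).
Proof.
move=> pF Fx; elim: s => [|i s IH].
  rewrite big_nil -cl_amul; last exact: psd_uin0.
  rewrite (amul0 S).
  have -> : cl 0 = 0.
    by apply: (cu_eq (cl_rep (psd_uin0 _)) (cu0_rep _)); exact: cuntz_0sub.
  exact: cu_le0x.
have ps : psd (uin (\sum_(i <- s) F i)) by rewrite uin_sum; apply: psd_sumr.
rewrite big_cons mulrS; apply: (@cu_le_trans _ _ (cl (F i) *+ k + cl (\sum_(i <- s) F i) *+ k)).
  rewrite -mulrnDl -cl_asum//; apply: cu_leMn; apply/cl_le; [exact: psdD_uin|exact: psd_asum|].
  exact: cuntz_add_asum.
exact: cu_leD.
Qed.

End ClassOf.

(** * Dividing locally in the fibres and assembling the pieces *)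

Section Halving.
Context (R : realType) (X : metricType R) (cX : compact [set: X]) (A : cstarAlgType R).
Context (n : nat) (dimX : covering_dim_le X n) (pA : pure A).
Context (D : ampAlg R).
Local Notation S := (stab_amp A).
Context (T : ampField X S D).
Local Notation ev := (@fev R X S D T).
Local Notation kappa := (@fcst R X S D T).
Local Notation hmul := (@fmul R X S D T).
Local Notation hS := (@rnorm_seminorm R S).
Local Notation hD := (@rnorm_seminorm R D).
Implicit Types (f g b z : D) (h : ufun X).

Let hev q : shom (ev q) := fev_shom T q.

Lemma fev_inj f g : (forall q, ev q f = ev q g) -> f = g.
Proof.
move=> fg; apply: rnorm_eq => e e0.
apply: (@fev_norm_le _ _ _ _ T) => [|q]; first exact: ltW.
by rewrite (shomB (hev q)) fg subrr (csn0 hS) ltW.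
Qed.

Lemma fmul_psd h f : psd (uin f) -> psd (uin (hmul h f)).
Proof.
move=> pf; have -> : hmul h f = hmul (ufun_sqrt h) (ssqrt f) ** star (hmul (ufun_sqrt h) (ssqrt f)).
  apply: fev_inj => q; rewrite (shomM (hev q)) (shom_star (hev q)) !fev_mul.
  rewrite starZ conjc_real scale_smull scale_smulr scalerA -rmorphM -expr2 sqr_sqrtr.
    by rewrite -(shom_star (hev q)) -(shomM (hev q)) ssqrt_sa// ssqrtK.
  by have /andP[] := uf_01 h q.
exact: psd_Mstar_uin.
Qed.

Lemma ufun_compl_cont h : continuous (fun x => 1 - h x).
Proof. by move=> x; apply: cvgB; [exact: cvg_cst|exact: uf_cont]. Qed.

Lemma ufun_compl_01 h x : 0 <= 1 - h x <= 1.
Proof. by have /andP[h0 h1] := uf_01 h x; rewrite subr_ge0 h1 lerBlDr lerDl. Qed.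

Definition ufun_compl h := Ufun (@ufun_compl_cont h) (ufun_compl_01 h).

Lemma fmul_ple h f : psd (uin f) -> ple (uin (hmul h f)) (uin f).
Proof.
move=> pf; rewrite /ple -uinB; have -> : f - hmul h f = hmul (ufun_compl h) f.
  apply: fev_inj => q; rewrite (shomB (hev q)) !fev_mul /=.
  by rewrite rmorphB rmorph1 scalerBl scale1r.
exact: fmul_psd.
Qed.

(* Of the cut-down [d + 2 * d], [2 * d] is spent at the base point and [d] on moving
   from there to [q]. *)
Definition halves b d N q z r :=
  cuntz_sub (amul N (ev q z)) (ev q b) /\
  cuntz_sub (cutdown (ev q b) (d + 2 * d)) (amul N.+1 (cutdown (ev q z) r)).

(** Divisibility in the fibre at [p] gives [c], approximated there by [v (ev p b) (star v)]. With
    the constant field of [v] and [Y = kappa v ** ssqrt b], the element [star Y ** Y] lies below a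
    multiple of [b] everywhere, and [Y ** star Y] stays close to [c] near [p]; [cuntz_star_swap_cut]
    passes between the two. *)
Lemma local_piece N (p : X) b d : (0 < N)%N -> psd (uin b) -> 0 < d ->
  exists (z : D) (r c : R), [/\ psd (uin z), 0 < r, 0 <= c, ple (uin z) (rs c * uin b)
    & \forall q \near p, halves b d N q z r].
Proof.
move=> N0 pb d0; have pbq q := shom_psd (hev q) pb.
have [c [pc c1 c2]] := almost_divisible_amul N pA.2 (pbq p) d0.
have [s s0 c3] := cuntz_room (psd_cutdown (pbq p) (ltW d0)) (psd_amul N.+1 pc) d0 c2.
rewrite cutdownD ?ltW// amul_cutdown ?ltW// in c3.
(* Budget [s = r + 2 r + r]: one [r] for moving from [c] to the conjugate of [b] at [q], [2 r]
   already cut from [star Y ** Y] to form [z], and [r] for the cut of [z] in [halves]. *)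
pose r := s / 4; have r0 : 0 < r by rewrite divr_gt0.
have [t t0 c4] := cuntz_room (psd_amul N pc) (pbq p) r0 c1.
rewrite amul_cutdown ?ltW// in c4.
have cb : cuntz_sub c (ev p b).
  apply: cuntz_trans c1; apply/cl_le => //; first exact: psd_amul.
  by rewrite cl_amul// -{1}[cl c]mulr1n; exact: cu_leMn2.
have /cuntz_subP/(_ r r0)[v hv] := cb.
pose Y := kappa v ** ssqrt b.
pose G := Y ** star Y - kappa c.
have evY q : ev q (Y ** star Y) = v ** ev q b ** star v.
  rewrite (shomM (hev q)) (shom_star (hev q)) (shomM (hev q)) fev_cst starM.
  rewrite -(shom_star (hev q)) ssqrt_sa// !smulA -(smulA v) -(shomM (hev q)).
  by rewrite ssqrtK.
have p1 : psd (uin (star Y ** Y)) by exact: psd_starM_uin.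
have p2 : psd (uin (Y ** star Y)) by exact: psd_Mstar_uin.
pose z := cutdown (star Y ** Y) (2 * r).
have r2 : 0 <= 2 * r by rewrite mulr_ge0 ?ltW.
pose m := un (uin (star (kappa v) ** kappa v)).
exists z, r, m; split=> //; [exact: psd_cutdown|exact: un_ge0| |].
  apply: (ple_trans (cutdown_ple p1 r2)).
  have -> : star Y ** Y = ssqrt b ** (star (kappa v) ** kappa v) ** star (ssqrt b).
    by rewrite /Y starM ssqrt_sa// !smulA.
  have pk : psd (uin (star (kappa v) ** kappa v)) by exact: psd_starM_uin.
  rewrite uinM [uin (ssqrt b ** _)]uinM uin_star; apply: (ple_trans (ple_conj _ (ple_rs (psd_sa pk)))).
  rewrite rsC -mulrA -uin_star ssqrt_sa// -uinM ssqrtK//; exact: ple_refl.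
have n1 : \forall q \near p, rnorm (ev q G) < r.
  apply: open_nbhs_nbhs; split; first exact: fev_lt_open.
  by rewrite /= (shomB (hev p)) evY fev_cst -un_uin uinB.
have n2 : \forall q \near p, rnorm (ev q (b - kappa (ev p b))) < Num.min t d.
  apply: open_nbhs_nbhs; split; first exact: fev_lt_open.
  by rewrite /= (shomB (hev p)) fev_cst subrr (csn0 hS) lt_min t0.
apply: filterS2 n1 n2 => q; rewrite !(shomB (hev q)) evY !fev_cst lt_min => q1 /andP[q2 q3].
set yy := v ** ev q b ** star v in q1; have yyE : yy = ev q Y ** star (ev q Y).
  by rewrite -(shom_star (hev q)) -(shomM (hev q)) evY.
have pyy : psd (uin yy) by rewrite yyE; exact: psd_Mstar_uin.
have py'y : psd (uin (star (ev q Y) ** ev q Y)) by exact: psd_starM_uin.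
have zE : ev q z = cutdown (star (ev q Y) ** ev q Y) (2 * r).
  rewrite -(shom_star (hev q)) -(shomM (hev q)); apply: (shom_cutdown (hev q)) => //.
  exact: psd_uin_sa.
have r20 : 0 < 2 * r by rewrite mulr_gt0.
have r30 : 0 < 2 * r + r by rewrite addr_gt0.
split.
- apply: (@cuntz_trans _ _ (cutdown (ev p b) t)); last first.
    by apply: cuntz_near => //; [exact: ltW|rewrite (csnBC hS) ltW].
  apply: cuntz_trans c4; apply: cuntz_amul; rewrite zE.
  apply: (cuntz_trans (cuntz_star_swap_cut _ r20)); rewrite -yyE.
  have -> : 2 * r = r + r by rewrite mulrDl mul1r.
  by apply: cuntz_near2 => //; exact: ltW.
- apply: (@cuntz_trans _ _ (cutdown (ev p b) (d + d))).
    have -> : d + 2 * d = d + (d + d) by rewrite mulrDl mul1r.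
    by apply: cuntz_near2 => //; rewrite ?addr_ge0 ?ltW.
  apply: (cuntz_trans c3); apply: cuntz_amul.
  have -> : cutdown (ev q z) r = cutdown (star (ev q Y) ** ev q Y) (2 * r + r).
    by rewrite zE; apply: cutdownD => //; exact: ltW.
  have -> : s = r + (2 * r + r) by rewrite /r; lra.
  apply: (@cuntz_trans _ _ (cutdown yy (2 * r + r))).
    apply: cuntz_near2 => //; [exact: ltW|exact: ltW|].
    by rewrite (csnBC hS) ltW.
  have := cuntz_star_swap_cut (star (ev q Y)) r30; rewrite starK -yyE; exact.
Qed.

Lemma rs_sum (V : cstarAlgType R) (K : finType) (F : K -> R) :
  rs (\sum_k F k) = \sum_k rs (F k) :> unz V.
Proof. by apply: big_morph; [exact: rsD|exact: rs0]. Qed.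

(** If all weights were below this bound, their sum would be at most [#|K| / (#|K| + 1) < 1]. *)
Lemma large_weight (K : finType) (w : K -> R) : \sum_k w k = 1 ->
  exists k, (#|K|%:R + 1)^-1 <= w k.
Proof.
move=> w1; apply: contrapT => no; have M0 : 0 < #|K|%:R + 1 :> R by rewrite ltr_wpDl.
suff : \sum_k w k < 1 by rewrite w1 ltxx.
apply: (@le_lt_trans _ _ (\sum_(k : K) (#|K|%:R + 1)^-1)).
  by apply: ler_sum => k _; rewrite leNgt; apply/negP => wk; apply: no; exists k; exact: ltW.
by rewrite sumr_const -[X in X < _]mulr_natl ltr_pdivrMr// mul1r ltrDl.
Qed.

Lemma global_piece b d : psd (uin b) -> 0 < d -> exists (g : D) (r c : R),
  [/\ psd (uin g), 0 < r, 0 <= c, ple (uin g) (rs c * uin b)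
    & forall q, cuntz_sub (amul 2 (ev q g)) (ev q b) /\
      cuntz_sub (cutdown (ev q b) (d + 2 * d)) (amul (4 * n.+1).+1 (cutdown (ev q g) r))].
Proof.
move=> pb d0; pose N := (4 * n.+1)%N; have pbq q := shom_psd (hev q) pb.
have /choice[Z hZ] (p : X) : exists u : D * R * R,
    [/\ psd (uin u.1.1), 0 < u.1.2, 0 <= u.2, ple (uin u.1.1) (rs u.2 * uin b)
      & \forall q \near p, halves b d N q u.1.1 u.1.2].
  by have [z [r [c hz]]] := @local_piece N p b d isT pb d0; exists (z, r, c).
have [|K [h [col [c [h1 hU hd]]]]] :=
    colored_cover cX dimX (U := fun p => [set q | halves b d N q (Z p).1.1 (Z p).1.2]).
  by move=> p; have [] := hZ p.
pose z k := (Z (c k)).1.1; pose r k := (Z (c k)).1.2; pose m k := (Z (c k)).2.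
have pz k : psd (uin (z k)) by have [] := hZ (c k).
have r0 k : 0 < r k by have [] := hZ (c k).
have m0 k : 0 <= m k by have [] := hZ (c k).
have zm k : ple (uin (z k)) (rs (m k) * uin b) by have [] := hZ (c k).
have hz k q : h k q != 0 -> halves b d N q (z k) (r k) by exact: hU.
pose g := \sum_k hmul (h k) (z k).
have pg : psd (uin g) by rewrite uin_sum; apply: psd_sumr => k; exact: fmul_psd.
pose M : R := #|K|%:R + 1; have M0 : 0 < M by rewrite ltr_wpDl.
(* Makes the cut [(M * I)^-1] of [g] uniform: at every point some weight is at least [M^-1], so that
   [z k <= M g] there, and [M * (M * I)^-1 = I^-1] is below every [r k]. *)
pose I : R := \sum_k (r k)^-1 + 1.
have rI k : (r k)^-1 <= I.
  rewrite /I (bigD1 k)//= -addrA lerDl addr_ge0// sumr_ge0// => j _.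
  by rewrite invr_ge0 ltW.
have I0 : 0 < I by rewrite /I ltr_wpDl// sumr_ge0// => k _; rewrite invr_ge0 ltW.
have pzq q k : psd (uin (ev q (z k))) by exact: shom_psd.
have evg q : ev q g = \sum_k (h k q)%:C *: ev q (z k).
  by rewrite ev_sum; apply: eq_bigr => k _; rewrite fev_mul.
have pterm q k : psd (uin ((h k q)%:C *: ev q (z k))).
  by rewrite uinZ rs_scale; apply: psdZ => //; have /andP[] := uf_01 (h k) q.
exists g, (M * I)^-1, (\sum_k m k); split=> //; [by rewrite invr_gt0 mulr_gt0|exact: sumr_ge0| |].
  rewrite /ple rs_sum mulr_suml uin_sum -sumrB; apply: psd_sumr => k.
  exact: ple_trans (fmul_ple (h k) (pz k)) (zm k).
move=> q; have pgq : psd (uin (ev q g)) by exact: shom_psd.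
split.
- pose part (i : 'I_n.+1) := \sum_(k | col k == i) (h k q)%:C *: ev q (z k).
  have ppart i : psd (uin (part i)) by rewrite /part -big_filter uin_sum; exact: psd_sumr.
  have part_le i : cu_le (cl (part i) *+ N) (cl (ev q b)).
    rewrite -cl_amul//; apply/cl_le => //; first exact: psd_amul.
    have [H|[k0 [k1 k2 k3]]] := @color_cases R n K col (fun k => h k q) i (fun k k' => hd k k' q).
      have -> : part i = 0 by rewrite /part big1// => k /eqP /H ->; rewrite scale0r.
      by rewrite (amul0 S); exact: cuntz_0sub.
    apply: cuntz_trans (hz _ _ k2).1; apply: cuntz_amul.
    have -> : part i = (h k0 q)%:C *: ev q (z k0).
      rewrite /part (bigD1 k0) ?k1//= big1 ?addr0// => k /andP[/eqP ki kk].
      by rewrite k3// scale0r.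
    by apply: cuntz_scale => //; have /andP[] := uf_01 (h k0) q.
  have gN : cu_le (cl (ev q g) *+ N) (cl (ev q b) *+ n.+1).
    have E : ev q g = \sum_i part i by rewrite evg (partition_big col predT).
    by have := cl_sum (enum 'I_n.+1) ppart part_le; rewrite size_enum_ord big_enum/= -E.
  have p2 := psd_amul 2 pgq; apply/cl_le => //.
  (* The colour sum gives [N [g] <= (n + 1) [b]], and [2 (n + 2) <= 4 (n + 1) = N] puts it into the
     form that unperforation requires. *)
  apply: (almost_unperforatedP pA.1 (k := n.+1)); apply: cu_le_trans gN.
  rewrite cl_amul// -mulrnA; apply: cu_leMn2.
  by rewrite /N -[4%N]/(2 * 2)%N -mulnA leq_pmul2l// mul2n doubleS !ltnS -addnn leq_addr.
- have [k hk] := large_weight (h1 q); rewrite -/M in hk.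
  have hk0 : h k q != 0 by rewrite gt_eqF// (lt_le_trans _ hk)// invr_gt0.
  apply: (cuntz_trans (hz k q hk0).2); apply: cuntz_amul.
  have s0 : 0 < (M * I)^-1 by rewrite invr_gt0 mulr_gt0.
  apply: (@cuntz_trans _ _ (cutdown (ev q (z k)) (M * (M * I)^-1))).
    apply: cuntz_cut_mono => //; first by rewrite mulr_ge0 ?ltW.
    rewrite invfM mulrA mulfV ?gt_eqF// mul1r -[leRHS]invrK lef_pV2 ?posrE ?invr_gt0//.
  apply: cuntz_cut_scale => //; first exact: ltW.
  have -> : uin (ev q (z k)) = rs M * (rs M^-1 * uin (ev q (z k))).
    by rewrite rsA mulfV ?gt_eqF// rs1 mul1r.
  apply: pleZ; first exact: ltW.
  apply: ple_trans (ple_scale (pzq q k) hk) _.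
  rewrite /ple evg (bigD1 k)//= uinD uinZ rs_scale addrC addKr -big_filter uin_sum.
  exact: psd_sumr.
Qed.

End Halving.

(** * Two orthogonal parts, each dominating after a fixed multiple *)

Section HalvingTheorem.
Context (R : realType) (X : metricType R) (cX : compact [set: X]) (A : cstarAlgType R).
Context (n : nat) (dimX : covering_dim_le X n) (pA : pure A).
Hypothesis noquot : ~ exists (I : set A) (B : cstarAlgType R) (q : A -> B),
  [/\ closed_ideal I, quotient_map I q
    & exists z : Cu B, [/\ z <> cu0, cu_compact z & cu_properly_infinite z]].
Context (D : ampAlg R).
Local Notation S := (stab_amp A).
Context (T : ampField X S D).
Local Notation ev := (@fev R X S D T).
Let hev q : shom (ev q) := fev_shom T q.

Lemma fev_amul q k (f : D) : ev q (amul k f) = amul k (ev q f).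
Proof.
elim: k => [|k IH]; first exact: (shom0 (hev q)).
by rewrite [amul k.+1 f]/(asum f (amul k f)) fev_asum IH.
Qed.

Lemma cuntz_of_fibres k (f g : D) d : psd (uin f) -> psd (uin g) -> 0 < d ->
  (forall q, cuntz_sub (ev q f) (amul k (ev q g))) ->
  cuntz_sub (cutdown f d) (amul n.+1 (amul k g)).
Proof.
move=> pf pg d0 fg; apply: (gluing cX dimX (T := T)) => //; first exact: psd_amul.
by move=> q; rewrite fev_amul.
Qed.

Lemma halving (b : D) e : psd (uin b) -> 0 < e -> exists y0 y1 : D,
  [/\ psd (uin y0), psd (uin y1), cuntz_sub (asum y0 y1) b,
    cuntz_sub (cutdown b e) (amul n.+1 (amul (4 * n.+1).+1 y0))
    & cuntz_sub (cutdown b e) (amul n.+1 (amul 3 y1))].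
Proof.
(* Six cuts of size [d]: one from [b] to [a], one from [a] to [a'], three in [global_piece] and one
   in gluing. Here [a] and [a'] play the roles of the two nested elements, and [b] only provides the
   room. *)
move=> pb e0; pose d := e / 6; have d0 : 0 < d by rewrite divr_gt0.
have dge : 0 <= d := ltW d0.
pose a := cutdown b d; have pa : psd (uin a) := psd_cutdown pb dge.
pose a' := cutdown a d; have pa' : psd (uin a') := psd_cutdown pa dge.
have [g [r [c [pg r0 c0 gc hg]]]] := global_piece cX dimX pA T pa' d0.
have gca : ple (uin g) (rs c * uin a).
  by apply: ple_trans gc _; apply: pleZ => //; exact: cutdown_ple.
have [p [q [M [K [ppE pq [M0 K0] hM hK]]]]] := complement pa pg r0 c0 gca.
pose y0 := cutdown g r; pose y1 := q ** star q.
have py0 : psd (uin y0) := psd_cutdown pg (ltW r0).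
have py1 : psd (uin y1) by exact: psd_Mstar_uin.
have scale (x y : D) k : 0 <= k -> psd (uin x) -> psd (uin y) ->
    ple (uin x) (rs k * uin y) -> cuntz_sub x y.
  move=> k0 px py xy; apply: cuntz_trans (cuntz_scale k0 py).
  by apply: cuntz_ple => //; rewrite uinZ rs_scale//; exact: psdZ.
have ab : cuntz_sub a b by apply: cuntz_ple => //; exact: cutdown_ple.
have y01 : cuntz_sub (asum y0 y1) b.
  apply: cuntz_trans ab; rewrite /y0 -ppE; apply: (cuntz_trans (asum_orth pq).1).
  by apply: (scale _ _ M) => //; rewrite ppE; exact: psdD_uin.
have agy : cuntz_sub a (asum g y1).
  apply: cuntz_trans (cuntz_add_asum pg py1).
  by apply: (scale _ _ K) => //; exact: psdD_uin.
exists y0, y1; split=> //.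
- have s0 : 0 <= d + 2 * d by move: dge; lra.
  have -> : cutdown b e = cutdown (cutdown a' (d + 2 * d)) d.
    rewrite (cutdownD pa' s0 dge) (cutdownD pa dge (addr_ge0 s0 dge)).
    rewrite (cutdownD pb dge (addr_ge0 dge (addr_ge0 s0 dge))).
    by congr cutdown; rewrite /d; lra.
  apply: cuntz_of_fibres; [exact: psd_cutdown pa' s0|exact: py0|exact: d0|].
  move=> x; have := (hg x).2.
  rewrite -(shom_cutdown (hev x) (psd_uin_sa pg) (ltW r0)).
  by rewrite -(shom_cutdown (hev x) (psd_uin_sa pa') s0).
- apply: (@cuntz_trans _ _ (cutdown a' d)).
    rewrite (cutdownD pa dge dge) (cutdownD pb dge (addr_ge0 dge dge)).
    by apply: cuntz_cut_mono => //; rewrite ?addr_ge0// /d; lra.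
  apply: cuntz_of_fibres => // x.
  (* The division was made for [a'], a strict cut-down of [a]; this gap is what [cuntz_full]
     needs. *)
  have h1 : cuntz_sub (amul 2 (ev x g)) (cutdown (ev x a) d).
    by rewrite -(shom_cutdown (hev x)) ?psd_uin_sa//; exact: (hg x).1.
  have h2 : cuntz_sub (ev x a) (asum (ev x g) (ev x y1)).
    by rewrite -fev_asum; exact: (shom_cuntz (hev x)).
  have pga := shom_psd (hev x) pg; have pya := shom_psd (hev x) py1.
  have paa := shom_psd (hev x) pa; have paa' := shom_psd (hev x) pa'.
  have [k hk] := cuntz_full noquot paa pga pya d0 d0 h2 h1.
  have a'E : ev x a' = cutdown (ev x a) d by rewrite /a' (shom_cutdown (hev x)) ?psd_uin_sa.
  rewrite -a'E in hk h1.
  have pk m (y : S) : psd (uin y) -> psd (uin (amul m y)) by exact: psd_amul.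
  apply/(cl_le paa' (pk 3 _ pya)); rewrite cl_amul//.
  (* Here [k] depends on the fibre and cannot be glued. Since [2 [a'] <= 2 [g] + 2 [y1] <= [a'] + 2
     [y1]], it is traded for the uniform factor 3. *)
  apply: (cu_le_cancel (k := k) pA.1); last by rewrite -cl_amul//; apply/cl_le => //; exact: pk.
  have l1 : cu_le (cl (ev x g) *+ 2) (cl (ev x a')).
    by rewrite -cl_amul//; apply/cl_le => //; exact: pk.
  have l2 : cu_le (cl (ev x a')) (cl (ev x g) + cl (ev x y1)).
    rewrite -cl_asum//; apply/cl_le => //; first exact: psd_asum.
    apply: cuntz_trans h2; rewrite a'E; apply: cuntz_ple => //; last exact: cutdown_ple.
    by apply: psd_cutdown.
  apply: (@cu_le_trans _ _ ((cl (ev x g) + cl (ev x y1)) *+ 2)); first exact: cu_leMn.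
  by rewrite mulrnDl; apply: cu_leD; [exact: l1|exact: cu_le_refl].
Qed.

End HalvingTheorem.

Definition stab_field (R : realType) (X : metricType R) (cX : compact [set: X])
    (A : cstarAlgType R) : ampField X (stab_amp A) (stab_amp (cfun cX A)) :=
  @AmpField R X (stab_amp A) (stab_amp (cfun cX A)) (@ev R X cX A) (@kappa R X cX A)
    (@hmul R X cX A) (@ev_shom R X cX A) (@ev_kappa R X cX A) (@ev_hmul R X cX A)
    (@ev_lt_open R X cX A) (@ev_norm_le R X cX A)
    (fun q => @stab_map_dsum _ _ _ _ (eval_shom cX A q)).

Theorem proposition5p10 (R : realType) (X : metricType R)
    (cX : compact [set: X]) (dX : finite_dimensional X)
    (A : cstarAlgType R) (pA : pure A)
    (noquot : ~ exists (I : set A) (B : cstarAlgType R) (q : A -> B),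
      [/\ closed_ideal I, quotient_map I q
        & exists z : Cu B,
            [/\ z <> cu0, cu_compact z & cu_properly_infinite z]]) :
  exists L : nat, forall x' x : Cu (cfun cX A), cu_ll x' x ->
    exists y0 y1 : Cu (cfun cX A),
      [/\ cu_le (cu_add y0 y1) x,
          cu_ll x' (cu_mul L y0)
        & cu_ll x' (cu_mul L y1)].
Proof.
(* The bounds are [n.+1 * N] for [y0] and [n.+1 * 3] for [y1]; as [3 <= N], one number covers
   both. *)
have [n dimX] := dX; pose N := (4 * n.+1).+1; exists (N * n.+1)%N => x' x.
have rx' := cu_reprP x'; have rx := cu_reprP x.
set a := cu_repr x' in rx'; set b := cu_repr x in rx.
move=> /(cu_llP rx' rx)[e e0 ab].
have pb := cu_rep_psd rx; have e2 : 0 < e / 2 by rewrite divr_gt0.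
have [y0 [y1 [p0 p1 y01 b0 b1]]] := halving cX dimX pA noquot (stab_field cX A) pb e2.
have mulE k (y : stab_amp (cfun cX A)) : psd (uin y) -> (k <= N)%N ->
    cuntz_sub (cutdown b (e / 2)) (amul n.+1 (amul k y)) -> cu_ll x' (cl y *+ (N * n.+1)).
  move=> py kN by_; have pk := psd_amul k py; have pnk := psd_amul n.+1 pk.
  have pN := psd_amul (N * n.+1) py.
  apply/(cu_llP rx' (cu_mul_rep _ (cl_rep py))).
  have by2 : cuntz_sub (cutdown b (e / 2)) (amul (N * n.+1) y).
    apply: (cuntz_trans by_); apply/(cl_le pnk pN); rewrite !cl_amul//.
    by rewrite -mulrnA; apply: cu_leMn2; rewrite leq_mul2r kN orbT.
  (* The second half of [e] is spent here to turn comparison into the way-below relation. *)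
  have [d d0 hd] := cuntz_room (psd_cutdown pb (ltW e2)) pN e2 by2.
  have E : cutdown (cutdown b (e / 2)) (e / 2) = cutdown b e.
    by rewrite (cutdownD pb (ltW e2) (ltW e2)) -splitr.
  by rewrite E in hd; exists d; [exact: d0|exact: cuntz_trans ab hd].
exists (cl y0), (cl y1); rewrite !cu_mulE; split.
- apply/(cu_leP (cu_add_rep (cl_rep p0) (cl_rep p1)) rx); exact: y01.
- exact: mulE p0 (leqnn _) b0.
- by apply: mulE p1 _ b1; rewrite /N mulnS.
Qed.
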